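(* Consider the system $$x'=y,\qquad y'=\rho z^2\cos x+(z^2+\kappa)\sin x\cos x-\sin x-\varepsilon y,\qquad z'=\alpha(\cos x-\beta)$$ with $\rho=0$, regarded as a family with parameter $\varepsilon$. Fix $\beta\in(0,1)$, $\alpha>0$ and $\kappa\in[0,1)$, and let $\varepsilon_c=2\alpha\beta^{3/2}(1-\kappa\beta)^{1/2}$. If $l_1(\beta,\alpha,0,\kappa)\neq0$, then the family has a transversal Hopf point at $P_0$ for $\varepsilon=\varepsilon_c$. Moreover: (a) if $l_1<0$, then at $\varepsilon=\varepsilon_c$ the equilibrium $P_0$ is asymptotically stable, and for each $\varepsilon<\varepsilon_c$ sufficiently close to $\varepsilon_c$ there is a stable periodic orbit near the unstable equilibrium $P_0$; (b) if $l_1>0$, then at $\varepsilon=\varepsilon_c$ the equilibrium $P_0$ is unstable, and for each $\varepsilon>\varepsilon_c$ sufficiently close to $\varepsilon_c$ there is an unstable periodic orbit near the asymptotically stable equilibrium $P_0$.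
   Context: For $\rho=0$ the equilibrium is $P_0=(\arccos\beta,0,(1/\beta-\kappa)^{1/2})$. Set $\omega_0=\omega_1=\sqrt{(1-\beta^2)/\beta}$. At $\varepsilon=\varepsilon_c$, the Jacobian $A=Df(P_0)$ has eigenvalues $-\varepsilon_c$ and $\pm i\omega_0$. First Lyapunov coefficient. Let $B$ and $C$ be the second- and third-derivative multilinear forms of the vector field $f$ at $P_0$ (at $\varepsilon=\varepsilon_c$). Take $q=(-i,\omega_0,\alpha\beta^{1/2}\omega_1/\omega_0)$, and let $p$ satisfy $A^{\top}p=-i\omega_0p$ and $\sum_i\bar p_iq_i=1$. Set $$G_{21}=\langle p,C(q,q,\bar q)+B(\bar q,(2i\omega_0I-A)^{-1}B(q,q))-2B(q,A^{-1}B(q,\bar q))\rangle.$$ Then $l_1(\beta,\alpha,0,\kappa)=\operatorname{Re}G_{21}/(2\omega_0)$. A Hopf point is an equilibrium whose Jacobian has eigenvalues $\pm i\omega_0$, $\omega_0>0$, and no other eigenvalues on the imaginary axis. It is transversal if the real part of the continued complex eigenvalue pair has nonzero derivative in $\varepsilon$. *)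

(* Defs.v *)
From Stdlib Require Import Reals.
From Coquelicot Require Import Coquelicot.
Open Scope R_scope.

Definition R3 : Type := (R * R * R)%type.
Definition coord (i : nat) (v : R3) : R :=
  match i with 0%nat => fst (fst v) | 1%nat => snd (fst v) | _ => snd v end.
Definition upd (i : nat) (v : R3) (t : R) : R3 :=
  match i with
  | 0%nat => (t, snd (fst v), snd v)
  | 1%nat => (fst (fst v), t, snd v)
  | _ => (fst (fst v), snd (fst v), t)
  end.
Definition dist3 (u v : R3) : R :=
  sqrt ((coord 0 u - coord 0 v) ^ 2 + (coord 1 u - coord 1 v) ^ 2
        + (coord 2 u - coord 2 v) ^ 2).

Definition pd (j : nat) (g : R3 -> R) (x : R3) : R :=
  Derive (fun t => g (upd j x t)) (coord j x).
Definition jac (F : R3 -> R3) (x : R3) (i j : nat) : R :=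
  pd j (fun v => coord i (F v)) x.
Definition d2 (F : R3 -> R3) (x : R3) (i j k : nat) : R :=
  pd j (fun w => pd k (fun v => coord i (F v)) w) x.
Definition d3 (F : R3 -> R3) (x : R3) (i j k l : nat) : R :=
  pd j (fun u => pd k (fun w => pd l (fun v => coord i (F v)) w) u) x.

(* ---------- complex linear algebra in C^3 (indices 0,1,2) ---------- *)
Definition CV : Type := nat -> C.
Definition sum3 (g : nat -> C) : C := Cplus (Cplus (g 0%nat) (g 1%nat)) (g 2%nat).
Definition CM : Type := nat -> nat -> C.
Definition realM (A : nat -> nat -> R) : CM := fun i j => RtoC (A i j).
Definition mv (M : CM) (v : CV) : CV := fun i => sum3 (fun j => Cmult (M i j) (v j)).
Definition trM (M : CM) : CM := fun i j => M j i.
Definition cscal (c : C) (v : CV) : CV := fun i => Cmult c (v i).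
Definition cvadd (u v : CV) : CV := fun i => Cplus (u i) (v i).
Definition cvopp (u : CV) : CV := fun i => Copp (u i).
Definition cconjv (v : CV) : CV := fun i => Cconj (v i).
Definition cinner (p v : CV) : C := sum3 (fun i => Cmult (Cconj (p i)) (v i)).
Definition det3 (M : CM) : C :=
  Cplus (Cminus
    (Cmult (M 0 0)%nat (Cminus (Cmult (M 1 1)%nat (M 2 2)%nat) (Cmult (M 1 2)%nat (M 2 1)%nat)))
    (Cmult (M 0 1)%nat (Cminus (Cmult (M 1 0)%nat (M 2 2)%nat) (Cmult (M 1 2)%nat (M 2 0)%nat))))
    (Cmult (M 0 2)%nat (Cminus (Cmult (M 1 0)%nat (M 2 1)%nat) (Cmult (M 1 1)%nat (M 2 0)%nat))).
(* inverse matrix via the adjugate (cyclic cofactor formula for 3x3) *)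
Definition inv3 (M : CM) : CM := fun i j =>
  let i1 := Nat.modulo (i + 1) 3 in let i2 := Nat.modulo (i + 2) 3 in
  let j1 := Nat.modulo (j + 1) 3 in let j2 := Nat.modulo (j + 2) 3 in
  Cdiv (Cminus (Cmult (M j1 i1) (M j2 i2)) (Cmult (M j1 i2) (M j2 i1))) (det3 M).
Definition idM : CM := fun i j => if Nat.eqb i j then RtoC 1 else RtoC 0.
Definition cMadd (M N : CM) : CM := fun i j => Cplus (M i j) (N i j).
Definition cMscal (c : C) (M : CM) : CM := fun i j => Cmult c (M i j).
Definition cMopp (M : CM) : CM := fun i j => Copp (M i j).

Definition is_eigenvalue (A : nat -> nat -> R) (lam : C) : Prop :=
  exists v : CV, (exists i, (i < 3)%nat /\ v i <> RtoC 0) /\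
    forall i, (i < 3)%nat -> mv (realM A) v i = Cmult lam (v i).

Definition Bform (F : R3 -> R3) (x : R3) (u v : CV) : CV := fun i =>
  sum3 (fun j => sum3 (fun k => Cmult (RtoC (d2 F x i j k)) (Cmult (u j) (v k)))).
Definition Cform (F : R3 -> R3) (x : R3) (u v w : CV) : CV := fun i =>
  sum3 (fun j => sum3 (fun k => sum3 (fun l =>
    Cmult (RtoC (d3 F x i j k l)) (Cmult (u j) (Cmult (v k) (w l)))))).

Definition equilibrium (F : R3 -> R3) (x0 : R3) : Prop := F x0 = (0, 0, 0).

Definition is_fsol (F : R3 -> R3) (phi : R -> R3) : Prop :=
  forall t, 0 <= t -> forall i, (i < 3)%nat ->
    is_derive (fun s => coord i (phi s)) t (coord i (F (phi t))).
Definition is_sol (F : R3 -> R3) (phi : R -> R3) : Prop :=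
  forall t i, (i < 3)%nat -> is_derive (fun s => coord i (phi s)) t (coord i (F (phi t))).

Definition lyap_stable (F : R3 -> R3) (x0 : R3) : Prop :=
  forall e, 0 < e -> exists d, 0 < d /\ forall phi, is_fsol F phi ->
    dist3 (phi 0) x0 < d -> forall t, 0 <= t -> dist3 (phi t) x0 < e.
Definition asympt_stable (F : R3 -> R3) (x0 : R3) : Prop :=
  lyap_stable F x0 /\ exists d, 0 < d /\ forall phi, is_fsol F phi ->
    dist3 (phi 0) x0 < d -> is_lim (fun t => dist3 (phi t) x0) p_infty 0.
Definition unstable_eq (F : R3 -> R3) (x0 : R3) : Prop := ~ lyap_stable F x0.

(* non-constant T-periodic solution (its range is the periodic orbit) *)
Definition periodic_orbit (F : R3 -> R3) (gam : R -> R3) (T : R) : Prop :=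
  0 < T /\ is_sol F gam /\ (forall t, gam (t + T) = gam t) /\ (exists t, gam t <> gam 0).
Definition near_orbit (gam : R -> R3) (x : R3) (e : R) : Prop :=
  exists s, dist3 x (gam s) < e.
Definition orbit_stable (F : R3 -> R3) (gam : R -> R3) : Prop :=
  forall e, 0 < e -> exists d, 0 < d /\ forall phi, is_fsol F phi ->
    near_orbit gam (phi 0) d -> forall t, 0 <= t -> near_orbit gam (phi t) e.
Definition orbit_asympt_stable (F : R3 -> R3) (gam : R -> R3) : Prop :=
  orbit_stable F gam /\ exists d, 0 < d /\ forall phi, is_fsol F phi ->
    near_orbit gam (phi 0) d ->
    forall e, 0 < e -> exists T0, forall t, T0 <= t -> near_orbit gam (phi t) e.
Definition orbit_unstable (F : R3 -> R3) (gam : R -> R3) : Prop := ~ orbit_stable F gam.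

Definition hopf_point (Fam : R -> R3 -> R3) (eps0 : R) (x0 : R3) : Prop :=
  equilibrium (Fam eps0) x0 /\
  exists w0, 0 < w0 /\
    is_eigenvalue (jac (Fam eps0) x0) (0, w0) /\
    is_eigenvalue (jac (Fam eps0) x0) (0, - w0) /\
    forall lam, is_eigenvalue (jac (Fam eps0) x0) lam -> Re lam = 0 ->
      lam = (0, w0) \/ lam = (0, - w0).

Definition transversal_hopf_point (Fam : R -> R3 -> R3) (eps0 : R) (x0 : R3) : Prop :=
  hopf_point Fam eps0 x0 /\
  exists w0 dl (mu om : R -> R), 0 < w0 /\ 0 < dl /\
    is_eigenvalue (jac (Fam eps0) x0) (0, w0) /\
    mu eps0 = 0 /\ om eps0 = w0 /\
    (forall e, Rabs (e - eps0) < dl ->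
       equilibrium (Fam e) x0 /\ continuous mu e /\ continuous om e /\
       is_eigenvalue (jac (Fam e) x0) (mu e, om e)) /\
    ex_derive mu eps0 /\ Derive mu eps0 <> 0.

Definition fam (alpha beta kappa rho : R) (eps : R) (v : R3) : R3 :=
  let x := coord 0 v in let y := coord 1 v in let z := coord 2 v in
  (y,
   rho * z ^ 2 * cos x + (z ^ 2 + kappa) * sin x * cos x - sin x - eps * y,
   alpha * (cos x - beta)).

Definition P0 (beta kappa : R) : R3 := (acos beta, 0, sqrt (1 / beta - kappa)).
Definition eps_c (alpha beta kappa : R) : R :=
  2 * alpha * (beta * sqrt beta) * sqrt (1 - kappa * beta).
Definition omega0 (beta : R) : R := sqrt ((1 - beta ^ 2) / beta).

(* q = (-i, w0, alpha beta^(1/2) w1 / w0) with w1 = w0 *)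
Definition qvec (alpha beta : R) : CV := fun i =>
  match i with
  | 0%nat => Copp Ci
  | 1%nat => RtoC (omega0 beta)
  | _ => RtoC (alpha * sqrt beta * omega0 beta / omega0 beta)
  end.

Definition Amat (alpha beta kappa : R) : nat -> nat -> R :=
  jac (fam alpha beta kappa 0 (eps_c alpha beta kappa)) (P0 beta kappa).

Definition G21 (alpha beta kappa : R) (p : CV) : C :=
  let F := fam alpha beta kappa 0 (eps_c alpha beta kappa) in
  let x0 := P0 beta kappa in
  let A := realM (Amat alpha beta kappa) in
  let w0 := omega0 beta in
  let q := qvec alpha beta in
  let qb := cconjv q in
  let h20 := mv (inv3 (cMadd (cMscal (Cmult (RtoC (2 * w0)) Ci) idM) (cMopp A)))
                (Bform F x0 q q) in
  let h11 := mv (inv3 A) (Bform F x0 q qb) in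
  cinner p (cvadd (cvadd (Cform F x0 q q qb) (Bform F x0 qb h20))
                  (cvopp (cscal (RtoC 2) (Bform F x0 q h11)))).

Definition adjoint_normalized (alpha beta kappa : R) (p : CV) : Prop :=
  (forall i, (i < 3)%nat ->
     mv (trM (realM (Amat alpha beta kappa))) p i
     = Cmult (Copp (Cmult (RtoC (omega0 beta)) Ci)) (p i)) /\
  cinner p (qvec alpha beta) = RtoC 1.

Definition l1 (alpha beta kappa : R) (p : CV) : R :=
  Re (G21 alpha beta kappa p) / (2 * omega0 beta).

(* Main.v *)
(* Around [P0] the family is an oscillator whose velocity is damped at the rate [eps] and which is driven by the
   integral [z] of a function of [x]; at [eps_c] the eigenvalues are [- eps_c] and [+- i om]. In coordinates
   [(u, v, S)] adapted to the eigenspaces, with [S] measured from the quadratic part of the centre manifold, a function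
   [W = (u^2 + v^2)/2 + cubic + quartic] satisfies [W' = n sigma r^2 + a r^4 + ...] with [n = eps - eps_c], [sigma < 0]
   and [a = Re G21 / 8]. The function [W +- K S^2] then decides the stability of the equilibrium, for [n = 0] by the
   sign of [a] and for small [n <> 0] by the sign of [n sigma].

   For the periodic orbit put [n = +- d^2] and scale [(u, v, S)] by [(d, d, d^2)]. In polar coordinates a closed orbit
   is a pair of 2 pi-periodic functions (the radial variable and [S]) of the angle, and these solve a fixed point
   equation for the Green operators of [y' = - k y + g], contracting for small [d]. The squared deviation from this
   closed curve serves as a Lyapunov function, or as a Chetaev function when [a > 0]. All of this is carried back to
   the original system by a conjugacy; global existence of its solutions comes from Picard iteration. *)
Require Import Defs.
From Stdlib Require Import Reals Lra Lia FunctionalExtensionality.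
From Coquelicot Require Import Coquelicot.
Open Scope R_scope.

(** * Calculus on the real line *)

Lemma is_derive_eq (f : R -> R) (t l l' : R) : is_derive f t l' -> l' = l -> is_derive f t l.
Proof. intros H <-; exact H. Qed.

(* Differentiates an expression in functions whose derivatives at the point are hypotheses. *)
Ltac derive_with :=
  auto_derive;
  [ repeat split; first [exact I | eexists; eassumption | idtac]
  | repeat match goal with
    | H : is_derive ?f ?t ?l |- context [Derive (fun x : R => ?f x) ?t] =>
        replace (Derive (fun x : R => f x) t) with l by (symmetry; apply is_derive_unique; exact H)
    end ].

Lemma is_derive_continuous (f : R -> R) (t l : R) : is_derive f t l -> continuous f t.
Proof. intros H. apply (ex_derive_continuous f t). exists l; exact H. Qed.

Lemma is_derive_mult_slope (k : R -> R) (c : R) : continuous k c ->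
  is_derive (fun x => (x - c) * k x) c (k c).
Proof.
  intros Hk. apply is_derive_Reals. intros e He. apply continuity_pt_filterlim in Hk.
  destruct (Hk e He) as [d [Hd near]]. exists (mkposreal d Hd). intros h Hh Hhd. simpl in Hhd.
  replace (((c + h - c) * k (c + h) - (c - c) * k c) / h - k c) with (k (c + h) - k c) by (field; auto).
  apply near. split; [split; [exact I|]|].
  - intros E. apply Hh. lra.
  - simpl. unfold Rdist. replace (c + h - c) with h by ring. exact Hhd.
Qed.

Ltac prove_continuous :=
  lazymatch goal with
  | |- continuous (fun _ => ?c) _ => apply continuous_const
  | |- continuous (fun x => x) _ => apply continuous_id
  | |- continuous (fun x => @?f x + @?g x) _ => apply (continuous_plus f g); prove_continuous
  | |- continuous (fun x => @?f x - @?g x) _ => apply (continuous_minus f g); prove_continuous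
  | |- continuous (fun x => @?f x * @?g x) _ => apply (continuous_mult f g); prove_continuous
  | |- continuous (fun x => @?f x / @?g x) _ => apply (continuous_mult f (fun x => / g x)); prove_continuous
  | |- continuous (fun x => - @?f x) _ => apply (continuous_opp f); prove_continuous
  | |- continuous (fun x => / @?f x) _ => apply (continuous_Rinv_comp f); [prove_continuous|]
  | |- continuous (fun x => @?f x ^ 2) _ =>
      apply (continuous_mult f (fun x => f x * 1)); [|apply (continuous_mult f (fun _ => 1))]; prove_continuous
  | |- continuous (fun x => Rabs (@?f x)) _ => apply (continuous_Rabs_comp f); prove_continuous
  | |- continuous (fun x => exp (@?f x)) _ => apply (continuous_exp_comp f); prove_continuous
  | |- continuous (fun x => sin (@?f x)) _ => apply (continuous_sin_comp f); prove_continuous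
  | |- continuous (fun x => cos (@?f x)) _ => apply (continuous_cos_comp f); prove_continuous
  | |- continuous (fun x => sqrt (@?f x)) _ => apply (continuous_sqrt_comp f); prove_continuous
  | |- _ => auto
  end.

Lemma continuous_Rabs_lt (f : R -> R) (t : R) : continuous f t ->
  forall e, 0 < e -> exists d, 0 < d /\ forall x, Rabs (x - t) < d -> Rabs (f x - f t) < e.
Proof.
  intros Hf e He. destruct (Hf (fun y => Rabs (y - f t) < e)) as [d Hd].
  - exists (mkposreal e He). intros y Hy. exact Hy.
  - exists d; split; [apply cond_pos|exact Hd].
Qed.

Lemma continuous_of_Rabs_lt (f : R -> R) (t : R) :
  (forall e, 0 < e -> exists d, 0 < d /\ forall x, Rabs (x - t) < d -> Rabs (f x - f t) < e) ->
  continuous f t.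
Proof.
  intros H P [e HP]. destruct (H e (cond_pos e)) as [d [Hd near]].
  exists (mkposreal d Hd). intros x Hx. apply HP, near. exact Hx.
Qed.

Lemma continuous_of_modulus (f m : R -> R) (t : R) : continuous m t -> m t = 0 ->
  locally t (fun s => Rabs (f s - f t) <= m s) -> continuous f t.
Proof.
  intros Hm m0 [d0 Hd0]. apply continuous_of_Rabs_lt. intros e He.
  destruct (continuous_Rabs_lt m t Hm e He) as [d [Hd near]].
  exists (Rmin d0 d). split; [apply Rmin_glb_lt; [apply cond_pos|exact Hd]|]. intros x Hx.
  pose proof (Rmin_l d0 d). pose proof (Rmin_r d0 d).
  apply Rle_lt_trans with (m x); [apply Hd0; change (Rabs (x - t) < d0); lra|].
  specialize (near x ltac:(lra)). rewrite m0, Rminus_0_r in near. apply Rabs_def2 in near. lra.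
Qed.

Lemma continuous_locally_lt (f : R -> R) (t c : R) : continuous f t -> f t < c ->
  exists d, 0 < d /\ forall x, Rabs (x - t) < d -> f x < c.
Proof.
  intros Hf Hc. destruct (continuous_Rabs_lt f t Hf (c - f t)) as [d [Hd near]]; [lra|].
  exists d. split; [exact Hd|]. intros x Hx. specialize (near x Hx). apply Rabs_def2 in near. lra.
Qed.

Lemma continuous_Rmax (f g : R -> R) (t : R) : continuous f t -> continuous g t ->
  continuous (fun s => Rmax (f s) (g s)) t.
Proof.
  intros Hf Hg. apply (continuous_ext (fun s => (f s + g s + Rabs (f s - g s)) * / 2)).
  - intros s. unfold Rmax. destruct (Rle_dec (f s) (g s)); [rewrite Rabs_left1|rewrite Rabs_pos_eq]; lra.
  - prove_continuous.
Qed.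

Lemma continuous_ex_RInt (f : R -> R) (a b : R) : (forall t, continuous f t) -> ex_RInt f a b.
Proof. intros Hf. apply (ex_RInt_continuous (V := R_CompleteNormedModule)). auto. Qed.

Lemma is_derive_primitive (f : R -> R) (a t : R) : (forall s, continuous f s) ->
  is_derive (fun x => RInt f a x) t (f t).
Proof.
  intros Hf. apply (is_derive_RInt f (fun x => RInt f a x) a t); [|apply Hf].
  apply filter_forall. intros y. apply (RInt_correct (V := R_CompleteNormedModule)).
  apply continuous_ex_RInt, Hf.
Qed.

Lemma mean_value (f : R -> R) (a b : R) : a <= b ->
  (forall t, a <= t <= b -> ex_derive f t) ->
  exists c, a <= c <= b /\ f b - f a = Derive f c * (b - a).
Proof.
  intros Hab Hf. destruct (MVT_gen f a b (Derive f)) as [c [Hc E]].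
  - intros x Hx; rewrite Rmin_left, Rmax_right in Hx by lra. apply Derive_correct, Hf; lra.
  - intros x Hx; rewrite Rmin_left, Rmax_right in Hx by lra.
    apply continuity_pt_filterlim, (ex_derive_continuous f), Hf; lra.
  - rewrite Rmin_left, Rmax_right in Hc by lra. exists c; auto.
Qed.

Lemma increment_le (f : R -> R) (m a b : R) : a <= b ->
  (forall t, a <= t <= b -> exists l, is_derive f t l /\ l <= m) -> f b <= f a + m * (b - a).
Proof.
  intros Hab Hf. destruct (mean_value f a b Hab) as [c [Hc E]].
  - intros t Ht. destruct (Hf t Ht) as [l [Hl _]]. exists l; exact Hl.
  - destruct (Hf c Hc) as [l [Hl Hm]]. rewrite (is_derive_unique _ _ _ Hl) in E. nra.
Qed.

Lemma increment_ge (f : R -> R) (m a b : R) : a <= b ->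
  (forall t, a <= t <= b -> exists l, is_derive f t l /\ m <= l) -> f a + m * (b - a) <= f b.
Proof.
  intros Hab Hf. pose proof (increment_le (fun t => - f t) (- m) a b Hab) as opp_increment.
  assert (- f b <= - f a + - m * (b - a)); [|lra]. apply opp_increment. intros t Ht.
  destruct (Hf t Ht) as [l [Hl Hm]]. exists (- l). split; [exact (is_derive_opp f t l Hl)|lra].
Qed.

Lemma derive_zero_const (f : R -> R) (a b : R) : a <= b ->
  (forall t, a <= t <= b -> is_derive f t 0) -> f b = f a.
Proof.
  intros Hab Hf.
  pose proof (increment_le f 0 a b Hab (fun t Ht => ex_intro _ 0 (conj (Hf t Ht) (Rle_refl 0)))).
  pose proof (increment_ge f 0 a b Hab (fun t Ht => ex_intro _ 0 (conj (Hf t Ht) (Rle_refl 0)))). lra.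
Qed.

Lemma gronwall_le (V : R -> R) (c a b : R) : a <= b ->
  (forall t, a <= t <= b -> exists l, is_derive V t l /\ l <= c * V t) ->
  V b <= V a * exp (c * (b - a)).
Proof.
  intros Hab HV.
  assert (decr : V b * exp (- c * (b - a)) <= V a * exp (- c * (a - a)) + 0 * (b - a)).
  { apply (increment_le (fun t => V t * exp (- c * (t - a))) 0 a b Hab).
    intros t Ht. destruct (HV t Ht) as [l [Hl Hc]].
    exists ((l - c * V t) * exp (- c * (t - a))). split; [derive_with; unfold Rminus; ring|].
    pose proof (exp_pos (- c * (t - a))). nra. }
  replace (- c * (a - a)) with 0 in decr by ring. rewrite exp_0 in decr.
  replace (- c * (b - a)) with (- (c * (b - a))) in decr by ring. rewrite exp_Ropp in decr.
  pose proof (exp_pos (c * (b - a))).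
  apply (Rle_div_l (V b) (V a)); [lra|]. unfold Rdiv. lra.
Qed.

Lemma gronwall_ge (V : R -> R) (c a b : R) : a <= b ->
  (forall t, a <= t <= b -> exists l, is_derive V t l /\ c * V t <= l) ->
  V a * exp (c * (b - a)) <= V b.
Proof.
  intros Hab HV. pose proof (gronwall_le (fun t => - V t) c a b Hab) as opp_growth.
  assert (- V b <= - V a * exp (c * (b - a))); [|lra]. apply opp_growth. intros t Ht.
  destruct (HV t Ht) as [l [Hl Hc]]. exists (- l). split; [exact (is_derive_opp V t l Hl)|lra].
Qed.

Lemma same_log_derivative (f g k : R -> R) (a b : R) : a <= b ->
  (forall t, a <= t <= b -> is_derive f t (k t * f t) /\ is_derive g t (k t * g t) /\ g t <> 0) ->
  f b / g b = f a / g a.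
Proof.
  intros Hab Hfg. apply (derive_zero_const (fun t => f t / g t) a b Hab).
  intros t Ht. destruct (Hfg t Ht) as [Df [Dg Hg]]. derive_with; [exact Hg|]. field. exact Hg.
Qed.

Lemma bootstrap_lt_0 (f : R -> R) :
  (forall t, 0 <= t -> continuous f t) -> f 0 < 0 ->
  (forall T, 0 <= T -> (forall t, 0 <= t <= T -> f t <= 0) -> f T < 0) ->
  forall t, 0 <= t -> f t < 0.
Proof.
  intros Hf f0 improves t1 Ht1.
  set (E := fun x => 0 <= x <= t1 /\ forall t, 0 <= t <= x -> f t <= 0).
  assert (E0 : E 0) by (split; [lra|]; intros t Ht; replace t with 0 by lra; lra).
  destruct (completeness E) as [T [upper least]]; [exists t1; intros x [Hx _]; lra|exists 0; exact E0|].
  assert (HT : 0 <= T <= t1) by (split; [apply upper, E0|apply least; intros x [Hx _]; lra]).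
  assert (before : forall t, 0 <= t < T -> f t <= 0).
  { intros t Ht. apply Rnot_lt_le. intros pos. assert (T <= t); [|lra].
    apply least. intros x [_ Hx]. apply Rnot_lt_le. intros tx. specialize (Hx t ltac:(lra)). lra. }
  assert (at_T : f T < 0).
  { apply improves; [lra|]. intros t Ht. destruct (Rlt_dec t T); [apply before; lra|].
    replace t with T by lra. apply Rnot_lt_le. intros pos.
    destruct (continuous_locally_lt (fun t => - f t) T 0) as [d [Hd near]];
      [apply (continuous_opp f), Hf; lra|lra|].
    set (x := Rmax 0 (T - d / 2)). pose proof (Rmax_r 0 (T - d / 2)).
    assert (T <> 0) by (intros E'; rewrite E' in pos; lra).
    assert (0 <= x < T) by (unfold x; split; [apply Rmax_l|apply Rmax_lub_lt; lra]).
    specialize (near x ltac:(rewrite Rabs_left; unfold x in *; lra)). specialize (before x ltac:(lra)). lra. }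
  destruct (Req_dec T t1) as [->|HTt]; [exact at_T|exfalso].
  destruct (continuous_locally_lt f T 0) as [d [Hd near]]; [apply Hf; lra|exact at_T|].
  set (x := Rmin t1 (T + d / 2)). pose proof (Rmin_r t1 (T + d / 2)).
  assert (Hx : T < x) by (unfold x; apply Rmin_glb_lt; lra).
  assert (E x) as Ex; [|specialize (upper x Ex); lra].
  split; [split; [lra|apply Rmin_l]|]. intros t Ht.
  destruct (Rlt_dec t T); [apply before; lra|]. left. apply near. rewrite Rabs_pos_eq; unfold x in *; lra.
Qed.

(** * Elementary inequalities *)

Lemma Rabs_minus_triang (x y z : R) : Rabs (x - z) <= Rabs (x - y) + Rabs (y - z).
Proof. apply (Rdist_tri x z y). Qed.

Lemma Rabs_le_of_pow2 (x y : R) : x ^ 2 <= y ^ 2 -> 0 <= y -> Rabs x <= y.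
Proof. intros H Hy. rewrite <- (Rabs_pos_eq y) by lra. apply Rsqr_le_abs_0. rewrite !Rsqr_pow2. exact H. Qed.

Lemma Rabs_mult_bounds (x y : R) : - (Rabs x * Rabs y) <= x * y <= Rabs x * Rabs y.
Proof. rewrite <- Rabs_mult. apply Rabs_le_between. lra. Qed.

Lemma Rabs_mult_le_pow2 (u v : R) : Rabs u * Rabs v <= u ^ 2 + v ^ 2.
Proof. rewrite <- (pow2_abs u), <- (pow2_abs v). pose proof (pow2_ge_0 (Rabs u - Rabs v)). nra. Qed.

Lemma sum_pow2_pos (x y : R) : 0 < y -> 0 < x ^ 2 + y ^ 2.
Proof. intros Hy. pose proof (pow2_ge_0 x). pose proof (pow_lt y 2 Hy). lra. Qed.

Lemma young (c p q x y : R) : 0 < p -> c ^ 2 <= 4 * p * q -> c * (x * y) <= p * x ^ 2 + q * y ^ 2.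
Proof.
  intros Hp Hc. assert (0 <= (2 * p * x - c * y) ^ 2 + (4 * p * q - c ^ 2) * y ^ 2).
  { apply Rplus_le_le_0_compat; [apply pow2_ge_0|]. apply Rmult_le_pos; [lra|apply pow2_ge_0]. }
  apply (Rmult_le_reg_l (4 * p)); [lra|]. nra.
Qed.

Lemma Rabs_linear_form_le (a b c u v w : R) :
  Rabs (a * u + b * v + c * w) <= (Rabs a + Rabs b + Rabs c) * (Rabs u + Rabs v + Rabs w).
Proof.
  eapply Rle_trans; [apply Rabs_triang|]. eapply Rle_trans; [apply Rplus_le_compat_r, Rabs_triang|].
  rewrite !Rabs_mult.
  pose proof (Rabs_pos a). pose proof (Rabs_pos b). pose proof (Rabs_pos c).
  pose proof (Rabs_pos u). pose proof (Rabs_pos v). pose proof (Rabs_pos w). nra.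
Qed.

Lemma Rabs_sign_mult (sg x : R) : sg * sg = 1 -> Rabs (sg * x) = Rabs x.
Proof.
  intros Hsg. assert (sq : Rabs sg * Rabs sg = 1) by (rewrite <- Rabs_mult, Hsg; apply Rabs_R1).
  rewrite Rabs_mult. pose proof (Rabs_pos sg). replace (Rabs sg) with 1 by nra. ring.
Qed.

Lemma sign_mult_ge (sg x : R) : sg * sg = 1 -> - Rabs x <= sg * x.
Proof. intros Hsg. rewrite <- (Rabs_sign_mult sg x Hsg). pose proof (Rabs_maj2 (sg * x)). lra. Qed.

Lemma exp_le_1 (x : R) : x <= 0 -> exp x <= 1.
Proof. intros Hx. rewrite <- exp_0. destruct Hx as [Hx| ->]; [left; apply exp_increasing, Hx|lra]. Qed.

Lemma pow_decr_exponent (d : R) (j k : nat) : 0 <= d <= 1 -> (j <= k)%nat -> d ^ k <= d ^ j.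
Proof.
  intros Hd Hjk. replace k with (j + (k - j))%nat by lia. rewrite pow_add.
  pose proof (pow_le d j (proj1 Hd)).
  assert (d ^ (k - j) <= 1) by (rewrite <- (pow1 (k - j)); apply pow_incr; lra). nra.
Qed.

Lemma Rabs_sin_le_1 (x : R) : Rabs (sin x) <= 1.
Proof. pose proof (SIN_bound x). apply Rabs_le_between. lra. Qed.

Lemma Rabs_cos_le_1 (x : R) : Rabs (cos x) <= 1.
Proof. pose proof (COS_bound x). apply Rabs_le_between. lra. Qed.

Lemma cos2_plus_sin2 (x : R) : cos x ^ 2 + sin x ^ 2 = 1.
Proof. rewrite <- !Rsqr_pow2, Rplus_comm. apply sin2_cos2. Qed.

Lemma sin_lipschitz (x y : R) : Rabs (sin x - sin y) <= Rabs (x - y).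
Proof.
  rewrite <- (Rmult_1_l (Rabs (x - y))). apply (bounded_variation sin cos).
  intros t _. split; [apply is_derive_sin|apply Rabs_cos_le_1].
Qed.

Lemma cos_lipschitz (x y : R) : Rabs (cos x - cos y) <= Rabs (x - y).
Proof.
  rewrite <- (Rmult_1_l (Rabs (x - y))). apply (bounded_variation cos (fun x => - sin x)).
  intros t _. split; [apply is_derive_cos|]. rewrite Rabs_Ropp. apply Rabs_sin_le_1.
Qed.

Lemma Rabs_atan_le (x : R) : Rabs (atan x) <= Rabs x.
Proof.
  pose proof (bounded_variation atan (fun x => / (1 + Rsqr x)) 1 0 x) as variation.
  rewrite atan_0, !Rminus_0_r, Rmult_1_l in variation. apply variation. intros t _. split; [apply is_derive_atan|].
  pose proof (Rle_0_sqr t). rewrite Rabs_pos_eq by (left; apply Rinv_0_lt_compat; lra).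
  rewrite <- Rinv_1. apply Rinv_le_contravar; lra.
Qed.

(** * Small parameters and dyadic limits *)

Lemma at_right_0_intro (P : R -> Prop) (d0 : R) : 0 < d0 -> (forall d, 0 < d <= d0 -> P d) -> at_right 0 P.
Proof.
  intros Hd0 HP. exists (mkposreal d0 Hd0). intros d Hd pos. apply HP.
  change (Rabs (d - 0) < d0) in Hd. rewrite Rminus_0_r in Hd. apply Rabs_def2 in Hd. lra.
Qed.

Lemma at_right_0_elim (P : R -> Prop) : at_right 0 P -> exists d0, 0 < d0 <= 1 /\ forall d, 0 < d <= d0 -> P d.
Proof.
  intros [e HP]. exists (Rmin 1 (e / 2)). pose proof (cond_pos e).
  split; [split; [apply Rmin_glb_lt; lra|apply Rmin_l]|]. intros d Hd.
  pose proof (Rmin_r 1 (e / 2)). apply HP; [|lra].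
  change (Rabs (d - 0) < e). rewrite Rminus_0_r, Rabs_pos_eq; lra.
Qed.

Lemma at_right_0_linear (c e : R) : 0 < e -> at_right 0 (fun d => c * d <= e).
Proof.
  intros He. pose proof (Rabs_pos c). apply (at_right_0_intro _ (e / (Rabs c + 1))); [apply Rdiv_lt_0_compat; lra|].
  intros d [Hd Hde]. apply Rle_div_r in Hde; [|lra]. pose proof (Rle_abs c). nra.
Qed.

Lemma pow2_neq_0 (n : nat) : 2 ^ n <> 0.
Proof. apply pow_nonzero; lra. Qed.

Lemma is_lim_seq_div_pow2 (r : R) : is_lim_seq (fun n => r / 2 ^ n) 0.
Proof.
  apply (is_lim_seq_ext (fun n => r * (/ 2) ^ n)); [intros n; rewrite pow_inv; reflexivity|].
  replace (Finite 0) with (Rbar_mult r 0) by (simpl; f_equal; ring).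
  apply is_lim_seq_scal_l, is_lim_seq_geom. rewrite Rabs_pos_eq; lra.
Qed.

Lemma div_pow2_lt (r e : R) : 0 < e -> exists n, r / 2 ^ n < e.
Proof.
  intros He. pose proof (is_lim_seq_div_pow2 r) as L. apply is_lim_seq_spec in L.
  destruct (L (mkposreal e He)) as [n Hn]. exists n. specialize (Hn n (Nat.le_refl n)).
  simpl in Hn. rewrite Rminus_0_r in Hn. apply Rabs_def2 in Hn. lra.
Qed.

Lemma le_of_div_pow2 (a b r : R) : (forall n : nat, a <= b + r / 2 ^ n) -> a <= b.
Proof.
  intros H. apply Rnot_lt_le. intros lt. destruct (div_pow2_lt r (a - b)) as [n Hn]; [lra|].
  specialize (H n). lra.
Qed.

Lemma Lim_seq_dyadic (x : nat -> R) (r : R) : (forall n, Rabs (x (S n) - x n) <= r / 2 ^ n) ->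
  forall n, Rabs (x n - real (Lim_seq x)) <= 2 * r / 2 ^ n.
Proof.
  intros Hx. set (e := fun n => 2 * r / 2 ^ n).
  assert (e_succ : forall n, e (S n) = e n - r / 2 ^ n) by (intros n; unfold e; simpl; field; apply pow2_neq_0).
  assert (incr : forall n, x n - e n <= x (S n) - e (S n)).
  { intros n. specialize (Hx n). apply Rabs_le_between in Hx. rewrite e_succ. lra. }
  assert (decr : forall n, x (S n) + e (S n) <= x n + e n).
  { intros n. specialize (Hx n). apply Rabs_le_between in Hx. rewrite e_succ. lra. }
  assert (e_lim : is_lim_seq e 0) by exact (is_lim_seq_div_pow2 (2 * r)).
  destruct (ex_lim_seq_adj (fun n => x n - e n) (fun n => x n + e n) incr decr) as [[l Hl] _].
  { apply (is_lim_seq_ext (fun n => 2 * e n)); [intros n; ring|].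
    replace (Finite 0) with (Rbar_mult 2 0) by (simpl; f_equal; ring). apply is_lim_seq_scal_l, e_lim. }
  assert (plus_e : forall (y : nat -> R) (z : R), is_lim_seq y z -> is_lim_seq (fun n => y n + e n) z).
  { intros y z Hy. replace (Finite z) with (Finite (z + 0)) by (f_equal; ring). apply is_lim_seq_plus'; auto. }
  assert (x_lim : is_lim_seq x l).
  { apply (is_lim_seq_ext (fun n => (x n - e n) + e n)); [intros n; ring|]. apply plus_e, Hl. }
  rewrite (is_lim_seq_unique _ _ x_lim). simpl. intros n. fold (e n). apply Rabs_le_between.
  pose proof (is_lim_seq_incr_compare _ _ Hl incr n).
  pose proof (is_lim_seq_decr_compare _ _ (plus_e _ _ x_lim) decr n). simpl in *. lra.
Qed.

Lemma dyadic_limit_continuous (f : nat -> R -> R) (g : R -> R) (r t : R) :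
  locally t (fun s => forall n, Rabs (f n s - g s) <= r / 2 ^ n) -> (forall n, continuous (f n) t) ->
  continuous g t.
Proof.
  intros [d0 Hfg] Hf. apply continuous_of_Rabs_lt. intros e He.
  destruct (div_pow2_lt r (e / 3)) as [n Hn]; [lra|].
  destruct (continuous_Rabs_lt _ _ (Hf n) (e / 3)) as [d [Hd near]]; [lra|].
  exists (Rmin d0 d). split; [apply Rmin_glb_lt; [apply cond_pos|exact Hd]|]. intros x Hx.
  pose proof (Rmin_l d0 d). pose proof (Rmin_r d0 d). specialize (near x ltac:(lra)).
  pose proof (Hfg x ltac:(change (Rabs (x - t) < d0); lra) n) as at_x.
  pose proof (Hfg t (ball_center t d0) n) as at_t.
  apply Rabs_le_between in at_x. apply Rabs_le_between in at_t. apply Rabs_def2 in near.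
  apply Rabs_def1; lra.
Qed.

(** * Vectors and vector fields *)

Lemma R3_eta (X : R3) : (coord 0 X, coord 1 X, coord 2 X) = X.
Proof. destruct X as [[x y] z]. reflexivity. Qed.

Lemma R3_ext (X Y : R3) : coord 0 X = coord 0 Y -> coord 1 X = coord 1 Y -> coord 2 X = coord 2 Y -> X = Y.
Proof. destruct X as [[x y] z], Y as [[x' y'] z']. simpl. congruence. Qed.

Lemma Rabs_coord_le_dist3 (X Y : R3) (i : nat) : Rabs (coord i X - coord i Y) <= dist3 X Y.
Proof.
  assert (le_norm : forall a b c, Rabs a <= sqrt (a ^ 2 + b ^ 2 + c ^ 2)).
  { intros a b c. rewrite <- sqrt_Rsqr_abs. apply sqrt_le_1_alt. rewrite Rsqr_pow2.
    pose proof (pow2_ge_0 b). pose proof (pow2_ge_0 c). lra. }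
  unfold dist3. destruct i as [|[|i]].
  - apply le_norm.
  - rewrite (Rplus_comm ((coord 0 X - coord 0 Y) ^ 2)). apply le_norm.
  - rewrite Rplus_comm, <- Rplus_assoc. apply le_norm.
Qed.

Lemma dist3_le_Rabs (X Y : R3) :
  dist3 X Y <= Rabs (coord 0 X - coord 0 Y) + Rabs (coord 1 X - coord 1 Y) + Rabs (coord 2 X - coord 2 Y).
Proof.
  unfold dist3. set (a := coord 0 X - coord 0 Y). set (b := coord 1 X - coord 1 Y).
  set (c := coord 2 X - coord 2 Y).
  pose proof (Rabs_pos a). pose proof (Rabs_pos b). pose proof (Rabs_pos c).
  rewrite <- (sqrt_pow2 (Rabs a + Rabs b + Rabs c)) by lra. apply sqrt_le_1_alt.
  rewrite <- (pow2_abs a), <- (pow2_abs b), <- (pow2_abs c). nra.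
Qed.

Lemma dist3_sym (X Y : R3) : dist3 X Y = dist3 Y X.
Proof. unfold dist3. f_equal. ring. Qed.

Definition field3 (f1 f2 f3 : R -> R -> R -> R) (X : R3) : R3 :=
  (f1 (coord 0 X) (coord 1 X) (coord 2 X), f2 (coord 0 X) (coord 1 X) (coord 2 X),
   f3 (coord 0 X) (coord 1 X) (coord 2 X)).

Definition sol_at (F : R3 -> R3) (phi : R -> R3) (t : R) : Prop :=
  forall i, (i < 3)%nat -> is_derive (fun s => coord i (phi s)) t (coord i (F (phi t))).

Lemma is_fsol_of_is_sol (F : R3 -> R3) (phi : R -> R3) : is_sol F phi -> is_fsol F phi.
Proof. intros H t _. apply H. Qed.

Lemma sol_at_coord (F : R3 -> R3) (phi : R -> R3) (t : R) : sol_at F phi t ->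
  is_derive (fun s => coord 0 (phi s)) t (coord 0 (F (phi t))) /\
  is_derive (fun s => coord 1 (phi s)) t (coord 1 (F (phi t))) /\
  is_derive (fun s => coord 2 (phi s)) t (coord 2 (F (phi t))).
Proof. intros H. split; [|split]; apply H; lia. Qed.

Lemma sol_at_intro (F : R3 -> R3) (phi : R -> R3) (t : R) :
  is_derive (fun s => coord 0 (phi s)) t (coord 0 (F (phi t))) ->
  is_derive (fun s => coord 1 (phi s)) t (coord 1 (F (phi t))) ->
  is_derive (fun s => coord 2 (phi s)) t (coord 2 (F (phi t))) -> sol_at F phi t.
Proof. intros D0 D1 D2 [|[|[|i]]] Hi; [exact D0|exact D1|exact D2|lia]. Qed.

(** * Bounded Lipschitz functions of three variables *)

Definition dist1 (x y z x' y' z' : R) : R := Rabs (x - x') + Rabs (y - y') + Rabs (z - z').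

Definition bounded_lipschitz (D : R -> R -> R -> Prop) (C : R) (f : R -> R -> R -> R) : Prop :=
  (forall x y z, D x y z -> Rabs (f x y z) <= C) /\
  (forall x y z x' y' z', D x y z -> D x' y' z' ->
     Rabs (f x y z - f x' y' z') <= C * dist1 x y z x' y' z').

Definition box (b x y z : R) : Prop := Rabs x <= b /\ Rabs y <= b /\ Rabs z <= b.

Definition in_box (b : R) (X : R3) : Prop := box b (coord 0 X) (coord 1 X) (coord 2 X).

Definition loc_lipschitz (f : R -> R -> R -> R) : Prop := forall b, exists C, bounded_lipschitz (box b) C f.

Lemma dist1_ge_0 (x y z x' y' z' : R) : 0 <= dist1 x y z x' y' z'.
Proof.
  unfold dist1. pose proof (Rabs_pos (x - x')). pose proof (Rabs_pos (y - y')). pose proof (Rabs_pos (z - z')). lra.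
Qed.

Lemma dist1_ge_coord (i : nat) (x y z x' y' z' : R) :
  Rabs (coord i (x, y, z) - coord i (x', y', z')) <= dist1 x y z x' y' z'.
Proof.
  unfold dist1. pose proof (Rabs_pos (x - x')). pose proof (Rabs_pos (y - y')). pose proof (Rabs_pos (z - z')).
  destruct i as [|[|i]]; simpl; lra.
Qed.

Lemma dist1_le_dist3 (X Y : R3) :
  dist1 (coord 0 X) (coord 1 X) (coord 2 X) (coord 0 Y) (coord 1 Y) (coord 2 Y) <= 3 * dist3 X Y.
Proof.
  unfold dist1. pose proof (Rabs_coord_le_dist3 X Y 0). pose proof (Rabs_coord_le_dist3 X Y 1).
  pose proof (Rabs_coord_le_dist3 X Y 2). lra.
Qed.

Lemma bounded_lipschitz_weaken D C C' f : bounded_lipschitz D C f -> C <= C' -> bounded_lipschitz D C' f.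
Proof.
  intros [bound lip] HC. split.
  - intros x y z Hx. specialize (bound x y z Hx). lra.
  - intros x y z x' y' z' Hx Hx'. specialize (lip _ _ _ _ _ _ Hx Hx').
    pose proof (dist1_ge_0 x y z x' y' z'). nra.
Qed.

Lemma bounded_lipschitz_subset (D D' : R -> R -> R -> Prop) C f :
  bounded_lipschitz D C f -> (forall x y z, D' x y z -> D x y z) -> bounded_lipschitz D' C f.
Proof. intros [bound lip] HD; split; intros; auto. Qed.

Lemma bounded_lipschitz_ext D C f g :
  (forall x y z, D x y z -> f x y z = g x y z) -> bounded_lipschitz D C f -> bounded_lipschitz D C g.
Proof.
  intros E [bound lip]; split.
  - intros x y z Hx. rewrite <- E; auto.
  - intros x y z x' y' z' Hx Hx'. rewrite <- !E; auto.
Qed.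

Lemma bounded_lipschitz_const D c : bounded_lipschitz D (Rabs c) (fun _ _ _ => c).
Proof.
  split; intros; [lra|]. rewrite Rminus_diag, Rabs_R0.
  apply Rmult_le_pos; [apply Rabs_pos|apply dist1_ge_0].
Qed.

Lemma bounded_lipschitz_coord D b (i : nat) : (forall x y z, D x y z -> Rabs (coord i (x, y, z)) <= b) ->
  bounded_lipschitz D (Rmax b 1) (fun x y z => coord i (x, y, z)).
Proof.
  intros HD. split.
  - intros x y z Hx. eapply Rle_trans; [apply HD, Hx|apply Rmax_l].
  - intros x y z x' y' z' _ _. eapply Rle_trans; [apply dist1_ge_coord|].
    pose proof (Rmax_r b 1). pose proof (dist1_ge_0 x y z x' y' z'). nra.
Qed.

Lemma bounded_lipschitz_plus D C C' f g : bounded_lipschitz D C f -> bounded_lipschitz D C' g ->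
  bounded_lipschitz D (C + C') (fun x y z => f x y z + g x y z).
Proof.
  intros [bf lf] [bg lg]; split.
  - intros x y z Hx. eapply Rle_trans; [apply Rabs_triang|]. specialize (bf _ _ _ Hx). specialize (bg _ _ _ Hx). lra.
  - intros x y z x' y' z' Hx Hx'.
    replace (f x y z + g x y z - (f x' y' z' + g x' y' z'))
      with (f x y z - f x' y' z' + (g x y z - g x' y' z')) by ring.
    eapply Rle_trans; [apply Rabs_triang|].
    specialize (lf _ _ _ _ _ _ Hx Hx'). specialize (lg _ _ _ _ _ _ Hx Hx'). lra.
Qed.

Lemma bounded_lipschitz_opp D C f : bounded_lipschitz D C f -> bounded_lipschitz D C (fun x y z => - f x y z).
Proof.
  intros [bound lip]; split.
  - intros x y z Hx. rewrite Rabs_Ropp; auto.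
  - intros x y z x' y' z' Hx Hx'. replace (- f x y z - - f x' y' z') with (- (f x y z - f x' y' z')) by ring.
    rewrite Rabs_Ropp; auto.
Qed.

Lemma bounded_lipschitz_mult D C C' f g : bounded_lipschitz D C f -> bounded_lipschitz D C' g ->
  bounded_lipschitz D (2 * (C * C')) (fun x y z => f x y z * g x y z).
Proof.
  intros [bf lf] [bg lg]; split.
  - intros x y z Hx. rewrite Rabs_mult. specialize (bf _ _ _ Hx). specialize (bg _ _ _ Hx).
    pose proof (Rabs_pos (f x y z)). pose proof (Rabs_pos (g x y z)).
    assert (Rabs (f x y z) * Rabs (g x y z) <= C * C') by (apply Rmult_le_compat; auto).
    assert (0 <= C * C') by (apply Rmult_le_pos; lra). lra.
  - intros x y z x' y' z' Hx Hx'.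
    replace (f x y z * g x y z - f x' y' z' * g x' y' z')
      with (f x y z * (g x y z - g x' y' z') + (f x y z - f x' y' z') * g x' y' z') by ring.
    eapply Rle_trans; [apply Rabs_triang|]. rewrite !Rabs_mult.
    specialize (lf _ _ _ _ _ _ Hx Hx'). specialize (lg _ _ _ _ _ _ Hx Hx').
    specialize (bf _ _ _ Hx). specialize (bg _ _ _ Hx').
    set (d := dist1 x y z x' y' z') in *.
    assert (Rabs (f x y z) * Rabs (g x y z - g x' y' z') <= C * (C' * d))
      by (apply Rmult_le_compat; auto; apply Rabs_pos).
    assert (Rabs (f x y z - f x' y' z') * Rabs (g x' y' z') <= C * d * C')
      by (apply Rmult_le_compat; auto; apply Rabs_pos).
    lra.
Qed.

Lemma bounded_lipschitz_inv D C m f : 0 < m -> bounded_lipschitz D C f ->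
  (forall x y z, D x y z -> m <= f x y z) ->
  bounded_lipschitz D (/ m + C / (m * m)) (fun x y z => / f x y z).
Proof.
  intros Hm [bound lip] Hf.
  assert (inv_le : forall x y z, D x y z -> 0 < / f x y z <= / m).
  { intros x y z Hx. specialize (Hf x y z Hx). split; [apply Rinv_0_lt_compat|apply Rinv_le_contravar]; lra. }
  assert (Hm' : 0 < / m) by (apply Rinv_0_lt_compat, Hm). split.
  - intros x y z Hx. specialize (inv_le x y z Hx). rewrite Rabs_pos_eq by lra.
    assert (0 <= C / (m * m)); [|lra]. apply Rdiv_le_0_compat; [|nra].
    eapply Rle_trans; [apply Rabs_pos|apply (bound x y z Hx)].
  - intros x y z x' y' z' Hx Hx'. pose proof (Hf _ _ _ Hx). pose proof (Hf _ _ _ Hx').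
    specialize (lip _ _ _ _ _ _ Hx Hx'). pose proof (inv_le _ _ _ Hx). pose proof (inv_le _ _ _ Hx').
    pose proof (dist1_ge_0 x y z x' y' z'). set (d := dist1 x y z x' y' z') in *.
    replace (/ f x y z - / f x' y' z')
      with (- (f x y z - f x' y' z') * (/ f x y z * / f x' y' z')) by (field; lra).
    rewrite Rabs_mult, Rabs_Ropp, (Rabs_pos_eq (/ _ * / _)) by (apply Rmult_le_pos; lra).
    apply Rle_trans with (C * d * (/ m * / m)).
    + apply Rmult_le_compat; auto using Rabs_pos; [apply Rmult_le_pos; lra|apply Rmult_le_compat; lra].
    + replace (C * d * (/ m * / m)) with (C / (m * m) * d) by (field; lra).
      assert (0 <= / m * d) by (apply Rmult_le_pos; lra). lra.
Qed.

Lemma bounded_lipschitz_comp (D D' : R -> R -> R -> Prop) C K f (m1 m2 m3 : R -> R -> R -> R) :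
  bounded_lipschitz D C f -> 0 <= C -> 1 <= K ->
  (forall x y z, D' x y z -> D (m1 x y z) (m2 x y z) (m3 x y z)) ->
  (forall x y z x' y' z', D' x y z -> D' x' y' z' ->
     dist1 (m1 x y z) (m2 x y z) (m3 x y z) (m1 x' y' z') (m2 x' y' z') (m3 x' y' z')
     <= K * dist1 x y z x' y' z') ->
  bounded_lipschitz D' (C * K) (fun x y z => f (m1 x y z) (m2 x y z) (m3 x y z)).
Proof.
  intros [bound lip] HC HK Hm Hd; split; intros.
  - eapply Rle_trans; [apply bound; auto|]. nra.
  - eapply Rle_trans; [apply lip; auto|]. rewrite Rmult_assoc.
    apply Rmult_le_compat_l; auto.
Qed.

Lemma bounded_lipschitz_continuous D C f (x y z : R -> R) (t : R) : bounded_lipschitz D C f ->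
  locally t (fun s => D (x s) (y s) (z s)) -> continuous x t -> continuous y t -> continuous z t ->
  continuous (fun s => f (x s) (y s) (z s)) t.
Proof.
  intros [_ lip] HD Hx Hy Hz.
  apply (continuous_of_modulus _ (fun s => C * (Rabs (x s - x t) + Rabs (y s - y t) + Rabs (z s - z t)))).
  - prove_continuous.
  - rewrite !Rminus_diag, Rabs_R0. ring.
  - apply (filter_imp _ _ (fun s Hs => lip _ _ _ _ _ _ Hs (locally_singleton _ _ HD)) HD).
Qed.

Lemma loc_lipschitz_continuous (f : R -> R -> R -> R) (x y z : R -> R) (t : R) :
  loc_lipschitz f -> continuous x t -> continuous y t -> continuous z t ->
  continuous (fun s => f (x s) (y s) (z s)) t.
Proof.
  intros Hf Hx Hy Hz. set (b := Rabs (x t) + Rabs (y t) + Rabs (z t) + 1). destruct (Hf b) as [C HC].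
  apply (bounded_lipschitz_continuous (box b) C f); auto.
  assert (near : forall u : R -> R, continuous u t -> locally t (fun s => Rabs (u s) < Rabs (u t) + 1)).
  { intros u Hu. destruct (continuous_locally_lt (fun s => Rabs (u s)) t (Rabs (u t) + 1)) as [d [Hd H]];
      [prove_continuous|lra|]. exists (mkposreal d Hd). exact H. }
  pose proof (Rabs_pos (x t)). pose proof (Rabs_pos (y t)). pose proof (Rabs_pos (z t)).
  refine (filter_imp _ _ _ (filter_and _ _ (near x Hx) (filter_and _ _ (near y Hy) (near z Hz)))).
  intros s [Hxs [Hys Hzs]]. unfold b. repeat split; lra.
Qed.

Lemma loc_lipschitz_const (c : R) : loc_lipschitz (fun _ _ _ => c).
Proof. intros b. exists (Rabs c). apply bounded_lipschitz_const. Qed.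

Lemma box_coord (b x y z : R) (i : nat) : box b x y z -> Rabs (coord i (x, y, z)) <= b.
Proof. intros [Hx [Hy Hz]]. destruct i as [|[|i]]; assumption. Qed.

Lemma loc_lipschitz_coord (i : nat) : loc_lipschitz (fun x y z => coord i (x, y, z)).
Proof. intros b. exists (Rmax b 1). apply bounded_lipschitz_coord. intros x y z. apply box_coord. Qed.

Lemma loc_lipschitz_plus f g : loc_lipschitz f -> loc_lipschitz g -> loc_lipschitz (fun x y z => f x y z + g x y z).
Proof.
  intros Hf Hg b. destruct (Hf b) as [Cf Kf], (Hg b) as [Cg Kg]. exists (Cf + Cg).
  apply bounded_lipschitz_plus; auto.
Qed.

Lemma loc_lipschitz_opp f : loc_lipschitz f -> loc_lipschitz (fun x y z => - f x y z).
Proof. intros Hf b. destruct (Hf b) as [C K]. exists C. apply bounded_lipschitz_opp, K. Qed.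

Lemma loc_lipschitz_mult f g : loc_lipschitz f -> loc_lipschitz g -> loc_lipschitz (fun x y z => f x y z * g x y z).
Proof.
  intros Hf Hg b. destruct (Hf b) as [Cf Kf], (Hg b) as [Cg Kg]. exists (2 * (Cf * Cg)).
  apply bounded_lipschitz_mult; auto.
Qed.

Lemma loc_lipschitz_comp (g : R -> R) f : (forall x y, Rabs (g x - g y) <= Rabs (x - y)) ->
  loc_lipschitz f -> loc_lipschitz (fun x y z => g (f x y z)).
Proof.
  intros Hg Hf b. destruct (Hf b) as [C [bound lip]]. exists (Rabs (g 0) + C). split.
  - intros x y z Hx. specialize (bound x y z Hx). specialize (Hg (f x y z) 0). rewrite Rminus_0_r in Hg.
    pose proof (Rabs_triang (g 0) (g (f x y z) - g 0)) as T.
    replace (g 0 + (g (f x y z) - g 0)) with (g (f x y z)) in T by ring. lra.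
  - intros x y z x' y' z' Hx Hx'. eapply Rle_trans; [apply Hg|]. specialize (lip _ _ _ _ _ _ Hx Hx').
    pose proof (dist1_ge_0 x y z x' y' z'). pose proof (Rabs_pos (g 0)). nra.
Qed.

Ltac prove_loc_lipschitz :=
  lazymatch goal with
  | |- loc_lipschitz (fun _ _ _ => ?c) => apply loc_lipschitz_const
  | |- loc_lipschitz (fun x y z => x) => exact (loc_lipschitz_coord 0)
  | |- loc_lipschitz (fun x y z => y) => exact (loc_lipschitz_coord 1)
  | |- loc_lipschitz (fun x y z => z) => exact (loc_lipschitz_coord 2)
  | |- loc_lipschitz (fun x y z => @?f x y z + @?g x y z) => apply (loc_lipschitz_plus f g); prove_loc_lipschitz
  | |- loc_lipschitz (fun x y z => - @?f x y z) => apply (loc_lipschitz_opp f); prove_loc_lipschitz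
  | |- loc_lipschitz (fun x y z => @?f x y z - @?g x y z) =>
      apply (loc_lipschitz_plus f (fun x y z => - g x y z)); prove_loc_lipschitz
  | |- loc_lipschitz (fun x y z => @?f x y z * @?g x y z) => apply (loc_lipschitz_mult f g); prove_loc_lipschitz
  | |- loc_lipschitz (fun x y z => @?f x y z / ?c) =>
      apply (loc_lipschitz_mult f (fun _ _ _ => / c)); prove_loc_lipschitz
  | |- loc_lipschitz (fun x y z => @?f x y z ^ 2) =>
      apply (loc_lipschitz_mult f (fun x y z => f x y z * 1)); prove_loc_lipschitz
  | |- loc_lipschitz (fun x y z => sin (@?f x y z)) =>
      apply (loc_lipschitz_comp sin f); [exact sin_lipschitz|prove_loc_lipschitz]
  | |- loc_lipschitz (fun x y z => cos (@?f x y z)) =>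
      apply (loc_lipschitz_comp cos f); [exact cos_lipschitz|prove_loc_lipschitz]
  | |- _ => auto
  end.

(** * Existence and uniqueness of solutions *)

Lemma continuous_bounded (f : R -> R) (a b : R) : (forall t, a <= t <= b -> continuous f t) ->
  exists M, forall t, a <= t <= b -> Rabs (f t) <= M.
Proof.
  intros Hf. destruct (bounded_continuity (K := R_AbsRing) (V := R_NormedModule) f a b) as [M HM].
  - intros x Hx. exact (Hf x Hx).
  - exists M. intros t Ht. left. exact (HM t Ht).
Qed.

Lemma fsol_bounded (F : R3 -> R3) (phi : R -> R3) (T : R) : is_fsol F phi ->
  exists b, forall t, 0 <= t <= T -> in_box b (phi t).
Proof.
  intros Hphi.
  assert (coord_bounded : forall i, (i < 3)%nat -> exists M, forall t, 0 <= t <= T -> Rabs (coord i (phi t)) <= M).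
  { intros i Hi. apply (continuous_bounded (fun t => coord i (phi t))). intros t Ht.
    exact (is_derive_continuous _ _ _ (Hphi t (proj1 Ht) i Hi)). }
  destruct (coord_bounded 0%nat) as [M0 H0], (coord_bounded 1%nat) as [M1 H1], (coord_bounded 2%nat) as [M2 H2];
    try lia.
  exists (Rmax M0 (Rmax M1 M2)). intros t Ht. specialize (H0 t Ht). specialize (H1 t Ht). specialize (H2 t Ht).
  pose proof (Rmax_l M0 (Rmax M1 M2)). pose proof (Rmax_r M0 (Rmax M1 M2)).
  pose proof (Rmax_l M1 M2). pose proof (Rmax_r M1 M2). repeat split; lra.
Qed.

Section Uniqueness.
Variables f1 f2 f3 : R -> R -> R -> R.
Hypothesis f1_lipschitz : loc_lipschitz f1.
Hypothesis f2_lipschitz : loc_lipschitz f2.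
Hypothesis f3_lipschitz : loc_lipschitz f3.

Let F := field3 f1 f2 f3.

Lemma field3_lipschitz (b : R) : exists L, 0 <= L /\ forall X Y i, in_box b X -> in_box b Y ->
  Rabs (coord i (F X) - coord i (F Y))
  <= L * dist1 (coord 0 X) (coord 1 X) (coord 2 X) (coord 0 Y) (coord 1 Y) (coord 2 Y).
Proof.
  destruct (f1_lipschitz b) as [C1 [_ lip1]], (f2_lipschitz b) as [C2 [_ lip2]], (f3_lipschitz b) as [C3 [_ lip3]].
  set (L := Rabs C1 + Rabs C2 + Rabs C3).
  pose proof (Rabs_pos C1). pose proof (Rabs_pos C2). pose proof (Rabs_pos C3).
  pose proof (Rle_abs C1). pose proof (Rle_abs C2). pose proof (Rle_abs C3).
  exists L. split; [unfold L; lra|]. intros X Y i HX HY.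
  set (d := dist1 (coord 0 X) (coord 1 X) (coord 2 X) (coord 0 Y) (coord 1 Y) (coord 2 Y)).
  assert (Hd : 0 <= d) by apply dist1_ge_0.
  assert (weaken : forall C x, C <= L -> x <= C * d -> x <= L * d) by (intros; nra).
  destruct i as [|[|i]]; simpl;
    [apply (weaken C1), lip1|apply (weaken C2), lip2|apply (weaken C3), lip3]; auto; unfold L; lra.
Qed.

Lemma fsol_unique (phi psi : R -> R3) : is_fsol F phi -> is_fsol F psi -> phi 0 = psi 0 ->
  forall t, 0 <= t -> phi t = psi t.
Proof.
  intros Hphi Hpsi E0 T HT.
  destruct (fsol_bounded F phi T Hphi) as [b1 B1], (fsol_bounded F psi T Hpsi) as [b2 B2].
  destruct (field3_lipschitz (Rmax b1 b2)) as [L [HL lip]].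
  set (d := fun i t => coord i (phi t) - coord i (psi t)).
  set (V := fun t => d 0%nat t ^ 2 + d 1%nat t ^ 2 + d 2%nat t ^ 2).
  assert (HV : V T <= V 0 * exp (6 * L * (T - 0))).
  { apply gronwall_le; [exact HT|]. intros t Ht.
    set (r := fun i => coord i (F (phi t)) - coord i (F (psi t))).
    assert (Dd : forall i, (i < 3)%nat -> is_derive (d i) t (r i)).
    { intros i Hi. apply (is_derive_minus (fun t => coord i (phi t)) (fun t => coord i (psi t)));
        [apply Hphi|apply Hpsi]; auto; lra. }
    pose proof (Dd 0%nat ltac:(lia)) as D0. pose proof (Dd 1%nat ltac:(lia)) as D1.
    pose proof (Dd 2%nat ltac:(lia)) as D2.
    exists (2 * (d 0%nat t * r 0%nat) + 2 * (d 1%nat t * r 1%nat) + 2 * (d 2%nat t * r 2%nat)). split.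
    { unfold V. generalize (d 0%nat) (d 1%nat) (d 2%nat) D0 D1 D2. intros u v w Du Dv Dw. derive_with. ring. }
    set (x := Rabs (d 0%nat t)). set (y := Rabs (d 1%nat t)). set (z := Rabs (d 2%nat t)).
    assert (prod : forall i, (i < 3)%nat -> d i t * r i <= Rabs (d i t) * (L * (x + y + z))).
    { intros i Hi. eapply Rle_trans; [apply (Rabs_mult_bounds (d i t) (r i))|].
      apply Rmult_le_compat_l; [apply Rabs_pos|]. apply lip.
      - destruct (B1 t Ht) as [? [? ?]]. pose proof (Rmax_l b1 b2). repeat split; lra.
      - destruct (B2 t Ht) as [? [? ?]]. pose proof (Rmax_r b1 b2). repeat split; lra. }
    pose proof (prod 0%nat ltac:(lia)) as prod_x. pose proof (prod 1%nat ltac:(lia)) as prod_y.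
    pose proof (prod 2%nat ltac:(lia)) as prod_z. unfold V.
    rewrite <- (pow2_abs (d 0%nat t)), <- (pow2_abs (d 1%nat t)), <- (pow2_abs (d 2%nat t)).
    fold x y z. fold x in prod_x. fold y in prod_y. fold z in prod_z.
    apply Rle_trans with (2 * L * (x + y + z) ^ 2); [lra|].
    replace (6 * L * (x ^ 2 + y ^ 2 + z ^ 2)) with (2 * L * (3 * (x ^ 2 + y ^ 2 + z ^ 2))) by ring.
    apply Rmult_le_compat_l; [lra|].
    pose proof (pow2_ge_0 (x - y)). pose proof (pow2_ge_0 (y - z)). pose proof (pow2_ge_0 (x - z)). lra. }
  replace (V 0) with 0 in HV by (unfold V, d; rewrite E0; ring).
  pose proof (pow2_ge_0 (d 0%nat T)). pose proof (pow2_ge_0 (d 1%nat T)). pose proof (pow2_ge_0 (d 2%nat T)).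
  assert (d_zero : forall i, d i T ^ 2 = 0 -> coord i (phi T) = coord i (psi T)).
  { intros i Hi. apply Rminus_diag_uniq, Rsqr_eq_0. rewrite Rsqr_pow2. exact Hi. }
  unfold V in HV. apply R3_ext; apply d_zero; lra.
Qed.

End Uniqueness.

Lemma sol_reverse_time f1 f2 f3 (phi : R -> R3) : is_sol (field3 f1 f2 f3) phi ->
  is_fsol (field3 (fun x y z => - f1 x y z) (fun x y z => - f2 x y z) (fun x y z => - f3 x y z))
    (fun t => phi (- t)).
Proof.
  intros Hphi t _. destruct (sol_at_coord _ _ (- t) (Hphi (- t))) as [D0 [D1 D2]]. simpl in D0, D1, D2.
  assert (reverse : forall (u : R -> R) l, is_derive u (- t) l -> is_derive (fun s => u (- s)) t (- l)).
  { intros u l Hu. derive_with. ring. }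
  refine (sol_at_intro _ _ _ _ _ _); [apply (reverse (fun s => coord 0 (phi s)))
    |apply (reverse (fun s => coord 1 (phi s)))
    |apply (reverse (fun s => coord 2 (phi s)))]; assumption.
Qed.

Lemma sol_unique f1 f2 f3 (phi psi : R -> R3) : loc_lipschitz f1 -> loc_lipschitz f2 -> loc_lipschitz f3 ->
  is_sol (field3 f1 f2 f3) phi -> is_sol (field3 f1 f2 f3) psi -> phi 0 = psi 0 -> forall t, phi t = psi t.
Proof.
  intros L1 L2 L3 Hphi Hpsi E0 t. destruct (Rle_dec 0 t) as [Ht|Ht].
  - apply (fsol_unique f1 f2 f3); auto; apply is_fsol_of_is_sol; assumption.
  - rewrite <- (Ropp_involutive t).
    apply (fsol_unique (fun x y z => - f1 x y z) (fun x y z => - f2 x y z) (fun x y z => - f3 x y z)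
      (loc_lipschitz_opp _ L1) (loc_lipschitz_opp _ L2) (loc_lipschitz_opp _ L3)
      (fun t => phi (- t)) (fun t => psi (- t))); [apply sol_reverse_time, Hphi|apply sol_reverse_time, Hpsi| |lra].
    rewrite Ropp_0. exact E0.
Qed.

Lemma primitive_le_exp (G g : R -> R) (c k T : R) : 0 <= c -> 0 < k -> G 0 = 0 ->
  (forall t, 0 <= t <= T -> is_derive G t (g t) /\ g t <= c * exp (k * t)) ->
  forall t, 0 <= t <= T -> G t <= c / k * exp (k * t).
Proof.
  intros Hc Hk G0 HG t Ht.
  assert (nonincreasing : G t - c / k * exp (k * t) <= G 0 - c / k * exp (k * 0) + 0 * (t - 0)).
  { apply (increment_le (fun t => G t - c / k * exp (k * t))); [lra|]. intros s Hs.
    destruct (HG s ltac:(lra)) as [DG Hg]. exists (g s - c * exp (k * s)). split; [|lra].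
    derive_with. field. lra. }
  rewrite G0, Rmult_0_r, exp_0 in nonincreasing. assert (0 <= c / k) by (apply Rdiv_le_0_compat; lra). lra.
Qed.

Lemma Rabs_primitive_le_exp (G g : R -> R) (c k T : R) : 0 <= c -> 0 < k -> G 0 = 0 ->
  (forall t, Rabs t <= T -> is_derive G t (g t) /\ Rabs (g t) <= c * exp (k * Rabs t)) ->
  forall t, Rabs t <= T -> Rabs (G t) <= c / k * exp (k * Rabs t).
Proof.
  intros Hc Hk G0 HG t Ht.
  assert (one_sided : forall sg e, sg * sg = 1 -> e * e = 1 -> t = e * Rabs t -> sg * G t <= c / k * exp (k * Rabs t)).
  { intros sg e Hsg He Et. rewrite Et at 1. pose proof (Rabs_pos t).
    apply (primitive_le_exp (fun s => sg * G (e * s)) (fun s => sg * (e * g (e * s))) c k T); auto.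
    - rewrite Rmult_0_r, G0. ring.
    - intros s Hs. assert (Es : Rabs (e * s) = s) by (rewrite Rabs_sign_mult, Rabs_pos_eq by lra; reflexivity).
      destruct (HG (e * s) ltac:(rewrite Es; lra)) as [DG Hg]. rewrite Es in Hg. split; [derive_with; ring|].
      eapply Rle_trans; [apply Rle_abs|]. rewrite !Rabs_sign_mult by assumption. exact Hg. }
  assert (sides : exists e, e * e = 1 /\ t = e * Rabs t).
  { destruct (Rle_dec 0 t).
    - exists 1. rewrite Rabs_pos_eq by lra. lra.
    - exists (-1). rewrite Rabs_left by lra. lra. }
  destruct sides as [e [He Et]]. pose proof (one_sided 1 e ltac:(ring) He Et).
  pose proof (one_sided (-1) e ltac:(ring) He Et). apply Rabs_le_between. lra.
Qed.

Section Picard.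
Variable F : R -> R3 -> R3.
Variable X0 : R3.

Let R3_dist1 (X Y : R3) : R := dist1 (coord 0 X) (coord 1 X) (coord 2 X) (coord 0 Y) (coord 1 Y) (coord 2 Y).
Let continuous_curve (phi : R -> R3) : Prop := forall i t, continuous (fun s => coord i (phi s)) t.

Hypothesis F_lipschitz : forall T, exists L, 0 < L /\ forall t X Y i, Rabs t <= T ->
  Rabs (coord i (F t X) - coord i (F t Y)) <= L * R3_dist1 X Y.
Hypothesis F_continuous : forall phi, continuous_curve phi -> continuous_curve (fun s => F s (phi s)).

Let primitive (phi : R -> R3) (i : nat) (t : R) : R := coord i X0 + RInt (fun s => coord i (F s (phi s))) 0 t.
Let step (phi : R -> R3) (t : R) : R3 := (primitive phi 0 t, primitive phi 1 t, primitive phi 2 t).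
Let iterate (n : nat) : R -> R3 := Nat.iter n step (fun _ => X0).

Let coord_min_2 (X : R3) (i : nat) : coord (Nat.min i 2) X = coord i X.
Proof. destruct i as [|[|[|i]]]; reflexivity. Qed.

Let coord_step (phi : R -> R3) i t : coord i (step phi t) = primitive phi (Nat.min i 2) t.
Proof. destruct i as [|[|[|i]]]; reflexivity. Qed.

Let step_derive phi i t : continuous_curve phi ->
  is_derive (fun s => coord i (step phi s)) t (coord i (F t (phi t))).
Proof.
  intros Hphi. apply (is_derive_ext (fun s => primitive phi (Nat.min i 2) s)).
  { intros s. symmetry. apply coord_step. }
  rewrite <- (coord_min_2 (F t (phi t))). set (j := Nat.min i 2).
  pose proof (is_derive_primitive (fun s => coord j (F s (phi s))) 0 t (F_continuous phi Hphi j)) as D.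
  unfold primitive. set (I := fun x => RInt (fun s => coord j (F s (phi s))) 0 x) in D.
  apply (is_derive_ext (fun s => coord j X0 + I s)); [reflexivity|]. derive_with. ring.
Qed.

Let step_continuous phi : continuous_curve phi -> continuous_curve (step phi).
Proof. intros Hphi i t. eapply is_derive_continuous, step_derive, Hphi. Qed.

Let step_at_0 phi i : coord i (step phi 0) = coord i X0.
Proof. rewrite coord_step. unfold primitive. rewrite RInt_point, coord_min_2. apply Rplus_0_r. Qed.

Let iterate_continuous n : continuous_curve (iterate n).
Proof. induction n as [|n IH]; [intros i t; apply continuous_const|exact (step_continuous _ IH)]. Qed.

Let step_contract phi psi L T c k : continuous_curve phi -> continuous_curve psi -> 0 <= c -> 0 < k -> 0 <= L ->
  (forall t X Y i, Rabs t <= T -> Rabs (coord i (F t X) - coord i (F t Y)) <= L * R3_dist1 X Y) ->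
  (forall t i, Rabs t <= T -> Rabs (coord i (phi t) - coord i (psi t)) <= c * exp (k * Rabs t)) ->
  forall i t, Rabs t <= T -> Rabs (coord i (step phi t) - coord i (step psi t)) <= 3 * L * c / k * exp (k * Rabs t).
Proof.
  intros Hphi Hpsi Hc Hk HL lip H i.
  apply (Rabs_primitive_le_exp (fun t => coord i (step phi t) - coord i (step psi t))
    (fun t => coord i (F t (phi t)) - coord i (F t (psi t)))); auto; [nra|rewrite !step_at_0; ring|].
  intros t Ht. split.
  - apply (is_derive_minus (fun t => coord i (step phi t)) (fun t => coord i (step psi t))); apply step_derive; auto.
  - eapply Rle_trans; [apply lip; auto|]. unfold R3_dist1, dist1.
    pose proof (H t 0%nat Ht). pose proof (H t 1%nat Ht). pose proof (H t 2%nat Ht).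
    replace (3 * L * c * exp (k * Rabs t)) with (L * (3 * (c * exp (k * Rabs t)))) by ring.
    apply Rmult_le_compat_l; lra.
Qed.

Let initial_field_bounded T : exists B, 0 <= B /\ forall t i, Rabs t <= T -> Rabs (coord i (F t X0)) <= B.
Proof.
  assert (coord_bounded : forall i, exists M, forall t, - T <= t <= T -> Rabs (coord i (F t X0)) <= M).
  { intros i. apply continuous_bounded. intros t _. apply (F_continuous (fun _ => X0)).
    intros j s. apply continuous_const. }
  destruct (coord_bounded 0%nat) as [M0 H0], (coord_bounded 1%nat) as [M1 H1], (coord_bounded 2%nat) as [M2 H2].
  exists (Rabs M0 + Rabs M1 + Rabs M2). pose proof (Rabs_pos M0). pose proof (Rabs_pos M1). pose proof (Rabs_pos M2).
  pose proof (Rle_abs M0). pose proof (Rle_abs M1). pose proof (Rle_abs M2).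
  split; [lra|]. intros t i Ht. apply Rabs_le_between in Ht.
  specialize (H0 t Ht). specialize (H1 t Ht). specialize (H2 t Ht). destruct i as [|[|i]]; simpl in *; lra.
Qed.

(* In the norm weighted by [exp (- 6 L |t|)] the integral operator contracts by the factor 1/2. *)
Let iterate_step T : exists C, 0 <= C /\ forall n i t, Rabs t <= T ->
  Rabs (coord i (iterate (S n) t) - coord i (iterate n t)) <= C / 2 ^ n.
Proof.
  destruct (F_lipschitz T) as [L [HL lip]], (initial_field_bounded T) as [B [HB bound]].
  set (k := 6 * L). assert (Hk : 0 < k) by (unfold k; lra).
  assert (HBk : 0 <= B / k) by (apply Rdiv_le_0_compat; lra).
  assert (weighted : forall n i t, Rabs t <= T ->
    Rabs (coord i (iterate (S n) t) - coord i (iterate n t)) <= B / k / 2 ^ n * exp (k * Rabs t)).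
  { induction n as [|n IH]; intros i.
    - replace (B / k / 2 ^ 0) with (B / k) by (simpl; field; lra).
      apply (Rabs_primitive_le_exp (fun t => coord i (step (fun _ => X0) t) - coord i X0) (fun t => coord i (F t X0)));
        auto; [rewrite step_at_0; ring|]. intros t Ht. split.
      + set (u := fun s => coord i (step (fun _ => X0) s)).
        assert (Du : is_derive u t (coord i (F t X0))) by exact (step_derive (fun _ => X0) i t (iterate_continuous 0)).
        apply (is_derive_ext (fun s => u s - coord i X0)); [reflexivity|]. derive_with. ring.
      + pose proof (bound t i Ht). pose proof (exp_ineq1_le (k * Rabs t)).
        assert (0 <= k * Rabs t) by (apply Rmult_le_pos; [lra|apply Rabs_pos]). nra.
    - intros t Ht. pose proof (pow2_neq_0 n).
      replace (B / k / 2 ^ S n) with (3 * L * (B / k / 2 ^ n) / k) by (unfold k; simpl; field; split; lra).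
      apply (step_contract (iterate (S n)) (iterate n) L T); auto; [|lra].
      apply Rdiv_le_0_compat; [exact HBk|apply pow_lt; lra]. }
  exists (B / k * exp (k * T)). split; [apply Rmult_le_pos; [exact HBk|left; apply exp_pos]|].
  intros n i t Ht. eapply Rle_trans; [apply weighted, Ht|].
  replace (B / k * exp (k * T) / 2 ^ n) with (B / k / 2 ^ n * exp (k * T))
    by (field; split; first [apply pow2_neq_0|lra]).
  apply Rmult_le_compat_l; [apply Rdiv_le_0_compat; [exact HBk|apply pow_lt; lra]|].
  destruct Ht as [Ht|Ht]; [left; apply exp_increasing, Rmult_lt_compat_l; lra|rewrite Ht; lra].
Qed.

Let limit_coord (i : nat) (t : R) : R := real (Lim_seq (fun n => coord i (iterate n t))).
Let limit (t : R) : R3 := (limit_coord 0 t, limit_coord 1 t, limit_coord 2 t).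

Let iterate_limit T : exists C, 0 <= C /\ forall n i t, Rabs t <= T ->
  Rabs (coord i (iterate n t) - coord i (limit t)) <= C / 2 ^ n.
Proof.
  destruct (iterate_step T) as [C [HC H]]. exists (2 * C). split; [lra|]. intros n i t Ht.
  replace (coord i (limit t)) with (limit_coord i t) by (destruct i as [|[|[|i]]]; reflexivity).
  apply (Lim_seq_dyadic (fun n => coord i (iterate n t))). intros m. apply H, Ht.
Qed.

Let limit_continuous : continuous_curve limit.
Proof.
  intros i t. destruct (iterate_limit (Rabs t + 1)) as [C [_ HC]].
  apply (dyadic_limit_continuous (fun n s => coord i (iterate n s)) _ C).
  - exists (mkposreal 1 Rlt_0_1). intros s Hs n. apply HC.
    pose proof (Rabs_triang_inv s t). change (Rabs (s - t) < 1) in Hs. lra.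
  - intros n. apply iterate_continuous.
Qed.

Let limit_fixed i t : coord i (step limit t) = coord i (limit t).
Proof.
  set (T := Rabs t). destruct (iterate_limit T) as [C [HC H]], (F_lipschitz T) as [L [HL lip]].
  apply Rminus_diag_uniq, Rabs_eq_0, Rle_antisym; [|apply Rabs_pos].
  apply (le_of_div_pow2 _ _ (3 * L * C * exp T + C)). intros n.
  assert (HCn : 0 <= C / 2 ^ n) by (apply Rdiv_le_0_compat; [lra|apply pow_lt; lra]).
  assert (steps : Rabs (coord i (step limit t) - coord i (step (iterate n) t))
    <= 3 * L * (C / 2 ^ n) / 1 * exp (1 * Rabs t)).
  { apply (step_contract limit (iterate n) L T); auto; [lra|lra| |unfold T; lra]. intros s j Hs.
    rewrite Rabs_minus_sym. eapply Rle_trans; [apply H, Hs|].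
    pose proof (exp_ineq1_le (1 * Rabs s)). pose proof (Rabs_pos s). nra. }
  pose proof (H (S n) i t ltac:(unfold T; lra)) as last_step.
  assert (C / 2 ^ S n <= C / 2 ^ n).
  { apply Rmult_le_compat_l; auto. apply Rinv_le_contravar; [apply pow_lt; lra|]. apply Rle_pow; [lra|lia]. }
  pose proof (Rabs_minus_triang (coord i (step limit t)) (coord i (step (iterate n) t)) (coord i (limit t))).
  change (iterate (S n) t) with (step (iterate n) t) in last_step. rewrite Rmult_1_l in steps. fold T in steps.
  replace ((3 * L * C * exp T + C) / 2 ^ n) with (3 * L * (C / 2 ^ n) / 1 * exp T + C / 2 ^ n)
    by (field; apply pow2_neq_0). lra.
Qed.

Lemma picard : exists phi : R -> R3, phi 0 = X0 /\
  forall i t, is_derive (fun s => coord i (phi s)) t (coord i (F t (phi t))).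
Proof.
  exists limit. split.
  - apply R3_ext; rewrite <- limit_fixed; apply step_at_0.
  - intros i t. apply (is_derive_ext (fun s => coord i (step limit s))); [intros s; apply limit_fixed|].
    apply step_derive, limit_continuous.
Qed.

End Picard.

(** * Conjugate vector fields *)

Definition uc_on_bounded (Phi : R3 -> R3) : Prop := forall b e, 0 < e ->
  exists d, 0 < d /\ forall X Y, in_box b X -> dist3 X Y < d -> dist3 (Phi X) (Phi Y) < e.

Record conjugacy (F G Phi Psi : R3 -> R3) : Prop := Conjugacy {
  conjugacy_left_inv : forall X, Psi (Phi X) = X;
  conjugacy_right_inv : forall Y, Phi (Psi Y) = Y;
  conjugacy_fwd : forall phi t, sol_at F phi t -> sol_at G (fun s => Phi (phi s)) t;
  conjugacy_bwd : forall psi t, sol_at G psi t -> sol_at F (fun s => Psi (psi s)) t;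
  conjugacy_fwd_uc : uc_on_bounded Phi;
  conjugacy_bwd_uc : uc_on_bounded Psi }.

Lemma in_box_exists (X : R3) : exists b, in_box b X.
Proof.
  exists (Rabs (coord 0 X) + Rabs (coord 1 X) + Rabs (coord 2 X)).
  pose proof (Rabs_pos (coord 0 X)). pose proof (Rabs_pos (coord 1 X)). pose proof (Rabs_pos (coord 2 X)).
  repeat split; lra.
Qed.

Lemma in_box_coord (b : R) (X : R3) (i : nat) : in_box b X -> Rabs (coord i X) <= b.
Proof. rewrite <- (R3_eta X) at 2. apply box_coord. Qed.

Lemma in_box_near (b r : R) (X Y : R3) : in_box b X -> dist3 X Y <= r -> in_box (b + r) Y.
Proof.
  intros HX Hr.
  assert (coord_le : forall i, Rabs (coord i Y) <= b + r).
  { intros i. pose proof (in_box_coord b X i HX). pose proof (Rabs_coord_le_dist3 X Y i) as H'.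
    rewrite Rabs_minus_sym in H'. pose proof (Rabs_triang_inv (coord i Y) (coord i X)). lra. }
  repeat split; apply coord_le.
Qed.

Lemma uc_on_bounded_continuous (Phi : R3 -> R3) (X : R3) (e : R) : uc_on_bounded Phi -> 0 < e ->
  exists d, 0 < d /\ forall Y, dist3 Y X < d -> dist3 (Phi Y) (Phi X) < e.
Proof.
  intros H He. destruct (in_box_exists X) as [b Hb], (H b e He) as [d [Hd near]].
  exists d. split; [exact Hd|]. intros Y HY. rewrite dist3_sym in HY |- *. apply near; auto.
Qed.

Lemma uc_on_bounded_comp (Phi Phi' : R3 -> R3) : (forall b, exists b', forall X, in_box b X -> in_box b' (Phi X)) ->
  uc_on_bounded Phi -> uc_on_bounded Phi' -> uc_on_bounded (fun X => Phi' (Phi X)).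
Proof.
  intros bounded H H' b e He. destruct (bounded b) as [b' Hb'], (H' b' e He) as [e' [He' near']].
  destruct (H b e' He') as [d [Hd near]]. exists d. split; auto.
Qed.

Lemma loc_lipschitz_in_box f1 f2 f3 : loc_lipschitz f1 -> loc_lipschitz f2 -> loc_lipschitz f3 ->
  forall b, exists b', forall X, in_box b X -> in_box b' (field3 f1 f2 f3 X).
Proof.
  intros L1 L2 L3 b. destruct (L1 b) as [C1 [B1 _]], (L2 b) as [C2 [B2 _]], (L3 b) as [C3 [B3 _]].
  exists (Rmax C1 (Rmax C2 C3)). intros X HX.
  specialize (B1 _ _ _ HX). specialize (B2 _ _ _ HX). specialize (B3 _ _ _ HX).
  pose proof (Rmax_l C1 (Rmax C2 C3)). pose proof (Rmax_r C1 (Rmax C2 C3)).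
  pose proof (Rmax_l C2 C3). pose proof (Rmax_r C2 C3). unfold in_box, field3. repeat split; simpl in *; lra.
Qed.

Lemma loc_lipschitz_uc_on_bounded f1 f2 f3 :
  loc_lipschitz f1 -> loc_lipschitz f2 -> loc_lipschitz f3 -> uc_on_bounded (field3 f1 f2 f3).
Proof.
  intros L1 L2 L3 b e He. destruct (field3_lipschitz f1 f2 f3 L1 L2 L3 (b + 1)) as [L [HL lip]].
  exists (Rmin 1 (e / (9 * L + 1))). split; [apply Rmin_glb_lt; [lra|apply Rdiv_lt_0_compat; lra]|].
  intros X Y HX HXY. pose proof (Rmin_l 1 (e / (9 * L + 1))). pose proof (Rmin_r 1 (e / (9 * L + 1))).
  assert (HY : in_box (b + 1) Y) by (apply (in_box_near b 1 X); [exact HX|lra]).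
  assert (HX1 : in_box (b + 1) X) by (destruct HX as [? [? ?]]; repeat split; lra).
  assert (coord_le : forall i, Rabs (coord i (field3 f1 f2 f3 X) - coord i (field3 f1 f2 f3 Y)) <= 3 * L * dist3 X Y).
  { intros i. eapply Rle_trans; [apply lip; assumption|].
    pose proof (dist1_le_dist3 X Y). rewrite (Rmult_comm 3 L), Rmult_assoc. apply Rmult_le_compat_l; lra. }
  eapply Rle_lt_trans; [apply dist3_le_Rabs|].
  pose proof (coord_le 0%nat). pose proof (coord_le 1%nat). pose proof (coord_le 2%nat).
  assert ((9 * L + 1) * dist3 X Y < e); [|pose proof (sqrt_pos ((coord 0 X - coord 0 Y) ^ 2
    + (coord 1 X - coord 1 Y) ^ 2 + (coord 2 X - coord 2 Y) ^ 2)); fold (dist3 X Y) in *; lra].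
  rewrite Rmult_comm. apply Rlt_div_r; lra.
Qed.

Lemma conjugacy_sym (F G Phi Psi : R3 -> R3) : conjugacy F G Phi Psi -> conjugacy G F Psi Phi.
Proof. intros []. constructor; assumption. Qed.

Section Transport.
Variables F G Phi Psi : R3 -> R3.
Hypothesis FG : conjugacy F G Phi Psi.

Lemma conjugacy_sol phi : is_sol F phi -> is_sol G (fun s => Phi (phi s)).
Proof. intros H t. apply (conjugacy_fwd _ _ _ _ FG). exact (H t). Qed.

Lemma conjugacy_fsol_bwd psi : is_fsol G psi -> is_fsol F (fun s => Psi (psi s)).
Proof. intros H t Ht. apply (conjugacy_bwd _ _ _ _ FG). exact (H t Ht). Qed.

Lemma conjugacy_existence : (forall X, exists phi, is_sol F phi /\ phi 0 = X) ->
  forall Y, exists psi, is_sol G psi /\ psi 0 = Y.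
Proof.
  intros H Y. destruct (H (Psi Y)) as [phi [Hphi E]]. exists (fun s => Phi (phi s)).
  split; [apply conjugacy_sol, Hphi|]. rewrite E. apply (conjugacy_right_inv _ _ _ _ FG).
Qed.

Lemma conjugacy_lyap_stable x0 : lyap_stable F x0 -> lyap_stable G (Phi x0).
Proof.
  intros H e He. destruct (uc_on_bounded_continuous Phi x0 e (conjugacy_fwd_uc _ _ _ _ FG) He) as [e' [He' K1]].
  destruct (H e' He') as [d' [Hd' stays]].
  destruct (uc_on_bounded_continuous Psi (Phi x0) d' (conjugacy_bwd_uc _ _ _ _ FG) Hd') as [d [Hd near]].
  exists d. split; auto. intros psi Hpsi H0 t Ht.
  rewrite <- (conjugacy_right_inv _ _ _ _ FG (psi t)). apply K1.
  apply (stays (fun s => Psi (psi s))); auto; [apply conjugacy_fsol_bwd; auto|].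
  specialize (near (psi 0) H0). rewrite (conjugacy_left_inv _ _ _ _ FG) in near. exact near.
Qed.

Lemma conjugacy_asympt_stable x0 : asympt_stable F x0 -> asympt_stable G (Phi x0).
Proof.
  intros [H [d' [Hd' attracts]]]. split; [apply conjugacy_lyap_stable; auto|].
  destruct (uc_on_bounded_continuous Psi (Phi x0) d' (conjugacy_bwd_uc _ _ _ _ FG) Hd') as [d [Hd near]].
  exists d. split; auto. intros psi Hpsi H0.
  specialize (near (psi 0) H0). rewrite (conjugacy_left_inv _ _ _ _ FG) in near.
  specialize (attracts (fun s => Psi (psi s)) (conjugacy_fsol_bwd _ Hpsi) near).
  apply is_lim_spec in attracts. apply is_lim_spec. intros e.
  destruct (uc_on_bounded_continuous Phi x0 e (conjugacy_fwd_uc _ _ _ _ FG) (cond_pos e)) as [e' [He' near_x0]].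
  destruct (attracts (mkposreal e' He')) as [M HM]. exists M. intros t Ht. specialize (HM t Ht). simpl in HM.
  rewrite Rminus_0_r in *. rewrite Rabs_pos_eq in * by apply sqrt_pos.
  rewrite <- (conjugacy_right_inv _ _ _ _ FG (psi t)). apply near_x0. exact HM.
Qed.

Variable gam : R -> R3.

Lemma conjugacy_periodic_orbit T : periodic_orbit F gam T -> periodic_orbit G (fun s => Phi (gam s)) T.
Proof.
  intros [HT [Hs [per [t Ht]]]]. split; [auto|split; [apply conjugacy_sol; auto|split]].
  - intros s. rewrite per; reflexivity.
  - exists t. intros E. apply Ht. rewrite <- (conjugacy_left_inv _ _ _ _ FG (gam t)), E.
    apply (conjugacy_left_inv _ _ _ _ FG).
Qed.

Variables b b' : R.
Hypothesis gam_bounded : forall s, in_box b (gam s).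
Hypothesis image_bounded : forall s, in_box b' (Phi (gam s)).

Let near_orbit_fwd e : 0 < e ->
  exists d, 0 < d /\ forall X, near_orbit gam X d -> near_orbit (fun s => Phi (gam s)) (Phi X) e.
Proof.
  intros He. destruct (conjugacy_fwd_uc _ _ _ _ FG b e He) as [d [Hd near]]. exists d. split; auto.
  intros X [s Hs]. exists s. rewrite dist3_sym in Hs |- *. apply near; auto.
Qed.

Let near_orbit_bwd e : 0 < e ->
  exists d, 0 < d /\ forall Y, near_orbit (fun s => Phi (gam s)) Y d -> near_orbit gam (Psi Y) e.
Proof.
  intros He. destruct (conjugacy_bwd_uc _ _ _ _ FG b' e He) as [d [Hd near]]. exists d. split; auto.
  intros X [s Hs]. exists s. rewrite <- (conjugacy_left_inv _ _ _ _ FG (gam s)).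
  rewrite dist3_sym in Hs |- *. apply near; auto.
Qed.

Lemma conjugacy_orbit_stable : orbit_stable F gam -> orbit_stable G (fun s => Phi (gam s)).
Proof.
  intros H e He. destruct (near_orbit_fwd e He) as [e' [He' fwd]], (H e' He') as [d' [Hd' stays]].
  destruct (near_orbit_bwd d' Hd') as [d [Hd bwd]]. exists d. split; auto. intros psi Hpsi H0 t Ht.
  rewrite <- (conjugacy_right_inv _ _ _ _ FG (psi t)). apply fwd.
  apply (stays (fun s => Psi (psi s))); auto. apply conjugacy_fsol_bwd; auto.
Qed.

Lemma conjugacy_orbit_asympt_stable : orbit_asympt_stable F gam -> orbit_asympt_stable G (fun s => Phi (gam s)).
Proof.
  intros [H [d' [Hd' attracts]]]. split; [apply conjugacy_orbit_stable; auto|].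
  destruct (near_orbit_bwd d' Hd') as [d [Hd bwd]]. exists d. split; auto. intros psi Hpsi H0 e He.
  destruct (near_orbit_fwd e He) as [e' [He' fwd]].
  destruct (attracts (fun s => Psi (psi s)) (conjugacy_fsol_bwd _ Hpsi) (bwd _ H0) e' He') as [T0 HT].
  exists T0. intros t Ht. rewrite <- (conjugacy_right_inv _ _ _ _ FG (psi t)). apply fwd, HT, Ht.
Qed.

End Transport.

Lemma conjugacy_unstable_eq (F G Phi Psi : R3 -> R3) x0 :
  conjugacy F G Phi Psi -> unstable_eq F x0 -> unstable_eq G (Phi x0).
Proof.
  intros FG H K. apply H. rewrite <- (conjugacy_left_inv _ _ _ _ FG x0).
  apply (conjugacy_lyap_stable G F Psi Phi (conjugacy_sym _ _ _ _ FG)). exact K.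
Qed.

Lemma conjugacy_orbit_unstable (F G Phi Psi : R3 -> R3) (gam : R -> R3) (b b' : R) :
  conjugacy F G Phi Psi -> (forall s, in_box b (gam s)) -> (forall s, in_box b' (Phi (gam s))) ->
  orbit_unstable F gam -> orbit_unstable G (fun s => Phi (gam s)).
Proof.
  intros FG Hb Hb' H K. apply H.
  replace gam with (fun s => Psi (Phi (gam s)))
    by (apply functional_extensionality; intros s; apply (conjugacy_left_inv _ _ _ _ FG)).
  apply (conjugacy_orbit_stable G F Psi Phi (conjugacy_sym _ _ _ _ FG) (fun s => Phi (gam s)) b' b); auto.
  intros s. rewrite (conjugacy_left_inv _ _ _ _ FG). apply Hb.
Qed.

Lemma conjugacy_trans (F G H Phi Psi Phi' Psi' : R3 -> R3) :
  (forall b, exists b', forall X, in_box b X -> in_box b' (Phi X)) ->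
  (forall b, exists b', forall X, in_box b X -> in_box b' (Psi' X)) ->
  conjugacy F G Phi Psi -> conjugacy G H Phi' Psi' ->
  conjugacy F H (fun X => Phi' (Phi X)) (fun Y => Psi (Psi' Y)).
Proof.
  intros BPhi BPsi' [l r fwd bwd ucl ucr] [l' r' fwd' bwd' ucl' ucr']. constructor.
  - intros X. rewrite l'. apply l.
  - intros Y. rewrite r. apply r'.
  - intros phi t Hphi. apply (fwd' (fun s => Phi (phi s))), fwd, Hphi.
  - intros psi t Hpsi. apply (bwd (fun s => Psi' (psi s))), bwd', Hpsi.
  - apply uc_on_bounded_comp; assumption.
  - apply uc_on_bounded_comp; assumption.
Qed.

Definition linear_coord (m : nat -> nat -> R) (i : nat) (x y z : R) : R :=
  m i 0%nat * x + m i 1%nat * y + m i 2%nat * z.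

Definition linear_map (m : nat -> nat -> R) : R3 -> R3 :=
  field3 (linear_coord m 0) (linear_coord m 1) (linear_coord m 2).

Definition affine_map (c : R3) (m : nat -> nat -> R) : R3 -> R3 :=
  field3 (fun x y z => coord 0 c + linear_coord m 0 x y z) (fun x y z => coord 1 c + linear_coord m 1 x y z)
    (fun x y z => coord 2 c + linear_coord m 2 x y z).

Lemma affine_map_sol_at c m (F G : R3 -> R3) phi t :
  (forall X, G (affine_map c m X) = linear_map m (F X)) ->
  sol_at F phi t -> sol_at G (fun s => affine_map c m (phi s)) t.
Proof.
  intros HG Hphi. destruct (sol_at_coord _ _ _ Hphi) as [D0 [D1 D2]].
  set (x := fun s => coord 0 (phi s)). set (y := fun s => coord 1 (phi s)). set (z := fun s => coord 2 (phi s)).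
  assert (D : forall i k, is_derive (fun s => k + linear_coord m i (x s) (y s) (z s)) t
    (linear_coord m i (coord 0 (F (phi t))) (coord 1 (F (phi t))) (coord 2 (F (phi t))))).
  { intros i k. change (is_derive x t (coord 0 (F (phi t)))) in D0.
    change (is_derive y t (coord 1 (F (phi t)))) in D1. change (is_derive z t (coord 2 (F (phi t)))) in D2.
    unfold linear_coord. derive_with. ring. }
  refine (sol_at_intro _ _ _ _ _ _); rewrite HG; apply D.
Qed.

Lemma affine_map_loc_lipschitz c m i : loc_lipschitz (fun x y z => coord i c + linear_coord m i x y z).
Proof. unfold linear_coord. prove_loc_lipschitz. Qed.

Lemma affine_map_in_box c m b : exists b', forall X, in_box b X -> in_box b' (affine_map c m X).
Proof. apply loc_lipschitz_in_box; apply affine_map_loc_lipschitz. Qed.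

Lemma linear_map_left_inv c m c' m' : (forall X, affine_map c' m' (affine_map c m X) = X) ->
  forall X, linear_map m' (linear_map m X) = X.
Proof.
  intros left_inv X. pose proof (left_inv X) as EX. pose proof (left_inv (0, 0, 0)) as E0.
  apply R3_ext;
    [apply (f_equal (coord 0)) in EX, E0|apply (f_equal (coord 1)) in EX, E0|apply (f_equal (coord 2)) in EX, E0];
    unfold affine_map, linear_map, field3, linear_coord in *; cbn [coord fst snd] in *; lra.
Qed.

Lemma affine_conjugacy c m c' m' (F G : R3 -> R3) :
  (forall X, affine_map c' m' (affine_map c m X) = X) -> (forall Y, affine_map c m (affine_map c' m' Y) = Y) ->
  (forall X, G (affine_map c m X) = linear_map m (F X)) ->
  conjugacy F G (affine_map c m) (affine_map c' m').
Proof.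
  intros left_inv right_inv HG. constructor; auto.
  - intros phi t. apply affine_map_sol_at, HG.
  - intros psi t. apply affine_map_sol_at. intros Y.
    rewrite <- (right_inv Y) at 2. rewrite HG. symmetry. apply (linear_map_left_inv c m c' m' left_inv).
  - apply loc_lipschitz_uc_on_bounded; apply affine_map_loc_lipschitz.
  - apply loc_lipschitz_uc_on_bounded; apply affine_map_loc_lipschitz.
Qed.

Definition shear (h : R -> R -> R) : R3 -> R3 :=
  field3 (fun u _ _ => u) (fun _ v _ => v) (fun u v s => s + h u v).

Lemma shear_loc_lipschitz (h : R -> R -> R) : loc_lipschitz (fun u v _ => h u v) ->
  loc_lipschitz (fun u v s => s + h u v).
Proof. intros Hh. apply (loc_lipschitz_plus (fun _ _ s => s)); [exact (loc_lipschitz_coord 2)|exact Hh]. Qed.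

Lemma shear_in_box (h : R -> R -> R) b : loc_lipschitz (fun u v _ => h u v) ->
  exists b', forall X, in_box b X -> in_box b' (shear h X).
Proof.
  intros Hh. apply loc_lipschitz_in_box; [exact (loc_lipschitz_coord 0)|exact (loc_lipschitz_coord 1)|].
  apply shear_loc_lipschitz, Hh.
Qed.

Lemma shear_opp (h : R -> R -> R) (X : R3) : shear (fun u v => - h u v) (shear h X) = X.
Proof. apply R3_ext; simpl; ring. Qed.

Lemma shear_uc_on_bounded (h : R -> R -> R) : loc_lipschitz (fun u v _ => h u v) -> uc_on_bounded (shear h).
Proof.
  intros Hh. apply loc_lipschitz_uc_on_bounded; [exact (loc_lipschitz_coord 0)|exact (loc_lipschitz_coord 1)|].
  apply shear_loc_lipschitz, Hh.
Qed.

Lemma shear_conjugacy (h hu hv : R -> R -> R) (F G : R3 -> R3) :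
  loc_lipschitz (fun u v _ => h u v) ->
  (forall (u v : R -> R) t du dv, is_derive u t du -> is_derive v t dv ->
     is_derive (fun s => h (u s) (v s)) t (hu (u t) (v t) * du + hv (u t) (v t) * dv)) ->
  (forall X, F X = let Y := G (shear h X) in (coord 0 Y, coord 1 Y,
     coord 2 Y - (hu (coord 0 X) (coord 1 X) * coord 0 Y + hv (coord 0 X) (coord 1 X) * coord 1 Y))) ->
  conjugacy F G (shear h) (shear (fun u v => - h u v)).
Proof.
  intros Hh Dh HF.
  assert (opp_shear : forall Y, shear h (shear (fun u v => - h u v) Y) = Y)
    by (intros Y; apply R3_ext; simpl; ring).
  constructor; auto using shear_opp, shear_uc_on_bounded.
  - intros phi t Hphi. destruct (sol_at_coord _ _ _ Hphi) as [Du [Dv Ds]]. rewrite HF in Du, Dv, Ds.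
    refine (sol_at_intro _ _ _ _ _ _); [exact Du|exact Dv|].
    eapply is_derive_eq; [exact (is_derive_plus _ _ _ _ _ Ds (Dh _ _ _ _ _ Du Dv))|].
    unfold plus; simpl. ring.
  - intros psi t Hpsi. destruct (sol_at_coord _ _ _ Hpsi) as [Du [Dv Ds]].
    refine (sol_at_intro _ _ _ _ _ _); rewrite HF; cbv zeta; rewrite opp_shear; [exact Du|exact Dv|].
    exact (is_derive_minus _ _ _ _ _ Ds (Dh _ _ _ _ _ Du Dv)).
  - apply shear_uc_on_bounded, loc_lipschitz_opp, Hh.
Qed.

(** * Lyapunov and Chetaev functions *)

Definition norm2 (X : R3) : R := coord 0 X ^ 2 + coord 1 X ^ 2 + coord 2 X ^ 2.

Lemma norm2_ge_0 (X : R3) : 0 <= norm2 X.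
Proof.
  unfold norm2. pose proof (pow2_ge_0 (coord 0 X)). pose proof (pow2_ge_0 (coord 1 X)).
  pose proof (pow2_ge_0 (coord 2 X)). lra.
Qed.

Lemma dist3_origin_lt (X : R3) (e : R) : 0 < e -> (dist3 X (0, 0, 0) < e <-> norm2 X < e ^ 2).
Proof.
  intros He. replace (dist3 X (0, 0, 0)) with (sqrt (norm2 X)) by (unfold dist3, norm2; f_equal; simpl; ring).
  pose proof (norm2_ge_0 X) as Hn. split; intros H.
  - rewrite <- (pow2_sqrt (norm2 X)) by auto. pose proof (sqrt_pos (norm2 X)). nra.
  - rewrite <- (sqrt_pow2 e) by lra. apply sqrt_lt_1_alt. lra.
Qed.

Lemma norm2_along_continuous (F : R3 -> R3) (phi : R -> R3) (t : R) : sol_at F phi t ->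
  continuous (fun s => norm2 (phi s)) t.
Proof.
  intros Hphi. destruct (sol_at_coord _ _ _ Hphi) as [D0 [D1 D2]]. unfold norm2.
  prove_continuous; eapply is_derive_continuous; first [exact D0|exact D1|exact D2].
Qed.

Section LyapunovFunction.
Variables (F : R3 -> R3) (V : R3 -> R) (r0 c1 c2 : R).
Hypothesis r0_pos : 0 < r0.
Hypothesis c1_pos : 0 < c1.
Hypothesis c2_pos : 0 < c2.
Hypothesis V_bounds : forall X, norm2 X <= r0 ^ 2 -> c1 * norm2 X <= V X <= c2 * norm2 X.

Section Stability.
Hypothesis V_decreases : forall phi t, sol_at F phi t -> norm2 (phi t) <= r0 ^ 2 ->
  exists l, is_derive (fun s => V (phi s)) t l /\ l <= 0.

Lemma lyapunov_nonincreasing phi a T : is_fsol F phi -> 0 <= a <= T ->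
  (forall t, 0 <= t <= T -> norm2 (phi t) <= r0 ^ 2) -> V (phi T) <= V (phi a).
Proof.
  intros Hphi Ha Hn. pose proof (increment_le (fun t => V (phi t)) 0 a T (proj2 Ha)) as increment.
  enough (V (phi T) <= V (phi a) + 0 * (T - a)) by lra. apply increment. intros t Ht.
  apply V_decreases; [exact (Hphi t ltac:(lra))|apply Hn; lra].
Qed.

Lemma lyapunov_stays_small e : 0 < e <= r0 -> exists d, 0 < d /\ forall phi, is_fsol F phi ->
  dist3 (phi 0) (0, 0, 0) < d -> forall t, 0 <= t -> norm2 (phi t) < e ^ 2.
Proof.
  intros He. set (q := c1 / (c1 + c2)). assert (Hq : 0 < q) by (apply Rdiv_lt_0_compat; lra).
  assert (Eq : c1 = (c1 + c2) * q) by (unfold q; field; lra).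
  exists (e * sqrt q). pose proof (sqrt_lt_R0 q Hq). split; [apply Rmult_lt_0_compat; lra|].
  intros phi Hphi H0. apply dist3_origin_lt in H0; [|apply Rmult_lt_0_compat; lra].
  rewrite Rpow_mult_distr, pow2_sqrt in H0 by lra.
  assert (er : e ^ 2 <= r0 ^ 2) by (apply pow_incr; lra).
  assert (e2 : 0 < e ^ 2) by (apply pow_lt; lra).
  assert (q <= 1) by (apply (Rdiv_le_1 c1 (c1 + c2)); lra).
  assert (e ^ 2 * q <= e ^ 2 * 1) by (apply Rmult_le_compat_l; lra).
  assert (small0 : norm2 (phi 0) < e ^ 2) by lra.
  assert (V0 : V (phi 0) < c1 * e ^ 2).
  { destruct (V_bounds (phi 0)) as [_ upper]; [lra|]. apply Rle_lt_trans with (1 := upper).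
    apply Rlt_le_trans with (c2 * (e ^ 2 * q)); [apply Rmult_lt_compat_l; lra|].
    rewrite Eq. assert (0 <= c1 * (e ^ 2 * q)) by (apply Rmult_le_pos; [lra|apply Rmult_le_pos; lra]). lra. }
  assert (Hf : forall t, 0 <= t -> norm2 (phi t) - e ^ 2 < 0); [|intros t Ht; specialize (Hf t Ht); lra].
  apply (bootstrap_lt_0 (fun t => norm2 (phi t) - e ^ 2)); [| lra |].
  - intros t Ht. apply (continuous_minus (fun t => norm2 (phi t)) (fun _ => e ^ 2)); [|apply continuous_const].
    exact (norm2_along_continuous F phi t (Hphi t Ht)).
  - intros T HT Hn.
    assert (in_ball : forall t, 0 <= t <= T -> norm2 (phi t) <= r0 ^ 2) by (intros t Ht; specialize (Hn t Ht); lra).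
    pose proof (lyapunov_nonincreasing phi 0 T Hphi ltac:(lra) in_ball).
    destruct (V_bounds (phi T)) as [lower _]; [apply in_ball; lra|]. nra.
Qed.

Lemma lyapunov_stable : lyap_stable F (0, 0, 0).
Proof.
  intros e He. destruct (lyapunov_stays_small (Rmin e r0)) as [d [Hd K]].
  { split; [apply Rmin_glb_lt; auto|apply Rmin_r]. }
  exists d. split; auto. intros phi Hphi H0 t Ht. apply dist3_origin_lt; [exact He|].
  apply Rlt_le_trans with (1 := K phi Hphi H0 t Ht). apply pow_incr.
  split; [left; apply Rmin_glb_lt; auto|apply Rmin_l].
Qed.

End Stability.

Lemma lyapunov_asympt_stable c : 0 < c ->
  (forall phi t, sol_at F phi t -> norm2 (phi t) <= r0 ^ 2 ->
     exists l, is_derive (fun s => V (phi s)) t l /\ l <= - c * V (phi t) ^ 2) ->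
  asympt_stable F (0, 0, 0).
Proof.
  intros Hc strict.
  assert (weak : forall phi t, sol_at F phi t -> norm2 (phi t) <= r0 ^ 2 ->
    exists l, is_derive (fun s => V (phi s)) t l /\ l <= 0).
  { intros phi t Hphi Ht. destruct (strict phi t Hphi Ht) as [l [Hl Hle]]. exists l. split; auto.
    pose proof (pow2_ge_0 (V (phi t))). nra. }
  split; [apply lyapunov_stable, weak|].
  destruct (lyapunov_stays_small weak r0) as [d [Hd K]]; [lra|]. exists d. split; [exact Hd|].
  intros phi Hphi H0.
  assert (in_ball : forall t, 0 <= t -> norm2 (phi t) <= r0 ^ 2) by (intros t Ht; left; apply (K phi); auto).
  assert (lower : forall t, 0 <= t -> c1 * norm2 (phi t) <= V (phi t)) by (intros t Ht; apply V_bounds, in_ball, Ht).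
  apply is_lim_spec. intros e. pose proof (cond_pos e) as He. set (w := c1 * e ^ 2 / 2).
  assert (He2 : 0 < e ^ 2) by (apply pow_lt, He).
  assert (Hw : 0 < w) by (unfold w; nra). assert (Hcw : 0 < c * w ^ 2) by (apply Rmult_lt_0_compat, pow_lt; lra).
  exists (Rmax 0 (V (phi 0) / (c * w ^ 2))). intros t Ht. apply Rmax_Rlt in Ht. destruct Ht as [Ht Htw].
  apply Rlt_div_l in Htw; [|lra].
  assert (HVt : V (phi t) <= w).
  { apply Rnot_lt_le. intros large.
    pose proof (increment_le (fun s => V (phi s)) (- (c * w ^ 2)) 0 t ltac:(lra)) as drop.
    assert (V (phi t) <= V (phi 0) + - (c * w ^ 2) * (t - 0)); [apply drop|lra]. intros s Hs.
    destruct (strict phi s (Hphi s (proj1 Hs)) (in_ball s (proj1 Hs))) as [l [Hl Hle]]. exists l. split; [exact Hl|].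
    pose proof (lyapunov_nonincreasing weak phi s t Hphi Hs (fun u Hu => in_ball u (proj1 Hu))).
    assert (w ^ 2 <= V (phi s) ^ 2) by (apply pow_incr; lra). nra. }
  rewrite Rminus_0_r, Rabs_pos_eq by apply sqrt_pos. apply dist3_origin_lt; [exact He|].
  specialize (lower t ltac:(lra)). unfold w in HVt. nra.
Qed.

End LyapunovFunction.

Section ChetaevFunction.
Variables (F : R3 -> R3) (V : R3 -> R) (r0 C c : R).
Hypothesis r0_pos : 0 < r0.
Hypothesis c_pos : 0 < c.
Hypothesis V_bound : forall X, norm2 X <= r0 ^ 2 -> V X <= C.
Hypothesis V_grows : forall phi t, sol_at F phi t -> norm2 (phi t) <= r0 ^ 2 ->
  exists l, is_derive (fun s => V (phi s)) t l /\ (0 < V (phi t) -> c * V (phi t) ^ 2 <= l).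

Lemma chetaev_growth phi w : is_fsol F phi -> (forall t, 0 <= t -> norm2 (phi t) <= r0 ^ 2) ->
  0 < w -> V (phi 0) = w -> forall T, 0 <= T -> w + c * (w / 2) ^ 2 * T <= V (phi T).
Proof.
  intros Hphi in_ball Hw V0.
  assert (grows : forall m T, 0 <= T -> (forall t, 0 <= t <= T -> 0 < V (phi t) /\ m <= c * V (phi t) ^ 2) ->
    w + m * T <= V (phi T)).
  { intros m T HT H. rewrite <- V0, <- (Rminus_0_r T) at 1. apply (increment_ge (fun t => V (phi t))); [exact HT|].
    intros t Ht. destruct (V_grows phi t (Hphi t (proj1 Ht)) (in_ball t (proj1 Ht))) as [l [Hl Hle]].
    destruct (H t Ht) as [Vpos Hm]. exists l. split; [exact Hl|]. specialize (Hle Vpos). lra. }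
  assert (above : forall t, 0 <= t -> w / 2 - V (phi t) < 0).
  { apply (bootstrap_lt_0 (fun t => w / 2 - V (phi t))).
    - intros t Ht. apply (continuous_minus (fun _ => w / 2)); [apply continuous_const|].
      destruct (V_grows phi t (Hphi t Ht) (in_ball t Ht)) as [l [Hl _]]. exact (is_derive_continuous _ _ _ Hl).
    - lra.
    - intros T HT H. assert (w + 0 * T <= V (phi T)); [|lra]. apply grows; [exact HT|]. intros t Ht.
      specialize (H t Ht). pose proof (pow2_ge_0 (V (phi t))). split; [lra|nra]. }
  intros T HT. apply grows; [exact HT|]. intros t Ht. specialize (above t (proj1 Ht)). split; [lra|].
  apply Rmult_le_compat_l; [lra|]. apply pow_incr; lra.
Qed.

Lemma chetaev_unstable : (forall d, 0 < d -> exists X, norm2 X < d ^ 2 /\ 0 < V X) ->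
  (forall X, exists phi, is_sol F phi /\ phi 0 = X) -> unstable_eq F (0, 0, 0).
Proof.
  intros V_pos existence stable. destruct (stable r0 r0_pos) as [d [Hd K]].
  destruct (V_pos d Hd) as [X [HX VX]], (existence X) as [phi [Hs H0]].
  pose proof (is_fsol_of_is_sol F phi Hs) as Hphi.
  assert (in_ball : forall t, 0 <= t -> norm2 (phi t) <= r0 ^ 2).
  { intros t Ht. left. apply dist3_origin_lt; [exact r0_pos|]. apply K; auto. rewrite H0.
    apply dist3_origin_lt; auto. }
  pose proof (chetaev_growth phi (V X) Hphi in_ball VX (f_equal V H0)) as growth.
  set (m := c * (V X / 2) ^ 2) in growth. assert (Hm : 0 < m) by (apply Rmult_lt_0_compat, pow_lt; lra).
  pose proof (Rabs_pos C). pose proof (Rle_abs C).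
  assert (HT : 0 <= Rabs C / m) by (apply Rdiv_le_0_compat; lra).
  specialize (growth _ HT). pose proof (V_bound _ (in_ball _ HT)).
  replace (m * (Rabs C / m)) with (Rabs C) in growth by (field; lra). lra.
Qed.

End ChetaevFunction.

(** * Periodic solutions by contraction *)

Section Contraction.
Variables (I : Type) (good : (I -> R -> R) -> Prop) (F : (I -> R -> R) -> I -> R -> R).
Variables (f0 : I -> R -> R) (r : R).
Hypothesis good_start : good f0.
Hypothesis F_good : forall f, good f -> good (F f).
Hypothesis F_start : forall i t, Rabs (F f0 i t - f0 i t) <= r.
Hypothesis F_contracts : forall f g d, good f -> good g -> (forall i t, Rabs (f i t - g i t) <= d) ->
  forall i t, Rabs (F f i t - F g i t) <= d / 2.
Hypothesis good_limit : forall fn g d, (forall n, good (fn n)) ->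
  (forall n i t, Rabs (fn n i t - g i t) <= d / 2 ^ n) -> good g.

Lemma contraction_fixed_point : exists f, good f /\ forall i t, F f i t = f i t.
Proof.
  set (x := fun n : nat => Nat.iter n F f0).
  assert (x_good : forall n, good (x n)) by (induction n as [|n IH]; [exact good_start|exact (F_good _ IH)]).
  assert (x_step : forall n i t, Rabs (x (S n) i t - x n i t) <= r / 2 ^ n).
  { induction n as [|n IH]; intros i t; [simpl pow; rewrite Rdiv_1_r; apply F_start|].
    replace (r / 2 ^ S n) with (r / 2 ^ n / 2) by (simpl; field; apply pow2_neq_0).
    apply (F_contracts (x (S n)) (x n)); auto. }
  set (g := fun i t => real (Lim_seq (fun n => x n i t))).
  assert (x_limit : forall n i t, Rabs (x n i t - g i t) <= 2 * r / 2 ^ n).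
  { intros n i t. apply (Lim_seq_dyadic (fun n => x n i t)). intros m. apply x_step. }
  assert (g_good : good g) by (apply (good_limit x g (2 * r)); auto).
  exists g. split; [exact g_good|]. intros i t.
  apply Rminus_diag_uniq, Rabs_eq_0, Rle_antisym; [|apply Rabs_pos].
  apply (le_of_div_pow2 _ _ (2 * r)). intros n.
  pose proof (F_contracts g (x n) _ g_good (x_good n)
    (fun i t => eq_ind _ (fun y => y <= _) (x_limit n i t) _ (Rabs_minus_sym _ _)) i t) as contracted.
  pose proof (x_limit (S n) i t) as next. change (x (S n) i t) with (F (x n) i t) in next.
  pose proof (Rabs_minus_triang (F g i t) (F (x n) i t) (g i t)).
  replace (2 * r / 2 ^ S n) with (2 * r / 2 ^ n / 2) in next by (simpl; field; apply pow2_neq_0). lra.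
Qed.

End Contraction.

(* The unique periodic solution of [y' = - k y + g], for either sign of [k]. *)
Definition green (k : R) (g : R -> R) (th : R) : R :=
  exp (- k * th) / (exp (k * (2 * PI)) - 1) * RInt (fun t => exp (k * t) * g t) th (th + 2 * PI).

Section Green.
Variable k : R.
Hypothesis k_neq_0 : k <> 0.

Let exp_period_div_pos : 0 < (exp (k * (2 * PI)) - 1) / k.
Proof.
  pose proof PI_RGT_0. rewrite <- exp_0. destruct (Rlt_dec 0 k) as [h|h].
  - apply Rdiv_lt_0_compat; auto. assert (exp 0 < exp (k * (2 * PI))) by (apply exp_increasing; nra). lra.
  - assert (exp (k * (2 * PI)) < exp 0) by (apply exp_increasing; nra).
    replace ((exp (k * (2 * PI)) - exp 0) / k) with ((exp 0 - exp (k * (2 * PI))) / (- k)) by (field; lra).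
    apply Rdiv_lt_0_compat; lra.
Qed.

Let exp_period_neq_1 : exp (k * (2 * PI)) - 1 <> 0.
Proof. intros E. pose proof exp_period_div_pos as P. rewrite E in P. lra. Qed.

Let integrand_continuous (g : R -> R) : (forall t, continuous g t) ->
  forall t, continuous (fun t => exp (k * t) * g t) t.
Proof. intros Hg t. prove_continuous. Qed.

Let integrand_ex_RInt (g : R -> R) (a b : R) : (forall t, continuous g t) -> ex_RInt (fun t => exp (k * t) * g t) a b.
Proof. intros Hg. apply continuous_ex_RInt, integrand_continuous, Hg. Qed.

Lemma green_derive (g : R -> R) (th : R) :
  (forall t, continuous g t) -> (forall t, g (t + 2 * PI) = g t) ->
  is_derive (green k g) th (- k * green k g th + g th).
Proof.
  intros Hg Hp. set (f := fun t => exp (k * t) * g t). set (J := fun x => RInt f 0 x : R).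
  assert (DJ : forall x, is_derive J x (f x)) by (intros x; apply is_derive_primitive, integrand_continuous, Hg).
  assert (EJ : forall x, green k g x = exp (- k * x) / (exp (k * (2 * PI)) - 1) * (J (x + 2 * PI) - J x)).
  { intros x. unfold green, J. fold f.
    pose proof (RInt_Chasles (V := R_CompleteNormedModule) f 0 x (x + 2 * PI)) as chasles.
    specialize (chasles ltac:(apply integrand_ex_RInt; auto) ltac:(apply integrand_ex_RInt; auto)).
    change ((RInt f 0 x + RInt f x (x + 2 * PI))%R = RInt f 0 (x + 2 * PI)) in chasles.
    rewrite <- chasles. field. exact exp_period_neq_1. }
  apply (is_derive_ext (fun x => exp (- k * x) / (exp (k * (2 * PI)) - 1) * (J (x + 2 * PI) - J x)));
    [intros x; symmetry; apply EJ|].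
  rewrite EJ. pose proof (DJ th) as D0. pose proof (DJ (th + 2 * PI)) as D1. derive_with.
  unfold f. rewrite Hp, (Rmult_plus_distr_l k th), exp_plus.
  replace (- k * th) with (- (k * th)) by ring. rewrite exp_Ropp.
  pose proof (exp_pos (k * th)). field. split; first [exact exp_period_neq_1|lra].
Qed.

Lemma green_periodic (g : R -> R) (th : R) :
  (forall t, continuous g t) -> (forall t, g (t + 2 * PI) = g t) ->
  green k g (th + 2 * PI) = green k g th.
Proof.
  intros Hg Hp. unfold green.
  set (f := fun t => exp (k * t) * g t).
  assert (shift : RInt f (th + 2 * PI) (th + 2 * PI + 2 * PI) = exp (k * (2 * PI)) * RInt f th (th + 2 * PI)).
  { pose proof (RInt_comp_lin (V := R_CompleteNormedModule) f 1 (2 * PI) th (th + 2 * PI)) as E.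
    rewrite !Rmult_1_l in E. rewrite <- E by (apply integrand_ex_RInt; auto).
    rewrite <- (RInt_scal (V := R_CompleteNormedModule) f) by (apply integrand_ex_RInt; auto).
    apply RInt_ext. intros x _. unfold f, scal; simpl. unfold mult; simpl.
    rewrite !Rmult_1_l, Hp, Rmult_plus_distr_l, exp_plus. ring. }
  rewrite shift, (Rmult_plus_distr_l (- k) th), exp_plus.
  replace (- k * (2 * PI)) with (- (k * (2 * PI))) by ring. rewrite exp_Ropp.
  pose proof (exp_pos (k * (2 * PI))). field. split; first [exact exp_period_neq_1|lra].
Qed.

Let RInt_weight (M th : R) : is_RInt (fun t => M * exp (k * t)) th (th + 2 * PI)
  (M * exp (k * th) * ((exp (k * (2 * PI)) - 1) / k)).
Proof.
  replace (M * exp (k * th) * ((exp (k * (2 * PI)) - 1) / k))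
    with (minus (M / k * exp (k * (th + 2 * PI))) (M / k * exp (k * th)))
    by (unfold minus, plus, opp; simpl; rewrite (Rmult_plus_distr_l k th), exp_plus; field; auto).
  apply (is_RInt_derive (V := R_CompleteNormedModule) (fun t => M / k * exp (k * t))).
  - intros x _. derive_with. field. exact k_neq_0.
  - intros x _. prove_continuous.
Qed.

Lemma green_bound (g : R -> R) (M th : R) :
  (forall t, continuous g t) -> (forall t, Rabs (g t) <= M) -> Rabs (green k g th) <= M / Rabs k.
Proof.
  intros Hg HM. unfold green. set (f := fun t => exp (k * t) * g t).
  assert (bound : Rabs (RInt f th (th + 2 * PI)) <= M * exp (k * th) * ((exp (k * (2 * PI)) - 1) / k)).
  { apply (norm_RInt_le (V := R_NormedModule) f (fun t => M * exp (k * t)) th (th + 2 * PI)).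
    - pose proof PI_RGT_0. lra.
    - intros x _. change (Rabs (f x) <= M * exp (k * x)). unfold f. pose proof (exp_pos (k * x)).
      rewrite Rabs_mult, Rabs_pos_eq, Rmult_comm by lra. apply Rmult_le_compat_r; [lra|apply HM].
    - apply (RInt_correct (V := R_CompleteNormedModule)), integrand_ex_RInt, Hg.
    - apply RInt_weight. }
  set (e := exp (k * (2 * PI)) - 1) in *.
  assert (Ee : Rabs e / Rabs k = e / k) by (rewrite <- Rabs_div, Rabs_pos_eq by lra; reflexivity).
  assert (He : 0 < Rabs e) by (apply Rabs_pos_lt, exp_period_neq_1). assert (Hk := Rabs_pos_lt k k_neq_0).
  replace (- k * th) with (- (k * th)) by ring. rewrite exp_Ropp. pose proof (exp_pos (k * th)).
  unfold Rdiv at 1. rewrite !Rabs_mult, !Rabs_inv, (Rabs_pos_eq (exp _)) by lra.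
  replace (M / Rabs k) with (/ exp (k * th) * / Rabs e * (M * exp (k * th) * (Rabs e / Rabs k))) by (field; lra).
  rewrite Ee. apply Rmult_le_compat_l; [|exact bound].
  apply Rmult_le_pos; left; apply Rinv_0_lt_compat; lra.
Qed.

Lemma green_diff (g g' : R -> R) (M th : R) :
  (forall t, continuous g t) -> (forall t, continuous g' t) ->
  (forall t, Rabs (g t - g' t) <= M) -> Rabs (green k g th - green k g' th) <= M / Rabs k.
Proof.
  intros Hg Hg' HM.
  replace (green k g th - green k g' th) with (green k (fun t => g t - g' t) th).
  - apply green_bound; auto. intros t. prove_continuous.
  - unfold green. rewrite <- Rmult_minus_distr_l. f_equal.
    rewrite <- (RInt_minus (V := R_CompleteNormedModule)) by (apply integrand_ex_RInt; auto).
    apply RInt_ext. intros x _. unfold minus, plus, opp; simpl. ring.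
Qed.

End Green.

Definition tube (rho0 rad sig rho s : R) : Prop := Rabs (rho - rho0) <= rad /\ Rabs s <= sig.

Definition periodic_in_angle (f : R -> R -> R -> R) : Prop := forall th rho s, f (th + 2 * PI) rho s = f th rho s.

(* The distance in [s] is weighted by [m], so that a large dependence of [A] on [s] is compensated by a small
   dependence of [B] on both variables. *)
Section PeriodicSolution.
Variables (A B E : R -> R -> R -> R) (kw ks rho0 rad sig L m : R).
Hypothesis kw_neq_0 : kw <> 0.
Hypothesis ks_neq_0 : ks <> 0.
Hypothesis m_pos : 0 < m.
Hypothesis rad_ge_0 : 0 <= rad.
Hypothesis sig_ge_0 : 0 <= sig.

Let in_tube (rho s : R) : Prop := tube rho0 rad sig rho s.

Hypothesis A_periodic : periodic_in_angle A.
Hypothesis B_periodic : periodic_in_angle B.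
Hypothesis E_periodic : periodic_in_angle E.
Hypothesis A_lipschitz : bounded_lipschitz (fun _ => in_tube) L A.
Hypothesis B_lipschitz : bounded_lipschitz (fun _ => in_tube) L B.
Hypothesis E_lipschitz : bounded_lipschitz (fun _ => in_tube) L E.
Hypothesis A_bound : forall th rho s, in_tube rho s -> Rabs (A th rho s) <= rad / 2 * Rabs kw.
Hypothesis B_bound : forall th rho s, in_tube rho s -> Rabs (B th rho s) <= sig * Rabs ks.
Hypothesis E_bound : forall th rho s, in_tube rho s -> Rabs (E th rho s) <= rad / 2.
Hypothesis A_contracts : forall th rho s rho' s', in_tube rho s -> in_tube rho' s' ->
  Rabs (A th rho s - A th rho' s') <= / 8 * (Rabs (rho - rho') + m * Rabs (s - s')) * Rabs kw.
Hypothesis B_contracts : forall th rho s rho' s', in_tube rho s -> in_tube rho' s' ->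
  m * Rabs (B th rho s - B th rho' s') <= / 8 * (Rabs (rho - rho') + m * Rabs (s - s')) * Rabs ks.
Hypothesis E_contracts : forall th rho s rho' s', in_tube rho s -> in_tube rho' s' ->
  Rabs (E th rho s - E th rho' s') <= / 8 * (Rabs (rho - rho') + m * Rabs (s - s')).

(* The unknown is the pair of functions [f true] (the radial variable) and [f false] ([m] times [s]). *)
Let along (G : R -> R -> R -> R) (f : bool -> R -> R) (t : R) : R := G t (f true t) (f false t / m).

Let good (f : bool -> R -> R) : Prop :=
  (forall i t, continuous (f i) t) /\ (forall i t, f i (t + 2 * PI) = f i t) /\
  forall t, in_tube (f true t) (f false t / m).

Let F (f : bool -> R -> R) (i : bool) (th : R) : R :=
  if i then rho0 + green kw (along A f) th - along E f th else m * green ks (along B f) th.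

Let along_continuous G f : bounded_lipschitz (fun _ => in_tube) L G -> good f -> forall t, continuous (along G f) t.
Proof.
  intros HG [cont [_ in_t]] t.
  apply (bounded_lipschitz_continuous (fun _ => in_tube) L G (fun t => t) (f true) (fun t => f false t / m)); auto.
  - apply filter_forall. exact in_t.
  - apply continuous_id.
  - assert (cf := cont false t). prove_continuous.
Qed.

Let along_periodic G f : periodic_in_angle G -> good f -> forall t, along G f (t + 2 * PI) = along G f t.
Proof. intros HG [_ [per _]] t. unfold along. rewrite !per. apply HG. Qed.

Let F_in_tube f t : good f -> in_tube (F f true t) (F f false t / m).
Proof.
  intros Hf. pose proof (proj2 (proj2 Hf)) as in_t.
  pose proof (Rabs_no_R0 _ kw_neq_0). pose proof (Rabs_no_R0 _ ks_neq_0). split; unfold F.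
  - pose proof (green_bound kw kw_neq_0 (along A f) _ t (along_continuous A f A_lipschitz Hf)
      (fun t => A_bound t _ _ (in_t t))) as KA.
    replace (rad / 2 * Rabs kw / Rabs kw) with (rad / 2) in KA by (field; auto).
    pose proof (E_bound t _ _ (in_t t)) as KE. fold (along E f t) in KE.
    apply Rabs_le_between in KA. apply Rabs_le_between in KE. apply Rabs_le_between. lra.
  - pose proof (green_bound ks ks_neq_0 (along B f) _ t (along_continuous B f B_lipschitz Hf)
      (fun t => B_bound t _ _ (in_t t))) as KB.
    replace (sig * Rabs ks / Rabs ks) with sig in KB by (field; auto).
    replace (m * green ks (along B f) t / m) with (green ks (along B f) t) by (field; lra). exact KB.
Qed.

Let F_good f : good f -> good (F f).
Proof.
  intros Hf. pose proof (along_continuous A f A_lipschitz Hf) as cA.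
  pose proof (along_continuous B f B_lipschitz Hf) as cB. pose proof (along_continuous E f E_lipschitz Hf) as cE.
  pose proof (along_periodic A f A_periodic Hf) as pA. pose proof (along_periodic B f B_periodic Hf) as pB.
  split; [|split; [|intros t; apply F_in_tube, Hf]].
  - intros [] t.
    + pose proof (is_derive_continuous _ _ _ (green_derive kw kw_neq_0 _ t cA pA)) as cG.
      unfold F. set (G := green kw (along A f)) in *. prove_continuous.
    + pose proof (is_derive_continuous _ _ _ (green_derive ks ks_neq_0 _ t cB pB)) as cG.
      unfold F. set (G := green ks (along B f)) in *. prove_continuous.
  - intros [] t; unfold F.
    + rewrite (green_periodic kw kw_neq_0 _ t cA pA), (along_periodic E f E_periodic Hf). reflexivity.
    + rewrite (green_periodic ks ks_neq_0 _ t cB pB). reflexivity.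
Qed.

Let F_contracts f g d : good f -> good g -> (forall i t, Rabs (f i t - g i t) <= d) ->
  forall i t, Rabs (F f i t - F g i t) <= d / 2.
Proof.
  intros Hf Hg Hd i t. pose proof (proj2 (proj2 Hf)) as in_f. pose proof (proj2 (proj2 Hg)) as in_g.
  assert (weighted : forall t, / 8 * (Rabs (f true t - g true t) + m * Rabs (f false t / m - g false t / m)) <= d / 4).
  { intros s. pose proof (Hd true s). pose proof (Hd false s).
    replace (f false s / m - g false s / m) with ((f false s - g false s) * / m) by (field; lra).
    rewrite Rabs_mult, (Rabs_pos_eq (/ m)) by (left; apply Rinv_0_lt_compat, m_pos).
    replace (m * (Rabs (f false s - g false s) * / m)) with (Rabs (f false s - g false s)) by (field; lra). lra. }
  pose proof (Rabs_pos_lt _ kw_neq_0). pose proof (Rabs_pos_lt _ ks_neq_0). destruct i; unfold F.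
  - assert (KA : Rabs (green kw (along A f) t - green kw (along A g) t) <= d / 4 * Rabs kw / Rabs kw).
    { apply green_diff; auto. intros s. eapply Rle_trans; [apply A_contracts; auto|].
      apply Rmult_le_compat_r; [lra|apply weighted]. }
    replace (d / 4 * Rabs kw / Rabs kw) with (d / 4) in KA by (field; lra).
    pose proof (Rle_trans _ _ _ (E_contracts t _ _ _ _ (in_f t) (in_g t)) (weighted t)) as KE.
    fold (along E f t) (along E g t) in KE.
    apply Rabs_le_between in KA. apply Rabs_le_between in KE. apply Rabs_le_between. lra.
  - assert (KB : Rabs (green ks (along B f) t - green ks (along B g) t) <= d / 4 * Rabs ks / m / Rabs ks).
    { apply green_diff; auto. intros s. apply Rle_div_r; [lra|]. rewrite Rmult_comm.
      eapply Rle_trans; [apply B_contracts; auto|]. apply Rmult_le_compat_r; [lra|apply weighted]. }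
    rewrite <- Rmult_minus_distr_l, Rabs_mult, (Rabs_pos_eq m) by lra.
    apply (Rmult_le_compat_l m) in KB; [|lra].
    replace (m * (d / 4 * Rabs ks / m / Rabs ks)) with (d / 4) in KB by (field; lra).
    pose proof (Rle_trans _ _ _ (Rabs_pos _) (Hd true t)). lra.
Qed.

Let good_limit fn g d : (forall n, good (fn n)) ->
  (forall n i t, Rabs (fn n i t - g i t) <= d / 2 ^ n) -> good g.
Proof.
  intros Hfn lim. split; [|split].
  - intros i t. apply (dyadic_limit_continuous (fun n => fn n i) (g i) d).
    + apply filter_forall. intros s n. apply lim.
    + intros n. apply (Hfn n).
  - intros i t. apply Rminus_diag_uniq, Rabs_eq_0, Rle_antisym; [|apply Rabs_pos].
    apply (le_of_div_pow2 _ _ (2 * d)). intros n. pose proof (lim n i t) as at_t.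
    pose proof (lim n i (t + 2 * PI)) as shifted.
    rewrite (proj1 (proj2 (Hfn n))), Rabs_minus_sym in shifted.
    pose proof (Rabs_minus_triang (g i (t + 2 * PI)) (fn n i t) (g i t)). lra.
  - intros t. split.
    + apply (le_of_div_pow2 _ _ d). intros n. destruct (proj2 (proj2 (Hfn n)) t) as [Ht _].
      pose proof (lim n true t) as at_t. rewrite Rabs_minus_sym in at_t.
      pose proof (Rabs_minus_triang (g true t) (fn n true t) rho0). lra.
    + apply (le_of_div_pow2 _ _ (d / m)). intros n. destruct (proj2 (proj2 (Hfn n)) t) as [_ Ht].
      pose proof (lim n false t) as at_t. rewrite Rabs_minus_sym in at_t.
      replace (g false t / m) with (fn n false t / m + (g false t - fn n false t) * / m) by (field; lra).
      eapply Rle_trans; [apply Rabs_triang|]. apply Rplus_le_compat; [exact Ht|].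
      assert (Hm : 0 < / m) by (apply Rinv_0_lt_compat, m_pos).
      rewrite Rabs_mult, (Rabs_pos_eq (/ m)) by lra.
      replace (d / m / 2 ^ n) with (d / 2 ^ n * / m) by (field; split; first [apply pow2_neq_0|lra]).
      apply Rmult_le_compat_r; lra.
Qed.

Lemma periodic_solution : exists rho s : R -> R,
  (forall t, rho (t + 2 * PI) = rho t) /\ (forall t, s (t + 2 * PI) = s t) /\
  (forall t, tube rho0 rad sig (rho t) (s t)) /\
  (forall t, is_derive (fun t => rho t + E t (rho t) (s t)) t
     (- kw * (rho t + E t (rho t) (s t) - rho0) + A t (rho t) (s t))) /\
  (forall t, is_derive s t (- ks * s t + B t (rho t) (s t))).
Proof.
  set (start := fun (i : bool) (_ : R) => if i then rho0 else 0).
  assert (start_good : good start).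
  { split; [intros i t; apply continuous_const|split; [reflexivity|]]. intros t. unfold start, in_tube, tube.
    rewrite Rminus_diag. unfold Rdiv. rewrite Rmult_0_l, Rabs_R0. auto. }
  destruct (contraction_fixed_point bool good F start (rad + m * sig)) as [f [Hf fixed]]; auto.
  { intros i t. destruct (F_in_tube start t start_good) as [Hrho Hs].
    change (start i t) with (if i then rho0 else 0).
    assert (0 <= m * sig) by (apply Rmult_le_pos; lra). destruct i; [lra|].
    rewrite Rminus_0_r. unfold Rdiv in Hs. rewrite Rabs_mult, (Rabs_pos_eq (/ m)) in Hs
      by (left; apply Rinv_0_lt_compat, m_pos). apply Rle_div_l in Hs; lra. }
  pose proof Hf as [_ [per in_t]]. unfold F in fixed.
  assert (Ew : forall t, rho0 + green kw (along A f) t = f true t + E t (f true t) (f false t / m)).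
  { intros t. specialize (fixed true t). unfold along in fixed at 2. simpl in fixed. lra. }
  assert (Es : forall t, green ks (along B f) t = f false t / m).
  { intros t. specialize (fixed false t). simpl in fixed. rewrite <- fixed. field. lra. }
  exists (f true), (fun t => f false t / m). split; [apply per|split; [|split; [exact in_t|split]]].
  - intros t. simpl. rewrite per. reflexivity.
  - intros t. apply (is_derive_ext (fun t => rho0 + green kw (along A f) t)); [exact Ew|]. rewrite <- Ew.
    pose proof (green_derive kw kw_neq_0 (along A f) t (along_continuous A f A_lipschitz Hf)
      (along_periodic A f A_periodic Hf)) as DA.
    set (G := green kw (along A f)) in *. derive_with. unfold along. ring.
  - intros t. apply (is_derive_ext (green ks (along B f))); [exact Es|]. simpl. rewrite <- Es at 1.
    apply (green_derive ks ks_neq_0 (along B f)); [apply along_continuous|apply along_periodic]; auto.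
Qed.

End PeriodicSolution.

(** * Action-angle coordinates *)

Definition action (x y : R) : R := (x ^ 2 + y ^ 2) / 2.

Definition polar_point (th rho s : R) : R3 := (sqrt (2 * rho) * cos th, sqrt (2 * rho) * sin th, s).

Definition at_polar (f : R -> R -> R -> R) (th rho s : R) : R :=
  f (sqrt (2 * rho) * cos th) (sqrt (2 * rho) * sin th) s.

Definition angular_velocity (f1 f2 : R -> R -> R -> R) (x y s : R) : R :=
  (x * f2 x y s - y * f1 x y s) / (x ^ 2 + y ^ 2).

(* The derivative with respect to the angle of a function whose time derivative is [g]. *)
Definition angular_rate (f1 f2 g : R -> R -> R -> R) (th rho s : R) : R :=
  at_polar g th rho s / at_polar (angular_velocity f1 f2) th rho s.

Definition derivative_along (f1 f2 f3 g g' : R -> R -> R -> R) : Prop :=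
  forall (x y s : R -> R) (t : R), is_derive x t (f1 (x t) (y t) (s t)) -> is_derive y t (f2 (x t) (y t) (s t)) ->
  is_derive s t (f3 (x t) (y t) (s t)) -> is_derive (fun t => g (x t) (y t) (s t)) t (g' (x t) (y t) (s t)).

Lemma action_polar (th rho : R) : 0 <= rho -> action (sqrt (2 * rho) * cos th) (sqrt (2 * rho) * sin th) = rho.
Proof.
  intros Hrho. unfold action. rewrite !Rpow_mult_distr, pow2_sqrt by lra.
  replace (2 * rho * cos th ^ 2 + 2 * rho * sin th ^ 2) with (2 * rho * (cos th ^ 2 + sin th ^ 2)) by ring.
  rewrite cos2_plus_sin2. field.
Qed.

Lemma polar_point_add_2PI (th rho s : R) : polar_point (th + 2 * PI) rho s = polar_point th rho s.
Proof. unfold polar_point. rewrite cos_plus, sin_plus, cos_2PI, sin_2PI. apply R3_ext; simpl; ring. Qed.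

Lemma polar_point_in_box (b th rho s : R) : 0 <= b -> 2 * rho <= b ^ 2 -> Rabs s <= b ->
  in_box b (polar_point th rho s).
Proof.
  intros Hb Hrho Hs.
  assert (radius : sqrt (2 * rho) <= b) by (rewrite <- (sqrt_pow2 b) by lra; apply sqrt_le_1_alt, Hrho).
  assert (bound : forall c, Rabs c <= 1 -> Rabs (sqrt (2 * rho) * c) <= b).
  { intros c Hc. pose proof (sqrt_pos (2 * rho)). rewrite Rabs_mult, Rabs_pos_eq by lra.
    rewrite <- (Rmult_1_r b). apply Rmult_le_compat; auto using Rabs_pos. }
  repeat split; [apply bound, Rabs_cos_le_1|apply bound, Rabs_sin_le_1|exact Hs].
Qed.

Lemma sqrt_lipschitz (m x y : R) : 0 < m -> m <= x -> m <= y ->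
  Rabs (sqrt x - sqrt y) <= Rabs (x - y) / (2 * sqrt m).
Proof.
  intros Hm Hx Hy. assert (Hs : 0 < sqrt m) by (apply sqrt_lt_R0; auto).
  assert (sqrt m <= sqrt x) by (apply sqrt_le_1_alt; lra). assert (sqrt m <= sqrt y) by (apply sqrt_le_1_alt; lra).
  replace (sqrt x - sqrt y) with ((x - y) * / (sqrt x + sqrt y)).
  - rewrite Rabs_mult, Rabs_inv, (Rabs_pos_eq (_ + _)) by lra.
    apply Rmult_le_compat_l; [apply Rabs_pos|apply Rinv_le_contravar; lra].
  - replace (x - y) with (sqrt x ^ 2 - sqrt y ^ 2) by (rewrite !pow2_sqrt by lra; ring). field. lra.
Qed.

Lemma dist3_polar_point_le (rho0 th rho s rho' s' : R) : 0 < rho0 -> rho0 / 2 <= rho -> rho0 / 2 <= rho' ->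
  dist3 (polar_point th rho s) (polar_point th rho' s') <= 2 * (Rabs (rho - rho') / sqrt rho0) + Rabs (s - s').
Proof.
  intros Hrho0 H H'. eapply Rle_trans; [apply dist3_le_Rabs|]. simpl.
  rewrite <- !Rmult_minus_distr_r, !Rabs_mult.
  pose proof (sqrt_lipschitz rho0 (2 * rho) (2 * rho') Hrho0 ltac:(lra) ltac:(lra)) as radius.
  rewrite <- Rmult_minus_distr_l, (Rabs_mult 2), (Rabs_pos_eq 2) in radius by lra.
  replace (2 * Rabs (rho - rho') / (2 * sqrt rho0)) with (Rabs (rho - rho') / sqrt rho0) in radius
    by (field; apply Rgt_not_eq, sqrt_lt_R0, Hrho0).
  pose proof (Rabs_cos_le_1 th). pose proof (Rabs_sin_le_1 th).
  pose proof (Rabs_pos (cos th)). pose proof (Rabs_pos (sin th)).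
  pose proof (Rabs_pos (sqrt (2 * rho) - sqrt (2 * rho'))). nra.
Qed.

(* In the frame rotating with the angle, both components have the same logarithmic derivative as the length. *)
Lemma rotating_frame_derive (x y A : R -> R) (t x' y' : R) (n := x t ^ 2 + y t ^ 2) (k := (x t * x' + y t * y') / n) :
  0 < n -> is_derive x t x' -> is_derive y t y' -> is_derive A t ((x t * y' - y t * x') / n) ->
  is_derive (fun t => x t * cos (A t) + y t * sin (A t)) t (k * (x t * cos (A t) + y t * sin (A t))) /\
  is_derive (fun t => y t * cos (A t) - x t * sin (A t)) t (k * (y t * cos (A t) - x t * sin (A t))) /\
  is_derive (fun t => sqrt (2 * action (x t) (y t))) t (k * sqrt (2 * action (x t) (y t))).
Proof.
  intros pos Dx Dy DA. assert (En : n = x t ^ 2 + y t ^ 2) by reflexivity.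
  assert (Eaction : 2 * action (x t) (y t) = n) by (unfold action; rewrite En; field).
  assert (len_pos : 0 < sqrt n) by (apply sqrt_lt_R0; exact pos). split; [|split].
  - derive_with. unfold k. apply (Rmult_eq_reg_l n); [|lra].
    transitivity (n * (x' * cos (A t) + y' * sin (A t))
      + (x t * y' - y t * x') * (y t * cos (A t) - x t * sin (A t))); [field; lra|].
    transitivity ((x t * x' + y t * y') * (x t * cos (A t) + y t * sin (A t))); [rewrite En; ring|field; lra].
  - derive_with. unfold k. apply (Rmult_eq_reg_l n); [|lra].
    transitivity (n * (y' * cos (A t) - x' * sin (A t))
      - (x t * y' - y t * x') * (x t * cos (A t) + y t * sin (A t))); [field; lra|].
    transitivity ((x t * x' + y t * y') * (y t * cos (A t) - x t * sin (A t))); [rewrite En; ring|field; lra].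
  - rewrite Eaction. apply (is_derive_eq _ _ _
      ((x t * x' + y t * y') / sqrt n)).
    + unfold action. derive_with; [change (0 < 2 * action (x t) (y t)); lra|].
      change (2 * ((x t * (x t * 1) + y t * (y t * 1)) * / 2)) with (2 * action (x t) (y t)).
      rewrite Eaction. field. lra.
    + unfold k. rewrite <- (pow2_sqrt n) at 2 by lra. field. lra.
Qed.

Lemma polar_lift (x y A : R -> R) (T : R) : 0 <= T ->
  (forall t, 0 <= t <= T -> 0 < x t ^ 2 + y t ^ 2 /\ exists x' y', is_derive x t x' /\ is_derive y t y' /\
     is_derive A t ((x t * y' - y t * x') / (x t ^ 2 + y t ^ 2))) ->
  x 0 = sqrt (2 * action (x 0) (y 0)) * cos (A 0) -> y 0 = sqrt (2 * action (x 0) (y 0)) * sin (A 0) ->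
  x T = sqrt (2 * action (x T) (y T)) * cos (A T) /\ y T = sqrt (2 * action (x T) (y T)) * sin (A T).
Proof.
  intros HT derive Hx0 Hy0. set (len := fun t => sqrt (2 * action (x t) (y t))).
  set (c := fun t => x t * cos (A t) + y t * sin (A t)). set (s := fun t => y t * cos (A t) - x t * sin (A t)).
  set (k := fun t => (x t * Derive x t + y t * Derive y t) / (x t ^ 2 + y t ^ 2)).
  assert (log_derive : forall t, 0 <= t <= T -> is_derive c t (k t * c t) /\ is_derive s t (k t * s t) /\
    is_derive len t (k t * len t) /\ len t <> 0).
  { intros t Ht. destruct (derive t Ht) as [pos [x' [y' [Dx [Dy DA]]]]]. unfold k.
    rewrite (is_derive_unique _ _ _ Dx), (is_derive_unique _ _ _ Dy).
    destruct (rotating_frame_derive x y A t x' y' pos Dx Dy DA) as [Dc [Ds Dlen]].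
    split; [exact Dc|split; [exact Ds|split; [exact Dlen|]]].
    apply Rgt_not_eq, sqrt_lt_R0. unfold action. lra. }
  pose proof (cos2_plus_sin2 (A 0)) as unit_0. pose proof (cos2_plus_sin2 (A T)) as unit_T.
  assert (len_0 := proj2 (proj2 (proj2 (log_derive 0 ltac:(lra))))).
  assert (len_T := proj2 (proj2 (proj2 (log_derive T ltac:(lra))))).
  change (x 0 = len 0 * cos (A 0)) in Hx0. change (y 0 = len 0 * sin (A 0)) in Hy0.
  assert (cT : c T = len T).
  { assert (E : c T / len T = c 0 / len 0)
      by (apply (same_log_derivative c len k 0 T HT); intros t Ht; destruct (log_derive t Ht); tauto).
    assert (E0 : c 0 = len 0) by (unfold c; rewrite Hx0, Hy0;
      transitivity (len 0 * (cos (A 0) ^ 2 + sin (A 0) ^ 2)); [ring|rewrite unit_0; ring]).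
    rewrite E0, Rdiv_diag in E by exact len_0. apply (Rmult_eq_reg_r (/ len T)); [|apply Rinv_neq_0_compat, len_T].
    rewrite Rinv_r by exact len_T. exact E. }
  assert (sT : s T = 0).
  { assert (E : s T / len T = s 0 / len 0)
      by (apply (same_log_derivative s len k 0 T HT); intros t Ht; destruct (log_derive t Ht); tauto).
    assert (E0 : s 0 = 0) by (unfold s; rewrite Hx0, Hy0; ring).
    rewrite E0, Rdiv_0_l in E. apply Rmult_integral in E as [E|E]; [exact E|].
    destruct (Rinv_neq_0_compat _ len_T E). }
  fold (len T). rewrite <- cT. split.
  - transitivity (c T * cos (A T) - s T * sin (A T)); [|rewrite sT; ring].
    unfold c, s. transitivity (x T * (cos (A T) ^ 2 + sin (A T) ^ 2)); [rewrite unit_T|]; ring.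
  - transitivity (c T * sin (A T) + s T * cos (A T)); [|rewrite sT; ring].
    unfold c, s. transitivity (y T * (cos (A T) ^ 2 + sin (A T) ^ 2)); [rewrite unit_T|]; ring.
Qed.

Lemma polar_right_half_plane (x y : R) : 0 < x ->
  x = sqrt (x ^ 2 + y ^ 2) * cos (atan (y / x)) /\ y = sqrt (x ^ 2 + y ^ 2) * sin (atan (y / x)).
Proof.
  intros Hx. set (t := y / x).
  assert (len : sqrt (x ^ 2 + y ^ 2) = x * sqrt (1 + t ^ 2)).
  { replace (x ^ 2 + y ^ 2) with (x ^ 2 * (1 + t ^ 2)) by (unfold t; field; lra).
    rewrite sqrt_mult, sqrt_pow2 by nra. reflexivity. }
  assert (0 < sqrt (1 + t ^ 2)) by (apply sqrt_lt_R0; nra).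
  rewrite len, cos_atan, sin_atan, Rsqr_pow2. split; [field; lra|].
  transitivity (x * t); [unfold t; field; lra|field; lra].
Qed.

Lemma nearby_angle (x y r0 th0 h r : R) : 0 < r <= r0 -> h <= r / 4 ->
  Rabs (x - r0 * cos th0) <= h -> Rabs (y - r0 * sin th0) <= h ->
  exists th, x = sqrt (2 * action x y) * cos th /\ y = sqrt (2 * action x y) * sin th /\ Rabs (th - th0) <= 4 * h / r.
Proof.
  intros Hr Hh Hx Hy.
  pose proof (cos2_plus_sin2 th0) as unit. pose proof (Rabs_cos_le_1 th0) as Hc. pose proof (Rabs_sin_le_1 th0) as Hs.
  set (c := cos th0) in *. set (s := sin th0) in *.
  set (dx := x - r0 * c) in *. set (dy := y - r0 * s) in *.
  set (u := x * c + y * s). set (v := y * c - x * s).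
  assert (Eu : u = r0 + (dx * c + dy * s)).
  { unfold u, dx, dy. transitivity (r0 * (c ^ 2 + s ^ 2) + ((x - r0 * c) * c + (y - r0 * s) * s)); [ring|].
    rewrite unit; ring. }
  assert (Ev : v = dy * c + - (dx * s)) by (unfold v, dx, dy; ring).
  assert (small : forall d e, Rabs d <= h -> Rabs e <= 1 -> Rabs (d * e) <= h).
  { intros d e Hd He. rewrite Rabs_mult, <- (Rmult_1_r h). apply Rmult_le_compat; auto using Rabs_pos. }
  assert (Hu : r / 2 <= u).
  { pose proof (small dx c Hx Hc) as B. pose proof (small dy s Hy Hs) as B'.
    apply Rabs_le_between in B. apply Rabs_le_between in B'. lra. }
  assert (Hv : Rabs v <= 2 * h).
  { pose proof (small dy c Hy Hc). pose proof (small dx s Hx Hs). rewrite Ev.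
    eapply Rle_trans; [apply Rabs_triang|]. rewrite Rabs_Ropp. lra. }
  assert (len : 2 * action x y = u ^ 2 + v ^ 2).
  { unfold action, u, v. transitivity ((x ^ 2 + y ^ 2) * (c ^ 2 + s ^ 2)); [rewrite unit; field|ring]. }
  destruct (polar_right_half_plane u v ltac:(lra)) as [Pu Pv]. rewrite <- len in Pu, Pv.
  set (a := atan (v / u)) in *. exists (th0 + a). rewrite cos_plus, sin_plus. fold c s. repeat split.
  - transitivity (u * c - v * s); [|rewrite Pu, Pv; ring].
    unfold u, v. transitivity (x * (c ^ 2 + s ^ 2)); [rewrite unit|]; ring.
  - transitivity (u * s + v * c); [|rewrite Pu, Pv; ring].
    unfold u, v. transitivity (y * (c ^ 2 + s ^ 2)); [rewrite unit|]; ring.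
  - replace (th0 + a - th0) with a by ring. eapply Rle_trans; [apply Rabs_atan_le|].
    unfold Rdiv at 1. rewrite Rabs_mult, Rabs_inv, (Rabs_pos_eq u) by lra.
    replace (4 * h / r) with (2 * h * / (r / 2)) by (field; lra).
    apply Rmult_le_compat; auto using Rabs_pos; [left; apply Rinv_0_lt_compat; lra|apply Rinv_le_contravar; lra].
Qed.

(** * Solutions near a closed curve *)

(* The curve [th |-> polar_point th (rho_c th) (s_c th)] is invariant. Along a solution that stays in the tube, the
   squared differences of [w] and [s] to their values on the curve at the same angle are combined with a weight,
   with equal signs for stability and opposite signs for instability. *)
Section ClosedCurve.
Variables f1 f2 f3 w w' : R -> R -> R -> R.
Variables rho0 rad sig kw ks weight vmin vmax b w_bound slope : R.
Variables rho_c s_c : R -> R.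

Local Notation in_tube := (tube rho0 rad sig).
Local Notation velocity := (angular_velocity f1 f2).
Local Notation w_rate := (angular_rate f1 f2 w').
Local Notation s_rate := (angular_rate f1 f2 f3).
Local Notation curve := (fun th => polar_point th (rho_c th) (s_c th)).
Local Notation w_c := (fun th => at_polar w th (rho_c th) (s_c th)).

Hypothesis rho0_pos : 0 < rho0.
Hypothesis rad_range : 0 < rad <= rho0 / 2.
Hypothesis sig_pos : 0 < sig.
Hypothesis ks_pos : 0 < ks.
Hypothesis weight_pos : 0 < weight.
Hypothesis vmin_pos : 0 < vmin.
Hypothesis kw_neq_0 : kw <> 0.
Hypothesis f1_lipschitz : loc_lipschitz f1.
Hypothesis f2_lipschitz : loc_lipschitz f2.
Hypothesis f3_lipschitz : loc_lipschitz f3.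
Hypothesis velocity_bounds : forall th rho s, in_tube rho s -> vmin <= at_polar velocity th rho s <= vmax.
Hypothesis rho_c_periodic : forall th, rho_c (th + 2 * PI) = rho_c th.
Hypothesis s_c_periodic : forall th, s_c (th + 2 * PI) = s_c th.
Hypothesis curve_well_inside : forall th, tube rho0 (rad / 2) (sig / 2) (rho_c th) (s_c th).
Hypothesis w_c_derive : forall th, is_derive w_c th (w_rate th (rho_c th) (s_c th)).
Hypothesis s_c_derive : forall th, is_derive s_c th (s_rate th (rho_c th) (s_c th)).
Hypothesis rates_close : forall th rho s rho' s', in_tube rho s -> in_tube rho' s' ->
  let dw := at_polar w th rho s - at_polar w th rho' s' in
  let ds := s - s' in
  Rabs dw * Rabs (w_rate th rho s - w_rate th rho' s' + kw * dw)
  + weight * (Rabs ds * Rabs (s_rate th rho s - s_rate th rho' s' + ks * ds))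
  <= Rabs kw / 2 * dw ^ 2 + weight * ks / 2 * ds ^ 2.
Hypothesis rho_le_w : forall th rho s rho' s', in_tube rho s -> in_tube rho' s' ->
  Rabs (rho - rho') <= 2 * (Rabs (at_polar w th rho s - at_polar w th rho' s') + Rabs (s - s')).
Hypothesis rates_bounded : forall th rho s, in_tube rho s ->
  Rabs (w_rate th rho s) <= slope /\ Rabs (s_rate th rho s) <= slope.
Hypothesis tube_size : 0 < b /\ 2 * (rho0 + rad) <= b ^ 2 /\ sig <= b.
Hypothesis w_lipschitz : bounded_lipschitz (box b) w_bound w.
Hypothesis w_derive : derivative_along f1 f2 f3 w w'.

Lemma curve_in_tube th : in_tube (rho_c th) (s_c th).
Proof. destruct (curve_well_inside th). split; lra. Qed.

Lemma tube_rho_ge rho s : in_tube rho s -> rho0 / 2 <= rho.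
Proof. intros [H _]. apply Rabs_le_between in H. lra. Qed.

Lemma tube_in_box th rho s : in_tube rho s -> in_box b (polar_point th rho s).
Proof. intros [Hrho Hs]. apply Rabs_le_between in Hrho. apply polar_point_in_box; lra. Qed.

Lemma rho_c_ge th : rho0 / 2 <= rho_c th.
Proof. exact (tube_rho_ge _ _ (curve_in_tube th)). Qed.

Section AlongSolution.
Variables (phi : R -> R3) (A : R -> R).

Local Notation x t := (coord 0 (phi t)).
Local Notation y t := (coord 1 (phi t)).
Local Notation z t := (coord 2 (phi t)).
Local Notation rho t := (action (coord 0 (phi t)) (coord 1 (phi t))).

Hypothesis phi_sol : is_fsol (field3 f1 f2 f3) phi.
Hypothesis A_derive : forall t, 0 <= t -> rho0 <= x t ^ 2 + y t ^ 2 -> is_derive A t (velocity (x t) (y t) (z t)).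
Hypothesis phi_0 : phi 0 = polar_point (A 0) (rho 0) (z 0).

Definition stays_in_tube (T : R) : Prop := forall t, 0 <= t <= T -> in_tube (rho t) (z t).

Lemma sol_coord_derive t : 0 <= t -> is_derive (fun t => x t) t (f1 (x t) (y t) (z t)) /\
  is_derive (fun t => y t) t (f2 (x t) (y t) (z t)) /\ is_derive (fun t => z t) t (f3 (x t) (y t) (z t)).
Proof. intros Ht. exact (sol_at_coord _ _ _ (phi_sol t Ht)). Qed.

Lemma radius_ge T t : stays_in_tube T -> 0 <= t <= T -> rho0 <= x t ^ 2 + y t ^ 2.
Proof. intros HT Ht. pose proof (tube_rho_ge _ _ (HT t Ht)) as rho_ge. unfold action in rho_ge. lra. Qed.

Lemma along_polar T : 0 <= T -> stays_in_tube T -> phi T = polar_point (A T) (rho T) (z T).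
Proof.
  intros HT in_T.
  destruct (polar_lift (fun t => x t) (fun t => y t) A T HT) as [Ex Ey].
  - intros t Ht. pose proof (radius_ge T t in_T Ht). split; [lra|].
    destruct (sol_coord_derive t ltac:(lra)) as [Dx [Dy _]].
    exists (f1 (x t) (y t) (z t)), (f2 (x t) (y t) (z t)). split; [exact Dx|split; [exact Dy|]].
    apply A_derive; lra.
  - exact (f_equal (coord 0) phi_0).
  - exact (f_equal (coord 1) phi_0).
  - apply R3_ext; [exact Ex|exact Ey|reflexivity].
Qed.

Lemma along_at (f : R -> R -> R -> R) T : 0 <= T -> stays_in_tube T ->
  f (x T) (y T) (z T) = at_polar f (A T) (rho T) (z T).
Proof. intros HT in_T. unfold at_polar. pose proof (along_polar T HT in_T) as E.
  apply f_equal3; [exact (f_equal (coord 0) E)|exact (f_equal (coord 1) E)|reflexivity]. Qed.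

Lemma stays_in_tube_before T t : stays_in_tube T -> t <= T -> stays_in_tube t.
Proof. intros HT Ht u Hu. apply HT. lra. Qed.

Lemma angle_speed T : 0 <= T -> stays_in_tube T ->
  is_derive A T (at_polar velocity (A T) (rho T) (z T)) /\ vmin <= at_polar velocity (A T) (rho T) (z T) <= vmax.
Proof.
  intros HT in_T. split; [|apply velocity_bounds, in_T; lra].
  rewrite <- along_at by assumption. apply A_derive; [exact HT|]. apply (radius_ge T); [exact in_T|lra].
Qed.

Definition gap_w (t : R) : R := w (x t) (y t) (z t) - w_c (A t).
Definition gap_s (t : R) : R := z t - s_c (A t).
Definition gap (sg t : R) : R := gap_w t ^ 2 + sg * (weight * gap_s t ^ 2).

Lemma gap_derive sg T : 0 <= T -> stays_in_tube T -> exists v errw errs, vmin <= v <= vmax /\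
  is_derive (gap sg) T (2 * v * (gap_w T * (- kw * gap_w T + errw)
    + sg * (weight * (gap_s T * (- ks * gap_s T + errs))))) /\
  Rabs (gap_w T * errw) + weight * Rabs (gap_s T * errs) <= Rabs kw / 2 * gap_w T ^ 2 + weight * ks / 2 * gap_s T ^ 2.
Proof.
  intros HT in_T. pose proof (in_T T ltac:(lra)) as tube_T.
  destruct (angle_speed T HT in_T) as [DA bounds]. destruct (sol_coord_derive T HT) as [Dx [Dy Dz]].
  pose proof (w_derive (fun t => x t) (fun t => y t) (fun t => z t) T Dx Dy Dz) as Dw. cbv beta in Dw.
  rewrite (along_at w' T HT in_T) in Dw. rewrite (along_at f3 T HT in_T) in Dz.
  pose proof (w_c_derive (A T)) as Dwc. pose proof (s_c_derive (A T)) as Dsc.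
  pose proof (rates_close (A T) _ _ _ _ tube_T (curve_in_tube (A T))) as close. cbv zeta in close.
  rewrite <- (along_at w T HT in_T) in close.
  set (rw := w_rate (A T) (rho T) (z T)) in *. set (rs := s_rate (A T) (rho T) (z T)) in *.
  set (rw_c := w_rate (A T) (rho_c (A T)) (s_c (A T))) in *. set (rs_c := s_rate (A T) (rho_c (A T)) (s_c (A T))) in *.
  set (v := at_polar velocity (A T) (rho T) (z T)) in *.
  assert (Ew : at_polar w' (A T) (rho T) (z T) = v * rw) by (unfold rw, angular_rate; fold v; field; lra).
  assert (Es : at_polar f3 (A T) (rho T) (z T) = v * rs) by (unfold rs, angular_rate; fold v; field; lra).
  rewrite Ew in Dw. rewrite Es in Dz.
  exists v, (rw - rw_c + kw * gap_w T), (rs - rs_c + ks * gap_s T).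
  split; [exact bounds|split; [|rewrite !Rabs_mult; exact close]].
  unfold gap, gap_w, gap_s.
  set (wt := fun t => w (x t) (y t) (z t)) in *. set (zt := fun t => z t) in *. set (wc := w_c) in *.
  change (is_derive (fun t => (wt t - wc (A t)) ^ 2 + sg * (weight * (zt t - s_c (A t)) ^ 2)) T
    (2 * v * ((wt T - wc (A T)) * (- kw * (wt T - wc (A T)) + (rw - rw_c + kw * (wt T - wc (A T))))
     + sg * (weight * ((zt T - s_c (A T)) * (- ks * (zt T - s_c (A T)) + (rs - rs_c + ks * (zt T - s_c (A T))))))))).
  assert (Dwt : is_derive wt T (v * rw)) by exact Dw. assert (Dzt : is_derive zt T (v * rs)) by exact Dz.
  assert (Dwc_A : is_derive wc (A T) rw_c) by exact Dwc. clear Dw Dz Dwc. derive_with. ring.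
Qed.

Lemma gap_growth T : 0 <= T -> stays_in_tube T -> gap 1 T <= gap 1 0 * exp (3 * Rabs kw * vmax * T).
Proof.
  intros HT in_T. rewrite <- (Rminus_0_r T) at 2. apply gronwall_le; [exact HT|]. intros t Ht.
  destruct (gap_derive 1 t) as [v [errw [errs [Hv [D errors]]]]]; [lra|apply (stays_in_tube_before T); auto; lra|].
  eexists. split; [exact D|]. rewrite Rmult_1_l. unfold gap. set (dw := gap_w t) in *. set (ds := gap_s t) in *.
  pose proof (Rle_abs (dw * errw)). pose proof (Rle_abs (ds * errs)).
  pose proof (Rabs_pos_lt _ kw_neq_0). pose proof (Rle_abs (- kw)) as neg. rewrite Rabs_Ropp in neg.
  assert (0 <= dw ^ 2) by apply pow2_ge_0. assert (0 <= weight * ds ^ 2) by (apply Rmult_le_pos; [lra|apply pow2_ge_0]).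
  assert (rate : dw * (- kw * dw + errw) + weight * (ds * (- ks * ds + errs)) <= 3 / 2 * Rabs kw * dw ^ 2).
  { assert (- kw * dw ^ 2 <= Rabs kw * dw ^ 2) by (apply Rmult_le_compat_r; lra).
    assert (weight * (ds * errs) <= weight * Rabs (ds * errs)) by (apply Rmult_le_compat_l; lra).
    assert (0 <= ks * (weight * ds ^ 2)) by (apply Rmult_le_pos; lra). nra. }
  assert (0 <= 3 / 2 * Rabs kw * dw ^ 2) by (apply Rmult_le_pos; lra).
  apply Rle_trans with (2 * v * (3 / 2 * Rabs kw * dw ^ 2)); [apply Rmult_le_compat_l; lra|].
  apply Rle_trans with (2 * vmax * (3 / 2 * Rabs kw * dw ^ 2)); [apply Rmult_le_compat_r; lra|].
  assert (0 <= 3 * Rabs kw * vmax * (weight * ds ^ 2)) by (apply Rmult_le_pos; [apply Rmult_le_pos; lra|lra]). lra.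
Qed.

Lemma gap_decay T : 0 < kw -> 0 <= T -> stays_in_tube T -> gap 1 T <= gap 1 0 * exp (- (Rmin kw ks * vmin) * T).
Proof.
  intros Hkw HT in_T. rewrite <- (Rminus_0_r T) at 2. apply gronwall_le; [exact HT|]. intros t Ht.
  destruct (gap_derive 1 t) as [v [errw [errs [Hv [D errors]]]]]; [lra|apply (stays_in_tube_before T); auto; lra|].
  eexists. split; [exact D|]. rewrite Rmult_1_l. unfold gap. set (dw := gap_w t) in *. set (ds := gap_s t) in *.
  pose proof (Rle_abs (dw * errw)). pose proof (Rle_abs (ds * errs)). rewrite (Rabs_pos_eq kw) in errors by lra.
  assert (0 < Rmin kw ks) by (apply Rmin_glb_lt; lra). pose proof (Rmin_l kw ks). pose proof (Rmin_r kw ks).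
  set (k := Rmin kw ks) in *.
  assert (0 <= dw ^ 2) by apply pow2_ge_0. assert (0 <= weight * ds ^ 2) by (apply Rmult_le_pos; [lra|apply pow2_ge_0]).
  assert (rate : dw * (- kw * dw + errw) + weight * (ds * (- ks * ds + errs))
    <= - (k / 2) * (dw ^ 2 + weight * ds ^ 2)).
  { assert (k * dw ^ 2 <= kw * dw ^ 2) by (apply Rmult_le_compat_r; lra).
    assert (k * (weight * ds ^ 2) <= ks * (weight * ds ^ 2)) by (apply Rmult_le_compat_r; lra).
    assert (weight * (ds * errs) <= weight * Rabs (ds * errs)) by (apply Rmult_le_compat_l; lra). nra. }
  apply Rle_trans with (2 * v * (- (k / 2) * (dw ^ 2 + weight * ds ^ 2))); [apply Rmult_le_compat_l; lra|].
  assert (0 <= k * (dw ^ 2 + weight * ds ^ 2)) by (apply Rmult_le_pos; lra). nra.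
Qed.

Lemma gap_escape T : kw < 0 -> 0 <= T -> stays_in_tube T -> gap (-1) 0 * exp (- kw * vmin * T) <= gap (-1) T.
Proof.
  intros Hkw HT in_T. rewrite <- (Rminus_0_r T) at 1. apply gronwall_ge; [exact HT|]. intros t Ht.
  destruct (gap_derive (-1) t) as [v [errw [errs [Hv [D errors]]]]]; [lra|apply (stays_in_tube_before T); auto; lra|].
  eexists. split; [exact D|]. unfold gap. set (dw := gap_w t) in *. set (ds := gap_s t) in *.
  rewrite (Rabs_left kw) in errors by lra.
  pose proof (Rabs_le_between (dw * errw) (Rabs (dw * errw))) as [Hdw _]. specialize (Hdw (Rle_refl _)).
  pose proof (Rle_abs (ds * errs)).
  assert (0 <= dw ^ 2) by apply pow2_ge_0. assert (0 <= weight * ds ^ 2) by (apply Rmult_le_pos; [lra|apply pow2_ge_0]).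
  assert (rate : - kw / 2 * dw ^ 2 <= dw * (- kw * dw + errw) + -1 * (weight * (ds * (- ks * ds + errs)))).
  { assert (weight * (ds * errs) <= weight * Rabs (ds * errs)) by (apply Rmult_le_compat_l; lra).
    assert (0 <= ks * (weight * ds ^ 2)) by (apply Rmult_le_pos; lra). nra. }
  apply Rle_trans with (2 * v * (- kw / 2 * dw ^ 2)); [|apply Rmult_le_compat_l; lra].
  assert (0 <= - kw * dw ^ 2) by (apply Rmult_le_pos; lra).
  assert (0 <= - kw * vmin * (weight * ds ^ 2)) by (apply Rmult_le_pos; [apply Rmult_le_pos; lra|lra]). nra.
Qed.

Definition deviation (v : R) : R := 2 * (sqrt v + sqrt (v / weight)).

Lemma close_to_curve v T : 0 <= T -> stays_in_tube T -> gap 1 T <= v ->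
  Rabs (rho T - rho_c (A T)) <= deviation v /\ Rabs (z T - s_c (A T)) <= deviation v.
Proof.
  intros HT in_T Hv. unfold gap in Hv. rewrite Rmult_1_l in Hv.
  assert (gap_w_le : Rabs (gap_w T) <= sqrt v).
  { rewrite <- sqrt_Rsqr_abs, Rsqr_pow2. apply sqrt_le_1_alt.
    assert (0 <= weight * gap_s T ^ 2) by (apply Rmult_le_pos; [lra|apply pow2_ge_0]). lra. }
  assert (gap_s_le : Rabs (gap_s T) <= sqrt (v / weight)).
  { rewrite <- sqrt_Rsqr_abs, Rsqr_pow2. apply sqrt_le_1_alt. apply (Rle_div_r (gap_s T ^ 2) v weight weight_pos).
    pose proof (pow2_ge_0 (gap_w T)). lra. }
  pose proof (rho_le_w (A T) _ _ _ _ (in_T T ltac:(lra)) (curve_in_tube (A T))) as rho_close.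
  rewrite <- (along_at w T HT in_T) in rho_close. fold (gap_w T) (gap_s T) in *. unfold deviation.
  pose proof (sqrt_pos v). pose proof (sqrt_pos (v / weight)). split; [|fold (gap_s T)]; lra.
Qed.

Lemma dist_to_curve v T : 0 <= T -> stays_in_tube T -> gap 1 T <= v ->
  dist3 (phi T) (curve (A T)) <= (2 / sqrt rho0 + 1) * deviation v.
Proof.
  intros HT in_T Hv. destruct (close_to_curve v T HT in_T Hv) as [Hrho Hs].
  rewrite (along_polar T HT in_T). eapply Rle_trans; [apply (dist3_polar_point_le rho0)|].
  - exact rho0_pos.
  - apply (tube_rho_ge _ (z T)), in_T. lra.
  - apply rho_c_ge.
  - assert (0 < / sqrt rho0) by (apply Rinv_0_lt_compat, sqrt_lt_R0, rho0_pos).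
    pose proof (Rmult_le_compat_r (/ sqrt rho0) _ _ ltac:(lra) Hrho). unfold Rdiv. lra.
Qed.

Lemma trapped_in_tube : Rabs (rho 0 - rho0) < rad -> Rabs (z 0) < sig -> deviation (gap 1 0) < rad / 2 ->
  deviation (gap 1 0) < sig / 2 -> (forall T, 0 <= T -> stays_in_tube T -> gap 1 T <= gap 1 0) ->
  forall T, stays_in_tube T.
Proof.
  intros rho_0 z_0 small_rad small_sig gap_le.
  set (excess := fun t => Rmax (Rabs (rho t - rho0) - rad) (Rabs (z t) - sig)).
  assert (excess_le_0 : forall t, excess t <= 0 -> in_tube (rho t) (z t)).
  { intros t Ht. unfold excess in Ht. pose proof (Rmax_l (Rabs (rho t - rho0) - rad) (Rabs (z t) - sig)).
    pose proof (Rmax_r (Rabs (rho t - rho0) - rad) (Rabs (z t) - sig)). split; lra. }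
  intros T t Ht. apply excess_le_0, Rlt_le. apply bootstrap_lt_0; [| | |lra].
  - intros u Hu. destruct (sol_coord_derive u Hu) as [Dx [Dy Dz]].
    pose proof (is_derive_continuous _ _ _ Dx) as cx. pose proof (is_derive_continuous _ _ _ Dy) as cy.
    pose proof (is_derive_continuous _ _ _ Dz) as cz.
    set (x := fun t => x t) in *. set (y := fun t => y t) in *. set (z := fun t => z t) in *.
    apply continuous_Rmax; [change (continuous (fun t => Rabs ((x t ^ 2 + y t ^ 2) / 2 - rho0) - rad) u)
      |change (continuous (fun t => Rabs (z t) - sig) u)]; prove_continuous.
  - unfold excess. apply Rmax_lub_lt; lra.
  - intros u Hu before.
    assert (in_u : stays_in_tube u) by (intros t' Ht'; apply excess_le_0, before, Ht').
    destruct (close_to_curve (gap 1 0) u Hu in_u (gap_le u Hu in_u)) as [Hrho Hs].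
    destruct (curve_well_inside (A u)) as [Hrho_c Hs_c]. unfold excess.
    pose proof (Rabs_minus_triang (rho u) (rho_c (A u)) rho0).
    pose proof (Rabs_minus_triang (z u) (s_c (A u)) 0). rewrite !Rminus_0_r in *. apply Rmax_lub_lt; lra.
Qed.

End AlongSolution.

Local Notation F := (field3 f1 f2 f3).

(* Outside of the tube the denominator of the angular velocity is modified, so that the angle exists at all times. *)
Lemma angle_exists phi th : is_fsol F phi -> exists A : R -> R, A 0 = th /\ (forall t, continuous A t) /\
  forall t, 0 <= t -> rho0 <= coord 0 (phi t) ^ 2 + coord 1 (phi t) ^ 2 ->
    is_derive A t (velocity (coord 0 (phi t)) (coord 1 (phi t)) (coord 2 (phi t))).
Proof.
  intros Hphi. set (clip := fun i t => coord i (phi (Rmax t 0))).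
  assert (clip_continuous : forall i, (i < 3)%nat -> forall t, continuous (clip i) t).
  { intros i Hi t. apply (continuous_comp (fun t => Rmax t 0) (fun u => coord i (phi u))).
    - apply continuous_Rmax; [apply continuous_id|apply continuous_const].
    - apply (is_derive_continuous _ _ _ (Hphi (Rmax t 0) (Rmax_r t 0) i Hi)). }
  set (x := clip 0%nat). set (y := clip 1%nat). set (z := clip 2%nat).
  set (speed := fun t => (x t * f2 (x t) (y t) (z t) - y t * f1 (x t) (y t) (z t))
                         / (Rmax (x t ^ 2 + y t ^ 2 - rho0) 0 + rho0)).
  assert (speed_continuous : forall t, continuous speed t).
  { intros t. assert (cx : continuous x t) by (apply clip_continuous; lia).
    assert (cy : continuous y t) by (apply clip_continuous; lia).
    assert (cz : continuous z t) by (apply clip_continuous; lia).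
    pose proof (loc_lipschitz_continuous f1 x y z t f1_lipschitz cx cy cz) as c1.
    pose proof (loc_lipschitz_continuous f2 x y z t f2_lipschitz cx cy cz) as c2.
    assert (cm : continuous (fun t => Rmax (x t ^ 2 + y t ^ 2 - rho0) 0) t)
      by (apply continuous_Rmax; prove_continuous).
    set (g1 := fun t => f1 (x t) (y t) (z t)) in *. set (g2 := fun t => f2 (x t) (y t) (z t)) in *.
    set (m := fun t => Rmax (x t ^ 2 + y t ^ 2 - rho0) 0) in *.
    change (continuous (fun t => (x t * g2 t - y t * g1 t) / (m t + rho0)) t). prove_continuous.
    unfold m. pose proof (Rmax_r (x t ^ 2 + y t ^ 2 - rho0) 0). lra. }
  pose proof (fun t => is_derive_primitive speed 0 t speed_continuous) as DI.
  assert (DA : forall t, is_derive (fun t => th + RInt speed 0 t) t (speed t)).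
  { intros t. specialize (DI t). set (I := fun t => RInt speed 0 t) in *.
    change (is_derive (fun t => th + I t) t (speed t)).
    derive_with. ring. }
  exists (fun t => th + RInt speed 0 t). split; [rewrite RInt_point; apply Rplus_0_r|split].
  - intros t. exact (is_derive_continuous _ _ _ (DA t)).
  - intros t Ht Hrho. refine (is_derive_eq _ _ _ _ (DA t) _).
    unfold speed, velocity, x, y, z, clip. rewrite (Rmax_left t 0) by lra. rewrite Rmax_left by lra.
    unfold Rminus. rewrite (Rplus_assoc (_ + _) (- rho0)), Rplus_opp_l, Rplus_0_r. reflexivity.
Qed.

Lemma solution_on_curve phi th : is_fsol F phi -> phi 0 = curve th ->
  exists A : R -> R, A 0 = th /\ (forall t, continuous A t) /\
    forall t, 0 <= t -> th + vmin * t <= A t /\ phi t = curve (A t).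
Proof.
  intros Hphi H0. destruct (angle_exists phi th Hphi) as [A [A0 [A_continuous A_derive]]].
  assert (rho_0 : action (coord 0 (phi 0)) (coord 1 (phi 0)) = rho_c th)
    by (rewrite H0; apply action_polar; pose proof (rho_c_ge th); lra).
  assert (phi_0 : phi 0 = polar_point (A 0) (action (coord 0 (phi 0)) (coord 1 (phi 0))) (coord 2 (phi 0)))
    by (rewrite rho_0, A0, H0; reflexivity).
  assert (no_gap : gap phi A 1 0 = 0)
    by (unfold gap, gap_w, gap_s; rewrite A0, H0; unfold polar_point, at_polar; simpl; ring).
  assert (deviation_0 : deviation 0 = 0) by (unfold deviation; rewrite Rdiv_0_l, sqrt_0; ring).
  assert (gap_le : forall T, 0 <= T -> stays_in_tube phi T -> gap phi A 1 T <= gap phi A 1 0).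
  { intros T HT in_T. pose proof (gap_growth phi A Hphi A_derive phi_0 T HT in_T) as growth.
    rewrite no_gap in *. lra. }
  destruct (curve_well_inside th) as [inside_rho inside_s].
  assert (in_T : forall T, stays_in_tube phi T).
  { apply (trapped_in_tube phi A); auto; rewrite ?no_gap, ?deviation_0, ?rho_0; try lra.
    rewrite H0. change (Rabs (s_c th) < sig). lra. }
  exists A. split; [exact A0|split; [exact A_continuous|]]. intros t Ht. split.
  - rewrite <- A0, <- (Rminus_0_r t) at 1. apply increment_ge; [exact Ht|]. intros u Hu.
    destruct (angle_speed phi A Hphi A_derive phi_0 u) as [D bounds]; [lra|apply in_T|].
    eexists; split; [exact D|lra].
  - specialize (gap_le t Ht (in_T t)). rewrite no_gap in gap_le.
    destruct (close_to_curve phi A Hphi A_derive phi_0 0 t Ht (in_T t) gap_le) as [Erho Es].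
    rewrite deviation_0 in Erho, Es.
    rewrite (along_polar phi A Hphi A_derive phi_0 t Ht (in_T t)). f_equal;
      apply Rminus_diag_uniq, Rabs_eq_0, Rle_antisym; auto using Rabs_pos.
Qed.

Hypothesis solutions_exist : forall X, exists phi, is_sol F phi /\ phi 0 = X.

Lemma curve_periodic th (n : nat) : curve (th + INR n * (2 * PI)) = curve th.
Proof.
  induction n as [|n IH]; [simpl; rewrite Rmult_0_l, Rplus_0_r; reflexivity|].
  rewrite S_INR. replace (th + (INR n + 1) * (2 * PI)) with (th + INR n * (2 * PI) + 2 * PI) by ring.
  rewrite rho_c_periodic, s_c_periodic, polar_point_add_2PI. exact IH.
Qed.

Lemma periodic_orbit_on_curve : exists (gam : R -> R3) (T : R),
  periodic_orbit F gam T /\ (forall t, exists th, gam t = curve th) /\ (forall th, exists t, gam t = curve th).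
Proof.
  destruct (solutions_exist (curve 0)) as [gam [gam_sol gam_0]].
  destruct (solution_on_curve gam 0 (is_fsol_of_is_sol _ _ gam_sol) gam_0) as [A [A0 [A_continuous on_curve]]].
  assert (reaches : forall th, 0 <= th -> exists t, 0 <= t /\ A t = th).
  { intros th Hth. assert (Ht : 0 <= th / vmin) by (apply Rdiv_le_0_compat; lra).
    destruct (on_curve _ Ht) as [far _]. replace (vmin * (th / vmin)) with th in far by (field; lra).
    destruct (IVT_gen A 0 (th / vmin) th) as [t [Ht' E]].
    - intros t. apply continuity_pt_filterlim, A_continuous.
    - rewrite A0, Rmin_left, Rmax_right by lra. lra.
    - rewrite Rmin_left, Rmax_right in Ht' by lra. exists t; split; [lra|exact E]. }
  pose proof PI_RGT_0. destruct (reaches (2 * PI)) as [T [HT AT]]; [lra|].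
  assert (T_pos : 0 < T) by (destruct (Req_dec T 0) as [E|]; [rewrite E, A0 in AT|]; lra).
  assert (period : forall t, gam (t + T) = gam t).
  { apply (sol_unique f1 f2 f3 (fun t => gam (t + T)) gam); auto.
    - intros t i Hi. set (g := fun s => coord i (gam s)).
      assert (D : is_derive g (t + T) (coord i (F (gam (t + T))))) by exact (gam_sol (t + T) i Hi).
      change (is_derive (fun s => g (s + T)) t (coord i (F (gam (t + T))))). derive_with. ring.
    - rewrite Rplus_0_l, (proj2 (on_curve T HT)), AT, gam_0. rewrite <- (curve_periodic 0 1). simpl.
      rewrite Rmult_1_l, Rplus_0_l. reflexivity. }
  assert (periods : forall (n : nat) t, gam (t + INR n * T) = gam t).
  { induction n as [|n IH]; intros t; [simpl; f_equal; ring|].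
    rewrite S_INR. replace (t + (INR n + 1) * T) with (t + INR n * T + T) by ring. rewrite period; auto. }
  exists gam, T. split; [|split].
  - split; [exact T_pos|split; [exact gam_sol|split; [exact period|]]].
    destruct (reaches PI) as [t [Ht E]]; [lra|]. exists t. rewrite (proj2 (on_curve t Ht)), E, gam_0.
    intros same. apply (f_equal (coord 0)) in same. simpl in same. rewrite cos_PI, cos_0 in same.
    assert (pos : forall th, 0 < sqrt (2 * rho_c th)) by (intros th; apply sqrt_lt_R0; pose proof (rho_c_ge th); lra).
    pose proof (pos PI). pose proof (pos 0). lra.
  - intros t. destruct (INR_archimed T (- t) T_pos) as [n Hn].
    exists (A (t + INR n * T)). rewrite <- (periods n t). apply on_curve. lra.
  - intros th. destruct (INR_archimed (2 * PI) (- th)) as [n Hn]; [lra|].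
    destruct (reaches (th + INR n * (2 * PI))) as [t [Ht E]]; [lra|].
    exists t. rewrite (proj2 (on_curve t Ht)), E. apply curve_periodic.
Qed.

Lemma near_curve_in_tube (X : R3) (th e : R) : e <= 1 -> (2 * b + 1) * e <= rad / 4 -> e <= sig / 4 ->
  dist3 X (curve th) <= e -> Rabs (action (coord 0 X) (coord 1 X) - rho0) < rad /\ Rabs (coord 2 X) < sig.
Proof.
  intros He e_rad e_sig Hdist. set (Y := curve th) in *.
  assert (HY : in_box b Y) by apply tube_in_box, curve_in_tube.
  assert (squares : forall i, Rabs (coord i X ^ 2 - coord i Y ^ 2) <= (2 * b + 1) * e).
  { intros i. pose proof (Rabs_coord_le_dist3 X Y i) as D. pose proof (in_box_coord b Y i HY).
    replace (coord i X ^ 2 - coord i Y ^ 2) with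
      ((2 * coord i Y + (coord i X - coord i Y)) * (coord i X - coord i Y)) by ring.
    rewrite Rabs_mult. apply Rmult_le_compat; try apply Rabs_pos; [|lra].
    eapply Rle_trans; [apply Rabs_triang|]. rewrite Rabs_mult, (Rabs_pos_eq 2) by lra. lra. }
  assert (action_close : Rabs (action (coord 0 X) (coord 1 X) - rho_c th) <= (2 * b + 1) * e).
  { rewrite <- (action_polar th (rho_c th)) by (pose proof (rho_c_ge th); lra).
    change (Rabs (action (coord 0 X) (coord 1 X) - action (coord 0 Y) (coord 1 Y)) <= (2 * b + 1) * e). unfold action.
    pose proof (squares 0%nat) as S0. pose proof (squares 1%nat) as S1.
    apply Rabs_le_between in S0. apply Rabs_le_between in S1. apply Rabs_le_between. lra. }
  destruct (curve_well_inside th) as [inside_rho inside_s].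
  pose proof (Rabs_minus_triang (action (coord 0 X) (coord 1 X)) (rho_c th) rho0).
  pose proof (Rabs_minus_triang (coord 2 X) (s_c th) 0) as T2. rewrite !Rminus_0_r in T2.
  pose proof (Rabs_coord_le_dist3 X Y 2). change (coord 2 Y) with (s_c th) in *. split; lra.
Qed.

Lemma small_neighbourhood : at_right 0 (fun e => (2 * b + 1) * e <= rad / 4 /\ e <= sig / 4).
Proof.
  apply filter_and; [apply at_right_0_linear; lra|].
  apply (filter_imp (fun e => 1 * e <= sig / 4)); [intros e; lra|apply at_right_0_linear; lra].
Qed.

(* The difference of the squared gaps is bounded in the tube, but would grow exponentially. *)
Lemma leaves_tube (phi : R -> R3) (A : R -> R) : kw < 0 -> is_fsol F phi ->
  (forall t, 0 <= t -> rho0 <= coord 0 (phi t) ^ 2 + coord 1 (phi t) ^ 2 ->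
     is_derive A t (velocity (coord 0 (phi t)) (coord 1 (phi t)) (coord 2 (phi t)))) ->
  phi 0 = polar_point (A 0) (action (coord 0 (phi 0)) (coord 1 (phi 0))) (coord 2 (phi 0)) ->
  (forall T, stays_in_tube phi T) -> gap phi A (-1) 0 <= 0.
Proof.
  intros Hkw Hphi A_derive phi_0 in_T. apply Rnot_lt_le. intros Hgap. set (g := gap phi A (-1) 0) in *.
  assert (bounded : forall t, 0 <= t -> gap phi A (-1) t <= (2 * w_bound) ^ 2).
  { intros t Ht. assert (gap_w_le : Rabs (gap_w phi A t) <= 2 * w_bound).
    { unfold gap_w. rewrite (along_at phi A Hphi A_derive phi_0 w t Ht (in_T t)).
      destruct w_lipschitz as [bound _].
      assert (bound_at : forall rho s, in_tube rho s -> Rabs (at_polar w (A t) rho s) <= w_bound)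
        by (intros rho s gap_w_le; exact (bound _ _ _ (tube_in_box (A t) _ _ gap_w_le))).
      pose proof (bound_at _ _ (in_T t t ltac:(lra))). pose proof (bound_at _ _ (curve_in_tube (A t))).
      eapply Rle_trans; [apply Rabs_triang|]. rewrite Rabs_Ropp. lra. }
    unfold gap. rewrite <- (pow2_abs (gap_w phi A t)).
    pose proof (pow_incr _ _ 2 (conj (Rabs_pos (gap_w phi A t)) gap_w_le)).
    assert (0 <= weight * gap_s phi A t ^ 2) by (apply Rmult_le_pos; [lra|apply pow2_ge_0]). lra. }
  set (r := (2 * w_bound) ^ 2 / g).
  assert (Hr : 0 <= r) by (apply Rdiv_le_0_compat; [apply pow2_ge_0|exact Hgap]).
  assert (Hk : 0 < - kw * vmin) by (apply Rmult_lt_0_compat; lra).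
  assert (HT : 0 <= r / (- kw * vmin)) by (apply Rdiv_le_0_compat; lra).
  pose proof (gap_escape phi A Hphi A_derive phi_0 _ Hkw HT (in_T _)) as growth. fold g in growth.
  replace (- kw * vmin * (r / (- kw * vmin))) with r in growth by (field; lra).
  specialize (bounded _ HT). pose proof (exp_ineq1_le r) as exp_ge.
  apply (Rmult_le_compat_l g) in exp_ge; [|lra].
  replace (g * (1 + r)) with (g + (2 * w_bound) ^ 2) in exp_ge by (unfold r; field; lra). lra.
Qed.

Lemma orbit_on_curve_unstable (gam : R -> R3) : kw < 0 -> (forall t, exists th, gam t = curve th) ->
  (forall th, exists t, gam t = curve th) -> orbit_unstable F gam.
Proof.
  intros Hkw gam_curve curve_gam stable.
  destruct (at_right_0_elim _ small_neighbourhood) as [e [He small]]. destruct (small e ltac:(lra)) as [e_rad e_sig].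
  destruct (stable e ltac:(lra)) as [d [Hd stays]].
  assert (root : 0 < sqrt rho0) by (apply sqrt_lt_R0, rho0_pos).
  set (h := Rmin (rad / 2) (d * sqrt rho0 / 4)).
  assert (Hh : 0 < h) by (apply Rmin_glb_lt; [lra|]; pose proof (Rmult_lt_0_compat _ _ Hd root); lra).
  assert (h_rad : h <= rad / 2) by apply Rmin_l. assert (h_d : h <= d * sqrt rho0 / 4) by apply Rmin_r.
  pose proof (rho_c_ge 0) as rho_pos.
  destruct (solutions_exist (polar_point 0 (rho_c 0 + h) (s_c 0))) as [phi [phi_sol H0]].
  pose proof (is_fsol_of_is_sol _ _ phi_sol) as Hphi.
  assert (rho_0 : action (coord 0 (phi 0)) (coord 1 (phi 0)) = rho_c 0 + h) by (rewrite H0; apply action_polar; lra).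
  assert (start_near : near_orbit gam (phi 0) d).
  { destruct (curve_gam 0) as [s Es]. exists s. rewrite Es, H0.
    eapply Rle_lt_trans; [apply (dist3_polar_point_le rho0); lra|].
    replace (rho_c 0 + h - rho_c 0) with h by ring. rewrite Rminus_diag, Rabs_R0, Rabs_pos_eq by lra.
    assert (h / sqrt rho0 <= d / 4) by (apply Rle_div_l; lra). lra. }
  assert (in_T : forall T, stays_in_tube phi T).
  { intros T t [Ht _]. destruct (stays phi Hphi start_near t Ht) as [s near]. destruct (gam_curve s) as [th E].
    rewrite E in near. destruct (near_curve_in_tube (phi t) th e); try lra. split; lra. }
  destruct (angle_exists phi 0 Hphi) as [A [A0 [_ A_derive]]].
  assert (phi_0 : phi 0 = polar_point (A 0) (action (coord 0 (phi 0)) (coord 1 (phi 0))) (coord 2 (phi 0)))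
    by (rewrite rho_0, A0, H0; reflexivity).
  pose proof (leaves_tube phi A Hkw Hphi A_derive phi_0 in_T) as gap_le.
  assert (tube_0 := in_T 0 0 ltac:(lra)). rewrite rho_0, H0 in tube_0. change (in_tube (rho_c 0 + h) (s_c 0)) in tube_0.
  pose proof (rho_le_w 0 _ _ _ _ tube_0 (curve_in_tube 0)) as Hw.
  unfold gap, gap_w, gap_s in gap_le. rewrite A0, H0 in gap_le. simpl in gap_le.
  change (w _ _ _) with (at_polar w 0 (rho_c 0 + h) (s_c 0)) in gap_le.
  rewrite Rminus_diag, Rabs_R0, Rplus_0_r in Hw. replace (rho_c 0 + h - rho_c 0) with h in Hw by ring.
  rewrite Rabs_pos_eq in Hw by lra. set (dw := at_polar w 0 (rho_c 0 + h) (s_c 0) - _) in *.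
  assert (dw <> 0) by (intros E; rewrite E, Rabs_R0 in Hw; lra). nra.
Qed.

Lemma near_curve_gap (X : R3) (th e : R) : 0 <= e <= 1 -> (2 * b + 1) * e <= rad / 4 -> e <= sig / 4 ->
  e <= sqrt rho0 / 4 -> dist3 X (curve th) <= e ->
  let c := 3 * w_bound + 1 + 4 * slope / sqrt rho0 in
  exists th', X = polar_point th' (action (coord 0 X) (coord 1 X)) (coord 2 X) /\
    Rabs (w (coord 0 X) (coord 1 X) (coord 2 X) - w_c th') <= c * e /\ Rabs (coord 2 X - s_c th') <= c * e.
Proof.
  intros He e_rad e_sig e_root Hdist c.
  destruct (near_curve_in_tube X th e ltac:(lra) e_rad e_sig Hdist) as [in_rho in_s].
  assert (root : 0 < sqrt rho0) by (apply sqrt_lt_R0, rho0_pos). pose proof (rho_c_ge th).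
  destruct (nearby_angle (coord 0 X) (coord 1 X) (sqrt (2 * rho_c th)) th e (sqrt rho0)) as [th' [Ex [Ey close]]].
  - split; [exact root|]. apply sqrt_le_1_alt. lra.
  - exact e_root.
  - exact (Rle_trans _ _ _ (Rabs_coord_le_dist3 X (curve th) 0) Hdist).
  - exact (Rle_trans _ _ _ (Rabs_coord_le_dist3 X (curve th) 1) Hdist).
  - assert (polar : X = polar_point th' (action (coord 0 X) (coord 1 X)) (coord 2 X))
      by (apply R3_ext; [exact Ex|exact Ey|reflexivity]).
    exists th'. split; [exact polar|].
    assert (X_in_box : in_box b X) by (rewrite polar; apply tube_in_box; split; lra).
    assert (slope_pos : 0 <= slope) by (destruct (rates_bounded 0 _ _ (curve_in_tube 0)) as [B _];
      exact (Rle_trans _ _ _ (Rabs_pos _) B)).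
    assert (turn : slope * Rabs (th - th') <= 4 * slope / sqrt rho0 * e).
    { rewrite Rabs_minus_sym. replace (4 * slope / sqrt rho0 * e) with (slope * (4 * e / sqrt rho0)) by (field; lra).
      apply Rmult_le_compat_l; assumption. }
    pose proof (bounded_variation w_c _ slope th' th
      (fun t _ => conj (w_c_derive t) (proj1 (rates_bounded t _ _ (curve_in_tube t))))) as w_turn.
    pose proof (bounded_variation s_c _ slope th' th
      (fun t _ => conj (s_c_derive t) (proj2 (rates_bounded t _ _ (curve_in_tube t))))) as s_turn.
    destruct w_lipschitz as [w_le lip].
    assert (w_bound_pos : 0 <= w_bound) by exact (Rle_trans _ _ _ (Rabs_pos _) (w_le _ _ _ X_in_box)).
    assert (w_close : Rabs (w (coord 0 X) (coord 1 X) (coord 2 X) - w_c th) <= w_bound * (3 * e)).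
    { eapply Rle_trans; [exact (lip _ _ _ _ _ _ X_in_box (tube_in_box th _ _ (curve_in_tube th)))|].
      apply Rmult_le_compat_l; [exact w_bound_pos|]. pose proof (dist1_le_dist3 X (curve th)). lra. }
    assert (0 <= w_bound * e) by (apply Rmult_le_pos; lra). unfold c. split.
    + eapply Rle_trans; [apply (Rabs_minus_triang _ (w_c th))|]. lra.
    + eapply Rle_trans; [apply (Rabs_minus_triang _ (s_c th))|].
      pose proof (Rle_trans _ _ _ (Rabs_coord_le_dist3 X (curve th) 2) Hdist) as Z.
      change (Rabs (coord 2 X - s_c th) <= e) in Z. lra.
Qed.

Lemma near_curve_enters (v : R) : 0 < v -> exists d, 0 < d /\ forall X th, dist3 X (curve th) < d ->
  exists th', X = polar_point th' (action (coord 0 X) (coord 1 X)) (coord 2 X) /\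
    Rabs (action (coord 0 X) (coord 1 X) - rho0) < rad /\ Rabs (coord 2 X) < sig /\
    (w (coord 0 X) (coord 1 X) (coord 2 X) - w_c th') ^ 2 + weight * (coord 2 X - s_c th') ^ 2 <= v.
Proof.
  intros Hv. set (c := 3 * w_bound + 1 + 4 * slope / sqrt rho0).
  assert (root : 0 < sqrt rho0) by (apply sqrt_lt_R0, rho0_pos).
  assert (quarter : 0 < sqrt rho0 / 4) by lra.
  destruct (at_right_0_elim _ (filter_and _ _ small_neighbourhood (filter_and _ _
    (at_right_0_linear 1 _ quarter) (at_right_0_linear ((1 + weight) * c ^ 2) v Hv)))) as [d [Hd small]].
  destruct (small d ltac:(lra)) as [[d_rad d_sig] [d_root d_v]].
  exists d. split; [lra|]. intros X th Hdist.
  destruct (near_curve_in_tube X th d) as [in_rho in_s]; try lra.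
  destruct (near_curve_gap X th d) as [th' [polar [w_gap s_gap]]]; try lra. fold c in w_gap, s_gap.
  exists th'. split; [exact polar|split; [exact in_rho|split; [exact in_s|]]].
  pose proof (pow_incr _ _ 2 (conj (Rabs_pos _) w_gap)) as w_sq.
  pose proof (pow_incr _ _ 2 (conj (Rabs_pos _) s_gap)) as s_sq. rewrite !pow2_abs in w_sq, s_sq.
  pose proof (Rmult_le_compat_l weight _ _ ltac:(lra) s_sq).
  apply Rle_trans with ((1 + weight) * c ^ 2 * d * d); [lra|].
  apply Rle_trans with (v * d); [apply Rmult_le_compat_r; lra|].
  rewrite <- (Rmult_1_r v) at 2. apply Rmult_le_compat_l; lra.
Qed.

Lemma deviation_le (v v' : R) : v <= v' -> deviation v <= deviation v'.
Proof.
  intros H. unfold deviation. assert (sqrt v <= sqrt v') by (apply sqrt_le_1_alt, H).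
  assert (sqrt (v / weight) <= sqrt (v' / weight)); [|lra].
  apply sqrt_le_1_alt, Rmult_le_compat_r; [left; apply Rinv_0_lt_compat, weight_pos|exact H].
Qed.

Lemma deviation_small (e : R) : 0 < e -> exists v, 0 < v /\ deviation v < e.
Proof.
  intros He. set (c := 2 * (1 + / sqrt weight)).
  destruct (at_right_0_elim _ (at_right_0_linear c (e / 2) ltac:(lra))) as [h [Hh small]].
  exists (h ^ 2). split; [apply pow_lt; lra|].
  replace (deviation (h ^ 2)) with (c * h); [specialize (small h ltac:(lra)); lra|].
  unfold deviation, Rdiv, c. rewrite sqrt_mult_alt, sqrt_inv, sqrt_pow2 by (try apply pow2_ge_0; lra). ring.
Qed.

Lemma near_curve_decays (e : R) : 0 < kw -> 0 < e -> exists d v, 0 < d /\ 0 < v /\ deviation v < e /\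
  forall phi th, is_fsol F phi -> dist3 (phi 0) (curve th) < d -> exists A : R -> R, forall t, 0 <= t ->
    dist3 (phi t) (curve (A t)) <= (2 / sqrt rho0 + 1) * deviation (v * exp (- (Rmin kw ks * vmin) * t)).
Proof.
  intros Hkw He. destruct (deviation_small (Rmin e (Rmin (rad / 2) (sig / 2)))) as [v [Hv Hdev]];
    [repeat apply Rmin_glb_lt; lra|].
  apply Rmin_Rgt in Hdev as [dev_e Hdev]. apply Rmin_Rgt in Hdev as [dev_rad dev_sig].
  destruct (near_curve_enters v Hv) as [d [Hd enters]].
  exists d, v. split; [exact Hd|split; [exact Hv|split; [exact dev_e|]]]. intros phi th Hphi near.
  destruct (enters (phi 0) th near) as [th' [polar [in_rho [in_s gap_0]]]].
  destruct (angle_exists phi th' Hphi) as [A [A0 [_ A_derive]]].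
  assert (gap_v : gap phi A 1 0 <= v) by (unfold gap, gap_w, gap_s; rewrite A0, Rmult_1_l; exact gap_0).
  assert (phi_0 : phi 0 = polar_point (A 0) (action (coord 0 (phi 0)) (coord 1 (phi 0))) (coord 2 (phi 0)))
    by (rewrite A0; exact polar).
  pose proof (deviation_le _ _ gap_v) as dev_0.
  assert (gap_ge_0 : 0 <= gap phi A 1 0).
  { unfold gap. pose proof (pow2_ge_0 (gap_w phi A 0)).
    pose proof (Rmult_le_pos _ _ (Rlt_le _ _ weight_pos) (pow2_ge_0 (gap_s phi A 0))). lra. }
  assert (k_pos : 0 < Rmin kw ks * vmin) by (apply Rmult_lt_0_compat; [apply Rmin_glb_lt|]; lra).
  assert (decay := fun T => gap_decay phi A Hphi A_derive phi_0 T Hkw).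
  assert (in_T : forall T, stays_in_tube phi T).
  { apply (trapped_in_tube phi A); auto; try lra. intros T HT in_T. eapply Rle_trans; [apply decay; assumption|].
    rewrite <- (Rmult_1_r (gap phi A 1 0)) at 2. apply Rmult_le_compat_l; [exact gap_ge_0|]. apply exp_le_1.
    pose proof (Rmult_le_pos _ _ (Rlt_le _ _ k_pos) HT). lra. }
  exists A. intros t Ht. apply dist_to_curve; auto. eapply Rle_trans; [apply decay; auto|].
  apply Rmult_le_compat_r; [left; apply exp_pos|exact gap_v].
Qed.

Lemma orbit_on_curve_asympt_stable (gam : R -> R3) : 0 < kw -> (forall t, exists th, gam t = curve th) ->
  (forall th, exists t, gam t = curve th) -> orbit_asympt_stable F gam.
Proof.
  intros Hkw gam_curve curve_gam. set (k := Rmin kw ks * vmin).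
  assert (k_pos : 0 < k) by (apply Rmult_lt_0_compat; [apply Rmin_glb_lt|]; lra).
  set (c := 2 / sqrt rho0 + 1).
  assert (c_pos : 0 < c).
  { pose proof (Rdiv_lt_0_compat 2 _ ltac:(lra) (sqrt_lt_R0 _ rho0_pos)). unfold c. lra. }
  assert (near_gam : forall X th e, dist3 X (curve th) < e -> near_orbit gam X e).
  { intros X th e H. destruct (curve_gam th) as [s Es]. exists s. rewrite Es. exact H. }
  assert (scale : forall u e, u < e / c -> c * u < e)
    by (intros u e H; rewrite Rmult_comm; apply Rlt_div_r; assumption).
  split.
  - intros e He. destruct (near_curve_decays (e / c) Hkw) as [d [v [Hd [Hv [dev decays]]]]];
      [apply Rdiv_lt_0_compat; lra|].
    exists d. split; [exact Hd|]. intros phi Hphi [s Hs] t Ht. destruct (gam_curve s) as [th Eth]. rewrite Eth in Hs.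
    destruct (decays phi th Hphi Hs) as [A HA]. apply (near_gam _ (A t)).
    eapply Rle_lt_trans; [apply HA, Ht|]. apply scale. eapply Rle_lt_trans; [apply deviation_le|exact dev].
    rewrite <- (Rmult_1_r v) at 2. apply Rmult_le_compat_l; [lra|]. apply exp_le_1. fold k.
    pose proof (Rmult_le_pos _ _ (Rlt_le _ _ k_pos) Ht). lra.
  - destruct (near_curve_decays 1 Hkw) as [d [v [Hd [Hv [_ decays]]]]]; [lra|].
    exists d. split; [exact Hd|]. intros phi Hphi [s Hs] e He. destruct (gam_curve s) as [th Eth]. rewrite Eth in Hs.
    destruct (decays phi th Hphi Hs) as [A HA].
    destruct (deviation_small (e / c)) as [v_e [Hv_e dev]]; [apply Rdiv_lt_0_compat; lra|].
    exists (v / v_e / k). intros t Ht.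
    assert (Ht0 : 0 <= t) by (pose proof (Rdiv_le_0_compat (v / v_e) k
      (Rdiv_le_0_compat v v_e (Rlt_le _ _ Hv) Hv_e) k_pos); lra).
    apply (near_gam _ (A t)). eapply Rle_lt_trans; [apply HA, Ht0|]. apply scale.
    eapply Rle_lt_trans; [apply deviation_le|exact dev]. fold k.
    apply Rle_div_l in Ht; [|exact k_pos]. pose proof (exp_ineq1_le (t * k)) as exp_ge.
    replace (- k * t) with (- (t * k)) by ring. rewrite exp_Ropp. apply Rle_div_l; [apply exp_pos|].
    apply Rle_trans with (v_e * (v / v_e)); [right; field; lra|]. apply Rmult_le_compat_l; lra.
Qed.

Theorem closed_curve_orbit : exists (gam : R -> R3) (T : R),
  periodic_orbit F gam T /\ (forall t, exists th, gam t = curve th) /\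
  (0 < kw -> orbit_asympt_stable F gam) /\ (kw < 0 -> orbit_unstable F gam).
Proof.
  destruct periodic_orbit_on_curve as [gam [T [periodic [gam_curve curve_gam]]]]. exists gam, T.
  split; [exact periodic|split; [exact gam_curve|split; intros Hkw]].
  - apply orbit_on_curve_asympt_stable; assumption.
  - apply orbit_on_curve_unstable; assumption.
Qed.

End ClosedCurve.

(** * Weighted orders *)

(* [f] is of weighted order [k] when [n], [u], [v], [S] have the weights [wn], [1], [1], [wS]: in the rescaled variables
   both [f] and its Lipschitz constant are of order [d ^ k]. *)
Definition weighted_order (wn wS k : nat) (f : R -> R -> R -> R -> R) : Prop :=
  forall b, 0 < b -> exists C, 0 <= C /\ forall d tau, 0 < d <= 1 -> Rabs tau <= 1 ->
    bounded_lipschitz (box b) (C * d ^ k) (fun p q s => f (tau * d ^ wn) (d * p) (d * q) (d ^ wS * s)).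

Section WeightedOrder.
Variables wn wS : nat.
Local Notation order := (weighted_order wn wS).

Lemma weighted_order_ext k f g : order k f -> (forall n u v S, f n u v S = g n u v S) -> order k g.
Proof.
  intros H E b Hb. destruct (H b Hb) as [C [HC bound]]. exists C; split; [exact HC|].
  intros d tau Hd Ht.
  apply (bounded_lipschitz_ext _ _ (fun p q s => f (tau * d ^ wn) (d * p) (d * q) (d ^ wS * s))); auto.
Qed.

Lemma weighted_order_decr j k f : (j <= k)%nat -> order k f -> order j f.
Proof.
  intros Hjk H b Hb. destruct (H b Hb) as [C [HC bound]]. exists C; split; [exact HC|].
  intros d tau Hd Ht. apply (bounded_lipschitz_weaken _ _ _ _ (bound d tau Hd Ht)).
  apply Rmult_le_compat_l; [exact HC|]. apply pow_decr_exponent; [lra|exact Hjk].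
Qed.

Lemma weighted_order_const c : order 0 (fun _ _ _ _ => c).
Proof.
  intros b Hb. exists (Rabs c); split; [apply Rabs_pos|]. intros. simpl. rewrite Rmult_1_r.
  apply bounded_lipschitz_const.
Qed.

Lemma weighted_order_n : order wn (fun n _ _ _ => n).
Proof.
  intros b Hb. exists 1; split; [lra|]. intros d tau Hd Ht. assert (0 <= d ^ wn) by (apply pow_le; lra).
  apply (bounded_lipschitz_weaken _ _ _ _ (bounded_lipschitz_const _ _)).
  rewrite Rabs_mult, (Rabs_pos_eq (d ^ wn)) by assumption. apply Rmult_le_compat_r; assumption.
Qed.

Lemma weighted_order_coord (k i : nat) (f : R -> R -> R -> R -> R) :
  (forall d tau p q s, f (tau * d ^ wn) (d * p) (d * q) (d ^ wS * s) = d ^ k * coord i (p, q, s)) -> order k f.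
Proof.
  intros E b Hb. exists (2 * Rmax b 1). pose proof (Rmax_l b 1). split; [lra|]. intros d tau Hd _.
  assert (0 <= d ^ k) by (apply pow_le; lra).
  apply (bounded_lipschitz_ext _ _ (fun p q s => d ^ k * coord i (p, q, s))); [intros p q s _; symmetry; apply E|].
  apply (bounded_lipschitz_weaken _ (2 * (Rabs (d ^ k) * Rmax b 1))).
  - apply (bounded_lipschitz_mult (box b) _ _ (fun _ _ _ => d ^ k) (fun p q s => coord i (p, q, s)));
      [apply bounded_lipschitz_const|].
    apply bounded_lipschitz_coord. intros p q s. apply box_coord.
  - rewrite Rabs_pos_eq by assumption. right. ring.
Qed.

Lemma weighted_order_u : order 1 (fun _ u _ _ => u).
Proof. apply (weighted_order_coord 1 0). intros. simpl. ring. Qed.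

Lemma weighted_order_v : order 1 (fun _ _ v _ => v).
Proof. apply (weighted_order_coord 1 1). intros. simpl. ring. Qed.

Lemma weighted_order_S : order wS (fun _ _ _ S => S).
Proof. apply (weighted_order_coord wS 2). reflexivity. Qed.

Lemma weighted_order_plus j k f g : order j f -> order k g ->
  order (Nat.min j k) (fun n u v S => f n u v S + g n u v S).
Proof.
  intros Hf%(weighted_order_decr (Nat.min j k)) Hg%(weighted_order_decr (Nat.min j k)) b Hb; [|lia|lia].
  destruct (Hf b Hb) as [Cf [HCf Kf]], (Hg b Hb) as [Cg [HCg Kg]].
  exists (Cf + Cg); split; [lra|]. intros d tau Hd Ht. rewrite Rmult_plus_distr_r.
  apply bounded_lipschitz_plus; auto.
Qed.

Lemma weighted_order_opp k f : order k f -> order k (fun n u v S => - f n u v S).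
Proof.
  intros H b Hb. destruct (H b Hb) as [C [HC bound]]. exists C; split; [exact HC|].
  intros d tau Hd Ht. apply bounded_lipschitz_opp; auto.
Qed.

Lemma weighted_order_minus j k f g : order j f -> order k g ->
  order (Nat.min j k) (fun n u v S => f n u v S - g n u v S).
Proof.
  intros Hf Hg. apply (weighted_order_plus j k f (fun n u v S => - g n u v S)), weighted_order_opp; assumption.
Qed.

Lemma weighted_order_mult j k f g : order j f -> order k g -> order (j + k) (fun n u v S => f n u v S * g n u v S).
Proof.
  intros Hf Hg b Hb. destruct (Hf b Hb) as [Cf [HCf Kf]], (Hg b Hb) as [Cg [HCg Kg]].
  exists (2 * (Cf * Cg)); split; [apply Rmult_le_pos; [lra|apply Rmult_le_pos; assumption]|].
  intros d tau Hd Ht. rewrite pow_add.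
  replace (2 * (Cf * Cg) * (d ^ j * d ^ k)) with (2 * ((Cf * d ^ j) * (Cg * d ^ k))) by ring.
  apply (bounded_lipschitz_mult (box b) _ _ _ _ (Kf d tau Hd Ht) (Kg d tau Hd Ht)).
Qed.

Lemma weighted_order_div k c f : order k f -> order k (fun n u v S => f n u v S / c).
Proof.
  intros H. apply (weighted_order_ext k (fun n u v S => / c * f n u v S)); [|intros; unfold Rdiv; ring].
  apply (weighted_order_mult 0 k (fun _ _ _ _ => / c) f (weighted_order_const _) H).
Qed.

Lemma weighted_order_pow k f (m : nat) : order k f -> order (m * k) (fun n u v S => f n u v S ^ m).
Proof.
  intros H. induction m as [|m IH]; [exact (weighted_order_const 1)|]. apply (weighted_order_mult k (m * k)); auto.
Qed.

Lemma weighted_order_comp (k : nat) (g : R -> R) (C : R) f : 0 <= C -> g 0 = 0 ->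
  (forall M x y, Rabs x <= M -> Rabs y <= M -> Rabs (g x - g y) <= C * M ^ k * Rabs (x - y)) ->
  order 1 f -> order (S k) (fun n u v S => g (f n u v S)).
Proof.
  intros HC g0 Hg Hf b Hb. destruct (Hf b Hb) as [Cf [HCf bound]].
  exists (C * Cf ^ k * Cf). split; [repeat apply Rmult_le_pos; auto; apply pow_le, HCf|].
  intros d tau Hd Ht. destruct (bound d tau Hd Ht) as [f_le f_lip]. rewrite pow_1 in f_le, f_lip.
  assert (HM : 0 <= Cf * d) by (apply Rmult_le_pos; lra).
  assert (E : forall e, C * Cf ^ k * Cf * d ^ S k * e = C * (Cf * d) ^ k * (Cf * d * e))
    by (intros e; rewrite Rpow_mult_distr; simpl; ring).
  assert (slope : 0 <= C * (Cf * d) ^ k) by (apply Rmult_le_pos; [exact HC|apply pow_le, HM]).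
  split.
  - intros p q s Hp. rewrite <- (Rmult_1_r (C * Cf ^ k * Cf * d ^ S k)), E, Rmult_1_r.
    pose proof (Hg (Cf * d) (f (tau * d ^ wn) (d * p) (d * q) (d ^ wS * s)) 0 (f_le _ _ _ Hp)) as variation.
    rewrite g0, Rabs_R0, !Rminus_0_r in variation. eapply Rle_trans; [apply variation, HM|].
    apply Rmult_le_compat_l; auto.
  - intros p q s p' q' s' Hp Hp'. rewrite E. eapply Rle_trans; [apply (Hg (Cf * d)); auto|].
    apply Rmult_le_compat_l; auto.
Qed.

End WeightedOrder.

(* Computes a weighted order of a polynomial expression, taking known orders from the context. *)
Ltac find_weighted_order :=
  lazymatch goal with
  | |- weighted_order _ _ _ (fun _ _ _ _ => ?c) => apply weighted_order_const
  | |- weighted_order _ _ _ (fun n u v S => n) => apply weighted_order_n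
  | |- weighted_order _ _ _ (fun n u v S => u) => apply weighted_order_u
  | |- weighted_order _ _ _ (fun n u v S => v) => apply weighted_order_v
  | |- weighted_order _ _ _ (fun n u v S => S) => apply weighted_order_S
  | |- weighted_order ?a ?b _ (fun n u v S => @?f n u v S + @?g n u v S) =>
      refine (weighted_order_plus a b _ _ f g _ _); find_weighted_order
  | |- weighted_order ?a ?b _ (fun n u v S => @?f n u v S - @?g n u v S) =>
      refine (weighted_order_minus a b _ _ f g _ _); find_weighted_order
  | |- weighted_order ?a ?b _ (fun n u v S => - @?f n u v S) =>
      refine (weighted_order_opp a b _ f _); find_weighted_order
  | |- weighted_order ?a ?b _ (fun n u v S => @?f n u v S * @?g n u v S) =>
      refine (weighted_order_mult a b _ _ f g _ _); find_weighted_order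
  | |- weighted_order ?a ?b _ (fun n u v S => @?f n u v S / ?c) =>
      refine (weighted_order_div a b _ c f _); find_weighted_order
  | |- weighted_order ?a ?b _ (fun n u v S => @?f n u v S ^ ?m) =>
      refine (weighted_order_pow a b _ f m _); find_weighted_order
  | |- weighted_order _ _ _ _ => eassumption
  end.
Ltac prove_weighted_order := eapply weighted_order_decr; [|find_weighted_order]; cbn; lia.

(** * Lipschitz estimates that are uniform in a small scale *)

Definition eventually_lipschitz (D : R -> R -> R -> Prop) (f : R -> R -> R -> R -> R) : Prop :=
  exists C, 0 <= C /\ at_right 0 (fun d => bounded_lipschitz D C (f d)).

Lemma at_right_0_pos : at_right 0 (fun d => 0 < d).
Proof. apply (at_right_0_intro _ 1); [lra|]. intros d Hd. lra. Qed.

Section EventuallyLipschitz.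
Variable D : R -> R -> R -> Prop.

Lemma eventually_lipschitz_fixed C (f : R -> R -> R -> R) : bounded_lipschitz D C f ->
  eventually_lipschitz D (fun _ => f).
Proof.
  intros H. exists (Rabs C). split; [apply Rabs_pos|]. apply filter_forall. intros _.
  apply (bounded_lipschitz_weaken _ _ _ _ H). apply Rle_abs.
Qed.

Lemma eventually_lipschitz_const c : eventually_lipschitz D (fun _ _ _ _ => c).
Proof. exact (eventually_lipschitz_fixed _ _ (bounded_lipschitz_const D c)). Qed.

Lemma eventually_lipschitz_scale : eventually_lipschitz D (fun d _ _ _ => d).
Proof.
  exists 1. split; [lra|]. apply (at_right_0_intro _ 1); [lra|]. intros d Hd.
  apply (bounded_lipschitz_weaken _ _ _ _ (bounded_lipschitz_const D d)). rewrite Rabs_pos_eq; lra.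
Qed.

Lemma eventually_lipschitz_plus f g : eventually_lipschitz D f -> eventually_lipschitz D g ->
  eventually_lipschitz D (fun d x y z => f d x y z + g d x y z).
Proof.
  intros [C [HC H]] [C' [HC' H']]. exists (C + C'). split; [lra|].
  apply (filter_imp _ _ (fun d K => bounded_lipschitz_plus D C C' _ _ (proj1 K) (proj2 K)) (filter_and _ _ H H')).
Qed.

Lemma eventually_lipschitz_opp f : eventually_lipschitz D f -> eventually_lipschitz D (fun d x y z => - f d x y z).
Proof.
  intros [C [HC H]]. exists C. split; [lra|]. apply (filter_imp _ _ (fun d K => bounded_lipschitz_opp D C _ K) H).
Qed.

Lemma eventually_lipschitz_minus f g : eventually_lipschitz D f -> eventually_lipschitz D g ->
  eventually_lipschitz D (fun d x y z => f d x y z - g d x y z).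
Proof.
  intros Hf Hg. apply (eventually_lipschitz_plus f (fun d x y z => - g d x y z)); [exact Hf|].
  apply eventually_lipschitz_opp, Hg.
Qed.

Lemma eventually_lipschitz_mult f g : eventually_lipschitz D f -> eventually_lipschitz D g ->
  eventually_lipschitz D (fun d x y z => f d x y z * g d x y z).
Proof.
  intros [C [HC H]] [C' [HC' H']]. exists (2 * (C * C')).
  split; [apply Rmult_le_pos; [lra|apply Rmult_le_pos; assumption]|].
  apply (filter_imp _ _ (fun d K => bounded_lipschitz_mult D C C' _ _ (proj1 K) (proj2 K)) (filter_and _ _ H H')).
Qed.

Lemma eventually_lipschitz_inv f m : 0 < m -> eventually_lipschitz D f ->
  at_right 0 (fun d => forall x y z, D x y z -> m <= f d x y z) ->
  eventually_lipschitz D (fun d x y z => / f d x y z).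
Proof.
  intros Hm [C [HC H]] Hf. exists (/ m + C / (m * m)). split.
  - pose proof (Rinv_0_lt_compat _ Hm). pose proof (Rdiv_le_0_compat C (m * m) HC (Rmult_lt_0_compat _ _ Hm Hm)). lra.
  - apply (filter_imp _ _ (fun d K => bounded_lipschitz_inv D C m _ Hm (proj1 K) (proj2 K)) (filter_and _ _ H Hf)).
Qed.

End EventuallyLipschitz.

(* Decomposes a polynomial expression, taking known estimates from the context. *)
Ltac prove_eventually_lipschitz :=
  first [assumption | lazymatch goal with
  | |- eventually_lipschitz _ (fun _ _ _ _ => ?c) => apply eventually_lipschitz_const
  | |- eventually_lipschitz _ (fun d _ _ _ => d) => apply eventually_lipschitz_scale
  | |- eventually_lipschitz ?D (fun d x y z => @?f d x y z + @?g d x y z) =>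
      apply (eventually_lipschitz_plus D f g); prove_eventually_lipschitz
  | |- eventually_lipschitz ?D (fun d x y z => @?f d x y z - @?g d x y z) =>
      apply (eventually_lipschitz_minus D f g); prove_eventually_lipschitz
  | |- eventually_lipschitz ?D (fun d x y z => - @?f d x y z) =>
      apply (eventually_lipschitz_opp D f); prove_eventually_lipschitz
  | |- eventually_lipschitz ?D (fun d x y z => @?f d x y z * @?g d x y z) =>
      apply (eventually_lipschitz_mult D f g); prove_eventually_lipschitz
  end].

Section Annulus.
Variables rho0 b : R.
Hypothesis rho0_pos : 0 < rho0.
Hypothesis b_large : 3 * rho0 <= b ^ 2 /\ 1 <= b.

Definition annulus (th rho s : R) : Prop := tube rho0 (rho0 / 2) 1 rho s.

Lemma annulus_rho th rho s : annulus th rho s -> rho0 / 2 <= rho <= 3 * rho0 / 2.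
Proof. intros [H _]. apply Rabs_le_between in H. lra. Qed.

Lemma annulus_in_box th rho s : annulus th rho s -> in_box b (polar_point th rho s).
Proof. intros H. pose proof (annulus_rho _ _ _ H). destruct H. apply polar_point_in_box; lra. Qed.

Lemma polar_coord_lipschitz (g : R -> R) th rho s th' rho' s' :
  (forall t, Rabs (g t) <= 1) -> (forall t t', Rabs (g t - g t') <= Rabs (t - t')) ->
  annulus th rho s -> annulus th' rho' s' ->
  Rabs (sqrt (2 * rho) * g th - sqrt (2 * rho') * g th') <= / sqrt rho0 * Rabs (rho - rho') + b * Rabs (th - th').
Proof.
  intros g_le g_lip H H'. pose proof (annulus_rho _ _ _ H). pose proof (annulus_rho _ _ _ H').
  assert (root : 0 < sqrt rho0) by (apply sqrt_lt_R0, rho0_pos).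
  pose proof (sqrt_lipschitz rho0 (2 * rho) (2 * rho') rho0_pos ltac:(lra) ltac:(lra)) as radius.
  rewrite <- Rmult_minus_distr_l, (Rabs_mult 2), (Rabs_pos_eq 2) in radius by lra.
  replace (2 * Rabs (rho - rho') / (2 * sqrt rho0)) with (/ sqrt rho0 * Rabs (rho - rho')) in radius by (field; lra).
  assert (sqrt (2 * rho') <= b) by (rewrite <- (sqrt_pow2 b) by lra; apply sqrt_le_1_alt; lra).
  replace (sqrt (2 * rho) * g th - sqrt (2 * rho') * g th')
    with ((sqrt (2 * rho) - sqrt (2 * rho')) * g th + sqrt (2 * rho') * (g th - g th')) by ring.
  eapply Rle_trans; [apply Rabs_triang|]. rewrite !Rabs_mult, (Rabs_pos_eq (sqrt (2 * rho'))) by apply sqrt_pos.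
  apply Rplus_le_compat; [|apply Rmult_le_compat; auto using Rabs_pos, sqrt_pos].
  rewrite <- (Rmult_1_r (/ sqrt rho0 * _)). apply Rmult_le_compat; auto using Rabs_pos.
Qed.

Lemma bounded_lipschitz_at_polar C f : bounded_lipschitz (box b) C f -> 0 <= C ->
  bounded_lipschitz annulus (C * (1 + 2 / sqrt rho0 + 2 * b)) (at_polar f).
Proof.
  intros Hf HC. assert (root : 0 < / sqrt rho0) by (apply Rinv_0_lt_compat, sqrt_lt_R0, rho0_pos).
  apply (bounded_lipschitz_comp (box b) annulus C _ f (fun th rho s => sqrt (2 * rho) * cos th)
    (fun th rho s => sqrt (2 * rho) * sin th) (fun th rho s => s)); auto.
  - unfold Rdiv. lra.
  - intros th rho s H. apply (annulus_in_box th rho s H).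
  - intros th rho s th' rho' s' H H'.
    pose proof (polar_coord_lipschitz cos _ _ _ _ _ _ Rabs_cos_le_1 cos_lipschitz H H').
    pose proof (polar_coord_lipschitz sin _ _ _ _ _ _ Rabs_sin_le_1 sin_lipschitz H H').
    pose proof (Rabs_pos (rho - rho')). pose proof (Rabs_pos (s - s')). pose proof (Rabs_pos (th - th')).
    assert (0 <= / sqrt rho0 * Rabs (th - th')) by (apply Rmult_le_pos; lra).
    assert (0 <= / sqrt rho0 * Rabs (s - s')) by (apply Rmult_le_pos; lra).
    assert (0 <= b * Rabs (rho - rho')) by (apply Rmult_le_pos; lra).
    assert (0 <= b * Rabs (s - s')) by (apply Rmult_le_pos; lra).
    unfold dist1, Rdiv in *. nra.
Qed.

Lemma eventually_lipschitz_at_polar f : eventually_lipschitz (box b) f ->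
  eventually_lipschitz annulus (fun d => at_polar (f d)).
Proof.
  intros [C [HC H]]. exists (C * (1 + 2 / sqrt rho0 + 2 * b)). split.
  - assert (0 < / sqrt rho0) by (apply Rinv_0_lt_compat, sqrt_lt_R0, rho0_pos).
    apply Rmult_le_pos; [exact HC|unfold Rdiv; lra].
  - apply (filter_imp _ _ (fun d K => bounded_lipschitz_at_polar C _ K HC) H).
Qed.

Lemma eventually_lipschitz_box_coord (i : nat) : eventually_lipschitz (box b) (fun _ p q s => coord i (p, q, s)).
Proof.
  apply (eventually_lipschitz_fixed _ (Rmax b 1)), bounded_lipschitz_coord. intros p q s. apply box_coord.
Qed.

Lemma eventually_lipschitz_x : eventually_lipschitz annulus (fun _ th rho _ => sqrt (2 * rho) * cos th).
Proof. exact (eventually_lipschitz_at_polar _ (eventually_lipschitz_box_coord 0)). Qed.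

Lemma eventually_lipschitz_y : eventually_lipschitz annulus (fun _ th rho _ => sqrt (2 * rho) * sin th).
Proof. exact (eventually_lipschitz_at_polar _ (eventually_lipschitz_box_coord 1)). Qed.

Lemma eventually_lipschitz_s : eventually_lipschitz annulus (fun _ _ _ s => s).
Proof. exact (eventually_lipschitz_at_polar _ (eventually_lipschitz_box_coord 2)). Qed.

Lemma eventually_lipschitz_rho : eventually_lipschitz annulus (fun _ _ rho _ => rho).
Proof.
  apply (eventually_lipschitz_fixed _ (Rmax (3 * rho0 / 2) 1)).
  apply (bounded_lipschitz_coord annulus (3 * rho0 / 2) 1). intros th rho s H.
  pose proof (annulus_rho _ _ _ H). simpl. rewrite Rabs_pos_eq; lra.
Qed.

End Annulus.

(** * The rescaled Hopf normal form *)

(* To leading order [w - rho0] decays at the rate [d ^ 2 * k], much more slowly than [s], and the angular velocity is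
   [om]. Dividing by the angular velocity turns the system into a periodically forced one with the angle as time. *)
Section ScaledHopf.
Variables om lam k quad rho0 b : R.
Variables nu nv ns shift coupling rem : R -> R -> R -> R -> R.
Hypothesis om_pos : 0 < om.
Hypothesis lam_pos : 0 < lam.
Hypothesis k_neq_0 : k <> 0.
Hypothesis rho0_pos : 0 < rho0.
Hypothesis b_large : 3 * rho0 <= b ^ 2 /\ 1 <= b.
Hypothesis nu_lipschitz : eventually_lipschitz (box b) nu.
Hypothesis nv_lipschitz : eventually_lipschitz (box b) nv.
Hypothesis ns_lipschitz : eventually_lipschitz (box b) ns.
Hypothesis shift_lipschitz : eventually_lipschitz (box b) shift.
Hypothesis coupling_lipschitz : eventually_lipschitz (box b) coupling.
Hypothesis rem_lipschitz : eventually_lipschitz (box b) rem.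

Definition scaled_f1 (d p q s : R) : R := - om * q + d * nu d p q s.
Definition scaled_f2 (d p q s : R) : R := om * p + d * nv d p q s.
Definition scaled_f3 (d p q s : R) : R := - lam * s + d * ns d p q s.
Definition scaled_w (d p q s : R) : R := action p q + d * shift d p q s.
Definition scaled_w' (d p q s : R) : R :=
  d ^ 2 * (- k * (action p q - rho0) + quad * (action p q - rho0) ^ 2 + coupling d p q s * s + d * rem d p q s).

Local Notation D := (annulus rho0).

Definition velocity_error (d th rho s : R) : R :=
  (sqrt (2 * rho) * cos th * at_polar (nv d) th rho s
   - sqrt (2 * rho) * sin th * at_polar (nu d) th rho s) * / (2 * rho).
Definition velocity (d th rho s : R) : R := om + d * velocity_error d th rho s.
Definition w_leading (d th rho s : R) : R :=
  (quad * ((rho - rho0) * (rho - rho0)) + at_polar (coupling d) th rho s * s) * / om.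
Definition w_residual (d th rho s : R) : R :=
  at_polar (rem d) th rho s * / velocity d th rho s
  - (- k * (rho - rho0) + om * w_leading d th rho s) * velocity_error d th rho s * (/ om * / velocity d th rho s)
  + k * / om * at_polar (shift d) th rho s.
Definition s_residual (d th rho s : R) : R :=
  at_polar (ns d) th rho s * / velocity d th rho s
  + lam * s * velocity_error d th rho s * (/ om * / velocity d th rho s).
Definition w_perturbation (d th rho s : R) : R := d * d * (w_leading d th rho s + d * w_residual d th rho s).
Definition s_perturbation (d th rho s : R) : R := d * s_residual d th rho s.
Definition w_shift (d th rho s : R) : R := d * at_polar (shift d) th rho s.

Lemma velocity_error_lipschitz : eventually_lipschitz D velocity_error.
Proof.
  pose proof (eventually_lipschitz_x rho0 b rho0_pos b_large).
  pose proof (eventually_lipschitz_y rho0 b rho0_pos b_large).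
  pose proof (eventually_lipschitz_at_polar rho0 b rho0_pos b_large _ nu_lipschitz).
  pose proof (eventually_lipschitz_at_polar rho0 b rho0_pos b_large _ nv_lipschitz).
  pose proof (eventually_lipschitz_rho rho0 rho0_pos).
  assert (eventually_lipschitz D (fun _ _ rho _ => / (2 * rho))).
  { apply (eventually_lipschitz_inv D (fun _ _ rho _ => 2 * rho) rho0 rho0_pos); [prove_eventually_lipschitz|].
    apply filter_forall. intros d th rho s in_D. pose proof (annulus_rho _ _ _ _ in_D). lra. }
  unfold velocity_error. prove_eventually_lipschitz.
Qed.

Lemma velocity_bounds : at_right 0 (fun d => forall th rho s, D th rho s -> om / 2 <= velocity d th rho s <= 2 * om).
Proof.
  destruct velocity_error_lipschitz as [C [HC lip]]. assert (half : 0 < om / 2) by lra.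
  generalize (filter_and _ _ lip (filter_and _ _ (at_right_0_linear C _ half) at_right_0_pos)).
  apply filter_imp. intros d [[bound _] [small Hd]] th rho s HD. specialize (bound th rho s HD). unfold velocity.
  apply Rabs_le_between in bound. nra.
Qed.

Lemma inv_velocity_lipschitz : eventually_lipschitz D (fun d th rho s => / velocity d th rho s).
Proof.
  pose proof velocity_error_lipschitz.
  apply (eventually_lipschitz_inv D velocity (om / 2)); [lra|unfold velocity; prove_eventually_lipschitz|].
  apply (filter_imp _ _ (fun d K th rho s HD => proj1 (K th rho s HD)) velocity_bounds).
Qed.

Lemma shift_polar_lipschitz : eventually_lipschitz D (fun d => at_polar (shift d)).
Proof. exact (eventually_lipschitz_at_polar rho0 b rho0_pos b_large _ shift_lipschitz). Qed.

Lemma coupling_polar_lipschitz : eventually_lipschitz D (fun d => at_polar (coupling d)).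
Proof. exact (eventually_lipschitz_at_polar rho0 b rho0_pos b_large _ coupling_lipschitz). Qed.

Lemma w_leading_lipschitz : eventually_lipschitz D w_leading.
Proof.
  pose proof coupling_polar_lipschitz. pose proof (eventually_lipschitz_rho rho0 rho0_pos).
  pose proof (eventually_lipschitz_s rho0 b rho0_pos b_large). unfold w_leading. prove_eventually_lipschitz.
Qed.

Lemma w_residual_lipschitz : eventually_lipschitz D w_residual.
Proof.
  pose proof (eventually_lipschitz_at_polar rho0 b rho0_pos b_large _ rem_lipschitz).
  pose proof shift_polar_lipschitz. pose proof inv_velocity_lipschitz. pose proof velocity_error_lipschitz.
  pose proof w_leading_lipschitz. pose proof (eventually_lipschitz_rho rho0 rho0_pos).
  unfold w_residual. prove_eventually_lipschitz.
Qed.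

Lemma s_residual_lipschitz : eventually_lipschitz D s_residual.
Proof.
  pose proof (eventually_lipschitz_at_polar rho0 b rho0_pos b_large _ ns_lipschitz).
  pose proof inv_velocity_lipschitz. pose proof velocity_error_lipschitz.
  pose proof (eventually_lipschitz_s rho0 b rho0_pos b_large). unfold s_residual. prove_eventually_lipschitz.
Qed.

Lemma angular_velocity_polar d th rho s : 0 < rho ->
  at_polar (angular_velocity (scaled_f1 d) (scaled_f2 d)) th rho s = velocity d th rho s.
Proof.
  intros Hrho. assert (E := action_polar th rho ltac:(lra)). unfold action in E.
  unfold velocity, velocity_error, at_polar, angular_velocity, scaled_f1, scaled_f2.
  set (x := sqrt (2 * rho) * cos th) in *. set (y := sqrt (2 * rho) * sin th) in *.
  replace (2 * rho) with (x ^ 2 + y ^ 2) by lra. field. lra.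
Qed.

Lemma scaled_w_polar d th rho s : 0 < rho -> at_polar (scaled_w d) th rho s = rho + w_shift d th rho s.
Proof. intros Hrho. unfold at_polar at 1, scaled_w. rewrite action_polar by lra. reflexivity. Qed.

Lemma w_rate_polar d th rho s : 0 < rho -> 0 < velocity d th rho s ->
  angular_rate (scaled_f1 d) (scaled_f2 d) (scaled_w' d) th rho s
  = - (d ^ 2 * k / om) * (rho + w_shift d th rho s - rho0) + w_perturbation d th rho s.
Proof.
  intros Hrho Hv. unfold angular_rate. rewrite angular_velocity_polar by exact Hrho.
  unfold at_polar, scaled_w'. rewrite action_polar by lra.
  unfold w_perturbation, w_residual, w_leading, w_shift, at_polar.
  set (x := sqrt (2 * rho) * cos th). set (y := sqrt (2 * rho) * sin th).
  assert (E : d * velocity_error d th rho s = velocity d th rho s - om) by (unfold velocity; ring).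
  set (v := velocity d th rho s) in *. set (e := velocity_error d th rho s) in *.
  set (leading := quad * ((rho - rho0) * (rho - rho0)) + coupling d x y s * s).
  apply (Rmult_eq_reg_l (om * v)); [|apply Rmult_integral_contrapositive; lra].
  transitivity (d ^ 2 * (v * (- k * (rho - rho0) + leading) + om * (d * rem d x y s)
    - (- k * (rho - rho0) + leading) * (d * e))); [rewrite E; unfold leading; field; lra|field; lra].
Qed.

Lemma s_rate_polar d th rho s : 0 < rho -> 0 < velocity d th rho s ->
  angular_rate (scaled_f1 d) (scaled_f2 d) (scaled_f3 d) th rho s = - (lam / om) * s + s_perturbation d th rho s.
Proof.
  intros Hrho Hv. unfold angular_rate. rewrite angular_velocity_polar by exact Hrho.
  unfold s_perturbation, s_residual, at_polar, scaled_f3.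
  set (x := sqrt (2 * rho) * cos th). set (y := sqrt (2 * rho) * sin th).
  assert (E : d * velocity_error d th rho s = velocity d th rho s - om) by (unfold velocity; ring).
  set (v := velocity d th rho s) in *. set (e := velocity_error d th rho s) in *.
  apply (Rmult_eq_reg_l (om * v)); [|apply Rmult_integral_contrapositive; lra].
  transitivity (- lam * s * v + om * (d * ns d x y s) + lam * s * (d * e)); [rewrite E; field; lra|field; lra].
Qed.

Lemma at_polar_periodic (f : R -> R -> R -> R) : periodic_in_angle (at_polar f).
Proof. intros th rho s. unfold at_polar. rewrite cos_plus, sin_plus, cos_2PI, sin_2PI. f_equal; ring. Qed.

Lemma velocity_error_periodic d : periodic_in_angle (velocity_error d).
Proof.
  intros th rho s. unfold velocity_error.
  rewrite !at_polar_periodic, cos_plus, sin_plus, cos_2PI, sin_2PI. ring.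
Qed.

Lemma w_perturbation_periodic d : periodic_in_angle (w_perturbation d).
Proof.
  intros th rho s. unfold w_perturbation, w_residual, w_leading, velocity.
  rewrite !at_polar_periodic, !velocity_error_periodic. reflexivity.
Qed.

Lemma s_perturbation_periodic d : periodic_in_angle (s_perturbation d).
Proof.
  intros th rho s. unfold s_perturbation, s_residual, velocity.
  rewrite !at_polar_periodic, !velocity_error_periodic. reflexivity.
Qed.

Lemma w_shift_periodic d : periodic_in_angle (w_shift d).
Proof. intros th rho s. unfold w_shift. rewrite at_polar_periodic. reflexivity. Qed.

Lemma residuals_common_constant : exists C, 1 <= C /\ at_right 0 (fun d =>
  bounded_lipschitz D C (w_residual d) /\ bounded_lipschitz D C (s_residual d) /\
  bounded_lipschitz D C (at_polar (shift d)) /\ bounded_lipschitz D C (at_polar (coupling d))).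
Proof.
  destruct w_residual_lipschitz as [C1 [P1 K1]], s_residual_lipschitz as [C2 [P2 K2]].
  destruct shift_polar_lipschitz as [C3 [P3 K3]], coupling_polar_lipschitz as [C4 [P4 K4]].
  exists (C1 + C2 + C3 + C4 + 1). split; [lra|].
  generalize (filter_and _ _ K1 (filter_and _ _ K2 (filter_and _ _ K3 K4))). apply filter_imp.
  intros d [L1 [L2 [L3 L4]]]. repeat match goal with |- _ /\ _ => split end;
    eapply bounded_lipschitz_weaken; try eassumption; lra.
Qed.

Lemma perturbations_common_constant : exists L, at_right 0 (fun d =>
  bounded_lipschitz D L (w_perturbation d) /\ bounded_lipschitz D L (s_perturbation d) /\
  bounded_lipschitz D L (w_shift d)).
Proof.
  pose proof w_leading_lipschitz. pose proof w_residual_lipschitz. pose proof s_residual_lipschitz.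
  pose proof shift_polar_lipschitz.
  assert (Uw : eventually_lipschitz D w_perturbation) by (unfold w_perturbation; prove_eventually_lipschitz).
  assert (Us : eventually_lipschitz D s_perturbation) by (unfold s_perturbation; prove_eventually_lipschitz).
  assert (Ushift : eventually_lipschitz D w_shift) by (unfold w_shift; prove_eventually_lipschitz).
  destruct Uw as [C1 [P1 K1]], Us as [C2 [P2 K2]], Ushift as [C3 [P3 K3]]. exists (C1 + C2 + C3).
  generalize (filter_and _ _ K1 (filter_and _ _ K2 K3)). apply filter_imp.
  intros d [L1 [L2 L3]]. repeat match goal with |- _ /\ _ => split end;
    eapply bounded_lipschitz_weaken; try eassumption; lra.
Qed.

Lemma rates_bound : exists slope, at_right 0 (fun d => forall th rho s, D th rho s ->
  Rabs (- (d ^ 2 * k / om) * (rho + w_shift d th rho s - rho0) + w_perturbation d th rho s) <= slope /\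
  Rabs (- (lam / om) * s + s_perturbation d th rho s) <= slope).
Proof.
  pose proof w_leading_lipschitz. pose proof w_residual_lipschitz. pose proof s_residual_lipschitz.
  pose proof shift_polar_lipschitz. pose proof (eventually_lipschitz_rho rho0 rho0_pos).
  pose proof (eventually_lipschitz_s rho0 b rho0_pos b_large).
  assert (Uw : eventually_lipschitz D (fun d th rho s => - (d * d * (k / om))
    * (rho + d * at_polar (shift d) th rho s - rho0) + d * d * (w_leading d th rho s + d * w_residual d th rho s)))
    by prove_eventually_lipschitz.
  assert (Us : eventually_lipschitz D (fun d th rho s => - (lam / om) * s + d * s_residual d th rho s))
    by prove_eventually_lipschitz.
  destruct Uw as [Cw [_ Kw]], Us as [Cs [_ Ks]]. exists (Rmax Cw Cs).
  generalize (filter_and _ _ Kw Ks). apply filter_imp. intros d [[Bw _] [Bs _]] th rho s HD.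
  replace (d ^ 2 * k / om) with (d * d * (k / om)) by (field; lra).
  split; [eapply Rle_trans; [exact (Bw th rho s HD)|apply Rmax_l]
    |eapply Rle_trans; [exact (Bs th rho s HD)|apply Rmax_r]].
Qed.

Lemma scaled_w_lipschitz : exists w_bound, at_right 0 (fun d => bounded_lipschitz (box b) w_bound (scaled_w d)).
Proof.
  pose proof (eventually_lipschitz_box_coord b 0) as Up. pose proof (eventually_lipschitz_box_coord b 1) as Uq.
  simpl in Up, Uq.
  assert (U : eventually_lipschitz (box b) (fun d p q s => (p * p + q * q) * / 2 + d * shift d p q s))
    by prove_eventually_lipschitz.
  destruct U as [C [_ K]]. exists C. revert K. apply filter_imp. intros d.
  apply bounded_lipschitz_ext. intros p q s _. unfold scaled_w, action. field.
Qed.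

Section FixedScale.
Variables d C L rad sig slope w_bound : R.

Local Notation kw := (d ^ 2 * k / om).
Local Notation ks := (lam / om).
Local Notation kappa := (Rabs k / om).
Local Notation m := (8 * C / Rabs k + 1).
Local Notation weight := (kappa * ks / (64 * C ^ 2)).

Hypothesis d_pos : 0 < d.
Hypothesis C_ge_1 : 1 <= C.
Hypothesis rad_range : 0 < rad <= rho0 / 4.
Hypothesis rad_le_1 : rad <= 1.
Hypothesis rad_small : Rabs quad * rad <= Rabs k / 64.
Hypothesis sig_range : 0 < sig <= 1.
Hypothesis sig_small : C * sig <= Rabs k * rad / 64.
Hypothesis w_residual_lip : bounded_lipschitz D C (w_residual d).
Hypothesis s_residual_lip : bounded_lipschitz D C (s_residual d).
Hypothesis shift_lip : bounded_lipschitz D C (at_polar (shift d)).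
Hypothesis coupling_lip : bounded_lipschitz D C (at_polar (coupling d)).
Hypothesis w_perturbation_lip : bounded_lipschitz D L (w_perturbation d).
Hypothesis s_perturbation_lip : bounded_lipschitz D L (s_perturbation d).
Hypothesis w_shift_lip : bounded_lipschitz D L (w_shift d).
Hypothesis slope_bound : forall th rho s, D th rho s ->
  Rabs (- kw * (rho + w_shift d th rho s - rho0) + w_perturbation d th rho s) <= slope /\
  Rabs (- ks * s + s_perturbation d th rho s) <= slope.
Hypothesis w_lip : bounded_lipschitz (box b) w_bound (scaled_w d).
Hypothesis velocity_at_d : forall th rho s, D th rho s -> om / 2 <= velocity d th rho s <= 2 * om.
Hypothesis d_small_rad : om * C * d <= Rabs k * rad / 64.
Hypothesis d_small_shift : C * d <= rad / 8.
Hypothesis d_small_sig : C * d <= sig / 2 * ks.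
Hypothesis d_small_m : 8 * m * C * d <= ks.
Hypothesis d_small_weight : kappa * m * d <= 2 * weight * C.
Hypothesis d_small_ks : 12 * C * d <= ks.

Local Notation in_tube := (tube rho0 rad sig).

Lemma Rabs_k_pos : 0 < Rabs k.
Proof. apply Rabs_pos_lt, k_neq_0. Qed.

Lemma ks_pos : 0 < ks.
Proof. apply Rdiv_lt_0_compat; assumption. Qed.

Lemma m_ge_1 : 1 <= m.
Proof. pose proof (Rdiv_lt_0_compat (8 * C) _ ltac:(lra) Rabs_k_pos). lra. Qed.

Lemma weight_pos : 0 < weight.
Proof.
  pose proof ks_pos. assert (0 < kappa) by (apply Rdiv_lt_0_compat; [apply Rabs_k_pos|assumption]).
  apply Rdiv_lt_0_compat; [apply Rmult_lt_0_compat; assumption|]. pose proof (pow_lt C 2 ltac:(lra)). lra.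
Qed.

Lemma Rabs_kw : Rabs kw = d ^ 2 / om * Rabs k.
Proof.
  pose proof (pow2_ge_0 d). unfold Rdiv. rewrite !Rabs_mult, Rabs_inv, (Rabs_pos_eq (d ^ 2)), (Rabs_pos_eq om) by lra.
  ring.
Qed.

Lemma d2_om_pos : 0 < d ^ 2 / om.
Proof. apply Rdiv_lt_0_compat; [apply pow_lt|]; assumption. Qed.

Lemma tube_annulus th rho s : in_tube rho s -> D th rho s.
Proof. intros [Hrho Hs]. split; lra. Qed.

Lemma tube_rho_pos rho s : in_tube rho s -> 0 < rho.
Proof. intros near. pose proof (annulus_rho _ _ _ _ (tube_annulus 0 _ _ near)). lra. Qed.

Lemma tube_velocity_pos th rho s : in_tube rho s -> 0 < velocity d th rho s.
Proof. intros near. pose proof (velocity_at_d _ _ _ (tube_annulus th _ _ near)). lra. Qed.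

Lemma diff_at_angle f th rho s rho' s' : bounded_lipschitz D C f -> in_tube rho s -> in_tube rho' s' ->
  Rabs (f th rho s - f th rho' s') <= C * (Rabs (rho - rho') + Rabs (s - s')).
Proof.
  intros [_ lip] near near'.
  pose proof (lip _ _ _ _ _ _ (tube_annulus th _ _ near) (tube_annulus th _ _ near')) as variation.
  unfold dist1 in variation. rewrite Rminus_diag, Rabs_R0, Rplus_0_l in variation. exact variation.
Qed.

Lemma w_perturbation_eq th rho s : w_perturbation d th rho s
  = d ^ 2 / om * (quad * (rho - rho0) ^ 2 + at_polar (coupling d) th rho s * s + om * (d * w_residual d th rho s)).
Proof. unfold w_perturbation, w_leading. field. lra. Qed.

Lemma w_perturbation_bound th rho s : in_tube rho s -> Rabs (w_perturbation d th rho s) <= rad / 4 * Rabs kw.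
Proof.
  intros near. pose proof (tube_annulus th _ _ near) as HD. destruct near as [Hrho Hs]. pose proof d2_om_pos.
  pose proof Rabs_k_pos.
  rewrite w_perturbation_eq, Rabs_mult, Rabs_kw, (Rabs_pos_eq (d ^ 2 / om)) by lra.
  replace (rad / 4 * (d ^ 2 / om * Rabs k)) with (d ^ 2 / om * (Rabs k * rad / 4)) by (field; lra).
  apply Rmult_le_compat_l; [lra|].
  assert (quadratic : Rabs (quad * (rho - rho0) ^ 2) <= Rabs k * rad / 64).
  { rewrite Rabs_mult, <- RPow_abs. pose proof (Rabs_pos quad).
    pose proof (pow_incr _ _ 2 (conj (Rabs_pos (rho - rho0)) Hrho)).
    apply Rle_trans with (Rabs quad * rad ^ 2); [apply Rmult_le_compat_l; assumption|].
    pose proof (Rmult_le_compat_r rad _ _ ltac:(lra) rad_small). lra. }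
  assert (coupled : Rabs (at_polar (coupling d) th rho s * s) <= Rabs k * rad / 64).
  { rewrite Rabs_mult. eapply Rle_trans; [|exact sig_small].
    apply Rmult_le_compat; auto using Rabs_pos. apply coupling_lip, HD. }
  assert (residual : Rabs (om * (d * w_residual d th rho s)) <= Rabs k * rad / 64).
  { rewrite !Rabs_mult, (Rabs_pos_eq om), (Rabs_pos_eq d) by lra. eapply Rle_trans; [|exact d_small_rad].
    rewrite Rmult_assoc, (Rmult_comm C). apply Rmult_le_compat_l; [lra|]. apply Rmult_le_compat_l; [lra|].
    apply w_residual_lip, HD. }
  assert (0 <= Rabs k * rad) by (apply Rmult_le_pos; lra).
  eapply Rle_trans; [apply Rabs_triang|]. eapply Rle_trans; [apply Rplus_le_compat_r, Rabs_triang|]. lra.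
Qed.

Lemma s_perturbation_bound th rho s : in_tube rho s -> Rabs (s_perturbation d th rho s) <= sig / 2 * Rabs ks.
Proof.
  intros near. pose proof ks_pos. unfold s_perturbation. rewrite Rabs_mult, (Rabs_pos_eq d), (Rabs_pos_eq ks) by lra.
  eapply Rle_trans; [|exact d_small_sig]. rewrite Rmult_comm. apply Rmult_le_compat_r; [lra|].
  apply s_residual_lip, tube_annulus, near.
Qed.

Lemma w_shift_bound th rho s : in_tube rho s -> Rabs (w_shift d th rho s) <= rad / 4.
Proof.
  intros near. unfold w_shift. rewrite Rabs_mult, (Rabs_pos_eq d) by lra.
  apply Rle_trans with (C * d); [|lra]. rewrite Rmult_comm. apply Rmult_le_compat_r; [lra|].
  apply shift_lip, tube_annulus, near.
Qed.

Lemma leading_terms_diff th rho s rho' s' : in_tube rho s -> in_tube rho' s' ->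
  Rabs (quad * (rho - rho0) ^ 2 + at_polar (coupling d) th rho s * s
        - (quad * (rho' - rho0) ^ 2 + at_polar (coupling d) th rho' s' * s'))
  <= Rabs k / 32 * Rabs (rho - rho') + C * Rabs (s - s') + Rabs k / 64 * (Rabs (rho - rho') + Rabs (s - s')).
Proof.
  intros near near'. pose proof Rabs_k_pos as k_pos.
  pose proof (diff_at_angle _ th _ _ _ _ coupling_lip near near') as coupling_diff.
  assert (coupling_le : Rabs (at_polar (coupling d) th rho s) <= C) by apply coupling_lip, tube_annulus, near.
  set (c := at_polar (coupling d) th rho s) in *. set (c' := at_polar (coupling d) th rho' s') in *.
  replace (quad * (rho - rho0) ^ 2 + c * s - (quad * (rho' - rho0) ^ 2 + c' * s'))
    with (quad * ((rho - rho0) + (rho' - rho0)) * (rho - rho') + c * (s - s') + (c - c') * s') by ring.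
  destruct near as [Hrho Hs], near' as [Hrho' Hs'].
  pose proof (Rabs_pos (rho - rho')). pose proof (Rabs_pos (s - s')).
  eapply Rle_trans; [apply Rabs_triang|]. apply Rplus_le_compat.
  - eapply Rle_trans; [apply Rabs_triang|]. rewrite !Rabs_mult.
    apply Rplus_le_compat; apply Rmult_le_compat_r; try assumption.
    apply Rle_trans with (Rabs quad * (2 * rad)); [apply Rmult_le_compat_l; [apply Rabs_pos|]|lra].
    eapply Rle_trans; [apply Rabs_triang|lra].
  - rewrite Rabs_mult. apply Rle_trans with (C * (Rabs (rho - rho') + Rabs (s - s')) * sig);
      [apply Rmult_le_compat; auto using Rabs_pos|].
    replace (C * (Rabs (rho - rho') + Rabs (s - s')) * sig) with
      (C * sig * (Rabs (rho - rho') + Rabs (s - s'))) by ring.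
    apply Rmult_le_compat_r; [lra|]. pose proof (Rmult_le_compat_l (Rabs k) rad 1 ltac:(lra) rad_le_1). lra.
Qed.

Lemma w_perturbation_contracts th rho s rho' s' : in_tube rho s -> in_tube rho' s' ->
  Rabs (w_perturbation d th rho s - w_perturbation d th rho' s')
  <= / 8 * (Rabs (rho - rho') + m * Rabs (s - s')) * Rabs kw.
Proof.
  intros near near'. pose proof d2_om_pos. pose proof Rabs_k_pos as k_pos.
  pose proof (leading_terms_diff th _ _ _ _ near near') as leading.
  pose proof (diff_at_angle _ th _ _ _ _ w_residual_lip near near') as residual.
  rewrite !w_perturbation_eq, <- Rmult_minus_distr_l, Rabs_mult, Rabs_kw, (Rabs_pos_eq (d ^ 2 / om)) by lra.
  replace (/ 8 * (Rabs (rho - rho') + m * Rabs (s - s')) * (d ^ 2 / om * Rabs k))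
    with (d ^ 2 / om * (/ 8 * (Rabs k * Rabs (rho - rho') + (8 * C + Rabs k) * Rabs (s - s')))) by (field; lra).
  apply Rmult_le_compat_l; [lra|].
  set (lead := quad * (rho - rho0) ^ 2 + at_polar (coupling d) th rho s * s) in *.
  set (lead' := quad * (rho' - rho0) ^ 2 + at_polar (coupling d) th rho' s' * s') in *.
  replace (lead + om * (d * w_residual d th rho s) - (lead' + om * (d * w_residual d th rho' s')))
    with ((lead - lead') + om * d * (w_residual d th rho s - w_residual d th rho' s')) by ring.
  pose proof (Rabs_pos (rho - rho')). pose proof (Rabs_pos (s - s')).
  set (X := Rabs (rho - rho')) in *. set (Y := Rabs (s - s')) in *.
  eapply Rle_trans; [apply Rabs_triang|]. rewrite (Rabs_mult (om * d)).
  assert (0 <= om * d) by (apply Rmult_le_pos; lra). rewrite (Rabs_pos_eq (om * d)) by assumption.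
  apply (Rmult_le_compat_l (om * d)) in residual; [|assumption].
  replace (om * d * (C * (X + Y))) with (om * C * d * (X + Y)) in residual by ring.
  assert (om * C * d * (X + Y) <= Rabs k / 64 * (X + Y)).
  { apply Rmult_le_compat_r; [lra|]. pose proof (Rmult_le_compat_l (Rabs k) rad 1 ltac:(lra) rad_le_1). lra. }
  assert (0 <= Rabs k * X) by (apply Rmult_le_pos; lra). assert (0 <= Rabs k * Y) by (apply Rmult_le_pos; lra). lra.
Qed.

Lemma s_perturbation_diff th rho s rho' s' : in_tube rho s -> in_tube rho' s' ->
  Rabs (s_perturbation d th rho s - s_perturbation d th rho' s') <= d * C * (Rabs (rho - rho') + Rabs (s - s')).
Proof.
  intros near near'. unfold s_perturbation.
  rewrite <- Rmult_minus_distr_l, Rabs_mult, (Rabs_pos_eq d), Rmult_assoc by lra.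
  apply Rmult_le_compat_l; [lra|]. apply diff_at_angle; assumption.
Qed.

Lemma s_perturbation_contracts th rho s rho' s' : in_tube rho s -> in_tube rho' s' ->
  m * Rabs (s_perturbation d th rho s - s_perturbation d th rho' s')
  <= / 8 * (Rabs (rho - rho') + m * Rabs (s - s')) * Rabs ks.
Proof.
  intros near near'. pose proof ks_pos as ks_pos'. pose proof m_ge_1 as m_1. rewrite (Rabs_pos_eq ks) by lra.
  pose proof (s_perturbation_diff th _ _ _ _ near near') as diff. apply (Rmult_le_compat_l m) in diff; [|lra].
  eapply Rle_trans; [exact diff|]. pose proof (Rabs_pos (rho - rho')). pose proof (Rabs_pos (s - s')).
  set (X := Rabs (rho - rho')) in *. set (Y := Rabs (s - s')) in *. set (r := ks) in *.
  replace (m * (d * C * (X + Y))) with (m * C * d * (X + Y)) by ring.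
  apply Rle_trans with (/ 8 * r * (X + Y)); [apply Rmult_le_compat_r; lra|].
  replace (/ 8 * (X + m * Y) * r) with (/ 8 * r * (X + m * Y)) by ring. apply Rmult_le_compat_l; [lra|].
  pose proof (Rmult_le_compat_r Y _ _ ltac:(lra) m_1). lra.
Qed.

Lemma w_shift_diff th rho s rho' s' : in_tube rho s -> in_tube rho' s' ->
  Rabs (w_shift d th rho s - w_shift d th rho' s') <= / 8 * (Rabs (rho - rho') + Rabs (s - s')).
Proof.
  intros near near'. unfold w_shift. rewrite <- Rmult_minus_distr_l, Rabs_mult, (Rabs_pos_eq d) by lra.
  pose proof (diff_at_angle _ th _ _ _ _ shift_lip near near') as shift_diff.
  apply (Rmult_le_compat_l d) in shift_diff; [|lra].
  eapply Rle_trans; [exact shift_diff|]. rewrite <- Rmult_assoc. pose proof (Rabs_pos (rho - rho')).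
  pose proof (Rabs_pos (s - s')). apply Rmult_le_compat_r; lra.
Qed.

Lemma w_shift_contracts th rho s rho' s' : in_tube rho s -> in_tube rho' s' ->
  Rabs (w_shift d th rho s - w_shift d th rho' s') <= / 8 * (Rabs (rho - rho') + m * Rabs (s - s')).
Proof.
  intros near near'. eapply Rle_trans; [apply w_shift_diff; assumption|].
  pose proof (Rmult_le_compat_r (Rabs (s - s')) _ _ (Rabs_pos _) m_ge_1). lra.
Qed.

Lemma rho_le_shifted th rho s rho' s' : in_tube rho s -> in_tube rho' s' ->
  let dw := rho + w_shift d th rho s - (rho' + w_shift d th rho' s') in
  Rabs (rho - rho') <= Rabs dw + / 8 * (Rabs (rho - rho') + Rabs (s - s')).
Proof.
  intros near near' dw. pose proof (w_shift_diff th _ _ _ _ near near') as shift_diff.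
  replace (rho - rho') with (dw + - (w_shift d th rho s - w_shift d th rho' s')) at 1 by (unfold dw; ring).
  eapply Rle_trans; [apply Rabs_triang|]. rewrite Rabs_Ropp. lra.
Qed.

Lemma weighted_products_le (x X Y dA dB : R) : 0 <= x -> 0 <= X -> 0 <= Y -> X <= x + / 8 * (X + Y) ->
  dA <= / 8 * (X + m * Y) * Rabs kw -> dB <= d * C * (X + Y) ->
  x * dA + weight * (Y * dB) <= Rabs kw / 2 * x ^ 2 + weight * ks / 2 * Y ^ 2.
Proof.
  intros Hx HX HY HXx HA HB. pose proof m_ge_1 as m_1. pose proof weight_pos as w_pos. pose proof ks_pos as s_pos.
  pose proof Rabs_k_pos. assert (kap_pos : 0 < kappa) by (apply Rdiv_lt_0_compat; assumption).
  assert (Ew : 64 * (weight * C ^ 2) = kappa * ks) by (field; lra).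
  assert (Ekw : Rabs kw = d ^ 2 * kappa) by (rewrite Rabs_kw; field; lra).
  assert (kw_pos : 0 < Rabs kw) by (rewrite Ekw; apply Rmult_lt_0_compat; [apply pow_lt|]; assumption).
  set (q := Rabs kw) in *. set (M := m) in *. set (W := weight) in *. set (r := ks) in *. set (p := kappa) in *.
  assert (0 <= x * Y) by (apply Rmult_le_pos; assumption).
  assert (first : x * dA <= q / 7 * x ^ 2 + q * M * (x * Y)).
  { apply Rle_trans with (x * (/ 8 * (8 / 7 * x + / 7 * Y + M * Y) * q)).
    - apply Rmult_le_compat_l; [exact Hx|]. eapply Rle_trans; [exact HA|]. apply Rmult_le_compat_r; lra.
    - pose proof (Rmult_le_compat_r (q * (x * Y)) 1 M ltac:(apply Rmult_le_pos; lra) m_1). nra. }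
  assert (second : W * (Y * dB) <= 2 * W * d * C * (x * Y) + 2 * W * d * C * Y ^ 2).
  { apply Rle_trans with (W * (Y * (d * C * (2 * x + 2 * Y)))); [|right; ring].
    apply Rmult_le_compat_l; [lra|]. apply Rmult_le_compat_l; [exact HY|]. eapply Rle_trans; [exact HB|].
    apply Rmult_le_compat_l; [apply Rmult_le_pos; lra|lra]. }
  assert (mixed : (q * M + 2 * W * d * C) * (x * Y) <= q / 4 * x ^ 2 + W * r / 4 * Y ^ 2).
  { apply young; [lra|]. rewrite Ekw.
    replace ((d ^ 2 * p * M + 2 * W * d * C) ^ 2) with (d ^ 2 * (p * M * d + 2 * W * C) ^ 2) by ring.
    apply Rle_trans with (d ^ 2 * (4 * W * C) ^ 2).
    - apply Rmult_le_compat_l; [apply pow2_ge_0|]. apply pow_incr.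
      assert (0 <= p * M * d) by (apply Rmult_le_pos; [apply Rmult_le_pos|]; lra).
      assert (0 <= W * C) by (apply Rmult_le_pos; lra). lra.
    - replace (4 * (d ^ 2 * p / 4) * (W * r / 4)) with (d ^ 2 * W * (p * r) / 4) by field.
      rewrite <- Ew. right. field. }
  assert (remaining : 2 * W * d * C * Y ^ 2 <= W * r / 4 * Y ^ 2).
  { apply Rmult_le_compat_r; [apply pow2_ge_0|]. pose proof (Rmult_le_compat_l W _ _ ltac:(lra) d_small_ks).
    assert (0 <= W * r) by (apply Rmult_le_pos; lra). lra. }
  pose proof (Rmult_le_pos _ _ (Rlt_le _ _ kw_pos) (pow2_ge_0 x)). lra.
Qed.

Lemma scaled_rates_close th rho s rho' s' : in_tube rho s -> in_tube rho' s' ->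
  let w_rate := angular_rate (scaled_f1 d) (scaled_f2 d) (scaled_w' d) th in
  let s_rate := angular_rate (scaled_f1 d) (scaled_f2 d) (scaled_f3 d) th in
  let dw := at_polar (scaled_w d) th rho s - at_polar (scaled_w d) th rho' s' in
  let ds := s - s' in
  Rabs dw * Rabs (w_rate rho s - w_rate rho' s' + kw * dw)
  + weight * (Rabs ds * Rabs (s_rate rho s - s_rate rho' s' + ks * ds))
  <= Rabs kw / 2 * dw ^ 2 + weight * ks / 2 * ds ^ 2.
Proof.
  intros near near'. cbv zeta. rewrite !w_rate_polar, !s_rate_polar, !scaled_w_polar
    by (first [apply (tube_rho_pos _ _ near)|apply (tube_rho_pos _ _ near')|apply (tube_velocity_pos th _ _ near)
              |apply (tube_velocity_pos th _ _ near')]).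
  set (dw := rho + w_shift d th rho s - (rho' + w_shift d th rho' s')).
  replace (- kw * (rho + w_shift d th rho s - rho0) + w_perturbation d th rho s
           - (- kw * (rho' + w_shift d th rho' s' - rho0) + w_perturbation d th rho' s') + kw * dw)
    with (w_perturbation d th rho s - w_perturbation d th rho' s') by (unfold dw; ring).
  replace (- ks * s + s_perturbation d th rho s - (- ks * s' + s_perturbation d th rho' s') + ks * (s - s'))
    with (s_perturbation d th rho s - s_perturbation d th rho' s') by ring.
  rewrite <- (pow2_abs dw), <- (pow2_abs (s - s')).
  apply (weighted_products_le _ (Rabs (rho - rho'))); auto using Rabs_pos.
  - apply rho_le_shifted; assumption.
  - apply w_perturbation_contracts; assumption.
  - apply s_perturbation_diff; assumption.
Qed.

Lemma scaled_periodic_solution : exists rho_c s_c : R -> R,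
  (forall th, rho_c (th + 2 * PI) = rho_c th) /\ (forall th, s_c (th + 2 * PI) = s_c th) /\
  (forall th, tube rho0 (rad / 2) (sig / 2) (rho_c th) (s_c th)) /\
  (forall th, is_derive (fun th => rho_c th + w_shift d th (rho_c th) (s_c th)) th
     (- kw * (rho_c th + w_shift d th (rho_c th) (s_c th) - rho0) + w_perturbation d th (rho_c th) (s_c th))) /\
  (forall th, is_derive s_c th (- ks * s_c th + s_perturbation d th (rho_c th) (s_c th))).
Proof.
  assert (in_half : forall rho s, tube rho0 (rad / 2) (sig / 2) rho s -> in_tube rho s)
    by (intros rho s [Hrho Hs]; split; lra).
  assert (half_annulus : forall th rho s, tube rho0 (rad / 2) (sig / 2) rho s -> D th rho s)
    by (intros; apply tube_annulus; auto).
  pose proof ks_pos. pose proof m_ge_1. pose proof Rabs_k_pos. pose proof d2_om_pos.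
  apply (periodic_solution _ _ _ kw ks rho0 (rad / 2) (sig / 2) L m); try lra.
  - intros E. pose proof Rabs_kw as Ekw. rewrite E, Rabs_R0 in Ekw.
    pose proof (Rmult_lt_0_compat (d ^ 2 / om) (Rabs k)). lra.
  - apply w_perturbation_periodic.
  - apply s_perturbation_periodic.
  - apply w_shift_periodic.
  - exact (bounded_lipschitz_subset _ _ _ _ w_perturbation_lip half_annulus).
  - exact (bounded_lipschitz_subset _ _ _ _ s_perturbation_lip half_annulus).
  - exact (bounded_lipschitz_subset _ _ _ _ w_shift_lip half_annulus).
  - intros th rho s near'. replace (rad / 2 / 2) with (rad / 4) by field. apply w_perturbation_bound; auto.
  - intros th rho s near'. apply s_perturbation_bound; auto.
  - intros th rho s near'. replace (rad / 2 / 2) with (rad / 4) by field. apply w_shift_bound; auto.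
  - intros. apply w_perturbation_contracts; auto.
  - intros. apply s_perturbation_contracts; auto.
  - intros. apply w_shift_contracts; auto.
Qed.

Local Notation F := (field3 (scaled_f1 d) (scaled_f2 d) (scaled_f3 d)).

Lemma scaled_orbit : derivative_along (scaled_f1 d) (scaled_f2 d) (scaled_f3 d) (scaled_w d) (scaled_w' d) ->
  loc_lipschitz (scaled_f1 d) -> loc_lipschitz (scaled_f2 d) -> loc_lipschitz (scaled_f3 d) ->
  (forall X, exists phi, is_sol F phi /\ phi 0 = X) ->
  exists (gam : R -> R3) (T : R), periodic_orbit F gam T /\ (0 < k -> orbit_asympt_stable F gam) /\
    (k < 0 -> orbit_unstable F gam) /\ (forall t, in_box b (gam t)).
Proof.
  intros w_derive lip1 lip2 lip3 existence.
  destruct scaled_periodic_solution as [rho_c [s_c [rho_per [s_per [inside [Dw Ds]]]]]].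
  assert (curve_in_tube : forall th, in_tube (rho_c th) (s_c th))
    by (intros th; destruct (inside th); split; lra).
  pose proof d2_om_pos as pos. pose proof ks_pos. pose proof weight_pos.
  assert (Ekw : kw = d ^ 2 / om * k) by (field; lra).
  destruct (closed_curve_orbit (scaled_f1 d) (scaled_f2 d) (scaled_f3 d) (scaled_w d) (scaled_w' d) rho0 rad sig
    kw ks weight (om / 2) (2 * om) b w_bound slope rho_c s_c) as [gam [T [periodic [on_curve [stable unstable]]]]];
    auto; try lra.
  - rewrite Ekw. apply Rmult_integral_contrapositive. lra.
  - intros th rho s near'. rewrite angular_velocity_polar by apply (tube_rho_pos _ _ near').
    apply velocity_at_d, tube_annulus, near'.
  - intros th. rewrite w_rate_polar by (first
      [apply (tube_rho_pos _ _ (curve_in_tube th))|apply (tube_velocity_pos th _ _ (curve_in_tube th))]).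
    refine (is_derive_ext _ _ _ _ _ (Dw th)). intros u. symmetry.
    apply scaled_w_polar, (tube_rho_pos _ _ (curve_in_tube u)).
  - intros th. rewrite s_rate_polar by (first
      [apply (tube_rho_pos _ _ (curve_in_tube th))|apply (tube_velocity_pos th _ _ (curve_in_tube th))]).
    exact (Ds th).
  - exact scaled_rates_close.
  - intros th rho s rho' s' near' near''.
    rewrite !scaled_w_polar by (first [apply (tube_rho_pos _ _ near')|apply (tube_rho_pos _ _ near'')]).
    pose proof (rho_le_shifted th _ _ _ _ near' near'') as rho_close. cbv zeta in rho_close.
    pose proof (Rabs_pos (rho + w_shift d th rho s - (rho' + w_shift d th rho' s'))). pose proof (Rabs_pos (s - s')).
    lra.
  - intros th rho s near'. rewrite w_rate_polar, s_rate_polar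
      by (first [apply (tube_rho_pos _ _ near')|apply (tube_velocity_pos th _ _ near')]).
    apply slope_bound, tube_annulus, near'.
  - exists gam, T. split; [exact periodic|split; [|split]].
    + intros Hk. apply stable. rewrite Ekw. apply Rmult_lt_0_compat; assumption.
    + intros Hk. apply unstable. rewrite Ekw. pose proof (Rmult_lt_0_compat _ (- k) pos). lra.
    + intros t. destruct (on_curve t) as [th ->]. apply (annulus_in_box rho0 b b_large th), tube_annulus, curve_in_tube.
Qed.

End FixedScale.

Lemma tube_size_exists (C : R) : 1 <= C -> exists rad sig, 0 < rad <= rho0 / 4 /\ rad <= 1 /\
  Rabs quad * rad <= Rabs k / 64 /\ 0 < sig <= 1 /\ C * sig <= Rabs k * rad / 64.
Proof.
  intros HC. pose proof (Rabs_pos_lt _ k_neq_0). pose proof (Rabs_pos quad).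
  assert (quarter : 0 < rho0 / 4) by lra. assert (k_part : 0 < Rabs k / 64) by lra.
  destruct (at_right_0_elim _ (filter_and _ _ (at_right_0_linear 1 _ quarter) (at_right_0_linear (Rabs quad) _ k_part)))
    as [rad [Hrad small]]. destruct (small rad ltac:(lra)) as [rad_rho rad_quad].
  assert (sig_part : 0 < Rabs k * rad / 64) by (pose proof (Rmult_lt_0_compat (Rabs k) rad); lra).
  destruct (at_right_0_elim _ (at_right_0_linear C _ sig_part)) as [sig [Hsig sig_small]].
  specialize (sig_small sig ltac:(lra)). exists rad, sig. repeat split; lra.
Qed.

Theorem scaled_hopf : at_right 0 (fun d => let F := field3 (scaled_f1 d) (scaled_f2 d) (scaled_f3 d) in
  derivative_along (scaled_f1 d) (scaled_f2 d) (scaled_f3 d) (scaled_w d) (scaled_w' d) ->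
  loc_lipschitz (scaled_f1 d) -> loc_lipschitz (scaled_f2 d) -> loc_lipschitz (scaled_f3 d) ->
  (forall X, exists phi, is_sol F phi /\ phi 0 = X) ->
  exists (gam : R -> R3) (T : R), periodic_orbit F gam T /\ (0 < k -> orbit_asympt_stable F gam) /\
    (k < 0 -> orbit_unstable F gam) /\ (forall t, in_box b (gam t))).
Proof.
  destruct residuals_common_constant as [C [HC residuals]], perturbations_common_constant as [L perturbations].
  destruct rates_bound as [slope slopes], scaled_w_lipschitz as [w_bound w_lips].
  destruct (tube_size_exists C HC) as [rad [sig [rad_range [rad_le_1 [rad_small [sig_range sig_small]]]]]].
  pose proof ks_pos as ks_positive.
  pose proof (weight_pos C HC) as weight_positive.
  assert (rad_part : 0 < Rabs k * rad / 64) by (pose proof (Rmult_lt_0_compat _ rad (Rabs_pos_lt _ k_neq_0)); lra).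
  assert (shift_part : 0 < rad / 8) by lra.
  assert (sig_part : 0 < sig / 2 * (lam / om)) by (apply Rmult_lt_0_compat; lra).
  assert (weight_part : 0 < 2 * (Rabs k / om * (lam / om) / (64 * C ^ 2)) * C) by (apply Rmult_lt_0_compat; lra).
  generalize (filter_and _ _ (filter_and _ _ at_right_0_pos (filter_and _ _ residuals (filter_and _ _ perturbations
      (filter_and _ _ slopes (filter_and _ _ w_lips velocity_bounds)))))
    (filter_and _ _ (at_right_0_linear (om * C) _ rad_part) (filter_and _ _ (at_right_0_linear C _ shift_part)
    (filter_and _ _ (at_right_0_linear C _ sig_part)
    (filter_and _ _ (at_right_0_linear (8 * (8 * C / Rabs k + 1) * C) _ ks_positive)
    (filter_and _ _ (at_right_0_linear (Rabs k / om * (8 * C / Rabs k + 1)) _ weight_part)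
      (at_right_0_linear (12 * C) _ ks_positive))))))).
  apply filter_imp.
  intros d [[d_pos [[Lw [Ls [Lshift Lcoupling]]] [[Pw [Ps Pshift]] [slope_d [w_d velocity_d]]]]]
    [small_rad [small_shift [small_sig [small_m [small_weight small_ks]]]]]].
  apply (scaled_orbit d C L rad sig slope w_bound); assumption.
Qed.

End ScaledHopf.

(** * Hopf bifurcation in normal coordinates *)

Lemma weighted_order_bound (wn wS k : nat) f : weighted_order wn wS (S k) f -> exists C, 0 <= C /\ forall n u v s d,
  0 <= d <= 1 -> Rabs n <= d ^ wn -> Rabs u <= d -> Rabs v <= d -> Rabs s <= d ^ wS -> Rabs (f n u v s) <= C * d ^ S k.
Proof.
  intros Hf. destruct (Hf 1 ltac:(lra)) as [C [HC bound]]. exists C. split; [exact HC|].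
  assert (quotient : forall x e, 0 < e -> Rabs x <= e -> Rabs (x / e) <= 1).
  { intros x e He Hx. unfold Rdiv. rewrite Rabs_mult, Rabs_inv, (Rabs_pos_eq e) by lra.
    apply (Rle_div_l (Rabs x) 1 e); lra. }
  assert (positive : forall n u v s d, 0 < d <= 1 -> Rabs n <= d ^ wn -> Rabs u <= d -> Rabs v <= d ->
    Rabs s <= d ^ wS -> Rabs (f n u v s) <= C * d ^ S k).
  { intros n u v s d Hd Hn Hu Hv Hs.
    assert (n_pos : 0 < d ^ wn) by (apply pow_lt; lra). assert (s_pos : 0 < d ^ wS) by (apply pow_lt; lra).
    destruct (bound d (n / d ^ wn) Hd (quotient n _ n_pos Hn)) as [B _].
    specialize (B (u / d) (v / d) (s / d ^ wS)).
    replace (n / d ^ wn * d ^ wn) with n in B by (field; lra). replace (d * (u / d)) with u in B by (field; lra).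
    replace (d * (v / d)) with v in B by (field; lra). replace (d ^ wS * (s / d ^ wS)) with s in B by (field; lra).
    apply B. repeat split; apply quotient; assumption || lra. }
  intros n u v s d Hd Hn Hu Hv Hs. destruct (Req_dec d 0) as [->|Hd0]; [|apply positive; lra].
  rewrite pow_i, Rmult_0_r by lia. apply Rnot_lt_le. intros Hpos.
  assert (half : 0 < Rabs (f n u v s) / 2) by lra.
  destruct (at_right_0_elim _ (at_right_0_linear C _ half)) as [e [He small]]. specialize (small e ltac:(lra)).
  assert (grows : forall j, 0 ^ j <= e ^ j) by (intros j; apply pow_incr; lra).
  pose proof (positive n u v s e He (Rle_trans _ _ _ Hn (grows _)) ltac:(lra) ltac:(lra)
    (Rle_trans _ _ _ Hs (grows _))).
  pose proof (Rmult_le_compat_l C _ _ HC (pow_decr_exponent e 1 (S k) ltac:(lra) ltac:(lia))) as decr.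
  rewrite pow_1 in decr. lra.
Qed.

Definition rescaled (tau : R) (k : nat) (f : R -> R -> R -> R -> R) (d p q s : R) : R :=
  f (tau * d ^ 2) (d * p) (d * q) (d ^ 2 * s) * / d ^ k.

Lemma rescaled_bounded_lipschitz (k : nat) f (tau d b C : R) : 0 < d ->
  bounded_lipschitz (box b) (C * d ^ k) (fun p q s => f (tau * d ^ 2) (d * p) (d * q) (d ^ 2 * s)) ->
  bounded_lipschitz (box b) C (rescaled tau k f d).
Proof.
  intros Hd [bound lip]. assert (pos : 0 < d ^ k) by (apply pow_lt, Hd).
  assert (cancel : forall x e, Rabs x <= C * d ^ k * e -> Rabs x * / d ^ k <= C * e).
  { intros x e H. apply (Rle_div_l (Rabs x) (C * e) (d ^ k) pos). lra. }
  unfold rescaled. split; intros.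
  - rewrite Rabs_mult, Rabs_inv, (Rabs_pos_eq (d ^ k)), <- (Rmult_1_r C) by lra.
    apply cancel. rewrite Rmult_1_r. apply bound; assumption.
  - rewrite <- Rmult_minus_distr_r, Rabs_mult, Rabs_inv, (Rabs_pos_eq (d ^ k)) by lra.
    apply cancel, lip; assumption.
Qed.

Lemma rescaled_eventually_lipschitz (k : nat) f (tau b : R) : Rabs tau <= 1 -> 0 < b -> weighted_order 2 2 k f ->
  eventually_lipschitz (box b) (rescaled tau k f).
Proof.
  intros Ht Hb Hf. destruct (Hf b Hb) as [C [HC bound]]. exists C. split; [exact HC|].
  apply (at_right_0_intro _ 1); [lra|]. intros d Hd. apply rescaled_bounded_lipschitz; [lra|]. apply bound; assumption.
Qed.

Lemma rescaled_loc_lipschitz (k : nat) f (tau d : R) : Rabs tau <= 1 -> 0 < d <= 1 -> weighted_order 2 2 k f ->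
  loc_lipschitz (rescaled tau k f d).
Proof.
  intros Ht Hd Hf b. destruct (Hf (Rabs b + 1)) as [C [HC bound]]; [pose proof (Rabs_pos b); lra|]. exists C.
  apply (bounded_lipschitz_subset (box (Rabs b + 1))).
  - apply rescaled_bounded_lipschitz; [lra|]. apply bound; assumption.
  - intros x y z [Hx [Hy Hz]]. pose proof (Rle_abs b). repeat split; lra.
Qed.

(* [V - sg * K * s ^ 2] is a Lyapunov function for [sg = -1] and a Chetaev function for [sg = 1]. *)
Section SignedLyapunov.
Variables (F : R3 -> R3) (V : R -> R -> R) (K m r0 : R).
Hypothesis K_pos : 0 < K.
Hypothesis m_pos : 0 < m.
Hypothesis r0_range : 0 < r0 <= 1.

Definition planar_bounds : Prop := forall X, norm2 X <= r0 ^ 2 ->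
  let r2 := coord 0 X ^ 2 + coord 1 X ^ 2 in r2 / 4 <= V (coord 0 X) (coord 1 X) <= r2.

Definition signed_growth (sg : R) : Prop := forall phi t, sol_at F phi t -> norm2 (phi t) <= r0 ^ 2 ->
  exists l, is_derive (fun t => V (coord 0 (phi t)) (coord 1 (phi t)) - sg * K * coord 2 (phi t) ^ 2) t l /\
    m * ((coord 0 (phi t) ^ 2 + coord 1 (phi t) ^ 2) ^ 2 + coord 2 (phi t) ^ 2) <= sg * l.

Lemma norm2_le_1 X : norm2 X <= r0 ^ 2 -> norm2 X <= 1.
Proof. intros H. pose proof (pow_incr r0 1 2 ltac:(lra)). rewrite pow1 in *. lra. Qed.

Lemma signed_lyapunov_stable : planar_bounds -> signed_growth (-1) -> asympt_stable F (0, 0, 0).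
Proof.
  intros bounds growth. pose proof (pow2_ge_0 K) as K2. pose proof (Rmin_l (/ 4) K). pose proof (Rmin_r (/ 4) K).
  assert (c_pos : 0 < Rmin (/ 4) K) by (apply Rmin_glb_lt; lra). set (c := Rmin (/ 4) K) in *.
  apply (lyapunov_asympt_stable F (fun X => V (coord 0 X) (coord 1 X) - -1 * K * coord 2 X ^ 2) r0 c (1 + K)) with
    (c := m / (2 + 2 * K ^ 2)); try lra; [|apply Rdiv_lt_0_compat; lra|].
  - intros X HX. specialize (bounds X HX). cbv zeta in bounds. unfold norm2.
    pose proof (pow2_ge_0 (coord 0 X)). pose proof (pow2_ge_0 (coord 1 X)). pose proof (pow2_ge_0 (coord 2 X)).
    set (r2 := coord 0 X ^ 2 + coord 1 X ^ 2) in *. set (s2 := coord 2 X ^ 2) in *.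
    assert (c * r2 <= / 4 * r2) by (apply Rmult_le_compat_r; unfold r2; lra).
    assert (c * s2 <= K * s2) by (apply Rmult_le_compat_r; lra).
    assert (0 <= K * r2) by (apply Rmult_le_pos; unfold r2; lra). split; lra.
  - intros phi t Hphi Ht. destruct (growth phi t Hphi Ht) as [l [D Hl]]. specialize (bounds _ Ht). cbv zeta in bounds.
    exists l. split; [exact D|].
    apply norm2_le_1 in Ht. unfold norm2 in Ht. pose proof (pow2_ge_0 (coord 0 (phi t))).
    pose proof (pow2_ge_0 (coord 1 (phi t))).
    pose proof (pow2_ge_0 (coord 2 (phi t))). set (v := V (coord 0 (phi t)) (coord 1 (phi t))) in *.
    set (r2 := coord 0 (phi t) ^ 2 + coord 1 (phi t) ^ 2) in *. set (s2 := coord 2 (phi t) ^ 2) in *.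
    assert (0 <= K * s2) by (apply Rmult_le_pos; lra). assert (0 <= r2) by (unfold r2; lra).
    assert (square : (v - -1 * K * s2) ^ 2 <= (2 + 2 * K ^ 2) * (r2 ^ 2 + s2)).
    { apply Rle_trans with ((r2 + K * s2) ^ 2); [apply pow_incr; lra|].
      apply Rle_trans with (2 * r2 ^ 2 + 2 * K ^ 2 * (s2 * s2)); [pose proof (pow2_ge_0 (r2 - K * s2)); lra|].
      assert (K ^ 2 * (s2 * s2) <= K ^ 2 * (1 * s2))
        by (apply Rmult_le_compat_l, Rmult_le_compat_r; unfold r2 in *; lra).
      pose proof (Rmult_le_pos _ _ K2 (pow2_ge_0 r2)). lra. }
    apply (Rmult_le_compat_l (m / (2 + 2 * K ^ 2))) in square; [|left; apply Rdiv_lt_0_compat; lra].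
    replace (m / (2 + 2 * K ^ 2) * ((2 + 2 * K ^ 2) * (r2 ^ 2 + s2))) with (m * (r2 ^ 2 + s2)) in square
      by (field; lra).
    lra.
Qed.

Lemma signed_lyapunov_unstable : planar_bounds -> signed_growth 1 ->
  (forall X, exists phi, is_sol F phi /\ phi 0 = X) -> unstable_eq F (0, 0, 0).
Proof.
  intros bounds growth. apply (chetaev_unstable F (fun X => V (coord 0 X) (coord 1 X) - 1 * K * coord 2 X ^ 2) r0 1 m);
    try lra.
  - intros X HX. specialize (bounds X HX). cbv zeta in bounds. apply norm2_le_1 in HX. unfold norm2 in HX.
    pose proof (Rmult_le_pos _ _ (Rlt_le _ _ K_pos) (pow2_ge_0 (coord 2 X))). pose proof (pow2_ge_0 (coord 2 X)). lra.
  - intros phi t Hphi Ht. destruct (growth phi t Hphi Ht) as [l [D Hl]]. specialize (bounds _ Ht). cbv zeta in bounds.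
    exists l. split; [exact D|]. intros positive.
    set (r2 := coord 0 (phi t) ^ 2 + coord 1 (phi t) ^ 2) in *. set (v := V (coord 0 (phi t)) (coord 1 (phi t))) in *.
    set (s2 := coord 2 (phi t) ^ 2) in *. assert (0 <= s2) by apply pow2_ge_0.
    assert (0 <= K * s2) by (apply Rmult_le_pos; lra). pose proof (Rmult_le_pos m s2).
    assert (m * (v - 1 * K * s2) ^ 2 <= m * r2 ^ 2) by (apply Rmult_le_compat_l, pow_incr; lra). lra.
  - intros d Hd. set (x := Rmin (d / 2) r0). assert (Hx : 0 < x) by (apply Rmin_glb_lt; lra).
    pose proof (Rmin_l (d / 2) r0 : x <= d / 2). pose proof (Rmin_r (d / 2) r0 : x <= r0).
    exists (x, 0, 0). pose proof (pow_lt x 2 Hx).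
    assert (En : norm2 (x, 0, 0) = x ^ 2) by (unfold norm2; simpl; ring).
    destruct (bounds (x, 0, 0)) as [V_ge _]; [rewrite En; apply pow_incr; lra|]. simpl in V_ge |- *.
    rewrite En. split; [nra|lra].
Qed.

End SignedLyapunov.

(* The coefficients of [n * u], [n * v], [n * s], of the quadratic and cubic monomials in [u], [v], and of
   [u * s], [v * s]. *)
Record component_jet := ComponentJet {
  jet_nu : R; jet_nv : R; jet_ns : R;
  jet_uu : R; jet_uv : R; jet_vv : R;
  jet_uuu : R; jet_uuv : R; jet_uvv : R; jet_vvv : R;
  jet_us : R; jet_vs : R }.

Definition jet_linear (J : component_jet) (u v : R) : R := jet_nu J * u + jet_nv J * v.
Definition jet_quadratic (J : component_jet) (u v : R) : R := jet_uu J * u ^ 2 + jet_uv J * (u * v) + jet_vv J * v ^ 2.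
Definition jet_cubic (J : component_jet) (u v : R) : R :=
  jet_uuu J * u ^ 3 + jet_uuv J * (u ^ 2 * v) + jet_uvv J * (u * v ^ 2) + jet_vvv J * v ^ 3.
Definition jet_coupling (J : component_jet) (u v : R) : R := jet_us J * u + jet_vs J * v.
Definition jet (J : component_jet) (n u v s : R) : R :=
  n * jet_linear J u v + jet_quadratic J u v + jet_cubic J u v + s * jet_coupling J u v.
Definition jet_remainder (f : R -> R -> R -> R -> R) (J : component_jet) (n u v s : R) : R := f n u v s - jet J n u v s.
Definition linear_remainder (f : R -> R -> R -> R -> R) (c0 c1 c2 : R) (n u v s : R) : R :=
  f n u v s - n * (c0 * u + c1 * v + c2 * s).
Definition has_jet (f : R -> R -> R -> R -> R) (J : component_jet) : Prop :=
  weighted_order 2 2 4 (jet_remainder f J) /\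
  weighted_order 0 1 2 (linear_remainder f (jet_nu J) (jet_nv J) (jet_ns J)).

Lemma has_jet_order f J : has_jet f J -> weighted_order 2 2 2 f.
Proof.
  intros [H _]. apply (weighted_order_ext 2 2 2 (fun n u v s => jet_remainder f J n u v s + jet J n u v s));
    [|intros; unfold jet_remainder; ring].
  unfold jet, jet_linear, jet_quadratic, jet_cubic, jet_coupling. prove_weighted_order.
Qed.

Section HopfNormalForm.
Variables om lam : R.
Variables f g h : R -> R -> R -> R -> R.
Variables (Jf Jg : component_jet) (h_nu h_nv h_ns : R).
Hypothesis om_pos : 0 < om.
Hypothesis lam_pos : 0 < lam.
Hypothesis f_jet : has_jet f Jf.
Hypothesis g_jet : has_jet g Jg.
Hypothesis h_order : weighted_order 2 2 3 h.
Hypothesis h_linear : weighted_order 0 1 2 (linear_remainder h h_nu h_nv h_ns).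

Definition hopf_field (n : R) : R3 -> R3 :=
  field3 (fun u v s => - om * v + f n u v s) (fun u v s => om * u + g n u v s) (fun u v s => - lam * s + h n u v s).

(* The derivative with respect to [n] of the real part of the critical eigenvalues. *)
Definition crossing_speed : R := (jet_nu Jf + jet_nv Jg) / 2.

(* The action is corrected by cubic and quartic terms and by terms of order [n], so that its derivative along
   solutions becomes rotationally symmetric up to weighted order five. *)
Definition act_uuv : R := - jet_uu Jf / om.
Definition act_uvv : R := jet_vv Jg / om.
Definition act_uuu : R := (2 * act_uvv + (jet_uv Jf + jet_uu Jg) / om) / 3.
Definition act_vvv : R := (2 * act_uuv - (jet_vv Jf + jet_uv Jg) / om) / 3.
Definition cubic_u (u v : R) : R := 3 * act_uuu * u ^ 2 + 2 * act_uuv * (u * v) + act_uvv * v ^ 2.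
Definition cubic_v (u v : R) : R := act_uuv * u ^ 2 + 2 * act_uvv * (u * v) + 3 * act_vvv * v ^ 2.

Definition rate_uuuu : R := 3 * act_uuu * jet_uu Jf + act_uuv * jet_uu Jg + jet_uuu Jf.
Definition rate_uuuv : R := 3 * act_uuu * jet_uv Jf + 2 * act_uuv * jet_uu Jf + act_uuv * jet_uv Jg
  + 2 * act_uvv * jet_uu Jg + jet_uuv Jf + jet_uuu Jg.
Definition rate_uuvv : R := 3 * act_uuu * jet_vv Jf + 2 * act_uuv * jet_uv Jf + act_uvv * jet_uu Jf
  + act_uuv * jet_vv Jg + 2 * act_uvv * jet_uv Jg + 3 * act_vvv * jet_uu Jg + jet_uvv Jf + jet_uuv Jg.
Definition rate_uvvv : R := 2 * act_uuv * jet_vv Jf + act_uvv * jet_uv Jf + 2 * act_uvv * jet_vv Jg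
  + 3 * act_vvv * jet_uv Jg + jet_vvv Jf + jet_uvv Jg.
Definition rate_vvvv : R := act_uvv * jet_vv Jf + 3 * act_vvv * jet_vv Jg + jet_vvv Jg.

(* The average over the circle of the quartic form with the coefficients above; up to a positive factor the first
   Lyapunov coefficient. *)
Definition hopf_coefficient : R := (3 * rate_uuuu + rate_uuvv + 3 * rate_vvvv) / 8.

Definition act_uuuv : R := (hopf_coefficient - rate_uuuu) / om.
Definition act_uvvv : R := (rate_vvvv - hopf_coefficient) / om.
Definition act_uuuu : R := rate_uuuv / (4 * om).
Definition act_vvvv : R := - rate_uvvv / (4 * om).
Definition quartic_u (u v : R) : R := 4 * act_uuuu * u ^ 3 + 3 * act_uuuv * (u ^ 2 * v) + act_uvvv * v ^ 3.
Definition quartic_v (u v : R) : R := act_uuuv * u ^ 3 + 3 * act_uvvv * (u * v ^ 2) + 4 * act_vvvv * v ^ 3.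

Definition act_nuv : R := (crossing_speed - jet_nu Jf) / om.
Definition act_nvv : R := - (jet_nv Jf + jet_nu Jg) / (2 * om).

Definition correction (n u v : R) : R :=
  act_uuu * u ^ 3 + act_uuv * (u ^ 2 * v) + act_uvv * (u * v ^ 2) + act_vvv * v ^ 3
  + (act_uuuu * u ^ 4 + act_uuuv * (u ^ 3 * v) + act_uvvv * (u * v ^ 3) + act_vvvv * v ^ 4)
  + n * (act_nuv * (u * v) + act_nvv * v ^ 2).
Definition corrected_action (n u v : R) : R := action u v + correction n u v.
Definition corrected_action_u (n u v : R) : R := u + (cubic_u u v + quartic_u u v + n * (act_nuv * v)).
Definition corrected_action_v (n u v : R) : R :=
  v + (cubic_v u v + quartic_v u v + n * (act_nuv * u + 2 * act_nvv * v)).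
Definition action_rate (n u v s : R) : R :=
  corrected_action_u n u v * (- om * v + f n u v s) + corrected_action_v n u v * (om * u + g n u v s).
Definition s_coupling (u v : R) : R := jet_us Jf * u ^ 2 + (jet_vs Jf + jet_us Jg) * (u * v) + jet_vs Jg * v ^ 2.
Definition action_rate_error (n u v s : R) : R := action_rate n u v s
  - (n * crossing_speed * (u ^ 2 + v ^ 2) + hopf_coefficient * (u ^ 2 + v ^ 2) ^ 2 + s * s_coupling u v).

Lemma corrected_action_derive (n : R) (u v : R -> R) (t u' v' : R) : is_derive u t u' -> is_derive v t v' ->
  is_derive (fun t => corrected_action n (u t) (v t)) t
    (corrected_action_u n (u t) (v t) * u' + corrected_action_v n (u t) (v t) * v').
Proof.
  intros Du Dv. unfold corrected_action, action, correction. derive_with.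
  unfold corrected_action_u, corrected_action_v, cubic_u, cubic_v, quartic_u, quartic_v. field.
Qed.

Lemma homological_linear u v :
  om * (u * (act_nuv * u + 2 * act_nvv * v) - v * (act_nuv * v)) + u * jet_linear Jf u v + v * jet_linear Jg u v
  = crossing_speed * (u ^ 2 + v ^ 2).
Proof. unfold act_nuv, act_nvv, jet_linear, crossing_speed. field. lra. Qed.

Lemma homological_cubic u v :
  om * (u * cubic_v u v - v * cubic_u u v) + u * jet_quadratic Jf u v + v * jet_quadratic Jg u v = 0.
Proof. unfold cubic_v, cubic_u, jet_quadratic, act_uuu, act_vvv, act_uuv, act_uvv. field. lra. Qed.

Lemma homological_quartic u v : om * (u * quartic_v u v - v * quartic_u u v)
  + cubic_u u v * jet_quadratic Jf u v + cubic_v u v * jet_quadratic Jg u v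
  + u * jet_cubic Jf u v + v * jet_cubic Jg u v = hopf_coefficient * (u ^ 2 + v ^ 2) ^ 2.
Proof.
  assert (E : cubic_u u v * jet_quadratic Jf u v + cubic_v u v * jet_quadratic Jg u v
      + u * jet_cubic Jf u v + v * jet_cubic Jg u v
    = rate_uuuu * u ^ 4 + rate_uuuv * (u ^ 3 * v) + rate_uuvv * (u ^ 2 * v ^ 2) + rate_uvvv * (u * v ^ 3)
      + rate_vvvv * v ^ 4).
  { unfold cubic_u, cubic_v, jet_quadratic, jet_cubic, rate_uuuu, rate_uuuv, rate_uuvv, rate_uvvv, rate_vvvv. ring. }
  assert (average : rate_uuvv = 8 * hopf_coefficient - 3 * rate_uuuu - 3 * rate_vvvv)
    by (unfold hopf_coefficient; field).
  rewrite !Rplus_assoc, <- (Rplus_assoc (cubic_u u v * _)), <- (Rplus_assoc _ (u * jet_cubic Jf u v)), E, average.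
  unfold quartic_u, quartic_v, act_uuuv, act_uvvv, act_uuuu, act_vvvv. field. lra.
Qed.

Lemma action_rate_error_order : weighted_order 2 2 5 action_rate_error.
Proof.
  destruct f_jet as [Rf _], g_jet as [Rg _].
  apply (weighted_order_ext 2 2 5 (fun n u v s =>
      corrected_action_u n u v * jet_remainder f Jf n u v s + corrected_action_v n u v * jet_remainder g Jg n u v s
    + (cubic_u u v * (n * jet_linear Jf u v + jet_cubic Jf u v + s * jet_coupling Jf u v)
       + cubic_v u v * (n * jet_linear Jg u v + jet_cubic Jg u v + s * jet_coupling Jg u v)
       + (quartic_u u v + n * (act_nuv * v)) * jet Jf n u v s
       + (quartic_v u v + n * (act_nuv * u + 2 * act_nvv * v)) * jet Jg n u v s))).
  - unfold jet, jet_linear, jet_quadratic, jet_cubic, jet_coupling, corrected_action_u, corrected_action_v,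
      cubic_u, cubic_v, quartic_u, quartic_v. prove_weighted_order.
  - intros n u v s. unfold action_rate_error, action_rate, jet_remainder, corrected_action_u, corrected_action_v.
    pose proof (homological_linear u v) as E2. pose proof (homological_cubic u v) as E3.
    rewrite <- (homological_quartic u v), (Rmult_assoc n), <- E2. unfold jet, s_coupling, jet_coupling.
    match type of E3 with ?l = 0 => assert (E : l * 1 = 0) by (rewrite E3; ring) end.
    revert E. generalize (cubic_u u v) (cubic_v u v) (quartic_u u v) (quartic_v u v) (jet_linear Jf u v)
      (jet_linear Jg u v) (jet_quadratic Jf u v) (jet_quadratic Jg u v) (jet_cubic Jf u v) (jet_cubic Jg u v)
      (f n u v s) (g n u v s). intros. lra.
Qed.

Lemma correction_order : weighted_order 2 2 3 (fun n u v _ => correction n u v).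
Proof. unfold correction. prove_weighted_order. Qed.

Lemma Rabs_coord_le_root (X : R3) (e : R) : 0 <= e -> norm2 X <= e ^ 2 -> forall i, (i < 3)%nat ->
  Rabs (coord i X) <= e.
Proof.
  intros He HX i Hi. unfold norm2 in HX. pose proof (pow2_ge_0 (coord 0 X)). pose proof (pow2_ge_0 (coord 1 X)).
  pose proof (pow2_ge_0 (coord 2 X)). apply Rabs_le_of_pow2; [|exact He].
  destruct i as [|[|[|i]]]; [lra|lra|lra|lia].
Qed.

Lemma corrected_action_bounds : exists n0, 0 < n0 /\ forall n, Rabs n <= n0 ->
  at_right 0 (fun r => planar_bounds (corrected_action n) r).
Proof.
  set (higher := fun n u v _ : R => correction n u v - n * (act_nuv * (u * v) + act_nvv * v ^ 2)).
  assert (higher_order : weighted_order 0 1 3 higher).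
  { apply (weighted_order_ext 0 1 3 (fun _ u v _ => act_uuu * u ^ 3 + act_uuv * (u ^ 2 * v) + act_uvv * (u * v ^ 2)
      + act_vvv * v ^ 3 + (act_uuuu * u ^ 4 + act_uuuv * (u ^ 3 * v) + act_uvvv * (u * v ^ 3) + act_vvvv * v ^ 4)));
      [prove_weighted_order|]. intros. unfold higher, correction. ring. }
  destruct (weighted_order_bound 0 1 2 _ higher_order) as [C [HC bound]].
  set (M := Rabs act_nuv + Rabs act_nvv). pose proof (Rabs_pos act_nuv). pose proof (Rabs_pos act_nvv).
  destruct (at_right_0_elim _ (at_right_0_linear M (/ 8) ltac:(lra))) as [n0 [Hn0 M_small]].
  specialize (M_small n0 ltac:(lra)). exists n0. split; [lra|]. intros n Hn.
  destruct (at_right_0_elim _ (at_right_0_linear C (/ 8) ltac:(lra))) as [r0 [Hr0 C_small]].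
  apply (at_right_0_intro _ r0); [lra|]. intros r Hr X HX. cbv zeta. specialize (C_small r Hr).
  pose proof (Rabs_coord_le_root X r ltac:(lra) HX) as coord_le. unfold norm2 in HX.
  pose proof (pow2_ge_0 (coord 2 X)). set (u := coord 0 X) in *. set (v := coord 1 X) in *.
  set (r2 := u ^ 2 + v ^ 2) in *.
  pose proof (pow2_ge_0 u). pose proof (pow2_ge_0 v). assert (Hr2 : 0 <= r2) by (unfold r2; lra).
  set (e := sqrt r2). assert (He : 0 <= e) by apply sqrt_pos. assert (Ee : e ^ 2 = r2) by (apply pow2_sqrt, Hr2).
  assert (e_le : e <= r) by (rewrite <- (sqrt_pow2 r) by lra; apply sqrt_le_1_alt; lra).
  pose proof (bound n u v 0 e ltac:(lra) ltac:(simpl; lra) ltac:(apply Rabs_le_of_pow2; unfold r2 in Ee; lra)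
    ltac:(apply Rabs_le_of_pow2; unfold r2 in Ee; lra) ltac:(rewrite Rabs_R0, pow_1; exact He)) as B.
  assert (higher_le : Rabs (higher n u v 0) <= / 8 * r2).
  { eapply Rle_trans; [exact B|]. rewrite <- Ee. replace (C * e ^ 3) with (C * e * e ^ 2) by ring.
    apply Rmult_le_compat_r; [apply pow2_ge_0|]. pose proof (Rmult_le_compat_l C e r HC e_le). lra. }
  assert (n_part : Rabs (n * (act_nuv * (u * v) + act_nvv * v ^ 2)) <= / 8 * r2).
  { rewrite Rabs_mult. apply Rle_trans with (n0 * (M * r2)).
    - apply Rmult_le_compat; auto using Rabs_pos. eapply Rle_trans; [apply Rabs_triang|].
      rewrite !Rabs_mult, (Rabs_pos_eq (v ^ 2)) by assumption. pose proof (Rabs_mult_le_pow2 u v).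
      unfold M. rewrite Rmult_plus_distr_r. apply Rplus_le_compat; apply Rmult_le_compat_l; unfold r2; lra.
    - rewrite <- Rmult_assoc, (Rmult_comm n0). apply Rmult_le_compat_r; lra. }
  unfold corrected_action, action. fold r2.
  replace (correction n u v) with (higher n u v 0 + n * (act_nuv * (u * v) + act_nvv * v ^ 2)) by (unfold higher; ring).
  apply Rabs_le_between in higher_le. apply Rabs_le_between in n_part. lra.
Qed.

Lemma signed_growth_intro (n K m r sg : R) :
  (forall u v s, norm2 (u, v, s) <= r ^ 2 ->
    m * ((u ^ 2 + v ^ 2) ^ 2 + s ^ 2) <= sg * (action_rate n u v s - sg * K * (2 * s * (- lam * s + h n u v s)))) ->
  signed_growth (hopf_field n) (corrected_action n) K m r sg.
Proof.
  intros estimate phi t Hphi Ht. destruct (sol_at_coord _ _ _ Hphi) as [Du [Dv Ds]].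
  rewrite <- (R3_eta (phi t)) in Ht. eexists. split; [|exact (estimate _ _ _ Ht)].
  pose proof (corrected_action_derive n _ _ t _ _ Du Dv) as DW.
  set (W := fun t => corrected_action n (coord 0 (phi t)) (coord 1 (phi t))) in *.
  set (s := fun t => coord 2 (phi t)) in *.
  change (is_derive (fun t => W t - sg * K * s t ^ 2) t (action_rate n (coord 0 (phi t)) (coord 1 (phi t)) (s t)
    - sg * K * (2 * s t * (- lam * s t + h n (coord 0 (phi t)) (coord 1 (phi t)) (s t))))).
  assert (DW_t : is_derive W t (action_rate n (coord 0 (phi t)) (coord 1 (phi t)) (s t))) by exact DW.
  assert (Ds_t : is_derive s t (- lam * s t + h n (coord 0 (phi t)) (coord 1 (phi t)) (s t))) by exact Ds.
  clear DW Ds. derive_with. ring.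
Qed.

Lemma weighted_size_small (e : R) : 0 < e -> at_right 0 (fun r => forall u v s,
  norm2 (u, v, s) <= r ^ 2 -> sqrt (u ^ 2 + v ^ 2 + Rabs s) <= e).
Proof.
  intros He. destruct (at_right_0_elim _ (at_right_0_linear 2 (e ^ 2) (pow_lt _ _ He))) as [r0 [Hr0 small]].
  apply (at_right_0_intro _ r0); [lra|]. intros r Hr u v s H. specialize (small r Hr).
  pose proof (Rabs_coord_le_root (u, v, s) r ltac:(lra) H 2 ltac:(lia)) as Hs. unfold norm2 in H. simpl coord in *.
  pose proof (pow2_ge_0 s). pose proof (Rmult_le_compat_l r r 1 ltac:(lra) ltac:(lra)).
  rewrite <- (sqrt_pow2 e) by lra. apply sqrt_le_1_alt. lra.
Qed.

Lemma s_coupling_bound (a : R) : 0 < a -> exists c, 0 <= c /\ forall u v s,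
  Rabs (s * s_coupling u v) <= a * (u ^ 2 + v ^ 2) ^ 2 + c * s ^ 2.
Proof.
  intros Ha. set (M := Rabs (jet_us Jf) + Rabs (jet_vs Jf + jet_us Jg) + Rabs (jet_vs Jg)).
  exists (M ^ 2 / (4 * a)). split; [apply Rdiv_le_0_compat; [apply pow2_ge_0|lra]|]. intros u v s.
  pose proof (pow2_ge_0 u). pose proof (pow2_ge_0 v). pose proof (Rabs_mult_le_pow2 u v).
  assert (form : Rabs (s_coupling u v) <= M * (u ^ 2 + v ^ 2)).
  { unfold s_coupling, M. eapply Rle_trans; [apply Rabs_triang|].
    eapply Rle_trans; [apply Rplus_le_compat_r, Rabs_triang|].
    rewrite !Rabs_mult, (Rabs_pos_eq (u ^ 2)), (Rabs_pos_eq (v ^ 2)), !Rmult_plus_distr_r by assumption.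
    repeat apply Rplus_le_compat; apply Rmult_le_compat_l; try apply Rabs_pos; lra. }
  rewrite Rabs_mult, Rmult_comm, <- (pow2_abs s). apply Rle_trans with (M * ((u ^ 2 + v ^ 2) * Rabs s)).
  - rewrite <- Rmult_assoc. apply Rmult_le_compat_r; [apply Rabs_pos|exact form].
  - apply young; [exact Ha|]. right. field. lra.
Qed.

Lemma fifth_power_le (B m r2 s d : R) : 0 <= B -> 0 <= m -> 0 <= d -> d ^ 2 = r2 + Rabs s -> 2 * B * d <= m ->
  B * d ^ 5 <= m * (r2 ^ 2 + s ^ 2).
Proof.
  intros HB Hm Hd Ed small.
  assert (Ed4 : d ^ 4 <= 2 * (r2 ^ 2 + s ^ 2)).
  { replace (d ^ 4) with ((d ^ 2) ^ 2) by ring. rewrite Ed, <- (pow2_abs s). pose proof (pow2_ge_0 (r2 - Rabs s)).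
    lra. }
  replace (B * d ^ 5) with (/ 2 * (2 * B * d) * d ^ 4) by field.
  apply Rle_trans with (/ 2 * m * d ^ 4).
  - apply Rmult_le_compat_r; [apply pow_le, Hd|lra].
  - pose proof (Rmult_le_compat_l (/ 2 * m) _ _ ltac:(lra) Ed4). lra.
Qed.

Lemma critical_growth (sg : R) : sg * sg = 1 -> 0 < sg * hopf_coefficient ->
  exists K m, 0 < K /\ 0 < m /\ at_right 0 (fun r => signed_growth (hopf_field 0) (corrected_action 0) K m r sg).
Proof.
  intros Hsg Ha. set (a := sg * hopf_coefficient) in *.
  destruct (weighted_order_bound 2 2 4 _ action_rate_error_order) as [Ce [HCe error_le]].
  destruct (weighted_order_bound 2 2 2 _ h_order) as [Ch [HCh h_le]].
  destruct (s_coupling_bound (a / 4) ltac:(lra)) as [c [Hc coupling_le]].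
  set (K := (c + 1) / lam). assert (HK : 0 < K) by (apply Rdiv_lt_0_compat; lra).
  assert (EK : K * lam = c + 1) by (unfold K; field; lra).
  set (m := Rmin (a / 4) (/ 2)). assert (Hm : 0 < m) by (apply Rmin_glb_lt; lra).
  pose proof (Rmin_l (a / 4) (/ 2) : m <= a / 4). pose proof (Rmin_r (a / 4) (/ 2) : m <= / 2).
  exists K, m. split; [exact HK|split; [exact Hm|]].
  destruct (at_right_0_elim _ (at_right_0_linear (2 * (Ce + 2 * K * Ch)) m Hm)) as [d0 [Hd0 small]].
  generalize (weighted_size_small d0 (proj1 Hd0)). apply filter_imp. intros r size. apply signed_growth_intro.
  intros u v s Hn. specialize (size u v s Hn). pose proof (pow2_ge_0 u). pose proof (pow2_ge_0 v).
  pose proof (Rabs_pos s).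
  set (r2 := u ^ 2 + v ^ 2) in *. assert (Hr2 : 0 <= r2) by (unfold r2; lra).
  set (d := sqrt (r2 + Rabs s)) in *. assert (Hd : 0 <= d) by apply sqrt_pos.
  assert (Ed : d ^ 2 = r2 + Rabs s) by (apply pow2_sqrt; lra).
  assert (Hu : Rabs u <= d) by (apply Rabs_le_of_pow2; unfold r2 in Ed; lra).
  assert (Hv : Rabs v <= d) by (apply Rabs_le_of_pow2; unfold r2 in Ed; lra).
  assert (Hn0 : Rabs 0 <= d ^ 2) by (rewrite Rabs_R0; apply pow2_ge_0).
  pose proof (error_le 0 u v s d ltac:(lra) Hn0 Hu Hv ltac:(lra)) as error.
  pose proof (h_le 0 u v s d ltac:(lra) Hn0 Hu Hv ltac:(lra)) as h_cubic.
  assert (sh_le : Rabs (s * h 0 u v s) <= Ch * d ^ 5).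
  { rewrite Rabs_mult. replace (Ch * d ^ 5) with (d ^ 2 * (Ch * d ^ 3)) by ring.
    apply Rmult_le_compat; auto using Rabs_pos. lra. }
  pose proof (coupling_le u v s) as coupling. fold r2 in coupling.
  assert (fifth_order : (Ce + 2 * K * Ch) * d ^ 5 <= m * (r2 ^ 2 + s ^ 2)).
  { apply fifth_power_le; try assumption; [pose proof (Rmult_le_pos K Ch); lra|lra|].
    pose proof (small d0 ltac:(lra)). pose proof (Rmult_le_pos K Ch).
    pose proof (Rmult_le_compat_l (2 * (Ce + 2 * K * Ch)) d d0 ltac:(lra) size). lra. }
  pose proof (sign_mult_ge sg (action_rate_error 0 u v s) Hsg). pose proof (sign_mult_ge sg (s * s_coupling u v) Hsg).
  replace (sg * (action_rate 0 u v s - sg * K * (2 * s * (- lam * s + h 0 u v s))))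
    with (a * r2 ^ 2 + sg * (s * s_coupling u v) + sg * action_rate_error 0 u v s
          + (sg * sg) * (2 * (K * lam) * s ^ 2 - 2 * K * (s * h 0 u v s))) by (unfold action_rate_error, a, r2; ring).
  rewrite Hsg, EK. apply Rabs_le_between in sh_le.
  pose proof (Rmult_le_compat_l (2 * K) (s * h 0 u v s) (Ch * d ^ 5) ltac:(lra) ltac:(lra)).
  pose proof (pow2_ge_0 r2) as r4. pose proof (pow2_ge_0 s) as s2. pose proof (Rmult_le_pos _ _ Hc s2).
  pose proof (Rmult_le_compat_r (r2 ^ 2) m (a / 4) r4 ltac:(assumption)).
  pose proof (Rmult_le_compat_r (s ^ 2) m (/ 2) s2 ltac:(assumption)).
  pose proof (Rmult_le_pos a (r2 ^ 2)). lra.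
Qed.

Definition cross_terms (sg n u v s : R) : R :=
  s * ((jet_ns Jf - 2 * sg * h_nu) * u + (jet_ns Jg - 2 * sg * h_nv) * v + (- 2 * sg * h_ns) * s)
  + n * (act_nuv * v * (jet_nu Jf * u + jet_nv Jf * v + jet_ns Jf * s)
         + (act_nuv * u + 2 * act_nvv * v) * (jet_nu Jg * u + jet_nv Jg * v + jet_ns Jg * s)).

Definition noncritical_remainder (sg n u v s : R) : R :=
  action_rate n u v s - sg * (2 * s * h n u v s) - n * (crossing_speed * (u ^ 2 + v ^ 2) + cross_terms sg n u v s).

Lemma noncritical_remainder_order (sg : R) : weighted_order 0 1 3 (noncritical_remainder sg).
Proof.
  destruct f_jet as [_ Rf], g_jet as [_ Rg]. pose proof h_linear as Rh.
  set (Lf := fun n u v s => n * (jet_nu Jf * u + jet_nv Jf * v + jet_ns Jf * s)).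
  set (Lg := fun n u v s => n * (jet_nu Jg * u + jet_nv Jg * v + jet_ns Jg * s)).
  assert (Lf_order : weighted_order 0 1 1 Lf) by (unfold Lf; prove_weighted_order).
  assert (Lg_order : weighted_order 0 1 1 Lg) by (unfold Lg; prove_weighted_order).
  set (rf := linear_remainder f (jet_nu Jf) (jet_nv Jf) (jet_ns Jf)) in *.
  set (rg := linear_remainder g (jet_nu Jg) (jet_nv Jg) (jet_ns Jg)) in *.
  set (rh := linear_remainder h h_nu h_nv h_ns) in *.
  apply (weighted_order_ext 0 1 3 (fun n u v s =>
      (cubic_u u v + quartic_u u v) * (- om * v + Lf n u v s + rf n u v s) + (u + n * (act_nuv * v)) * rf n u v s
    + (cubic_v u v + quartic_v u v) * (om * u + Lg n u v s + rg n u v s)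
    + (v + n * (act_nuv * u + 2 * act_nvv * v)) * rg n u v s - sg * (2 * s * rh n u v s))).
  - unfold cubic_u, cubic_v, quartic_u, quartic_v. prove_weighted_order.
  - intros n u v s. unfold noncritical_remainder, cross_terms, action_rate, rf, rg, rh, linear_remainder, Lf, Lg,
      corrected_action_u, corrected_action_v.
    rewrite <- (homological_linear u v). unfold jet_linear. ring.
Qed.

Lemma cross_terms_bound : exists M, 0 < M /\ forall sg n u v s, sg * sg = 1 ->
  Rabs (cross_terms sg n u v s)
  <= M * (Rabs s * (Rabs u + Rabs v + Rabs s) + Rabs n * ((Rabs u + Rabs v) * (Rabs u + Rabs v + Rabs s))).
Proof.
  set (Mf := Rabs (jet_nu Jf) + Rabs (jet_nv Jf) + Rabs (jet_ns Jf)).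
  set (Mg := Rabs (jet_nu Jg) + Rabs (jet_nv Jg) + Rabs (jet_ns Jg)).
  set (Mh := Rabs h_nu + Rabs h_nv + Rabs h_ns). set (Ma := Rabs act_nuv + 2 * Rabs act_nvv).
  assert (nonneg : 0 <= Mf /\ 0 <= Mg /\ 0 <= Mh /\ 0 <= Ma).
  { unfold Mf, Mg, Mh, Ma. repeat split; repeat apply Rplus_le_le_0_compat; try apply Rabs_pos.
    pose proof (Rabs_pos act_nvv). lra. }
  exists (1 + Mf + Mg + 2 * Mh + Ma * (Mf + Mg)). pose proof (Rmult_le_pos Ma (Mf + Mg)). split; [lra|].
  intros sg n u v s Hsg. unfold cross_terms. pose proof (Rabs_pos u). pose proof (Rabs_pos v). pose proof (Rabs_pos s).
  set (q := Rabs u + Rabs v + Rabs s).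
  assert (s_row : Rabs ((jet_ns Jf - 2 * sg * h_nu) * u + (jet_ns Jg - 2 * sg * h_nv) * v + (- 2 * sg * h_ns) * s)
    <= (Mf + Mg + 2 * Mh) * q).
  { eapply Rle_trans; [apply Rabs_linear_form_le|]. apply Rmult_le_compat_r; [unfold q; lra|].
    assert (entry : forall x y, Rabs (x - 2 * sg * y) <= Rabs x + 2 * Rabs y).
    { intros x y. eapply Rle_trans; [apply Rabs_triang|]. rewrite Rabs_Ropp, Rmult_assoc, Rabs_mult, (Rabs_pos_eq 2),
        Rabs_sign_mult by (assumption || lra). lra. }
    pose proof (entry (jet_ns Jf) h_nu). pose proof (entry (jet_ns Jg) h_nv). pose proof (entry 0 h_ns) as last.
    rewrite Rabs_R0 in last. replace (0 - 2 * sg * h_ns) with (- 2 * sg * h_ns) in last by ring.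
    pose proof (Rabs_pos (jet_nu Jf)). pose proof (Rabs_pos (jet_nv Jf)).
    pose proof (Rabs_pos (jet_nu Jg)). pose proof (Rabs_pos (jet_nv Jg)). unfold Mf, Mg, Mh. lra. }
  assert (u_row : Rabs (act_nuv * v) <= Ma * (Rabs u + Rabs v)).
  { rewrite Rabs_mult. apply Rmult_le_compat; try apply Rabs_pos; [|lra]. unfold Ma. pose proof (Rabs_pos act_nvv).
    lra. }
  assert (v_row : Rabs (act_nuv * u + 2 * act_nvv * v) <= Ma * (Rabs u + Rabs v)).
  { pose proof (Rabs_linear_form_le act_nuv (2 * act_nvv) 0 u v 0) as L.
    rewrite Rmult_0_l, Rabs_R0, !Rplus_0_r, (Rabs_mult 2), (Rabs_pos_eq 2) in L by lra. exact L. }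
  set (M := 1 + Mf + Mg + 2 * Mh + Ma * (Mf + Mg)).
  eapply Rle_trans; [apply Rabs_triang|]. rewrite (Rmult_plus_distr_l M). apply Rplus_le_compat; rewrite Rabs_mult.
  - replace (M * (Rabs s * q)) with (Rabs s * (M * q)) by ring.
    apply Rmult_le_compat_l; [assumption|]. eapply Rle_trans; [exact s_row|].
    apply Rmult_le_compat_r; [unfold q|unfold M]; lra.
  - replace (M * (Rabs n * ((Rabs u + Rabs v) * q))) with (Rabs n * (M * ((Rabs u + Rabs v) * q))) by ring.
    apply Rmult_le_compat_l; [apply Rabs_pos|]. eapply Rle_trans; [apply Rabs_triang|]. rewrite !Rabs_mult.
    apply Rle_trans with (Ma * (Rabs u + Rabs v) * (Mf * q) + Ma * (Rabs u + Rabs v) * (Mg * q)).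
    + rewrite <- Rabs_mult. apply Rplus_le_compat; apply Rmult_le_compat; try apply Rabs_pos; try assumption;
        apply Rabs_linear_form_le.
    + assert (0 <= (Rabs u + Rabs v) * q) by (apply Rmult_le_pos; unfold q; lra).
      pose proof (Rmult_le_pos (1 + Mf + Mg + 2 * Mh) ((Rabs u + Rabs v) * q)). unfold M. lra.
Qed.

Lemma quadratic_estimate : crossing_speed <> 0 -> exists n0, 0 < n0 /\ forall n sg u v s,
  0 < Rabs n < n0 -> sg * sg = 1 -> 0 < sg * (n * crossing_speed) ->
  Rabs n * Rabs crossing_speed / 2 * (u ^ 2 + v ^ 2) + lam * s ^ 2
  <= sg * (n * (crossing_speed * (u ^ 2 + v ^ 2) + cross_terms sg n u v s)) + 2 * lam * s ^ 2.
Proof.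
  intros Hmu. pose proof (Rabs_pos_lt _ Hmu) as mu_pos. destruct cross_terms_bound as [M [HM cross_le]].
  set (mu := Rabs crossing_speed) in *. set (Z := 8 * M ^ 2 / mu + M).
  assert (mu_part : 0 < mu / 4) by lra.
  destruct (at_right_0_elim _ (filter_and _ _ (at_right_0_linear (4 * M) _ mu_part) (at_right_0_linear Z lam lam_pos)))
    as [n0 [Hn0 small]].
  exists n0. split; [lra|]. intros n sg u v s [Hn Hn_n0] Hsg Hpos. set (an := Rabs n) in *.
  destruct (small an ltac:(lra)) as [M_small Z_small].
  assert (main : sg * (n * crossing_speed) = an * mu).
  { rewrite <- (Rabs_pos_eq (sg * _)), Rabs_sign_mult, Rabs_mult by (assumption || lra). reflexivity. }
  pose proof (sign_mult_ge sg (n * cross_terms sg n u v s) Hsg) as cross_ge. rewrite Rabs_mult in cross_ge.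
  pose proof (cross_le sg n u v s Hsg) as cross. fold an in cross, cross_ge.
  pose proof (Rabs_pos u). pose proof (Rabs_pos v). pose proof (Rabs_pos s). rewrite <- (pow2_abs s).
  set (q := Rabs u + Rabs v) in *. set (t := Rabs s) in *. set (r2 := u ^ 2 + v ^ 2).
  assert (Hq : 0 <= q) by (unfold q; lra).
  assert (q_le : q ^ 2 <= 2 * r2).
  { unfold q, r2. rewrite <- (pow2_abs u), <- (pow2_abs v). pose proof (pow2_ge_0 (Rabs u - Rabs v)). lra. }
  assert (qt : 0 <= q * t) by (apply Rmult_le_pos; assumption). pose proof (pow2_ge_0 q). pose proof (pow2_ge_0 t).
  assert (mixed : M * 2 * (q * t) <= mu / 8 * q ^ 2 + 8 * M ^ 2 / mu * t ^ 2) by (apply young; [lra|right; field; lra]).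
  assert (bound : M * (t * (q + t) + an * (q * (q + t))) <= mu / 4 * r2 + 2 * M * an * r2 + Z * t ^ 2).
  { assert (an * (q * t) <= 1 * (q * t)) by (apply Rmult_le_compat_r; lra).
    assert (M * (an * (q * t)) <= M * (1 * (q * t))) by (apply Rmult_le_compat_l; lra).
    pose proof (Rmult_le_compat_l (M * an) _ _ ltac:(apply Rmult_le_pos; lra) q_le).
    pose proof (Rmult_le_compat_l (mu / 8) _ _ ltac:(lra) q_le). unfold Z. lra. }
  pose proof (Rmult_le_compat_l an _ _ ltac:(lra) (Rle_trans _ _ _ cross bound)) as total.
  assert (0 <= r2) by (unfold r2; pose proof (pow2_ge_0 u); pose proof (pow2_ge_0 v); lra).
  pose proof (Rmult_le_compat_r (an * r2) _ _ ltac:(apply Rmult_le_pos; lra) M_small).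
  pose proof (Rmult_le_compat_r (t ^ 2) _ _ ltac:(lra) Z_small).
  replace (sg * (n * (crossing_speed * r2 + cross_terms sg n u v s)))
    with (sg * (n * crossing_speed) * r2 + sg * (n * cross_terms sg n u v s)) by ring.
  rewrite main. pose proof (Rmult_le_pos (an * mu) r2 ltac:(apply Rmult_le_pos; lra)). lra.
Qed.

Lemma noncritical_growth : crossing_speed <> 0 -> exists n0, 0 < n0 <= 1 /\ forall n sg,
  0 < Rabs n < n0 -> sg * sg = 1 -> 0 < sg * (n * crossing_speed) ->
  exists m, 0 < m /\ at_right 0 (fun r => signed_growth (hopf_field n) (corrected_action n) 1 m r sg).
Proof.
  intros Hmu. pose proof (Rabs_pos_lt _ Hmu) as mu_pos.
  destruct (quadratic_estimate Hmu) as [n0 [Hn0 quadratic]]. pose proof (Rmin_l n0 1). pose proof (Rmin_r n0 1).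
  exists (Rmin n0 1). split; [split; [apply Rmin_glb_lt|]; lra|]. intros n sg Hn Hsg Hpos.
  destruct (weighted_order_bound 0 1 2 _ (noncritical_remainder_order sg)) as [C [HC bound]].
  set (m := Rmin (Rabs n * Rabs crossing_speed / 4) (lam / 2)).
  assert (Hm : 0 < m) by (apply Rmin_glb_lt; [pose proof (Rmult_lt_0_compat _ _ (proj1 Hn) mu_pos)|]; lra).
  pose proof (Rmin_l (Rabs n * Rabs crossing_speed / 4) (lam / 2) : m <= _) as m_n.
  pose proof (Rmin_r (Rabs n * Rabs crossing_speed / 4) (lam / 2) : m <= _) as m_lam.
  exists m. split; [exact Hm|]. destruct (at_right_0_elim _ (at_right_0_linear C m Hm)) as [r0 [Hr0 small]].
  apply (at_right_0_intro _ r0); [lra|]. intros r Hr. apply signed_growth_intro. intros u v s Hs.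
  pose proof (norm2_ge_0 (u, v, s)) as norm_pos. set (e := sqrt (norm2 (u, v, s))).
  assert (He : 0 <= e) by apply sqrt_pos. assert (Ee : e ^ 2 = norm2 (u, v, s)) by (apply pow2_sqrt, norm_pos).
  assert (e_r : e <= r) by (rewrite <- (sqrt_pow2 r) by lra; apply sqrt_le_1_alt, Hs).
  pose proof (Rabs_coord_le_root (u, v, s) e He ltac:(lra)) as coord_le.
  pose proof (bound n u v s e ltac:(lra) ltac:(simpl; lra) (coord_le 0%nat ltac:(lia)) (coord_le 1%nat ltac:(lia))
    ltac:(rewrite pow_1; exact (coord_le 2%nat ltac:(lia)))) as remainder.
  assert (cubic_small : C * e ^ 3 <= m * (u ^ 2 + v ^ 2 + s ^ 2)).
  { change (u ^ 2 + v ^ 2 + s ^ 2) with (norm2 (u, v, s)). rewrite <- Ee.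
    replace (C * e ^ 3) with (C * e * e ^ 2) by ring.
    apply Rmult_le_compat_r; [apply pow2_ge_0|]. pose proof (small r Hr). pose proof (Rmult_le_compat_l C e r HC e_r).
    lra. }
  pose proof (sign_mult_ge sg (noncritical_remainder sg n u v s) Hsg).
  specialize (quadratic n sg u v s ltac:(lra) Hsg Hpos).
  replace (sg * (action_rate n u v s - sg * 1 * (2 * s * (- lam * s + h n u v s))))
    with (sg * (n * (crossing_speed * (u ^ 2 + v ^ 2) + cross_terms sg n u v s)) + sg * noncritical_remainder sg n u v s
          + (sg * sg) * (2 * lam * s ^ 2)) by (unfold noncritical_remainder; ring).
  rewrite Hsg. unfold norm2 in Hs; simpl coord in Hs.
  pose proof (pow2_ge_0 u). pose proof (pow2_ge_0 v). pose proof (pow2_ge_0 s).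
  set (r2 := u ^ 2 + v ^ 2) in *. assert (Hr2 : 0 <= r2 <= 1) by (pose proof (pow_incr r 1 2 ltac:(lra)) as r_1;
    rewrite pow1 in r_1; unfold r2 in *; lra).
  pose proof (Rmult_le_compat_r r2 _ _ (proj1 Hr2) m_n). pose proof (Rmult_le_compat_r (s ^ 2) _ _ ltac:(lra) m_lam).
  pose proof (Rmult_le_compat_l m (r2 ^ 2) r2 ltac:(lra) ltac:(nra)). lra.
Qed.

Lemma critical_stable : hopf_coefficient < 0 -> asympt_stable (hopf_field 0) (0, 0, 0).
Proof.
  intros Ha. destruct (critical_growth (-1)) as [K [m [HK [Hm growth]]]]; [ring|lra|].
  destruct corrected_action_bounds as [n0 [Hn0 bounds]]. specialize (bounds 0 ltac:(rewrite Rabs_R0; lra)).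
  destruct (at_right_0_elim _ (filter_and _ _ bounds growth)) as [r0 [Hr0 both]].
  destruct (both r0 ltac:(lra)) as [B G]. exact (signed_lyapunov_stable _ _ K m r0 HK Hm Hr0 B G).
Qed.

Lemma critical_unstable : 0 < hopf_coefficient -> (forall X, exists phi, is_sol (hopf_field 0) phi /\ phi 0 = X) ->
  unstable_eq (hopf_field 0) (0, 0, 0).
Proof.
  intros Ha. destruct (critical_growth 1) as [K [m [HK [Hm growth]]]]; [ring|lra|].
  destruct corrected_action_bounds as [n0 [Hn0 bounds]]. specialize (bounds 0 ltac:(rewrite Rabs_R0; lra)).
  destruct (at_right_0_elim _ (filter_and _ _ bounds growth)) as [r0 [Hr0 both]].
  destruct (both r0 ltac:(lra)) as [B G]. exact (signed_lyapunov_unstable _ _ K m r0 HK Hm Hr0 B G).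
Qed.

Lemma noncritical_stability : crossing_speed <> 0 -> exists n0, 0 < n0 /\ forall n, 0 < Rabs n < n0 ->
  (n * crossing_speed < 0 -> asympt_stable (hopf_field n) (0, 0, 0)) /\
  (0 < n * crossing_speed -> (forall X, exists phi, is_sol (hopf_field n) phi /\ phi 0 = X) ->
     unstable_eq (hopf_field n) (0, 0, 0)).
Proof.
  intros Hmu. destruct corrected_action_bounds as [n1 [Hn1 bounds]], (noncritical_growth Hmu) as [n2 [Hn2 growth]].
  pose proof (Rmin_l n1 n2). pose proof (Rmin_r n1 n2).
  exists (Rmin n1 n2). split; [apply Rmin_glb_lt; lra|]. intros n Hn. specialize (bounds n ltac:(lra)).
  split; intros Hs.
  - destruct (growth n (-1)) as [m [Hm G]]; [lra|ring|lra|].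
    destruct (at_right_0_elim _ (filter_and _ _ bounds G)) as [r0 [Hr0 both]]. destruct (both r0 ltac:(lra)).
    apply (signed_lyapunov_stable _ (corrected_action n) 1 m r0); assumption || lra.
  - destruct (growth n 1) as [m [Hm G]]; [lra|ring|lra|].
    destruct (at_right_0_elim _ (filter_and _ _ bounds G)) as [r0 [Hr0 both]]. destruct (both r0 ltac:(lra)).
    apply (signed_lyapunov_unstable _ (corrected_action n) 1 m r0); assumption || lra.
Qed.

Definition diagonal (d0 d1 d2 : R) (i j : nat) : R :=
  match i, j with 0%nat, 0%nat => d0 | 1%nat, 1%nat => d1 | 2%nat, 2%nat => d2 | _, _ => 0 end.

Section Rescaling.
Variables tau rho0 d : R.
Hypothesis tau_le_1 : Rabs tau <= 1.
Hypothesis d_range : 0 < d <= 1.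
Hypothesis rho0_eq : 2 * hopf_coefficient * rho0 = - tau * crossing_speed.

Local Notation F1 := (scaled_f1 om (rescaled tau 2 f) d).
Local Notation F2 := (scaled_f2 om (rescaled tau 2 g) d).
Local Notation F3 := (scaled_f3 lam (rescaled tau 3 h) d).

Lemma rescaling_conjugacy : conjugacy (field3 F1 F2 F3) (hopf_field (tau * d ^ 2))
  (affine_map (0, 0, 0) (diagonal d d (d ^ 2))) (affine_map (0, 0, 0) (diagonal (/ d) (/ d) (/ d ^ 2))).
Proof.
  apply affine_conjugacy; intros X.
  - apply R3_ext; unfold affine_map, field3, linear_coord, diagonal; cbn [coord fst snd]; field; lra.
  - apply R3_ext; unfold affine_map, field3, linear_coord, diagonal; cbn [coord fst snd]; field; lra.
  - unfold hopf_field, affine_map, linear_map, field3, linear_coord, diagonal, scaled_f1, scaled_f2, scaled_f3,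
      rescaled.
    cbn [coord fst snd]. rewrite !Rplus_0_l, !Rmult_0_l, !Rplus_0_l, !Rplus_0_r.
    apply R3_ext; cbn [coord fst snd]; field; lra.
Qed.

Lemma rescaled_fields_loc_lipschitz : loc_lipschitz F1 /\ loc_lipschitz F2 /\ loc_lipschitz F3.
Proof.
  pose proof (rescaled_loc_lipschitz 2 f tau d tau_le_1 d_range (has_jet_order _ _ f_jet)).
  pose proof (rescaled_loc_lipschitz 2 g tau d tau_le_1 d_range (has_jet_order _ _ g_jet)).
  pose proof (rescaled_loc_lipschitz 3 h tau d tau_le_1 d_range h_order).
  unfold scaled_f1, scaled_f2, scaled_f3.
  split; [|split]; prove_loc_lipschitz.
Qed.

Lemma rescaled_action_derivative : derivative_along F1 F2 F3
  (scaled_w (rescaled tau 3 (fun n u v _ => correction n u v)) d)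
  (scaled_w' (2 * tau * crossing_speed) (4 * hopf_coefficient) rho0 (fun _ p q _ => s_coupling p q)
     (rescaled tau 5 action_rate_error) d).
Proof.
  intros p q s t Dp Dq Ds. set (n := tau * d ^ 2).
  assert (Du : is_derive (fun t => d * p t) t (- om * (d * q t) + f n (d * p t) (d * q t) (d ^ 2 * s t))).
  { derive_with. unfold scaled_f1, rescaled. fold n. field. lra. }
  assert (Dv : is_derive (fun t => d * q t) t (om * (d * p t) + g n (d * p t) (d * q t) (d ^ 2 * s t))).
  { derive_with. unfold scaled_f2, rescaled. fold n. field. lra. }
  pose proof (corrected_action_derive n _ _ t _ _ Du Dv) as DW. cbv beta in DW.
  fold (action_rate n (d * p t) (d * q t) (d ^ 2 * s t)) in DW.
  set (W := fun t => corrected_action n (d * p t) (d * q t)) in *.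
  assert (scaled : forall u, / d ^ 2 * W u
    = scaled_w (rescaled tau 3 (fun n u v _ => correction n u v)) d (p u) (q u) (s u)).
  { intros u. unfold scaled_w, rescaled, W, corrected_action, action. fold n. field. lra. }
  apply (is_derive_ext _ _ _ _ scaled).
  assert (DW_t : is_derive W t (action_rate n (d * p t) (d * q t) (d ^ 2 * s t))) by exact DW. clear DW.
  derive_with. unfold scaled_w', rescaled, action. fold n.
  set (P := p t). set (Q := q t). set (Z := s t). set (error := action_rate_error n (d * P) (d * Q) (d ^ 2 * Z)).
  replace (action_rate n (d * P) (d * Q) (d ^ 2 * Z)) with (n * crossing_speed * ((d * P) ^ 2 + (d * Q) ^ 2)
    + hopf_coefficient * ((d * P) ^ 2 + (d * Q) ^ 2) ^ 2 + d ^ 2 * Z * s_coupling (d * P) (d * Q) + error)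
    by (unfold error, action_rate_error; ring).
  unfold n, s_coupling.
  transitivity (d ^ 2 * (2 * (tau * crossing_speed) * ((P ^ 2 + Q ^ 2) / 2)
    + 4 * hopf_coefficient * ((P ^ 2 + Q ^ 2) / 2) ^ 2
    + (jet_us Jf * P ^ 2 + (jet_vs Jf + jet_us Jg) * (P * Q) + jet_vs Jg * Q ^ 2) * Z + d * (error * / d ^ 5)));
    [field; lra|].
  replace (2 * tau * crossing_speed) with (2 * (tau * crossing_speed)) by ring.
  replace (tau * crossing_speed) with (- (2 * hopf_coefficient * rho0)) by lra. ring.
Qed.

End Rescaling.

Lemma rescaled_orbit (tau rho0 b : R) : tau * tau = 1 -> 0 < rho0 -> 3 * rho0 <= b ^ 2 /\ 1 <= b ->
  2 * hopf_coefficient * rho0 = - tau * crossing_speed -> crossing_speed <> 0 ->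
  (forall n X, exists phi, is_sol (hopf_field n) phi /\ phi 0 = X) ->
  at_right 0 (fun d => exists gam T,
    let F := field3 (scaled_f1 om (rescaled tau 2 f) d) (scaled_f2 om (rescaled tau 2 g) d)
               (scaled_f3 lam (rescaled tau 3 h) d) in
    periodic_orbit F gam T /\ (0 < 2 * tau * crossing_speed -> orbit_asympt_stable F gam) /\
    (2 * tau * crossing_speed < 0 -> orbit_unstable F gam) /\ forall t, in_box b (gam t)).
Proof.
  intros Ht Hrho0 Hb Erho0 Hmu existence.
  assert (tau_le_1 : Rabs tau <= 1) by (pose proof (Rabs_sign_mult tau 1 Ht) as E;
    rewrite Rmult_1_r, Rabs_R1 in E; lra).
  assert (Hk : 2 * tau * crossing_speed <> 0).
  { assert (tau <> 0) by (intros E; rewrite E in Ht; lra).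
    apply Rmult_integral_contrapositive_currified; [|exact Hmu].
    apply Rmult_integral_contrapositive_currified; assumption || lra. }
  pose proof (scaled_hopf om lam (2 * tau * crossing_speed) (4 * hopf_coefficient) rho0 b
    (rescaled tau 2 f) (rescaled tau 2 g) (rescaled tau 3 h) (rescaled tau 3 (fun n u v _ => correction n u v))
    (fun _ p q _ => s_coupling p q) (rescaled tau 5 action_rate_error) om_pos lam_pos Hk Hrho0 Hb) as orbits.
  assert (coupling : eventually_lipschitz (box b) (fun _ p q _ => s_coupling p q)).
  { pose proof (eventually_lipschitz_box_coord b 0) as Up. pose proof (eventually_lipschitz_box_coord b 1) as Uq.
    simpl in Up, Uq. unfold s_coupling. simpl pow. prove_eventually_lipschitz. }
  specialize (orbits (rescaled_eventually_lipschitz 2 f tau b tau_le_1 ltac:(lra) (has_jet_order _ _ f_jet))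
    (rescaled_eventually_lipschitz 2 g tau b tau_le_1 ltac:(lra) (has_jet_order _ _ g_jet))
    (rescaled_eventually_lipschitz 3 h tau b tau_le_1 ltac:(lra) h_order)
    (rescaled_eventually_lipschitz 3 _ tau b tau_le_1 ltac:(lra) correction_order) coupling
    (rescaled_eventually_lipschitz 5 _ tau b tau_le_1 ltac:(lra) action_rate_error_order)).
  assert (range : at_right 0 (fun d => 0 < d <= 1)) by (apply (at_right_0_intro _ 1); [lra|auto]).
  generalize (filter_and _ _ range orbits). apply filter_imp. intros d [Hd orbit].
  destruct (rescaled_fields_loc_lipschitz tau d tau_le_1 Hd) as [L1 [L2 L3]].
  apply (orbit (rescaled_action_derivative tau rho0 d Hd Erho0) L1 L2 L3).
  exact (conjugacy_existence _ _ _ _ (conjugacy_sym _ _ _ _ (rescaling_conjugacy tau d Hd)) (existence _)).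
Qed.

Theorem hopf_orbit (tau : R) : tau * tau = 1 -> crossing_speed < 0 -> 0 < tau * hopf_coefficient ->
  (forall n X, exists phi, is_sol (hopf_field n) phi /\ phi 0 = X) ->
  forall eta, 0 < eta -> exists n0, 0 < n0 /\ forall n, 0 < tau * n < n0 ->
    exists (gam : R -> R3) (T : R), periodic_orbit (hopf_field n) gam T /\
      (tau < 0 -> orbit_asympt_stable (hopf_field n) gam) /\ (0 < tau -> orbit_unstable (hopf_field n) gam) /\
      forall t, dist3 (gam t) (0, 0, 0) < eta.
Proof.
  intros Ht Hmu Ha existence eta Heta. assert (tau_neq_0 : tau <> 0) by (intros E; rewrite E in Ht; lra).
  assert (a_neq_0 : hopf_coefficient <> 0) by (intros E; rewrite E in Ha; lra).
  set (rho0 := - crossing_speed / (2 * (tau * hopf_coefficient))).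
  assert (Hrho0 : 0 < rho0) by (apply Rdiv_lt_0_compat; lra).
  assert (Erho0 : 2 * hopf_coefficient * rho0 = - tau * crossing_speed).
  { apply (Rmult_eq_reg_l tau); [|exact tau_neq_0]. transitivity (- crossing_speed);
      [unfold rho0; field; auto|rewrite <- Rmult_assoc, Ropp_mult_distr_r_reverse, Ht; ring]. }
  set (b := 1 + 3 * rho0). assert (Hb : 3 * rho0 <= b ^ 2 /\ 1 <= b) by (unfold b; split; nra).
  assert (half : 0 < eta / 2) by lra.
  destruct (at_right_0_elim _ (filter_and _ _ (at_right_0_linear (3 * b) _ half)
    (rescaled_orbit tau rho0 b Ht Hrho0 Hb Erho0 ltac:(lra) existence))) as [d0 [Hd0 orbits]].
  exists (d0 ^ 2). split; [apply pow_lt; lra|]. intros n Hn. set (d := sqrt (tau * n)).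
  assert (Hd : 0 < d) by (apply sqrt_lt_R0; lra). assert (Ed : d ^ 2 = tau * n) by (apply pow2_sqrt; lra).
  assert (d_d0 : d <= d0) by (unfold d; rewrite <- (sqrt_pow2 d0) by lra; apply sqrt_le_1_alt; lra).
  assert (En : n = tau * d ^ 2) by (rewrite Ed, <- Rmult_assoc, Ht; ring). rewrite En.
  destruct (orbits d ltac:(lra)) as [small [gam [T [periodic [stable [unstable in_b]]]]]].
  pose proof (rescaling_conjugacy tau d ltac:(lra)) as conj.
  set (S := affine_map (0, 0, 0) (diagonal d d (d ^ 2))) in *.
  destruct (affine_map_in_box (0, 0, 0) (diagonal d d (d ^ 2)) b) as [b' Hb']. fold S in Hb'.
  exists (fun t => S (gam t)), T. split; [|split; [|split]].
  - exact (conjugacy_periodic_orbit _ _ _ _ conj gam T periodic).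
  - intros Hneg. apply (conjugacy_orbit_asympt_stable _ _ _ _ conj gam b b' in_b); [auto|]. apply stable. nra.
  - intros Hpos. apply (conjugacy_orbit_unstable _ _ _ _ gam b b' conj in_b); [auto|]. apply unstable. nra.
  - intros t. eapply Rle_lt_trans; [apply dist3_le_Rabs|]. destruct (in_b t) as [Bx [By Bz]].
    unfold S, affine_map, field3, linear_coord, diagonal. cbn [coord fst snd].
    rewrite !Rminus_0_r, !Rplus_0_l, !Rmult_0_l, !Rplus_0_l, !Rplus_0_r, !Rabs_mult, (Rabs_pos_eq d),
      (Rabs_pos_eq (d ^ 2)) by (apply pow2_ge_0 || lra).
    pose proof (Rmult_le_compat_l d _ _ ltac:(lra) Bx). pose proof (Rmult_le_compat_l d _ _ ltac:(lra) By).
    assert (d ^ 2 * Rabs (coord 2 (gam t)) <= d * b)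
      by (apply Rmult_le_compat; [apply pow2_ge_0|apply Rabs_pos|nra|exact Bz]).
    unfold coord in *. lra.
Qed.

End HopfNormalForm.

(** * An oscillator with integral feedback *)

Definition jet_plus (J J' : component_jet) : component_jet := ComponentJet
  (jet_nu J + jet_nu J') (jet_nv J + jet_nv J') (jet_ns J + jet_ns J')
  (jet_uu J + jet_uu J') (jet_uv J + jet_uv J') (jet_vv J + jet_vv J')
  (jet_uuu J + jet_uuu J') (jet_uuv J + jet_uuv J') (jet_uvv J + jet_uvv J') (jet_vvv J + jet_vvv J')
  (jet_us J + jet_us J') (jet_vs J + jet_vs J').

Definition jet_scal (c : R) (J : component_jet) : component_jet := ComponentJet
  (c * jet_nu J) (c * jet_nv J) (c * jet_ns J) (c * jet_uu J) (c * jet_uv J) (c * jet_vv J)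
  (c * jet_uuu J) (c * jet_uuv J) (c * jet_uvv J) (c * jet_vvv J) (c * jet_us J) (c * jet_vs J).

Lemma has_jet_plus f g Jf Jg : has_jet f Jf -> has_jet g Jg ->
  has_jet (fun n u v s => f n u v s + g n u v s) (jet_plus Jf Jg).
Proof.
  intros [Rf Lf] [Rg Lg]. split.
  - apply (weighted_order_ext 2 2 4 (fun n u v s => jet_remainder f Jf n u v s + jet_remainder g Jg n u v s));
      [prove_weighted_order|]. intros. unfold jet_remainder, jet, jet_linear, jet_quadratic, jet_cubic, jet_coupling.
      simpl. ring.
  - set (lf := linear_remainder f _ _ _) in *. set (lg := linear_remainder g _ _ _) in *.
    apply (weighted_order_ext 0 1 2 (fun n u v s => lf n u v s + lg n u v s)); [prove_weighted_order|].
    intros. unfold lf, lg, linear_remainder. simpl. ring.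
Qed.

Lemma has_jet_scal c f J : has_jet f J -> has_jet (fun n u v s => c * f n u v s) (jet_scal c J).
Proof.
  intros [Rf Lf]. split.
  - apply (weighted_order_ext 2 2 4 (fun n u v s => c * jet_remainder f J n u v s)); [prove_weighted_order|].
    intros. unfold jet_remainder, jet, jet_linear, jet_quadratic, jet_cubic, jet_coupling. simpl. ring.
  - set (lf := linear_remainder f _ _ _) in *.
    apply (weighted_order_ext 0 1 2 (fun n u v s => c * lf n u v s)); [prove_weighted_order|].
    intros. unfold lf, linear_remainder. simpl. ring.
Qed.

Record force_jet := ForceJet {
  force_xx : R; force_xz : R; force_zz : R; force_xxx : R; force_xxz : R; force_xzz : R }.

Definition force_polynomial (J : force_jet) (x z : R) : R :=
  force_xx J * x ^ 2 + force_xz J * (x * z) + force_zz J * z ^ 2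
  + (force_xxx J * x ^ 3 + force_xxz J * (x ^ 2 * z) + force_xzz J * (x * z ^ 2)).

Definition fourth_order (f : R -> R -> R) : Prop := forall wn wS X Z,
  weighted_order wn wS 1 X -> weighted_order wn wS 1 Z ->
  weighted_order wn wS 4 (fun n u v s => f (X n u v s) (Z n u v s)).

Definition has_force_jet (f : R -> R -> R) (J : force_jet) : Prop :=
  fourth_order (fun x z => f x z - force_polynomial J x z).

(* In terms of the deviations [x], [z] from an equilibrium and the velocity [y], the system is
   [x' = y], [y' = - om ^ 2 * x + lam * om / eta * z - (lam + n) * y + G x z], [z' = - eta * om * x + K x z]. At [n = 0]
   the linear part has the eigenvalues [+- i om] and [- lam]. *)
Section IntegralFeedback.
Variables om lam eta : R.
Variables G K : R -> R -> R.
Variables JG JK : force_jet.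
Hypothesis om_pos : 0 < om.
Hypothesis lam_pos : 0 < lam.
Hypothesis eta_pos : 0 < eta.
Hypothesis G_jet : has_force_jet G JG.
Hypothesis K_jet : has_force_jet K JK.

Local Notation D := (lam ^ 2 + om ^ 2).

(* The components of the vector [(0, y, z)] in the coordinates [u], [v], [s] are combinations of [z] and [y]. *)
Definition u_of_z : R := lam ^ 2 / (eta * D).
Definition u_of_y : R := om / D.
Definition v_of_z : R := - (lam * om) / (eta * D).
Definition v_of_y : R := lam / D.
Definition s_of_z : R := om / (eta * D).
Definition s_of_y : R := - / D.

Definition slow_uu : R := (s_of_z * force_zz JK + s_of_y * force_zz JG) * eta ^ 2.
Definition slow_uv : R := (s_of_z * force_xz JK + s_of_y * force_xz JG) * eta.
Definition slow_vv : R := s_of_z * force_xx JK + s_of_y * force_xx JG.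

Definition manifold_uv : R := (lam * slow_uv + 2 * om * (slow_uu - slow_vv)) / (lam ^ 2 + 4 * om ^ 2).
Definition manifold_uu : R := (slow_uu - om * manifold_uv) / lam.
Definition manifold_vv : R := (slow_vv + om * manifold_uv) / lam.

(* The quadratic part of the centre manifold [s = manifold u v]. *)
Definition manifold (u v : R) : R := manifold_uu * u ^ 2 + manifold_uv * (u * v) + manifold_vv * v ^ 2.
Definition manifold_u (u v : R) : R := 2 * manifold_uu * u + manifold_uv * v.
Definition manifold_v (u v : R) : R := manifold_uv * u + 2 * manifold_vv * v.

Definition x_of (u v s : R) : R := v + lam * s.
Definition y_of (u v s : R) : R := om * u - lam ^ 2 * s.
Definition z_of (u v s : R) : R := eta * u + eta * om * s.

Definition y_force (n u v s : R) : R := G (x_of u v s) (z_of u v s) - n * y_of u v s.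
Definition z_force (u v s : R) : R := K (x_of u v s) (z_of u v s).
Definition projected (cz cy n u v s : R) : R := cz * z_force u v s + cy * y_force n u v s.
Definition u_force (n u v S : R) : R := projected u_of_z u_of_y n u v (S + manifold u v).
Definition v_force (n u v S : R) : R := projected v_of_z v_of_y n u v (S + manifold u v).
Definition s_force (n u v S : R) : R := - lam * manifold u v + projected s_of_z s_of_y n u v (S + manifold u v)
  - manifold_u u v * (- om * v + u_force n u v S) - manifold_v u v * (om * u + v_force n u v S).

(* The jet of a force, evaluated at the point [(u, v, S + manifold u v)]. *)
Definition normal_jet (J : force_jet) : component_jet :=
  let us := force_xz J * lam * eta + 2 * force_zz J * eta ^ 2 * om in
  let vs := 2 * force_xx J * lam + force_xz J * eta * om in
  ComponentJet 0 0 0 (force_zz J * eta ^ 2) (force_xz J * eta) (force_xx J)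
    (us * manifold_uu) (us * manifold_uv + vs * manifold_uu + force_xzz J * eta ^ 2)
    (us * manifold_vv + vs * manifold_uv + force_xxz J * eta) (vs * manifold_vv + force_xxx J) us vs.

Definition damping_jet : component_jet := ComponentJet (- om) 0 (lam ^ 2) 0 0 0 0 0 0 0 0 0.

Definition projected_jet (cz cy : R) : component_jet :=
  jet_plus (jet_scal cz (normal_jet JK)) (jet_scal cy (jet_plus (normal_jet JG) damping_jet)).

Definition u_jet : component_jet := projected_jet u_of_z u_of_y.
Definition v_jet : component_jet := projected_jet v_of_z v_of_y.

Lemma manifold_homological u v : - lam * manifold u v + (slow_uu * u ^ 2 + slow_uv * (u * v) + slow_vv * v ^ 2)
  + om * (manifold_u u v * v - manifold_v u v * u) = 0.
Proof.
  assert (0 < lam ^ 2 + 4 * om ^ 2) by (pose proof (pow_lt lam 2 lam_pos); pose proof (pow_lt om 2 om_pos); lra).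
  unfold manifold, manifold_u, manifold_v, manifold_uu, manifold_vv, manifold_uv.
  generalize slow_uu slow_uv slow_vv. intros. field. lra.
Qed.

Lemma has_jet_force f J : has_force_jet f J ->
  has_jet (fun _ u v S => f (x_of u v (S + manifold u v)) (z_of u v (S + manifold u v))) (normal_jet J).
Proof.
  intros HF. set (s := fun n u v S : R => S + manifold u v).
  set (X := fun n u v S => v + lam * s n u v S). set (Z := fun n u v S => eta * u + eta * om * s n u v S).
  split.
  - assert (s_order : weighted_order 2 2 2 s) by (unfold s, manifold; prove_weighted_order).
    assert (X_order : weighted_order 2 2 1 X) by (unfold X; prove_weighted_order).
    assert (Z_order : weighted_order 2 2 1 Z) by (unfold Z; prove_weighted_order).
    pose proof (HF 2%nat 2%nat X Z X_order Z_order) as rem_order.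
    cbv beta in rem_order.
    set (rem := fun n u v S : R => f (X n u v S) (Z n u v S) - force_polynomial J (X n u v S) (Z n u v S)) in rem_order.
    apply (weighted_order_ext 2 2 4 (fun n u v S => rem n u v S
      + s n u v S ^ 2 * (force_xx J * lam ^ 2 + force_xz J * (lam * (eta * om)) + force_zz J * (eta * om) ^ 2)
      + force_xxx J * (lam * s n u v S * (X n u v S ^ 2 + X n u v S * v + v ^ 2))
      + force_xxz J * (X n u v S ^ 2 * (eta * om * s n u v S) + eta * u * (lam * s n u v S) * (X n u v S + v))
      + force_xzz J * (lam * s n u v S * Z n u v S ^ 2 + v * (eta * om * s n u v S) * (Z n u v S + eta * u))));
      [prove_weighted_order|].
    intros n u v S. unfold rem, jet_remainder, x_of, z_of, jet, jet_linear, jet_quadratic, jet_cubic, jet_coupling,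
      force_polynomial, normal_jet, X, Z, s, manifold.
    cbn [jet_nu jet_nv jet_uu jet_uv jet_vv jet_uuu jet_uuv jet_uvv jet_vvv jet_us jet_vs]. ring.
  - assert (X_order : weighted_order 0 1 1 X) by (unfold X, s, manifold; prove_weighted_order).
    assert (Z_order : weighted_order 0 1 1 Z) by (unfold Z, s, manifold; prove_weighted_order).
    pose proof (HF 0%nat 1%nat X Z X_order Z_order) as rem_order.
    cbv beta in rem_order.
    set (rem := fun n u v S : R => f (X n u v S) (Z n u v S) - force_polynomial J (X n u v S) (Z n u v S)) in rem_order.
    apply (weighted_order_ext 0 1 2 (fun n u v S => rem n u v S
      + (force_xx J * X n u v S ^ 2 + force_xz J * (X n u v S * Z n u v S) + force_zz J * Z n u v S ^ 2
         + (force_xxx J * X n u v S ^ 3 + force_xxz J * (X n u v S ^ 2 * Z n u v S)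
            + force_xzz J * (X n u v S * Z n u v S ^ 2))))); [prove_weighted_order|].
    intros n u v S. unfold rem, linear_remainder, force_polynomial. simpl. unfold x_of, z_of, X, Z, s. ring.
Qed.

Lemma has_jet_damping : has_jet (fun n u v S => - n * y_of u v (S + manifold u v)) damping_jet.
Proof.
  split.
  - apply (weighted_order_ext 2 2 4 (fun n u v S => n * (lam ^ 2 * (S + (manifold_uu * u ^ 2 + manifold_uv * (u * v)
      + manifold_vv * v ^ 2))))); [prove_weighted_order|].
    intros. unfold jet_remainder, jet, jet_linear, jet_quadratic, jet_cubic, jet_coupling, y_of, manifold. simpl. ring.
  - apply (weighted_order_ext 0 1 2 (fun n u v S => n * (lam ^ 2 * (manifold_uu * u ^ 2 + manifold_uv * (u * v)
      + manifold_vv * v ^ 2)))); [prove_weighted_order|].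
    intros. unfold linear_remainder, y_of, manifold. simpl. ring.
Qed.

Lemma has_jet_ext f g J : (forall n u v s, f n u v s = g n u v s) -> has_jet f J -> has_jet g J.
Proof.
  intros E [H L]. split; [apply (weighted_order_ext _ _ _ _ _ H)|apply (weighted_order_ext _ _ _ _ _ L)];
    intros; unfold jet_remainder, linear_remainder; rewrite E; reflexivity.
Qed.

Lemma has_jet_projected cz cy :
  has_jet (fun n u v S => projected cz cy n u v (S + manifold u v)) (projected_jet cz cy).
Proof.
  pose proof (has_jet_plus _ _ _ _ (has_jet_force _ _ G_jet) has_jet_damping) as Y.
  pose proof (has_jet_force _ _ K_jet) as Z.
  apply (has_jet_ext _ _ _) with (2 := has_jet_plus _ _ _ _ (has_jet_scal cz _ _ Z) (has_jet_scal cy _ _ Y)).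
  intros. unfold projected, y_force, z_force. ring.
Qed.

Lemma s_force_order : weighted_order 2 2 3 s_force.
Proof.
  pose proof (has_jet_order _ _ (has_jet_projected u_of_z u_of_y) : weighted_order 2 2 2 u_force) as Hu.
  pose proof (has_jet_order _ _ (has_jet_projected v_of_z v_of_y) : weighted_order 2 2 2 v_force) as Hv.
  destruct (has_jet_projected s_of_z s_of_y) as [Hs _]. set (P := projected_jet s_of_z s_of_y) in *.
  set (rem := jet_remainder _ _) in Hs.
  apply (weighted_order_ext 2 2 3 (fun n u v S => rem n u v S
    + n * (jet_nu P * u + jet_nv P * v) + (jet_uuu P * u ^ 3 + jet_uuv P * (u ^ 2 * v) + jet_uvv P * (u * v ^ 2)
      + jet_vvv P * v ^ 3) + S * (jet_us P * u + jet_vs P * v)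
    - (2 * manifold_uu * u + manifold_uv * v) * u_force n u v S
    - (manifold_uv * u + 2 * manifold_vv * v) * v_force n u v S)); [prove_weighted_order|].
  intros n u v S. unfold s_force.
  assert (E : - lam * manifold u v = - (slow_uu * u ^ 2 + slow_uv * (u * v) + slow_vv * v ^ 2)
    - om * (manifold_u u v * v - manifold_v u v * u)) by (pose proof (manifold_homological u v); lra).
  rewrite E. unfold rem, jet_remainder, jet, jet_linear, jet_quadratic, jet_cubic, jet_coupling, manifold_u, manifold_v.
  replace (jet_uu P) with slow_uu by (unfold P; simpl; unfold slow_uu; ring).
  replace (jet_uv P) with slow_uv by (unfold P; simpl; unfold slow_uv; ring).
  replace (jet_vv P) with slow_vv by (unfold P; simpl; unfold slow_vv; ring). ring.
Qed.

Lemma s_force_linear : weighted_order 0 1 2 (linear_remainder s_force (s_of_y * - om) 0 (s_of_y * lam ^ 2)).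
Proof.
  destruct (has_jet_projected u_of_z u_of_y) as [_ Hu], (has_jet_projected v_of_z v_of_y) as [_ Hv].
  destruct (has_jet_projected s_of_z s_of_y) as [_ Hs].
  fold u_force in Hu. fold v_force in Hv. fold u_jet in Hu. fold v_jet in Hv.
  set (ru := linear_remainder u_force _ _ _) in Hu. set (rv := linear_remainder v_force _ _ _) in Hv.
  set (rs := linear_remainder _ _ _ _) in Hs.
  apply (weighted_order_ext 0 1 2 (fun n u v S => rs n u v S
    - lam * (manifold_uu * u ^ 2 + manifold_uv * (u * v) + manifold_vv * v ^ 2)
    - (2 * manifold_uu * u + manifold_uv * v)
      * (- om * v + (ru n u v S + n * (jet_nu u_jet * u + jet_nv u_jet * v + jet_ns u_jet * S)))
    - (manifold_uv * u + 2 * manifold_vv * v)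
      * (om * u + (rv n u v S + n * (jet_nu v_jet * u + jet_nv v_jet * v + jet_ns v_jet * S)))));
    [prove_weighted_order|].
  intros. unfold rs, ru, rv, s_force, linear_remainder, manifold, manifold_u, manifold_v. simpl. ring.
Qed.

Definition projected_field (n : R) : R3 -> R3 := field3
  (fun u v s => - om * v + projected u_of_z u_of_y n u v s)
  (fun u v s => om * u + projected v_of_z v_of_y n u v s)
  (fun u v s => - lam * s + projected s_of_z s_of_y n u v s).

Definition normal_field (n : R) : R3 -> R3 := hopf_field om lam u_force v_force s_force n.

Lemma normal_conjugacy n :
  conjugacy (normal_field n) (projected_field n) (shear manifold) (shear (fun u v => - manifold u v)).
Proof.
  apply (shear_conjugacy manifold manifold_u manifold_v).
  - unfold manifold. prove_loc_lipschitz.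
  - intros u v t lu lv Du Dv. unfold manifold, manifold_u, manifold_v. derive_with. ring.
  - intros [[u v] S]. unfold normal_field, hopf_field, projected_field, shear, field3. cbn [coord fst snd].
    unfold s_force, u_force, v_force. f_equal. ring.
Qed.

Definition from_normal (i j : nat) : R :=
  match i, j with
  | 0%nat, 1%nat => 1 | 0%nat, 2%nat => lam
  | 1%nat, 0%nat => om | 1%nat, 2%nat => - lam ^ 2
  | 2%nat, 0%nat => eta | 2%nat, 2%nat => eta * om
  | _, _ => 0
  end.

Definition to_normal (i j : nat) : R :=
  match i, j with
  | 0%nat, 1%nat => u_of_y | 0%nat, 2%nat => u_of_z
  | 1%nat, 0%nat => 1 | 1%nat, 1%nat => v_of_y | 1%nat, 2%nat => v_of_z
  | 2%nat, 1%nat => s_of_y | 2%nat, 2%nat => s_of_z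
  | _, _ => 0
  end.

Variable F : R -> R3 -> R3.
Variable c : R3.
Hypothesis F_expansion : forall eps x y z, F eps (coord 0 c + x, coord 1 c + y, coord 2 c + z) =
  (y, - om ^ 2 * x + lam * om / eta * z - eps * y + G x z, - eta * om * x + K x z).
Hypothesis F_existence : forall eps X, exists phi, is_sol (F eps) phi /\ phi 0 = X.

Let shift : R3 := let X := linear_map to_normal c in (- coord 0 X, - coord 1 X, - coord 2 X).

Lemma linear_part_conjugacy n :
  conjugacy (projected_field n) (F (lam + n)) (affine_map c from_normal) (affine_map shift to_normal).
Proof.
  pose proof (sum_pow2_pos lam om om_pos).
  apply affine_conjugacy.
  - intros [[u v] s].
    unfold affine_map, shift, linear_map, field3, linear_coord, to_normal, from_normal, coord, fst, snd.
    unfold u_of_y, u_of_z, v_of_y, v_of_z, s_of_y, s_of_z. f_equal; [f_equal|]; field; lra.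
  - intros [[x y] z].
    unfold affine_map, shift, linear_map, field3, linear_coord, to_normal, from_normal, coord, fst, snd.
    unfold u_of_y, u_of_z, v_of_y, v_of_z, s_of_y, s_of_z. f_equal; [f_equal|]; field; lra.
  - intros [[u v] s]. unfold affine_map at 1, field3 at 1. rewrite F_expansion.
    unfold projected_field, linear_map, field3, linear_coord, from_normal, projected, y_force, z_force, coord, fst, snd.
    replace (0 * u + 1 * v + lam * s) with (x_of u v s) by (unfold x_of; ring).
    replace (om * u + 0 * v + - lam ^ 2 * s) with (y_of u v s) by (unfold y_of; ring).
    replace (eta * u + 0 * v + eta * om * s) with (z_of u v s) by (unfold z_of; ring).
    generalize (G (x_of u v s) (z_of u v s)) (K (x_of u v s) (z_of u v s)). intros.
    unfold u_of_y, u_of_z, v_of_y, v_of_z, s_of_y, s_of_z, x_of, y_of, z_of.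
    f_equal; [f_equal|]; field; lra.
Qed.

Definition coordinates (X : R3) : R3 := affine_map c from_normal (shear manifold X).
Definition normal_coordinates (X : R3) : R3 := shear (fun u v => - manifold u v) (affine_map shift to_normal X).

Lemma coordinates_conjugacy n : conjugacy (normal_field n) (F (lam + n)) coordinates normal_coordinates.
Proof.
  apply (conjugacy_trans _ (projected_field n) _ (shear manifold) (shear (fun u v => - manifold u v))
    (affine_map c from_normal) (affine_map shift to_normal)).
  - intros b. apply shear_in_box. unfold manifold. prove_loc_lipschitz.
  - apply affine_map_in_box.
  - apply normal_conjugacy.
  - apply linear_part_conjugacy.
Qed.

Lemma coordinates_origin : coordinates (0, 0, 0) = c.
Proof.
  unfold coordinates, shear, affine_map, field3, linear_coord, from_normal, manifold. cbn [coord fst snd].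
  apply R3_ext; cbn [coord fst snd]; ring.
Qed.

Lemma normal_field_existence n X : exists phi, is_sol (normal_field n) phi /\ phi 0 = X.
Proof. apply (conjugacy_existence _ _ _ _ (conjugacy_sym _ _ _ _ (coordinates_conjugacy n))), F_existence. Qed.

Lemma u_force_jet : has_jet u_force u_jet.
Proof. apply has_jet_projected. Qed.

Lemma v_force_jet : has_jet v_force v_jet.
Proof. apply has_jet_projected. Qed.

Lemma crossing_speed_neg : crossing_speed u_jet v_jet < 0.
Proof.
  pose proof (sum_pow2_pos lam om om_pos). pose proof (pow_lt om 2 om_pos).
  assert (E : crossing_speed u_jet v_jet = - (om ^ 2 / (2 * D))).
  { unfold crossing_speed. cbn. unfold u_of_z, u_of_y, v_of_z, v_of_y. field. lra. }
  rewrite E. apply Ropp_lt_gt_0_contravar, Rdiv_lt_0_compat; lra.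
Qed.

Lemma critical_equilibrium_stable : hopf_coefficient om u_jet v_jet < 0 -> asympt_stable (F lam) c.
Proof.
  intros neg. rewrite <- coordinates_origin, <- (Rplus_0_r lam).
  apply (conjugacy_asympt_stable _ _ _ _ (coordinates_conjugacy 0)).
  exact (critical_stable _ _ _ _ _ _ _ om_pos lam_pos u_force_jet v_force_jet s_force_order neg).
Qed.

Lemma critical_equilibrium_unstable : 0 < hopf_coefficient om u_jet v_jet -> unstable_eq (F lam) c.
Proof.
  intros pos. rewrite <- coordinates_origin, <- (Rplus_0_r lam).
  apply (conjugacy_unstable_eq _ _ _ _ _ (coordinates_conjugacy 0)).
  apply (critical_unstable _ _ _ _ _ _ _ om_pos lam_pos u_force_jet v_force_jet s_force_order pos),
    normal_field_existence.
Qed.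

Lemma noncritical_equilibrium : exists n0, 0 < n0 /\ forall eps, Rabs (eps - lam) < n0 ->
  (lam < eps -> asympt_stable (F eps) c) /\ (eps < lam -> unstable_eq (F eps) c).
Proof.
  pose proof crossing_speed_neg as speed_neg.
  destruct (noncritical_stability _ _ _ _ _ _ _ _ _ _ om_pos lam_pos u_force_jet v_force_jet s_force_linear
    ltac:(lra)) as [n0 [n0_pos H]].
  exists n0. split; [exact n0_pos|]. intros eps Heps.
  rewrite <- coordinates_origin. replace eps with (lam + (eps - lam)) by ring. split; intros Hlt.
  - apply (conjugacy_asympt_stable _ _ _ _ (coordinates_conjugacy (eps - lam))), H; [|nra].
    split; [apply Rabs_pos_lt; lra|exact Heps].
  - apply (conjugacy_unstable_eq _ _ _ _ _ (coordinates_conjugacy (eps - lam))), H;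
      [|nra|apply normal_field_existence]. split; [apply Rabs_pos_lt; lra|exact Heps].
Qed.

Lemma bifurcating_orbit tau : tau * tau = 1 -> 0 < tau * hopf_coefficient om u_jet v_jet -> forall r, 0 < r ->
  exists dl, 0 < dl /\ forall eps, 0 < tau * (eps - lam) < dl -> exists (gam : R -> R3) (T : R),
    periodic_orbit (F eps) gam T /\
    (tau < 0 -> orbit_asympt_stable (F eps) gam) /\
    (0 < tau -> orbit_unstable (F eps) gam) /\
    forall t, dist3 (gam t) c < r.
Proof.
  intros tau_unit coef_sign r r_pos.
  destruct (uc_on_bounded_continuous coordinates (0, 0, 0) r (conjugacy_fwd_uc _ _ _ _ (coordinates_conjugacy 0)) r_pos)
    as [d [d_pos near]]. rewrite coordinates_origin in near.
  destruct (hopf_orbit _ _ _ _ _ _ _ om_pos lam_pos u_force_jet v_force_jet s_force_order tau tau_unit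
    crossing_speed_neg coef_sign normal_field_existence d d_pos) as [dl [dl_pos H]].
  exists dl. split; [exact dl_pos|]. intros eps Heps. replace eps with (lam + (eps - lam)) by ring.
  destruct (H _ Heps) as [gam [T [periodic [stable [unstable gam_near]]]]].
  pose proof (coordinates_conjugacy (eps - lam)) as conj.
  destruct (in_box_exists (0, 0, 0)) as [b zero_in_box]. destruct (in_box_exists c) as [b' c_in_box].
  assert (gam_bounded : forall t, in_box (b + d) (gam t)).
  { intros t. apply (in_box_near b d (0, 0, 0)); [exact zero_in_box|]. rewrite dist3_sym. apply Rlt_le, gam_near. }
  assert (image_bounded : forall t, in_box (b' + r) (coordinates (gam t))).
  { intros t. apply (in_box_near b' r c); [exact c_in_box|]. rewrite dist3_sym. apply Rlt_le, near, gam_near. }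
  exists (fun t => coordinates (gam t)), T. split; [|split; [|split]].
  - exact (conjugacy_periodic_orbit _ _ _ _ conj gam T periodic).
  - intros tau_neg.
    exact (conjugacy_orbit_asympt_stable _ _ _ _ conj gam _ _ gam_bounded image_bounded (stable tau_neg)).
  - intros tau_pos. exact (conjugacy_orbit_unstable _ _ _ _ gam _ _ conj gam_bounded image_bounded (unstable tau_pos)).
  - intros t. apply near, gam_near.
Qed.

Lemma hopf_bifurcation tau : tau * tau = 1 -> 0 < tau * hopf_coefficient om u_jet v_jet -> forall r, 0 < r ->
  exists dl, 0 < dl /\ forall eps, 0 < tau * (eps - lam) < dl ->
    (0 < tau -> asympt_stable (F eps) c) /\ (tau < 0 -> unstable_eq (F eps) c) /\
    exists (gam : R -> R3) (T : R), periodic_orbit (F eps) gam T /\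
      (tau < 0 -> orbit_asympt_stable (F eps) gam) /\ (0 < tau -> orbit_unstable (F eps) gam) /\
      forall t, dist3 (gam t) c < r.
Proof.
  intros tau_unit coef_sign r r_pos.
  destruct noncritical_equilibrium as [n0 [n0_pos equilibrium_type]].
  destruct (bifurcating_orbit tau tau_unit coef_sign r r_pos) as [dl [dl_pos orbit]].
  exists (Rmin n0 dl). split; [apply Rmin_glb_lt; assumption|]. intros eps Heps.
  pose proof (Rmin_l n0 dl). pose proof (Rmin_r n0 dl).
  destruct (equilibrium_type eps) as [stable unstable].
  { rewrite <- (Rabs_sign_mult tau _ tau_unit), Rabs_pos_eq; lra. }
  split; [|split; [|apply orbit; lra]].
  - intros tau_pos. apply stable. nra.
  - intros tau_neg. apply unstable. nra.
Qed.

Lemma supercritical_bifurcation : hopf_coefficient om u_jet v_jet < 0 -> asympt_stable (F lam) c /\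
  forall r, 0 < r -> exists dl, 0 < dl /\ forall eps, lam - dl < eps < lam -> unstable_eq (F eps) c /\
    exists (gam : R -> R3) (T : R),
      periodic_orbit (F eps) gam T /\ orbit_asympt_stable (F eps) gam /\ forall t, dist3 (gam t) c < r.
Proof.
  intros coef_neg. split; [exact (critical_equilibrium_stable coef_neg)|]. intros r r_pos.
  destruct (hopf_bifurcation (-1) ltac:(ring) ltac:(lra) r r_pos) as [dl [dl_pos H]].
  exists dl. split; [exact dl_pos|]. intros eps Heps.
  destruct (H eps ltac:(lra)) as [_ [unstable [gam [T [periodic [stable [_ near]]]]]]].
  split; [apply unstable; lra|]. exists gam, T. split; [exact periodic|]. split; [apply stable; lra|exact near].
Qed.

Lemma subcritical_bifurcation : 0 < hopf_coefficient om u_jet v_jet -> unstable_eq (F lam) c /\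
  forall r, 0 < r -> exists dl, 0 < dl /\ forall eps, lam < eps < lam + dl -> asympt_stable (F eps) c /\
    exists (gam : R -> R3) (T : R),
      periodic_orbit (F eps) gam T /\ orbit_unstable (F eps) gam /\ forall t, dist3 (gam t) c < r.
Proof.
  intros coef_pos. split; [exact (critical_equilibrium_unstable coef_pos)|]. intros r r_pos.
  destruct (hopf_bifurcation 1 ltac:(ring) ltac:(lra) r r_pos) as [dl [dl_pos H]].
  exists dl. split; [exact dl_pos|]. intros eps Heps.
  destruct (H eps ltac:(lra)) as [stable [_ [gam [T [periodic [_ [unstable near]]]]]]].
  split; [apply stable; lra|]. exists gam, T. split; [exact periodic|]. split; [apply unstable; lra|exact near].
Qed.

End IntegralFeedback.

(** * Global solutions of the family *)

Definition clamp (M z : R) : R := (Rabs (z + M) - Rabs (z - M)) / 2.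

Lemma Rabs_clamp_le (M z : R) : 0 <= M -> Rabs (clamp M z) <= M.
Proof.
  intros HM. apply Rabs_le_between. unfold clamp, Rabs. destruct (Rcase_abs (z + M)), (Rcase_abs (z - M)); lra.
Qed.

Lemma clamp_id (M z : R) : Rabs z <= M -> clamp M z = z.
Proof.
  intros Hz%Rabs_le_between. unfold clamp. rewrite (Rabs_pos_eq (z + M)), (Rabs_left1 (z - M)) by lra. field.
Qed.

Lemma clamp_lipschitz (M z z' : R) : Rabs (clamp M z - clamp M z') <= Rabs (z - z').
Proof.
  unfold clamp, Rabs.
  destruct (Rcase_abs (z + M)), (Rcase_abs (z - M)), (Rcase_abs (z' + M)), (Rcase_abs (z' - M));
    destruct (Rcase_abs (z - z')), Rcase_abs; lra.
Qed.

Section BoundedThirdComponent.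
Variable F : R3 -> R3.
Variable B : R.
Hypothesis third_bounded : forall X, Rabs (coord 2 (F X)) <= B.
Hypothesis F_lipschitz_slab : forall M, exists L, 0 < L /\ forall X Y i,
  Rabs (coord 2 X) <= M -> Rabs (coord 2 Y) <= M ->
  Rabs (coord i (F X) - coord i (F Y))
    <= L * dist1 (coord 0 X) (coord 1 X) (coord 2 X) (coord 0 Y) (coord 1 Y) (coord 2 Y).
Variable X0 : R3.

Let height (t : R) : R := Rabs (coord 2 X0) + B * Rabs t.
Let into_slab (t : R) (X : R3) : R3 := (coord 0 X, coord 1 X, clamp (height t) (coord 2 X)).

Let B_nonneg : 0 <= B.
Proof. eapply Rle_trans; [apply Rabs_pos|apply (third_bounded X0)]. Qed.

Let into_slab_bounded t T X : Rabs t <= T -> Rabs (coord 2 (into_slab t X)) <= height T.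
Proof.
  intros Ht. pose proof (Rabs_pos (coord 2 X0)). pose proof (Rmult_le_pos B (Rabs t) B_nonneg (Rabs_pos t)).
  eapply Rle_trans; [apply Rabs_clamp_le; unfold height; lra|]. unfold height.
  apply Rplus_le_compat_l, Rmult_le_compat_l; [exact B_nonneg|]. pose proof (Rle_abs T). lra.
Qed.

(* The third coordinate of a solution grows at most at the rate [B], so the solution is not affected by the truncation
   of [F] at [height]. *)
Lemma global_solution_of_bounded_third : exists phi, is_sol F phi /\ phi 0 = X0.
Proof.
  destruct (picard (fun t X => F (into_slab t X)) X0) as [phi [phi_0 phi_sol]].
  - intros T. destruct (F_lipschitz_slab (height T)) as [L [L_pos lip]]. exists L. split; [exact L_pos|].
    intros t [[x y] z] [[x' y'] z'] i Ht. eapply Rle_trans; [apply lip; apply into_slab_bounded, Ht|].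
    apply Rmult_le_compat_l; [lra|]. apply Rplus_le_compat_l, clamp_lipschitz.
  - intros phi phi_cont i t. destruct (F_lipschitz_slab (height (Rabs t + 1))) as [L [L_pos lip]].
    set (x := fun s => coord 0 (phi s)). set (y := fun s => coord 1 (phi s)). set (z := fun s => coord 2 (phi s)).
    assert (x_cont : continuous x t) by apply phi_cont. assert (y_cont : continuous y t) by apply phi_cont.
    assert (z_cont : continuous z t) by apply phi_cont.
    apply (continuous_of_modulus _ (fun s => L * (Rabs (x s - x t) + Rabs (y s - y t)
      + Rabs ((Rabs (z s + (Rabs (coord 2 X0) + B * Rabs s)) - Rabs (z s - (Rabs (coord 2 X0) + B * Rabs s))) / 2
              - clamp (height t) (z t))))).
    + prove_continuous.
    + unfold clamp, height. rewrite !Rminus_diag, Rabs_R0. ring.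
    + exists (mkposreal 1 Rlt_0_1). intros s Hs. change (Rabs (s - t) < 1) in Hs.
      apply lip; apply into_slab_bounded; [|lra].
      replace s with (s - t + t) by ring. eapply Rle_trans; [apply Rabs_triang|]. lra.
  - exists phi. split; [|exact phi_0]. intros t i _.
    assert (in_slab : Rabs (coord 2 (phi t)) <= height t).
    { pose proof (bounded_variation (fun s => coord 2 (phi s)) (fun s => coord 2 (F (into_slab s (phi s)))) B 0 t
        (fun s _ => conj (phi_sol 2%nat s) (third_bounded _)))
          as variation. cbv beta in variation. rewrite phi_0, Rminus_0_r in variation.
      pose proof (Rabs_minus_triang (coord 2 (phi t)) (coord 2 X0) 0) as L. rewrite !Rminus_0_r in L. unfold height.
      lra. }
    pose proof (phi_sol i t) as D. unfold into_slab in D. rewrite (clamp_id _ _ in_slab), R3_eta in D. exact D.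
Qed.

End BoundedThirdComponent.

Lemma fam_existence (alpha beta kappa eps : R) (X0 : R3) : 0 <= alpha ->
  exists phi, is_sol (fam alpha beta kappa 0 eps) phi /\ phi 0 = X0.
Proof.
  intros alpha_nonneg. apply (global_solution_of_bounded_third _ (alpha * (1 + Rabs beta))).
  - intros X. change (Rabs (alpha * (cos (coord 0 X) - beta)) <= alpha * (1 + Rabs beta)).
    rewrite Rabs_mult, (Rabs_pos_eq alpha) by exact alpha_nonneg. apply Rmult_le_compat_l; [exact alpha_nonneg|].
    eapply Rle_trans; [apply Rabs_triang|]. rewrite Rabs_Ropp. pose proof (Rabs_cos_le_1 (coord 0 X)). lra.
  - intros M.
    assert (polynomial : loc_lipschitz (fun s c z => (z ^ 2 + kappa) * s * c - s)) by prove_loc_lipschitz.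
    destruct (polynomial (Rmax 1 M)) as [C [_ lip]].
    pose proof (Rabs_pos C). pose proof (Rabs_pos eps).
    exists (1 + alpha + 2 * Rabs C + Rabs eps). split; [lra|].
    intros [[x y] z] [[x' y'] z'] i Hz Hz'. cbn [coord fst snd] in Hz, Hz' |- *.
    pose proof (sin_lipschitz x x') as sin_le. pose proof (cos_lipschitz x x') as cos_le.
    assert (in_unit_box : forall t w, Rabs w <= M -> box (Rmax 1 M) (sin t) (cos t) w).
    { intros t w Hw. pose proof (Rmax_l 1 M). pose proof (Rmax_r 1 M).
      pose proof (Rabs_sin_le_1 t). pose proof (Rabs_cos_le_1 t). repeat split; lra. }
    specialize (lip _ _ _ _ _ _ (in_unit_box x z Hz) (in_unit_box x' z' Hz')).
    set (d := dist1 x y z x' y' z'). assert (d_nonneg : 0 <= d) by apply dist1_ge_0.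
    assert (dx : Rabs (x - x') <= d) by apply (dist1_ge_coord 0).
    assert (dy : Rabs (y - y') <= d) by apply (dist1_ge_coord 1).
    destruct i as [|[|i]]; unfold fam; cbn [coord fst snd].
    + nra.
    + set (q := (z ^ 2 + kappa) * sin x * cos x - sin x) in *.
      set (q' := (z' ^ 2 + kappa) * sin x' * cos x' - sin x') in *.
      assert (q_le : Rabs (q - q') <= 2 * Rabs C * d).
      { eapply Rle_trans; [exact lip|].
        eapply Rle_trans; [apply Rmult_le_compat_r; [apply dist1_ge_0|apply Rle_abs]|].
        rewrite (Rmult_comm 2), Rmult_assoc. apply Rmult_le_compat_l; [apply Rabs_pos|].
        unfold d, dist1. pose proof (Rabs_pos (y - y')). pose proof (Rabs_pos (z - z')). lra. }
      replace (_ - _) with (q - q' + - (eps * (y - y'))) by (unfold q, q'; ring).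
      eapply Rle_trans; [apply Rabs_triang|]. rewrite Rabs_Ropp, Rabs_mult. nra.
    + rewrite <- Rmult_minus_distr_l, Rabs_mult, (Rabs_pos_eq alpha) by exact alpha_nonneg.
      replace (cos x - beta - (cos x' - beta)) with (cos x - cos x') by ring. nra.
Qed.

(** * The first Lyapunov coefficient *)

Lemma inv3_solve (M : CM) (v w : CV) : det3 M <> RtoC 0 -> (forall i, (i < 3)%nat -> mv M w i = v i) ->
  forall i, (i < 3)%nat -> mv (inv3 M) v i = w i.
Proof.
  intros det_nonzero Mw i Hi. unfold mv, sum3.
  rewrite <- (Mw 0%nat), <- (Mw 1%nat), <- (Mw 2%nat) by lia. unfold mv, sum3, det3 in *.
  destruct i as [|[|[|i]]]; [| | |lia]; unfold inv3, det3; cbn [Nat.modulo Nat.add Nat.divmod fst snd Nat.sub];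
    revert det_nonzero;
    generalize (M 0 0)%nat (M 0 1)%nat (M 0 2)%nat (M 1 0)%nat (M 1 1)%nat (M 1 2)%nat
      (M 2 0)%nat (M 2 1)%nat (M 2 2)%nat;
    intros; field; assumption.
Qed.

Section FirstLyapunovCoefficient.
Variables om lam eta : R.
Variables JG JK : force_jet.
Hypothesis om_pos : 0 < om.
Hypothesis lam_pos : 0 < lam.
Hypothesis eta_pos : 0 < eta.

Local Notation D := (lam ^ 2 + om ^ 2).
Local Notation E := (lam ^ 2 + 4 * om ^ 2).

Definition feedback_matrix (eps : R) (i j : nat) : R :=
  match i, j with
  | 0%nat, 1%nat => 1
  | 1%nat, 0%nat => - om ^ 2
  | 1%nat, 1%nat => - eps
  | 1%nat, S (S _) => lam * om / eta
  | S (S _), 0%nat => - (eta * om)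
  | _, _ => 0
  end.

Definition second_derivative (J : force_jet) (u v : CV) : C :=
  (RtoC (2 * force_xx J) * (u 0%nat * v 0%nat) + RtoC (force_xz J) * (u 0%nat * v 2%nat + u 2%nat * v 0%nat)
   + RtoC (2 * force_zz J) * (u 2%nat * v 2%nat))%C.

Definition third_derivative (J : force_jet) (u v w : CV) : C :=
  (RtoC (6 * force_xxx J) * (u 0%nat * v 0%nat * w 0%nat)
   + RtoC (2 * force_xxz J) * (u 0%nat * v 0%nat * w 2%nat + u 0%nat * v 2%nat * w 0%nat + u 2%nat * v 0%nat * w 0%nat)
   + RtoC (2 * force_xzz J)
     * (u 0%nat * v 2%nat * w 2%nat + u 2%nat * v 0%nat * w 2%nat + u 2%nat * v 2%nat * w 0%nat))%C.

Definition feedback_B (u v : CV) : CV := fun i =>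
  match i with 0%nat => RtoC 0 | 1%nat => second_derivative JG u v | _ => second_derivative JK u v end.

Definition feedback_C (u v w : CV) : CV := fun i =>
  match i with 0%nat => RtoC 0 | 1%nat => third_derivative JG u v w | _ => third_derivative JK u v w end.

Definition critical_vector : CV := fun i => match i with 0%nat => Copp Ci | 1%nat => RtoC om | _ => RtoC eta end.

Let A : CM := realM (feedback_matrix lam).
Let R2 : CM := cMadd (cMscal (Cmult (RtoC (2 * om)) Ci) idM) (cMopp A).

Let D_gt_0 : 0 < D.
Proof. apply sum_pow2_pos, om_pos. Qed.
Let E_gt_0 : 0 < E.
Proof. pose proof (pow_lt lam 2 lam_pos). pose proof (pow_lt om 2 om_pos). lra. Qed.

Definition second_harmonic (c1 c2 : C) : C :=
  Cmult (- (4 / (3 * E)), - (2 * lam / (3 * om * E))) (Cminus c1 (Cmult (0, lam / (2 * eta)) c2)).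

Lemma inv3_second_harmonic (v : CV) : v 0%nat = RtoC 0 ->
  let h := second_harmonic (v 1%nat) (v 2%nat) in
  mv (inv3 R2) v 0%nat = h /\
  mv (inv3 R2) v 2%nat = Cmult (0, - / (2 * om)) (Cminus (v 2%nat) (Cmult (RtoC (eta * om)) h)).
Proof.
  intros v_0 h.
  set (w := fun i : nat => match i with 0%nat => h | 1%nat => Cmult (0, 2 * om) h
    | _ => Cmult (0, - / (2 * om)) (Cminus (v 2%nat) (Cmult (RtoC (eta * om)) h)) end : C).
  assert (solution : forall i, (i < 3)%nat -> mv (inv3 R2) v i = w i).
  { apply inv3_solve.
    - replace (det3 R2) with ((- 3 * lam * om ^ 2, - 6 * om ^ 3) : C).
      + intros H. injection H. intros H1 _. pose proof (pow_lt om 3 om_pos). lra.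
      + unfold det3, R2, A, cMadd, cMscal, cMopp, realM, idM. simpl. apply injective_projections; simpl; field; lra.
    - intros i Hi. unfold w, h, second_harmonic.
      destruct i as [|[|[|i]]]; [| | |lia]; unfold mv, sum3, R2, A, cMadd, cMscal, cMopp, realM, idM;
        simpl; rewrite ?v_0;
        destruct (v 1%nat) as [a1 a2], (v 2%nat) as [b1 b2]; apply injective_projections; simpl; field; lra. }
  split; apply solution; lia.
Qed.

Lemma inv3_mean_response (v : CV) : v 0%nat = RtoC 0 ->
  let h := Cmult (RtoC (- / (eta * om))) (v 2%nat) in
  mv (inv3 A) v 0%nat = h /\
  mv (inv3 A) v 2%nat = Cmult (RtoC (eta / (om * lam))) (Cplus (v 1%nat) (Cmult (RtoC (om ^ 2)) h)).
Proof.
  intros v_0 h.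
  set (w := fun i : nat => match i with 0%nat => h | 1%nat => RtoC 0
    | _ => Cmult (RtoC (eta / (om * lam))) (Cplus (v 1%nat) (Cmult (RtoC (om ^ 2)) h)) end : C).
  assert (solution : forall i, (i < 3)%nat -> mv (inv3 A) v i = w i).
  { apply inv3_solve.
    - replace (det3 A) with (RtoC (- (om ^ 2 * lam))).
      + intros H. injection H. pose proof (Rmult_lt_0_compat _ _ (pow_lt om 2 om_pos) lam_pos). lra.
      + unfold det3, A, realM. simpl. apply injective_projections; simpl; field; lra.
    - intros i Hi. unfold w, h.
      destruct i as [|[|[|i]]]; [| | |lia]; unfold mv, sum3, A, realM; simpl; rewrite ?v_0;
        destruct (v 1%nat) as [a1 a2], (v 2%nat) as [b1 b2]; apply injective_projections; simpl; field; lra. }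
  split; apply solution; lia.
Qed.

Lemma adjoint_vector_coords (p : CV) :
  (forall i, (i < 3)%nat -> mv (trM A) p i = Cmult (Copp (Cmult (RtoC om) Ci)) (p i)) ->
  cinner p critical_vector = RtoC 1 ->
  Cconj (p 1%nat) = (om / (2 * D), lam / (2 * D)) /\
  Cconj (p 2%nat) = (lam ^ 2 / (2 * eta * D), - (lam * om) / (2 * eta * D)).
Proof.
  intros eigen normal.
  pose proof (eigen 1%nat ltac:(lia)) as row1. pose proof (eigen 2%nat ltac:(lia)) as row2. clear eigen.
  unfold mv, sum3, trM, A, realM in row1, row2. unfold cinner, sum3, critical_vector in normal.
  simpl in row1, row2, normal. revert row1 row2 normal.
  destruct (p 0%nat) as [a1 a2], (p 1%nat) as [b1 b2], (p 2%nat) as [c1 c2]. intros row1 row2 normal.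
  injection row1 as row1_re row1_im. injection row2 as row2_re row2_im. injection normal as normal_re normal_im.
  simpl in row1_re, row1_im, row2_re, row2_im, normal_re, normal_im.
  ring_simplify in row1_re. ring_simplify in row1_im. ring_simplify in row2_re. ring_simplify in row2_im.
  assert (a1_eq : a1 = lam * b1 + om * b2) by lra.
  assert (a2_eq : a2 = lam * b2 - om * b1) by lra.
  assert (c1_eq : c1 = - lam * b2 / eta).
  { apply (Rmult_eq_reg_l om); [|lra]. transitivity (- (lam * om / eta * b2)); [lra|field; lra]. }
  assert (c2_eq : c2 = lam * b1 / eta).
  { apply (Rmult_eq_reg_l om); [|lra]. transitivity (lam * om / eta * b1); [lra|field; lra]. }
  assert (re_eq : 2 * om * b1 - 2 * lam * b2 = 1).
  { rewrite <- normal_re, a2_eq, c1_eq. field. lra. }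
  assert (im_eq : 2 * om * b2 + 2 * lam * b1 = 0).
  { rewrite <- Ropp_0, <- normal_im, a1_eq, c2_eq. field. lra. }
  assert (b1_eq : b1 = om / (2 * D)).
  { apply (Rmult_eq_reg_r (2 * D)); [|lra].
    transitivity (om * (2 * om * b1 - 2 * lam * b2) + lam * (2 * om * b2 + 2 * lam * b1)); [ring|].
    rewrite re_eq, im_eq. field. lra. }
  assert (b2_eq : b2 = - lam / (2 * D)).
  { apply (Rmult_eq_reg_r (2 * D)); [|lra].
    transitivity (- lam * (2 * om * b1 - 2 * lam * b2) + om * (2 * om * b2 + 2 * lam * b1)); [ring|].
    rewrite re_eq, im_eq. field. lra. }
  rewrite c1_eq, c2_eq, b1_eq, b2_eq. unfold Cconj. simpl. split; f_equal; field; lra.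
Qed.

Definition normal_form_coefficient (p : CV) : C :=
  let q := critical_vector in let q' := cconjv critical_vector in
  cinner p (cvadd (cvadd (feedback_C q q q') (feedback_B q' (mv (inv3 R2) (feedback_B q q))))
    (cvopp (cscal (RtoC 2) (feedback_B q (mv (inv3 A) (feedback_B q q')))))).

Lemma Re_normal_form_coefficient (p : CV) :
  (forall i, (i < 3)%nat -> mv (trM A) p i = Cmult (Copp (Cmult (RtoC om) Ci)) (p i)) ->
  cinner p critical_vector = RtoC 1 ->
  Re (normal_form_coefficient p) = 8 * hopf_coefficient om (u_jet om lam eta JG JK) (v_jet om lam eta JG JK).
Proof.
  intros eigen normal. destruct (adjoint_vector_coords p eigen normal) as [p1_eq p2_eq].
  set (q := critical_vector). set (q' := cconjv q).
  destruct (inv3_second_harmonic (feedback_B q q) eq_refl) as [h20_0 h20_2].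
  destruct (inv3_mean_response (feedback_B q q') eq_refl) as [h11_0 h11_2].
  unfold normal_form_coefficient. cbv zeta. fold q. fold q'.
  set (h20 := mv (inv3 R2) (feedback_B q q)) in *. set (h11 := mv (inv3 A) (feedback_B q q')) in *.
  unfold cinner, sum3. rewrite p1_eq, p2_eq.
  unfold cvadd, cvopp, cscal, feedback_B, feedback_C, second_derivative, third_derivative.
  rewrite h20_0, h20_2, h11_0, h11_2. clearbody h20 h11.
  unfold second_harmonic, feedback_B, second_derivative.
  unfold hopf_coefficient, rate_uuuu, rate_uuvv, rate_vvvv, act_uuu, act_vvv, act_uuv, act_uvv. simpl.
  unfold manifold_uu, manifold_vv, manifold_uv, slow_uu, slow_uv, slow_vv,
    u_of_z, u_of_y, v_of_z, v_of_y, s_of_z, s_of_y.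
  destruct JG as [a1 a2 a3 a4 a5 a6], JK as [c1 c2 c3 c4 c5 c6]. simpl.
  field. lra.
Qed.

End FirstLyapunovCoefficient.

(** * Eigenvalues of the linear part *)

Lemma Cmult_integral (z w : C) : (z * w)%C = RtoC 0 -> z = RtoC 0 \/ w = RtoC 0.
Proof.
  intros H. destruct (Ceq_dec z (RtoC 0)) as [z_eq|z_ne]; [left; exact z_eq|].
  destruct (Ceq_dec w (RtoC 0)) as [w_eq|w_ne]; [right; exact w_eq|]. exfalso. exact (Cmult_neq_0 z w z_ne w_ne H).
Qed.

Section Eigenvalues.
Variables om lam eta : R.
Hypothesis om_pos : 0 < om.
Hypothesis lam_pos : 0 < lam.
Hypothesis eta_pos : 0 < eta.

Definition char_poly (eps : R) (l : C) : C :=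
  (l * l * l + RtoC eps * (l * l) + RtoC (om ^ 2) * l + RtoC (om ^ 2 * lam))%C.

Lemma eigenvalue_of_root eps l : char_poly eps l = RtoC 0 -> is_eigenvalue (feedback_matrix om lam eta eps) l.
Proof.
  intros root.
  exists (fun i => match i with 0%nat => l | 1%nat => (l * l)%C | _ => RtoC (- (eta * om)) end). split.
  - exists 2%nat. split; [lia|]. intros H. injection H. pose proof (Rmult_lt_0_compat _ _ eta_pos om_pos). lra.
  - destruct l as [x y]. injection root as root_re root_im.
    intros [|[|[|i]]] Hi; [| | |lia]; unfold mv, sum3, realM; simpl; apply injective_projections; simpl; try ring.
    + replace (lam * om / eta * - (eta * om)) with (- (om ^ 2 * lam)) by (field; lra). lra.
    + lra.
Qed.

Lemma root_of_eigenvalue eps l : is_eigenvalue (feedback_matrix om lam eta eps) l -> char_poly eps l = RtoC 0.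
Proof.
  intros [v [[i [Hi v_nonzero]] eigen]].
  pose proof (eigen 0%nat ltac:(lia)) as row0. pose proof (eigen 1%nat ltac:(lia)) as row1.
  pose proof (eigen 2%nat ltac:(lia)) as row2. clear eigen. unfold mv, sum3, realM, feedback_matrix in row0, row1, row2.
  assert (v1_eq : v 1%nat = (l * v 0%nat)%C) by (rewrite <- row0; ring).
  assert (v2_eq : (l * v 2%nat)%C = (RtoC (- (eta * om)) * v 0%nat)%C) by (rewrite <- row2; ring).
  rewrite v1_eq in row1.
  assert (coupling : (RtoC (lam * om / eta) * RtoC (- (eta * om)))%C = Copp (RtoC (om ^ 2 * lam))).
  { rewrite <- RtoC_mult, <- RtoC_opp. f_equal. field. lra. }
  assert (coupling_nonzero : RtoC (lam * om / eta) <> RtoC 0).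
  { intros H. injection H. pose proof (Rdiv_lt_0_compat _ _ (Rmult_lt_0_compat _ _ lam_pos om_pos) eta_pos). lra. }
  assert (root : (char_poly eps l * v 0%nat)%C = RtoC 0).
  { transitivity (l * (l * (l * v 0%nat)) - l * (RtoC (- om ^ 2) * v 0%nat + RtoC (- eps) * (l * v 0%nat))
      - RtoC (lam * om / eta) * RtoC (- (eta * om)) * v 0%nat)%C.
    - rewrite coupling, !RtoC_opp. unfold char_poly. ring.
    - rewrite <- row1, <- (Cmult_assoc (RtoC (lam * om / eta))), <- v2_eq. ring. }
  apply Cmult_integral in root. destruct root as [root|v0_eq]; [exact root|]. exfalso. apply v_nonzero.
  rewrite v0_eq in v1_eq, row1.
  destruct i as [|[|[|i]]]; [exact v0_eq|rewrite v1_eq; ring| |lia].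
  destruct (Cmult_integral (RtoC (lam * om / eta)) (v 2%nat)) as [H|H]; [|contradiction|exact H].
  transitivity (l * (l * RtoC 0))%C; [rewrite <- row1|]; ring.
Qed.

Lemma char_poly_critical l : char_poly lam l = ((l * l + RtoC (om ^ 2)) * (l + RtoC lam))%C.
Proof. unfold char_poly. rewrite RtoC_mult. ring. Qed.

Lemma imaginary_eigenvalue l :
  is_eigenvalue (feedback_matrix om lam eta lam) l -> Re l = 0 -> l = (0, om) \/ l = (0, - om).
Proof.
  intros root%root_of_eigenvalue re_zero. rewrite char_poly_critical in root. destruct l as [x y].
  simpl in re_zero. subst x.
  injection root as root_re _.
  assert (factors : (om - y) * (om + y) = 0).
  { apply (Rmult_eq_reg_r lam); [|lra]. rewrite Rmult_0_l, <- root_re. ring. }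
  apply Rmult_integral in factors. destruct factors; [left|right]; f_equal; lra.
Qed.

Definition damping_share (r : R) : R := r ^ 2 / (r ^ 2 + om ^ 2).

Lemma damping_share_range r : 0 <= damping_share r <= 1.
Proof.
  pose proof (sum_pow2_pos r om om_pos). pose proof (pow2_ge_0 r). pose proof (pow2_ge_0 om).
  unfold damping_share. split.
  - apply Rdiv_le_0_compat; lra.
  - apply Rle_div_l; lra.
Qed.

Lemma damping_share_derive r : is_derive damping_share r (2 * om ^ 2 * r / (r ^ 2 + om ^ 2) ^ 2).
Proof. pose proof (sum_pow2_pos r om om_pos). unfold damping_share. auto_derive; [lra|field; lra]. Qed.

Lemma damping_share_lipschitz r s : Rabs (damping_share r - damping_share s) <= / om * Rabs (r - s).
Proof.
  apply (bounded_variation damping_share (fun r => 2 * om ^ 2 * r / (r ^ 2 + om ^ 2) ^ 2)).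
  intros t _. split; [apply damping_share_derive|].
  pose proof (sum_pow2_pos t om om_pos) as den_pos. pose proof (pow2_ge_0 t).
  rewrite Rabs_div by (apply pow_nonzero; lra). rewrite (Rabs_pos_eq (_ ^ 2)) by apply pow2_ge_0.
  apply Rle_div_l; [apply pow_lt, den_pos|].
  rewrite !Rabs_mult, (Rabs_pos_eq 2), (Rabs_pos_eq (om ^ 2)) by (try apply pow2_ge_0; lra).
  rewrite <- (pow2_abs t) in *. pose proof (Rabs_pos t). set (a := Rabs t) in *.
  apply (Rmult_le_reg_l om); [exact om_pos|]. replace (om * (/ om * _)) with ((a ^ 2 + om ^ 2) ^ 2) by (field; lra).
  pose proof (pow2_ge_0 (a - om)). pose proof (pow_lt om 2 om_pos).
  apply Rle_trans with (om ^ 2 * (a ^ 2 + om ^ 2)); [nra|]. nra.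
Qed.

(* [- r] is a root of [char_poly eps] exactly when [r = lam + (eps - lam) * damping_share r]. *)
Lemma decay_rate_exists : exists r : R -> R, forall eps, r eps = lam + (eps - lam) * damping_share (r eps).
Proof.
  assert (solvable : forall n, {r : R | r = lam + n * damping_share r}).
  { intros n.
    assert (shift_le : forall r, - Rabs n <= n * damping_share r <= Rabs n).
    { intros r. pose proof (damping_share_range r). apply Rabs_le_between.
      rewrite Rabs_mult, (Rabs_pos_eq (damping_share r)) by lra.
      pose proof (Rabs_pos n). nra. }
    destruct (IVT_gen_consistent (fun r => r - n * damping_share r) (lam - Rabs n) (lam + Rabs n) lam) as [r [_ Hr]].
    - intros r. pose proof (is_derive_continuous _ _ _ (damping_share_derive r)). prove_continuous.
    - pose proof (shift_le (lam - Rabs n)). pose proof (shift_le (lam + Rabs n)). split.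
      + eapply Rle_trans; [apply Rmin_l|]. lra.
      + eapply Rle_trans; [|apply Rmax_r]. lra.
    - exists r. lra. }
  exists (fun eps => proj1_sig (solvable (eps - lam))). intros eps. exact (proj2_sig (solvable (eps - lam))).
Qed.

Section CriticalPair.
Variable r : R -> R.
Hypothesis r_fixed : forall eps, r eps = lam + (eps - lam) * damping_share (r eps).

Let r_lam : r lam = lam.
Proof. rewrite r_fixed. ring. Qed.

Let r_near eps : Rabs (r eps - lam) <= Rabs (eps - lam).
Proof.
  replace (r eps - lam) with ((eps - lam) * damping_share (r eps)) by (pose proof (r_fixed eps); lra).
  pose proof (damping_share_range (r eps)). rewrite Rabs_mult, (Rabs_pos_eq (damping_share _)) by lra.
  pose proof (Rabs_pos (eps - lam)). nra.
Qed.

Let r_lipschitz eps eps' : Rabs (eps' - lam) < om / 2 -> Rabs (r eps - r eps') <= 2 * Rabs (eps - eps').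
Proof.
  intros near. set (share := damping_share (r eps)). set (share' := damping_share (r eps')).
  assert (E : r eps - r eps' = (eps - eps') * share + (eps' - lam) * (share - share')).
  { unfold share, share'. pose proof (r_fixed eps). pose proof (r_fixed eps'). lra. }
  pose proof (damping_share_range (r eps) : 0 <= share <= 1).
  pose proof (damping_share_lipschitz (r eps) (r eps') : Rabs (share - share') <= _) as lip.
  assert (first : Rabs ((eps - eps') * share) <= Rabs (eps - eps')).
  { rewrite Rabs_mult, (Rabs_pos_eq share) by lra. pose proof (Rabs_pos (eps - eps')). nra. }
  assert (second : Rabs ((eps' - lam) * (share - share')) <= Rabs (r eps - r eps') / 2).
  { rewrite Rabs_mult. replace (_ / 2) with (om / 2 * (/ om * Rabs (r eps - r eps'))) by (field; lra).
    apply Rmult_le_compat; try apply Rabs_pos; [lra|exact lip]. }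
  pose proof (Rabs_triang ((eps - eps') * share) ((eps' - lam) * (share - share'))) as tri. rewrite <- E in tri. lra.
Qed.

Let r_continuous eps : Rabs (eps - lam) < om / 2 -> continuous r eps.
Proof.
  intros near. apply (continuous_of_modulus r (fun s => 2 * Rabs (s - eps))).
  - prove_continuous.
  - rewrite Rminus_diag, Rabs_R0. ring.
  - apply filter_forall. intros s. apply r_lipschitz, near.
Qed.

Definition growth_rate (eps : R) : R := (r eps - eps) / 2.
Definition frequency (eps : R) : R := sqrt (om ^ 2 * lam / r eps - growth_rate eps ^ 2).

Lemma growth_rate_critical : growth_rate lam = 0.
Proof. unfold growth_rate. rewrite r_lam. field. Qed.

Lemma frequency_critical : frequency lam = om.
Proof.
  unfold frequency. rewrite growth_rate_critical, r_lam. replace (_ - _) with (om ^ 2) by (field; lra).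
  apply sqrt_pow2. lra.
Qed.

Lemma growth_rate_continuous eps : Rabs (eps - lam) < om / 2 -> continuous growth_rate eps.
Proof. intros near. pose proof (r_continuous eps near). unfold growth_rate. prove_continuous. Qed.

Lemma frequency_continuous eps : Rabs (eps - lam) < om / 2 -> Rabs (eps - lam) < lam -> continuous frequency eps.
Proof.
  intros near near_lam. pose proof (r_continuous eps near). pose proof (growth_rate_continuous eps near).
  unfold frequency. prove_continuous. pose proof (r_near eps) as r_le. apply Rabs_le_between in r_le. lra.
Qed.

Lemma growth_rate_derive : is_derive growth_rate lam (- (om ^ 2 / (2 * (lam ^ 2 + om ^ 2)))).
Proof.
  pose proof (sum_pow2_pos lam om om_pos).
  assert (share_continuous : continuous (fun eps => damping_share (r eps)) lam).
  { apply (continuous_comp r damping_share).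
    - apply r_continuous. rewrite Rminus_diag, Rabs_R0. lra.
    - exact (is_derive_continuous _ _ _ (damping_share_derive (r lam))). }
  set (shift := fun eps => (eps - lam) * damping_share (r eps)).
  assert (shift_derive : is_derive shift lam (damping_share lam)).
  { rewrite <- r_lam at 2. exact (is_derive_mult_slope _ lam share_continuous). }
  apply (is_derive_ext (fun eps => (lam + shift eps - eps) / 2)).
  - intros eps. unfold growth_rate, shift. rewrite <- r_fixed. reflexivity.
  - apply (is_derive_eq _ _ _ ((damping_share lam - 1) / 2)); [derive_with; field|]. unfold damping_share. field. lra.
Qed.

(* The remaining factor of [char_poly eps] is [l ^ 2 - 2 * growth_rate eps * l + om ^ 2 * lam / r eps]. *)
Lemma char_poly_critical_pair eps : Rabs (eps - lam) <= om / 2 -> Rabs (eps - lam) <= lam / 2 ->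
  char_poly eps (growth_rate eps, frequency eps) = RtoC 0.
Proof.
  intros near near_lam. pose proof (r_near eps) as r_le. pose proof (r_fixed eps) as fixed.
  set (m := growth_rate eps). set (s := r eps) in *.
  assert (m_eq : m = (s - eps) / 2) by reflexivity.
  assert (s_range : lam / 2 <= s <= 3 * lam / 2) by (apply Rabs_le_between in r_le; lra).
  assert (real_root : s * (s - eps) = om ^ 2 * lam / s - om ^ 2).
  { pose proof (sum_pow2_pos s om om_pos). apply (Rmult_eq_reg_r s); [|lra].
    assert (F : (s - lam) * (s ^ 2 + om ^ 2) = (eps - lam) * s ^ 2).
    { rewrite fixed at 1. unfold damping_share. field. lra. }
    transitivity (om ^ 2 * lam - om ^ 2 * s); [lra|field; lra]. }
  assert (m_small : m ^ 2 <= (om / 2) ^ 2).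
  { apply pow_maj_Rabs. rewrite m_eq. pose proof (proj1 (Rabs_le_between _ _) near).
    apply Rabs_le_between in r_le. apply Rabs_le_between. lra. }
  pose proof (pow_lt om 2 om_pos).
  assert (modulus_ge : om ^ 2 * (2 / 3) <= om ^ 2 * lam / s).
  { apply (Rle_div_r _ (om ^ 2 * lam)); [lra|]. rewrite Rmult_assoc. apply Rmult_le_compat_l; lra. }
  assert (frequency_pow2 : frequency eps ^ 2 = om ^ 2 * lam / s - m ^ 2).
  { unfold frequency. fold m s. apply pow2_sqrt. lra. }
  set (y := frequency eps) in *.
  assert (modulus_eq : om ^ 2 * lam = s * (y ^ 2 + m ^ 2)) by (rewrite frequency_pow2; field; lra).
  assert (om_pow2 : om ^ 2 = y ^ 2 + m ^ 2 - 2 * m * s) by (rewrite frequency_pow2, m_eq; lra).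
  unfold char_poly. rewrite modulus_eq, om_pow2. replace eps with (s - 2 * m) by (rewrite m_eq; field).
  apply injective_projections; simpl; ring.
Qed.

End CriticalPair.

Lemma eigenvalue_continuation : exists dl (mu w : R -> R), 0 < dl /\ mu lam = 0 /\ w lam = om /\
  (forall e, Rabs (e - lam) < dl ->
     continuous mu e /\ continuous w e /\ is_eigenvalue (feedback_matrix om lam eta e) (mu e, w e)) /\
  ex_derive mu lam /\ Derive mu lam <> 0.
Proof.
  destruct decay_rate_exists as [r r_fixed].
  exists (Rmin (lam / 2) (om / 2)), (growth_rate r), (frequency r).
  split; [apply Rmin_glb_lt; lra|]. split; [exact (growth_rate_critical r r_fixed)|].
  split; [exact (frequency_critical r r_fixed)|]. split; [|split].
  - intros e He. pose proof (Rmin_l (lam / 2) (om / 2)). pose proof (Rmin_r (lam / 2) (om / 2)).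
    split; [|split].
    + apply growth_rate_continuous; [exact r_fixed|lra].
    + apply frequency_continuous; [exact r_fixed|lra|lra].
    + apply eigenvalue_of_root, char_poly_critical_pair; [exact r_fixed|lra|lra].
  - exists (- (om ^ 2 / (2 * (lam ^ 2 + om ^ 2)))). exact (growth_rate_derive r r_fixed).
  - rewrite (is_derive_unique _ _ _ (growth_rate_derive r r_fixed)). apply Rlt_not_eq, Ropp_lt_gt_0_contravar.
    apply Rdiv_lt_0_compat; [apply pow_lt, om_pos|]. pose proof (sum_pow2_pos lam om om_pos). lra.
Qed.

End Eigenvalues.

(** * Taylor expansion of the family at its equilibrium *)

Lemma lipschitz_of_derive_le_pow (f df : R -> R) (k : nat) : (forall x, is_derive f x (df x)) ->
  (forall x, Rabs (df x) <= Rabs x ^ k) ->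
  forall M x y, Rabs x <= M -> Rabs y <= M -> Rabs (f x - f y) <= M ^ k * Rabs (x - y).
Proof.
  intros Df df_le M x y Hx Hy. destruct (MVT_gen f y x df) as [c [Hc ->]].
  - intros t _. apply Df.
  - intros t _. apply continuity_pt_filterlim, (is_derive_continuous f t (df t)), Df.
  - rewrite Rabs_mult. apply Rmult_le_compat_r; [apply Rabs_pos|]. eapply Rle_trans; [apply df_le|].
    apply pow_incr. split; [apply Rabs_pos|]. apply Rabs_le_between in Hx. apply Rabs_le_between in Hy.
    apply Rabs_le_between. revert Hc. unfold Rmin, Rmax. destruct (Rle_dec y x); lra.
Qed.

Lemma Rabs_le_pow_of_derive (f df : R -> R) (k : nat) : f 0 = 0 -> (forall x, is_derive f x (df x)) ->
  (forall x, Rabs (df x) <= Rabs x ^ k) -> forall x, Rabs (f x) <= Rabs x ^ S k.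
Proof.
  intros f_0 Df df_le x.
  pose proof (lipschitz_of_derive_le_pow f df k Df df_le (Rabs x) x 0 (Rle_refl _)) as variation.
  rewrite f_0, !Rminus_0_r, Rabs_R0 in variation. simpl. rewrite Rmult_comm. apply variation, Rabs_pos.
Qed.

Definition sin_remainder (a x : R) : R :=
  sin (a + x) - (sin a + cos a * x - sin a * x ^ 2 / 2 - cos a * x ^ 3 / 6).

Lemma sin_remainder_lipschitz (a M x y : R) : Rabs x <= M -> Rabs y <= M ->
  Rabs (sin_remainder a x - sin_remainder a y) <= M ^ 3 * Rabs (x - y).
Proof.
  set (r1 := fun x => - cos (a + x) + cos a).
  set (r2 := fun x => - sin (a + x) + sin a + cos a * x).
  set (r3 := fun x => cos (a + x) - (cos a - sin a * x - cos a * x ^ 2 / 2)).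
  assert (r1_le : forall x, Rabs (r1 x) <= Rabs x ^ 1).
  { apply (Rabs_le_pow_of_derive r1 (fun x => sin (a + x))).
    - unfold r1. rewrite Rplus_0_r. ring.
    - intros t. unfold r1. auto_derive; [exact I|ring].
    - intros t. apply Rabs_sin_le_1. }
  assert (r2_le : forall x, Rabs (r2 x) <= Rabs x ^ 2).
  { apply (Rabs_le_pow_of_derive r2 r1); [unfold r2; rewrite Rplus_0_r; ring| |exact r1_le].
    intros t. unfold r2, r1. auto_derive; [exact I|ring]. }
  assert (r3_le : forall x, Rabs (r3 x) <= Rabs x ^ 3).
  { apply (Rabs_le_pow_of_derive r3 r2); [unfold r3; rewrite Rplus_0_r; field| |exact r2_le].
    intros t. unfold r3, r2. auto_derive; [exact I|field]. }
  apply (lipschitz_of_derive_le_pow (sin_remainder a) r3); [|exact r3_le].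
  intros t. unfold sin_remainder, r3. auto_derive; [exact I|field].
Qed.

Lemma weighted_order_sin_remainder wn wS a f : weighted_order wn wS 1 f ->
  weighted_order wn wS 4 (fun n u v s => sin_remainder a (f n u v s)).
Proof.
  apply (weighted_order_comp wn wS 3 (sin_remainder a) 1); [lra| |].
  - unfold sin_remainder. rewrite Rplus_0_r. field.
  - intros M x y Hx Hy. rewrite Rmult_1_l. apply sin_remainder_lipschitz; assumption.
Qed.

Section FamilyDerivatives.
Variables alpha beta kappa eps : R.

Definition fam_d1 (i k : nat) (v : R3) : R :=
  let x := coord 0 v in let z := coord 2 v in
  match i, k with
  | 0%nat, 1%nat => 1
  | 1%nat, 0%nat => (z ^ 2 + kappa) * (cos x ^ 2 - sin x ^ 2) - cos x
  | 1%nat, 1%nat => - eps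
  | 1%nat, S (S _) => 2 * z * (sin x * cos x)
  | S (S _), 0%nat => - alpha * sin x
  | _, _ => 0
  end.

Definition fam_d2 (i j k : nat) (v : R3) : R :=
  let x := coord 0 v in let z := coord 2 v in
  match i, j, k with
  | 1%nat, 0%nat, 0%nat => sin x - 4 * (z ^ 2 + kappa) * (sin x * cos x)
  | 1%nat, 0%nat, S (S _) | 1%nat, S (S _), 0%nat => 2 * z * (cos x ^ 2 - sin x ^ 2)
  | 1%nat, S (S _), S (S _) => 2 * (sin x * cos x)
  | S (S _), 0%nat, 0%nat => - alpha * cos x
  | _, _, _ => 0
  end.

Definition fam_d3 (i j k l : nat) (v : R3) : R :=
  let x := coord 0 v in let z := coord 2 v in
  match i, j, k, l with
  | 1%nat, 0%nat, 0%nat, 0%nat => cos x - 4 * (z ^ 2 + kappa) * (cos x ^ 2 - sin x ^ 2)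
  | 1%nat, 0%nat, 0%nat, S (S _) | 1%nat, 0%nat, S (S _), 0%nat | 1%nat, S (S _), 0%nat, 0%nat =>
      - 8 * z * (sin x * cos x)
  | 1%nat, 0%nat, S (S _), S (S _) | 1%nat, S (S _), 0%nat, S (S _) | 1%nat, S (S _), S (S _), 0%nat =>
      2 * (cos x ^ 2 - sin x ^ 2)
  | S (S _), 0%nat, 0%nat, 0%nat => alpha * sin x
  | _, _, _, _ => 0
  end.

Lemma jac_fam (v : R3) (i k : nat) : jac (fam alpha beta kappa 0 eps) v i k = fam_d1 i k v.
Proof.
  destruct v as [[x y] z]. unfold jac, pd.
  destruct i as [|[|i]], k as [|[|k]]; apply is_derive_unique; simpl; auto_derive; auto; ring.
Qed.

Lemma d2_fam (v : R3) (i j k : nat) : Defs.d2 (fam alpha beta kappa 0 eps) v i j k = fam_d2 i j k v.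
Proof.
  unfold Defs.d2. replace (fun w => pd k (fun v => coord i (fam alpha beta kappa 0 eps v)) w) with (fam_d1 i k)
    by (apply functional_extensionality; intros w; symmetry; apply jac_fam).
  destruct v as [[x y] z]. unfold pd.
  destruct i as [|[|i]], j as [|[|j]], k as [|[|k]]; apply is_derive_unique; simpl; auto_derive; auto; ring.
Qed.

Lemma d3_fam (v : R3) (i j k l : nat) : Defs.d3 (fam alpha beta kappa 0 eps) v i j k l = fam_d3 i j k l v.
Proof.
  unfold Defs.d3.
  replace (fun u => pd k (fun w => pd l (fun v => coord i (fam alpha beta kappa 0 eps v)) w) u) with (fam_d2 i k l)
    by (apply functional_extensionality; intros w; symmetry; apply d2_fam).
  destruct v as [[x y] z]. unfold pd.
  destruct i as [|[|i]], j as [|[|j]], k as [|[|k]], l as [|[|l]];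
    apply is_derive_unique; simpl; auto_derive; auto; ring.
Qed.

End FamilyDerivatives.

(* The equilibrium is [(x0, 0, z0)]; in terms of [b = sqrt beta], [z0] and [om] all the coefficients are rational. *)
Section FamilyAtEquilibrium.
Variables alpha b z0 : R.
Hypothesis alpha_pos : 0 < alpha.
Hypothesis b_range : 0 < b < 1.
Hypothesis z0_pos : 0 < z0.

Local Notation x0 := (acos (b ^ 2)).
Local Notation om := (omega0 (b ^ 2)).

Definition kappa_of : R := 1 / b ^ 2 - z0 ^ 2.
Definition damping : R := 2 * alpha * z0 * b ^ 4.
Definition feedback : R := alpha * b.

Lemma b_pow2_range : 0 < b ^ 2 < 1.
Proof. nra. Qed.

Lemma omega0_pow2 : om ^ 2 = (1 - b ^ 4) / b ^ 2.
Proof.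
  pose proof b_pow2_range. unfold omega0. rewrite pow2_sqrt; [field; lra|]. apply Rdiv_le_0_compat; nra.
Qed.

Lemma omega0_pos : 0 < om.
Proof. pose proof b_pow2_range. apply sqrt_lt_R0, Rdiv_lt_0_compat; nra. Qed.

Lemma cos_x0 : cos x0 = b ^ 2.
Proof. pose proof b_pow2_range. apply cos_acos. lra. Qed.

Lemma sin_x0 : sin x0 = om * b.
Proof.
  pose proof b_pow2_range. pose proof omega0_pos. rewrite sin_acos by lra. rewrite <- (sqrt_pow2 (om * b)) by nra.
  f_equal. rewrite Rpow_mult_distr, omega0_pow2. unfold Rsqr. field. lra.
Qed.

Lemma P0_eq : P0 (b ^ 2) kappa_of = (x0, 0, z0).
Proof.
  unfold P0, kappa_of. f_equal. replace (1 / b ^ 2 - (1 / b ^ 2 - z0 ^ 2)) with (z0 ^ 2) by ring. apply sqrt_pow2. lra.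
Qed.

Lemma eps_c_eq : eps_c alpha (b ^ 2) kappa_of = damping.
Proof.
  unfold eps_c, kappa_of, damping. rewrite sqrt_pow2 by lra.
  replace (1 - (1 / b ^ 2 - z0 ^ 2) * b ^ 2) with ((z0 * b) ^ 2) by (field; lra).
  rewrite sqrt_pow2 by nra. ring.
Qed.

Definition y_rest (x z : R) : R := ((z0 + z) ^ 2 + kappa_of) * sin (x0 + x) * cos (x0 + x) - sin (x0 + x)
  + om ^ 2 * x - damping * om / feedback * z.
Definition z_rest (x z : R) : R := alpha * (cos (x0 + x) - b ^ 2) + feedback * om * x.

Definition y_jet : force_jet := ForceJet (- 3 * (om * b) / 2) (2 * z0 * (2 * b ^ 4 - 1)) (om * b * b ^ 2)
  ((- 7 * b ^ 2 + 4 / b ^ 2) / 6) (- 4 * z0 * (om * b) * b ^ 2) (2 * b ^ 4 - 1).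
Definition z_jet : force_jet := ForceJet (- (alpha * b ^ 2) / 2) 0 0 (alpha * (om * b) / 6) 0 0.

Lemma fam_expansion eps x y z : fam alpha (b ^ 2) kappa_of 0 eps (x0 + x, 0 + y, z0 + z) =
  (y, - om ^ 2 * x + damping * om / feedback * z - eps * y + y_rest x z, - feedback * om * x + z_rest x z).
Proof.
  unfold fam, y_rest, z_rest. cbn [coord fst snd]. rewrite Rplus_0_l. f_equal; [f_equal|]; ring.
Qed.

(* [sin * cos] is half the sine of the double angle. *)
Lemma y_rest_jet : has_force_jet y_rest y_jet.
Proof.
  intros wn wS X Z X_order Z_order.
  set (cubic := - (2 / 3) * (2 * b ^ 4 - 1)).
  assert (X2_order : weighted_order wn wS 1 (fun n u v S => 2 * X n u v S)) by prove_weighted_order.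
  pose proof (weighted_order_sin_remainder _ _ x0 _ X_order) as r_order.
  pose proof (weighted_order_sin_remainder _ _ (2 * x0) _ X2_order) as r2_order.
  set (r := fun n u v S => sin_remainder x0 (X n u v S)) in r_order.
  set (r2 := fun n u v S => sin_remainder (2 * x0) (2 * X n u v S)) in r2_order.
  apply (weighted_order_ext wn wS 4 (fun n u v S =>
    (1 / b ^ 2 + 2 * z0 * Z n u v S + Z n u v S ^ 2) * (/ 2 * r2 n u v S)
    - r n u v S + 2 * z0 * cubic * (Z n u v S * X n u v S ^ 3)
    - 2 * (om * b) * b ^ 2 * (Z n u v S ^ 2 * X n u v S ^ 2) + cubic * (Z n u v S ^ 2 * X n u v S ^ 3)));
    [prove_weighted_order|].
  intros n u v S. unfold r, r2, sin_remainder. set (x := X n u v S). set (z := Z n u v S).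
  replace (2 * x0 + 2 * x) with (2 * (x0 + x)) by ring. rewrite !sin_2a, cos_2a_cos, sin_x0, cos_x0.
  unfold y_rest, force_polynomial, kappa_of, damping, feedback, y_jet, cubic.
  cbn [force_xx force_xz force_zz force_xxx force_xxz force_xzz].
  rewrite omega0_pow2. field. lra.
Qed.

Lemma z_rest_jet : has_force_jet z_rest z_jet.
Proof.
  intros wn wS X Z X_order _.
  pose proof (weighted_order_sin_remainder _ _ (PI / 2 + x0) _ X_order) as r_order.
  set (r := fun n u v S => sin_remainder (PI / 2 + x0) (X n u v S)) in r_order.
  apply (weighted_order_ext wn wS 4 (fun n u v S => alpha * r n u v S)); [prove_weighted_order|].
  intros n u v S. unfold r, sin_remainder. rewrite Rplus_assoc, <- !cos_sin.
  rewrite (cos_plus (PI / 2) x0), cos_PI2, sin_PI2, sin_x0, cos_x0.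
  unfold z_rest, force_polynomial, feedback, z_jet.
  cbn [force_xx force_xz force_zz force_xxx force_xxz force_xzz]. field.
Qed.

Local Notation F := (fam alpha (b ^ 2) kappa_of 0).

Lemma equilibrium_P0 eps : equilibrium (F eps) (x0, 0, z0).
Proof.
  unfold equilibrium, fam, kappa_of. cbn [coord fst snd]. rewrite cos_x0, sin_x0. f_equal; [f_equal|]; field; lra.
Qed.

Lemma jac_P0 eps : jac (F eps) (x0, 0, z0) = feedback_matrix om damping feedback eps.
Proof.
  apply functional_extensionality. intros i. apply functional_extensionality. intros j.
  rewrite jac_fam. destruct i as [|[|i]], j as [|[|j]]; cbn [fam_d1 feedback_matrix coord fst snd];
    rewrite ?cos_x0, ?sin_x0; unfold kappa_of, damping, feedback; try ring.
  - rewrite Rpow_mult_distr, omega0_pow2. field. lra.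
  - field. lra.
Qed.

Lemma Bform_P0 eps u v : Bform (F eps) (x0, 0, z0) u v = feedback_B y_jet z_jet u v.
Proof.
  apply functional_extensionality. intros i. unfold Bform, sum3. rewrite !d2_fam.
  assert (om_b_pow2 : (om * b) ^ 2 = 1 - b ^ 4) by (rewrite Rpow_mult_distr, omega0_pow2; field; lra).
  destruct i as [|[|i]]; cbn [fam_d2 feedback_B coord fst snd]; rewrite ?cos_x0, ?sin_x0, ?om_b_pow2;
    unfold second_derivative, y_jet, z_jet, kappa_of; apply injective_projections; simpl; field; lra.
Qed.

Lemma Cform_P0 eps u v w : Cform (F eps) (x0, 0, z0) u v w = feedback_C y_jet z_jet u v w.
Proof.
  apply functional_extensionality. intros i. unfold Cform, sum3. rewrite !d3_fam.
  assert (om_b_pow2 : (om * b) ^ 2 = 1 - b ^ 4) by (rewrite Rpow_mult_distr, omega0_pow2; field; lra).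
  destruct i as [|[|i]]; cbn [fam_d3 feedback_C coord fst snd]; rewrite ?cos_x0, ?sin_x0, ?om_b_pow2;
    unfold third_derivative, y_jet, z_jet, kappa_of; apply injective_projections; simpl; field; lra.
Qed.

Lemma qvec_eq : qvec alpha (b ^ 2) = critical_vector om feedback.
Proof.
  pose proof omega0_pos. apply functional_extensionality. intros [|[|i]]; try reflexivity.
  simpl. f_equal. unfold feedback. change (b * (b * 1)) with (b ^ 2). rewrite sqrt_pow2 by lra. field. lra.
Qed.

Lemma damping_pos : 0 < damping.
Proof. unfold damping. pose proof (pow_lt b 4). repeat apply Rmult_lt_0_compat; lra. Qed.

Lemma feedback_pos : 0 < feedback.
Proof. apply Rmult_lt_0_compat; lra. Qed.

Definition stability_coefficient : R :=
  hopf_coefficient om (u_jet om damping feedback y_jet z_jet) (v_jet om damping feedback y_jet z_jet).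

Lemma l1_eq p : adjoint_normalized alpha (b ^ 2) kappa_of p ->
  l1 alpha (b ^ 2) kappa_of p = 4 / om * stability_coefficient.
Proof.
  unfold adjoint_normalized, l1, G21, Amat. rewrite eps_c_eq, P0_eq, jac_P0, qvec_eq. intros [eigen normal].
  pose proof (Re_normal_form_coefficient om damping feedback y_jet z_jet omega0_pos damping_pos feedback_pos
    p eigen normal) as coefficient.
  unfold normal_form_coefficient in coefficient.
  rewrite !Bform_P0, Cform_P0, coefficient. fold stability_coefficient. pose proof omega0_pos. field. lra.
Qed.

Lemma transversal_hopf_P0 : transversal_hopf_point F damping (x0, 0, z0).
Proof.
  pose proof omega0_pos as om_pos. pose proof damping_pos as lam_pos. pose proof feedback_pos as eta_pos.
  assert (critical : forall w, w ^ 2 = om ^ 2 -> is_eigenvalue (jac (F damping) (x0, 0, z0)) (0, w)).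
  { intros w Hw. rewrite jac_P0. apply eigenvalue_of_root; auto. rewrite char_poly_critical.
    replace ((0, w) * (0, w) + RtoC (om ^ 2))%C with (RtoC 0); [ring|].
    rewrite <- Hw. apply injective_projections; simpl; ring. }
  split.
  - split; [apply equilibrium_P0|]. exists om. split; [exact om_pos|].
    split; [apply critical; ring|]. split; [apply critical; ring|].
    intros l. rewrite jac_P0. apply imaginary_eigenvalue; auto.
  - destruct (eigenvalue_continuation om damping feedback om_pos lam_pos eta_pos)
      as [dl [mu [w [dl_pos [mu_0 [w_0 [pair [mu_diff mu_speed]]]]]]]].
    exists om, dl, mu, w. split; [exact om_pos|]. split; [exact dl_pos|]. split; [apply critical; ring|].
    split; [exact mu_0|]. split; [exact w_0|]. split; [|split; assumption].
    intros e near. destruct (pair e near) as [mu_cont [w_cont eigenvalue]]. rewrite jac_P0.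
    split; [apply equilibrium_P0|]. split; [exact mu_cont|]. split; assumption.
Qed.

End FamilyAtEquilibrium.

Lemma parameters_exist beta kappa : 0 < beta < 1 -> kappa < 1 ->
  exists b z0, 0 < b < 1 /\ 0 < z0 /\ beta = b ^ 2 /\ kappa = kappa_of b z0.
Proof.
  intros beta_range kappa_lt. exists (sqrt beta), (sqrt (1 / beta - kappa)).
  assert (1 < 1 / beta) by (apply (Rlt_div_r 1 1 beta); lra).
  assert (beta_eq : sqrt beta ^ 2 = beta) by (apply pow2_sqrt; lra).
  repeat split.
  - apply sqrt_lt_R0. lra.
  - rewrite <- sqrt_1. apply sqrt_lt_1; lra.
  - apply sqrt_lt_R0. lra.
  - symmetry. exact beta_eq.
  - unfold kappa_of. rewrite beta_eq, pow2_sqrt by lra. ring.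
Qed.

Theorem theorem3p5 (alpha beta kappa : R)
  (hbeta : 0 < beta < 1) (halpha : 0 < alpha) (hkappa : 0 <= kappa < 1)
  (p : CV) (hp : adjoint_normalized alpha beta kappa p)
  (hl1 : l1 alpha beta kappa p <> 0) :
  transversal_hopf_point (fam alpha beta kappa 0) (eps_c alpha beta kappa) (P0 beta kappa) /\
  (l1 alpha beta kappa p < 0 ->
     asympt_stable (fam alpha beta kappa 0 (eps_c alpha beta kappa)) (P0 beta kappa) /\
     forall eta, 0 < eta -> exists dl, 0 < dl /\
       forall eps, eps_c alpha beta kappa - dl < eps < eps_c alpha beta kappa ->
         unstable_eq (fam alpha beta kappa 0 eps) (P0 beta kappa) /\
         exists (gam : R -> R3) (T : R),
           periodic_orbit (fam alpha beta kappa 0 eps) gam T /\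
           orbit_asympt_stable (fam alpha beta kappa 0 eps) gam /\
           forall t, dist3 (gam t) (P0 beta kappa) < eta) /\
  (0 < l1 alpha beta kappa p ->
     unstable_eq (fam alpha beta kappa 0 (eps_c alpha beta kappa)) (P0 beta kappa) /\
     forall eta, 0 < eta -> exists dl, 0 < dl /\
       forall eps, eps_c alpha beta kappa < eps < eps_c alpha beta kappa + dl ->
         asympt_stable (fam alpha beta kappa 0 eps) (P0 beta kappa) /\
         exists (gam : R -> R3) (T : R),
           periodic_orbit (fam alpha beta kappa 0 eps) gam T /\
           orbit_unstable (fam alpha beta kappa 0 eps) gam /\
           forall t, dist3 (gam t) (P0 beta kappa) < eta).
Proof.
  destruct (parameters_exist beta kappa hbeta (proj2 hkappa)) as [b [z0 [b_range [z0_pos [-> ->]]]]].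
  rewrite (l1_eq alpha b z0 halpha b_range z0_pos p hp), (eps_c_eq alpha b z0 b_range z0_pos), (P0_eq b z0 z0_pos).
  split; [exact (transversal_hopf_P0 alpha b z0 halpha b_range z0_pos)|].
  pose proof (omega0_pos b b_range) as om_pos.
  pose proof (damping_pos alpha b z0 halpha b_range z0_pos) as lam_pos.
  pose proof (feedback_pos alpha b halpha b_range) as eta_pos.
  pose proof (y_rest_jet alpha b z0 halpha b_range) as y_taylor.
  pose proof (z_rest_jet alpha b b_range) as z_taylor.
  pose proof (fam_expansion alpha b z0 : forall eps x y z, _) as expansion.
  pose proof (fun eps X => fam_existence alpha (b ^ 2) (kappa_of b z0) eps X (Rlt_le _ _ halpha)) as existence.
  pose proof (Rdiv_lt_0_compat 4 _ ltac:(lra) om_pos) as factor_pos.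
  split; intros sign.
  - apply (supercritical_bifurcation _ _ _ _ _ _ _ om_pos lam_pos eta_pos y_taylor z_taylor _ (_, 0, z0)
      expansion existence).
    fold (stability_coefficient alpha b z0). nra.
  - apply (subcritical_bifurcation _ _ _ _ _ _ _ om_pos lam_pos eta_pos y_taylor z_taylor _ (_, 0, z0)
      expansion existence).
    fold (stability_coefficient alpha b z0). nra.
Qed.
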